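(* Let $g$ be an odd entire function with $g(0)=0$ and $g'(0)=1$. Let $s$ be a real number greater than $3/2$. For every $T$ greater than, but close enough to, $2\pi$, there exists, up to translation (in $x$) and sign, a unique nonzero $T$-periodic (in $t$) solution of $$u_{tt} - u_{xx} + g(u) = 0$$ which tends exponentially to zero as $x$ tends to $+\infty$, is odd in $\cos(2\pi t/T)$, and is of class $H^{s}$ in $x$ and $t$.
   Context: $g$ has real Taylor coefficients and solutions are real-valued. ''$T$ greater than, but close enough to, $2\pi$'' means that there is $T_0>2\pi$ such that the assertion holds for all $T\in(2\pi,T_0)$. Solutions are considered for $x$ in a half-line $[x_0,+\infty)$ (nothing is asserted as $x\to-\infty$); two solutions are identified if they coincide, for $x$ large, after a translation in $x$ and possibly multiplication by $-1$. ''Odd in $\cos(2\pi t/T)$'' means that the Fourier expansion of $u$ in $t$ contains only the terms $\cos(2\pi jt/T)$ with $j$ odd. Put $\varepsilon=\sqrt{1-(2\pi/T)^2}$, $\xi=\varepsilon x$, $\tau=2\pi t/T$, and for $w=\sum_jw_j\cos j\tau$ let $|w|_s^2=\sum_j|w_j|^2(1+j^2)^s$. ''Tends exponentially to zero'' means that $|u(\xi,\cdot)|_s^2+\varepsilon^2|u_\xi(\xi,\cdot)|_{s-1}^2\le Ce^{-2\beta\xi}$ for large $\xi$, for some constants $C$ and $\beta\in(0,1)$. *)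

(* Defs.v *)
From HB Require Import structures.
From mathcomp Require Import all_boot all_order all_algebra.
From mathcomp Require Import all_classical all_reals all_analysis.
From mathcomp Require Import complex.

Set Implicit Arguments.
Unset Strict Implicit.
Unset Printing Implicit Defensive.

Import Order.TTheory GRing.Theory Num.Theory.
Import numFieldNormedType.Exports.

Local Open Scope classical_set_scope.
Local Open Scope ring_scope.
Local Open Scope complex_scope.

(* An entire function is the sum of a power series that converges on all of
   [R[i]]; its coefficients, which are the Taylor coefficients at 0, are
   required to be real. The regular module [R[i]^o] carries the topology of the
   complex plane. *)
Definition entire_real_coef (R : realType) (g : R[i]^o -> R[i]^o) : Prop :=
  exists a : nat -> R, forall z : R[i]^o,
    series (fun n => ((a n)%:C * z ^+ n : R[i]^o)) @ \oo --> g z.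

(* [g] maps the real axis to itself, so that taking the real part loses
   nothing. *)
Definition on_reals (R : realType) (g : R[i]^o -> R[i]^o) (y : R) : R :=
  complex.Re (g y%:C).

Definition cos_coef (R : realType) (w : R -> R) (j : nat) : R :=
  (if j == 0%N then 1 else 2) / (2 * pi)
    * \int[lebesgue_measure]_(tau in `[0, 2 * pi]) (w tau * cos (j%:R * tau)).

Definition sin_coef (R : realType) (w : R -> R) (j : nat) : R :=
  pi^-1
    * \int[lebesgue_measure]_(tau in `[0, 2 * pi]) (w tau * sin (j%:R * tau)).

Definition odd_in_cos (R : realType) (w : R -> R) : Prop :=
  (forall j : nat, sin_coef w j = 0) /\
  (forall j : nat, ~~ odd j -> cos_coef w j = 0).

(* |w|_s ^ 2 for the series w = \sum_j (c j) cos (j tau). *)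
Definition sobolev_sqnorm (R : realType) (s : R) (c : nat -> R) : \bar R :=
  (\sum_(0 <= j <oo) ((c j) ^+ 2 * (1 + j%:R ^+ 2) `^ s)%:E)%E.

Definition eps (R : realType) (T : R) : R := Num.sqrt (1 - (2 * pi / T) ^+ 2).

(* [u] in the variables xi = eps x and tau = 2 pi t / T. *)
Definition rescale (R : realType) (T : R) (u : R -> R -> R) (xi tau : R) : R :=
  u (xi / eps T) (T * tau / (2 * pi)).

(* The Fourier coefficients of [u_xi (xi, .)] are the xi-derivatives of those of
   [u (xi, .)]: for u of class H^s with s > 3/2 the latter are C^1 in xi, whereas
   u_xi need not be a pointwise derivative. *)
Definition exp_decay (R : realType) (s T : R) (u : R -> R -> R) : Prop :=
  let c (xi : R) := cos_coef (rescale T u xi) in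
  let c' (xi : R) (j : nat) := derive1 (fun y => c y j) xi in
  exists C beta : R, 0 < beta < 1 /\
    \forall xi \near +oo,
      (sobolev_sqnorm s (c xi)
         + (eps T ^+ 2)%:E * sobolev_sqnorm (s - 1) (c' xi)
       <= (C * expR (- (2 * beta * xi)))%:E)%E.

(* H^s of the cylinder R x (R / T Z), for s > 1: the functions
     U (x, t) = \sum_(k in Z) \int F_k(eta) exp (i (eta x + 2 pi k t / T)) d eta
   with \sum_k \int (1 + eta^2 + (2 pi k / T)^2)^s |F_k(eta)|^2 d eta < +oo.
   As s > 1 this makes the F_k jointly integrable, so that U is continuous and
   given pointwise by the inversion formula. For real-valued U one has
   F_(-k)(- eta) = conj F_k(eta); grouping k with - k gives the real form below,
   with A_k - i B_k = 2 F_k for k > 0 and A_0 - i B_0 = F_0. *)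
Definition Hs_cylinder (R : realType) (s T : R) (U : R -> R -> R) : Prop :=
  exists A B : nat -> R -> R,
    [/\ forall k, measurable_fun setT (A k),
        forall k, measurable_fun setT (B k),
        (\sum_(0 <= k <oo) \int[lebesgue_measure]_eta
           ((1 + eta ^+ 2 + (2 * pi * k%:R / T) ^+ 2) `^ s
              * ((A k eta) ^+ 2 + (B k eta) ^+ 2))%:E < +oo)%E
      & forall x t : R,
          series (fun k : nat => \int[lebesgue_measure]_eta
            (A k eta * cos (eta * x + 2 * pi * k%:R / T * t)
             + B k eta * sin (eta * x + 2 * pi * k%:R / T * t)))
          @ \oo --> U x t].

(* On a half-cylinder, H^s is the space of restrictions. *)
Definition Hs_halfline (R : realType) (s T x0 : R) (u : R -> R -> R) : Prop :=
  exists2 U : R -> R -> R, Hs_cylinder s T U &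
    forall x t, x0 <= x -> u x t = U x t.

Definition dx (R : realType) (f : R -> R -> R) : R -> R -> R :=
  fun x t => derive1 (f^~ t) x.

Definition dt (R : realType) (f : R -> R -> R) : R -> R -> R :=
  fun x t => derive1 (f x) t.

(* The iterated partial derivative read off a word: [true] is d/dx, [false] is
   d/dt. *)
Definition partial (R : realType) (w : seq bool) (f : R -> R -> R) :
    R -> R -> R :=
  foldr (fun b h => if b then dx h else dt h) f w.

Definition smooth2 (R : realType) (f : R -> R -> R) : Prop :=
  forall w : seq bool,
    [/\ continuous (fun p : R * R => partial w f p.1 p.2),
        forall x t, derivable ((partial w f)^~ t) x 1
      & forall x t, derivable (partial w f x) t 1].

(* Smooth functions on the cylinder R x (R / T Z) with compact support in
   {x > x0}. *)
Definition test_function (R : realType) (T x0 : R) (phi : R -> R -> R) : Prop :=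
  [/\ smooth2 phi,
      forall x t, phi x (t + T) = phi x t
    & exists a b : R, x0 < a /\
        forall x t, ~~ (a <= x <= b) -> phi x t = 0].

(* u_tt - u_xx + f (u) = 0 in the sense of distributions on
   (x0, +oo) x (R / T Z); for s < 2, u_tt and u_xx need not be functions. *)
Definition wave_equation (R : realType) (f : R -> R) (T x0 : R)
    (u : R -> R -> R) : Prop :=
  forall phi : R -> R -> R, test_function T x0 phi ->
    \int[lebesgue_measure]_(x in `]x0, +oo[)
      \int[lebesgue_measure]_(t in `[0, T])
        (u x t * (dt (dt phi) x t - dx (dx phi) x t)
         + f (u x t) * phi x t) = 0.

(* Only the values of [u] on {x >= x0} matter. *)
Definition decaying_solution (R : realType) (f : R -> R) (s T x0 : R)
    (u : R -> R -> R) : Prop :=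
  [/\ forall x t, x0 <= x -> u x (t + T) = u x t,
      forall x, x0 <= x -> odd_in_cos (fun tau => u x (T * tau / (2 * pi))),
      Hs_halfline s T x0 u,
      wave_equation f T x0 u
    & exp_decay s T u].

Definition nonzero_on (R : realType) (x0 : R) (u : R -> R -> R) : Prop :=
  exists x t, x0 <= x /\ u x t != 0.

Definition same_up_to_translation_sign (R : realType) (u v : R -> R -> R) :
    Prop :=
  exists (a : R) (neg : bool),
    \forall x \near +oo, forall t, u x t = (-1) ^+ neg * v (x + a) t.

(* Main.v *)
(* A solution of class H^s, s > 3/2, is a uniformly convergent Fourier series
   u = \sum_j a_j(x) cos (j w t), w = 2 pi / T, whose modes satisfy
   a_j'' = (1 - w^2 j^2) a_j + n_j in the classical sense, n_j being the
   coefficients of P(u) = g(u) - u = O(u^3). For 2 pi < T < 5/2 pi the first mode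
   is hyperbolic, with rate e = sqrt (1 - w^2), and all the others are elliptic.

   Uniqueness. If the nonlinear terms of two decaying solutions differ by
   O(exp (- g x)), the energy \sum_j (d_j'^2 + (w^2 j^2 - 1) d_j^2) of their
   elliptic modes bounds these by O(exp (- g x)), and so does the first mode
   equation when g < e. Since P is cubic this bootstraps the decay rate up to
   e / 2, whence a_1 = k exp (- e x) + O(exp (- 3 e x / 2)). Two solutions with the same k
   coincide, by a contraction in a norm with weight exp (g x), g large; as k <> 0
   for a nonzero solution, a translation and a sign make the two k equal.

   Existence. The solution is a series \sum_n z^n phi_n(t) in z = r exp (- e x),
   with phi_1 = 2 cos (w t) and each phi_n a trigonometric polynomial of degree at
   most n. The coefficient of z^n cos (j w t) is obtained by dividing by
   e^2 n^2 + w^2 j^2 - 1 >= 8 e^2, so that the series is dominated by the solution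
   of a scalar equation and converges for small r. Extension to an H^s function on
   the whole cylinder amounts to writing exp (- a x), for large x, as the cosine
   transform of a kernel decaying faster than any prescribed power. *)
Require Import Defs.
From HB Require Import structures.
From mathcomp Require Import all_boot all_order all_algebra.
From mathcomp Require Import all_classical all_reals all_analysis.
From mathcomp Require Import measurable_realfun lebesgue_integral_under complex ring lra zify.

Set Implicit Arguments.
Unset Strict Implicit.
Unset Printing Implicit Defensive.

Import Order.TTheory GRing.Theory Num.Theory.
Import numFieldNormedType.Exports.

Local Open Scope classical_set_scope.
Local Open Scope ring_scope.

(** * Absolutely convergent series and integrals of continuous functions *)

(** Only the first mode has a decaying homogeneous solution; the elliptic modes oscillate, so decay
    determines them from the nonlinear term, by integration from infinity. This leaves one real
    parameter, the leading coefficient. The decay rate is unknown at the start, so each estimate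
    takes some exponential bound as input, mainly to discard terms at infinity. Two contractions are
    used. Far out the solutions are small, and the cubic nonlinearity has a small Lipschitz
    constant: a fixed weight suffices to compare two solutions there. Propagating vanishing back to
    the whole half-line involves nothing small; there a large weight is needed, and the elliptic
    modes gain a factor 1 / sqrt g. In the existence proof, oddness of the nonlinearity keeps n and
    2 k - n odd; this is what gives the lower bound 8 e ^ 2 for n >= 3, while at n = 1 the divisor
    is zero and the amplitude is free. The equation is checked on finite sums with geometric
    residual, and only its weak form passes to the limit. The even extension exp (- a |x|) has a
    corner at 0, too rough for large s; local averaging smooths it and changes the exponential only
    on a bounded interval. *)

Definition bsum (R : realType) (u : nat -> R) (M : R) : Prop :=
  forall n, \sum_(0 <= k < n) `|u k| <= M.

Lemma cvgn_ler (R : realType) (u : nat -> R) (l M : R) :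
  u @ \oo --> l -> (forall n, u n <= M) -> l <= M.
Proof.
move=> ul uM; rewrite -(cvg_lim _ ul)//; apply: limr_le.
  by apply/cvg_ex; exists l.
exact: nearW.
Qed.

Lemma cvgn_norm_ler (R : realType) (u : nat -> R) (l M : R) :
  u @ \oo --> l -> (forall n, `|u n| <= M) -> `|l| <= M.
Proof. by move=> ul; apply: cvgn_ler; apply: cvg_norm. Qed.

Lemma bsum_ge0 (R : realType) (u : nat -> R) M : bsum u M -> 0 <= M.
Proof. by move=> /(_ 0%N); rewrite big_geq. Qed.

Lemma bsum_norm_cvg (R : realType) (u : nat -> R) M :
  bsum u M -> cvgn (series (fun k => `|u k|)).
Proof.
move=> uM; apply: nondecreasing_is_cvgn.
  by apply: nondecreasing_series.
by exists M => _ [n _ <-]; exact: uM.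
Qed.

Lemma bsum_cvg (R : realType) (u : nat -> R) M : bsum u M -> cvgn (series u).
Proof. by move=> /bsum_norm_cvg; exact: (@normed_cvg _ R^o). Qed.

Lemma bsum_cvgP (R : realType) (u : nat -> R) M :
  bsum u M -> series u @ \oo --> limn (series u).
Proof. by move=> /bsum_cvg. Qed.

Lemma bsum_series_le (R : realType) (u : nat -> R) M n :
  bsum u M -> `|series u n| <= M.
Proof. by move=> uM; apply: le_trans (uM n); exact: ler_norm_sum. Qed.

Lemma bsum_lim_le (R : realType) (u : nat -> R) M :
  bsum u M -> `|limn (series u)| <= M.
Proof.
move=> uM; apply: (cvgn_norm_ler (bsum_cvgP uM)) => n; exact: bsum_series_le.
Qed.

Lemma bsum_le (R : realType) (u v : nat -> R) M :
  (forall k, `|u k| <= `|v k|) -> bsum v M -> bsum u M.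
Proof. by move=> uv vM n; apply: le_trans (vM n); apply: ler_sum. Qed.

Lemma bsumZ (R : realType) (u : nat -> R) M c :
  bsum u M -> bsum (fun k => c * u k) (`|c| * M).
Proof.
move=> uM n; under eq_bigr do rewrite normrM.
by rewrite -mulr_sumr ler_wpM2l.
Qed.

Lemma bsumD (R : realType) (u v : nat -> R) M N :
  bsum u M -> bsum v N -> bsum (fun k => u k + v k) (M + N).
Proof.
move=> uM vN n; apply: le_trans (lerD (uM n) (vN n)).
by rewrite -big_split/=; apply: ler_sum => k _; exact: ler_normD.
Qed.

Lemma sum_geometric_le (R : realType) (q : R) n :
  0 <= q < 1 -> \sum_(0 <= k < n) q ^+ k <= (1 - q)^-1.
Proof.
move=> /andP[q0 q1]; have q'0 : 0 < 1 - q by lra.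
rewrite -[leRHS]mul1r ler_pdivlMr//.
suff -> : (\sum_(0 <= k < n) q ^+ k) * (1 - q) = 1 - q ^+ n.
  by have := exprn_ge0 n q0; lra.
elim: n => [|n IH]; first by rewrite big_geq// mul0r expr0 subrr.
by rewrite big_nat_recr//= mulrDl IH exprS; ring.
Qed.

Lemma bsum_geometric (R : realType) (u : nat -> R) (C q : R) :
  0 <= q < 1 -> (forall k, `|u k| <= C * q ^+ k) -> bsum u (C / (1 - q)).
Proof.
move=> q01 uC n; apply: (@le_trans _ _ (\sum_(0 <= k < n) C * q ^+ k)).
  by apply: ler_sum => k _.
rewrite -mulr_sumr ler_wpM2l ?sum_geometric_le//.
by have := uC 0%N; rewrite expr0 mulr1; exact: le_trans.
Qed.

(** The rate [r] is the tail of the series of [|u k|]. It serves every [v] dominated by [u] at once,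
    which is the uniformity needed for continuity in a parameter. *)
Lemma bsum_tail (R : realType) (u : nat -> R) M : bsum u M ->
  exists2 r : nat -> R, r @ \oo --> 0 &
    forall v : nat -> R, (forall k, `|v k| <= `|u k|) ->
      forall n, `|limn (series v) - series v n| <= r n.
Proof.
move=> uM; have cu := bsum_norm_cvg uM.
pose L := limn (series (fun k => `|u k|)).
exists (fun n => L - series (fun k => `|u k|) n).
  by rewrite -[0 in X in _ --> X](subrr L); apply: cvgB => //; exact: cvg_cst.
move=> v vu n.
have vM : bsum v M by exact: bsum_le uM.
have h1 : (fun m => series v (m + n)%N - series v n) @ \oo -->
   limn (series v) - series v n.
  apply: cvgB; last exact: cvg_cst.
  by rewrite (cvg_shiftn n); exact: bsum_cvgP vM.
apply: (cvgn_norm_ler h1) => m.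
rewrite /series/= (big_cat_nat (n := n))//= ?leq_addl// addrAC subrr add0r.
apply: (le_trans (ler_norm_sum _ _ _)).
apply: (@le_trans _ _ (\sum_(n <= k < m + n) `|u k|)); first exact: ler_sum.
have : series (fun k => `|u k|) (m + n)%N <= L.
  apply: nondecreasing_cvgn_le => //; exact: nondecreasing_series.
rewrite /series/= (big_cat_nat (n := n))//= ?leq_addl//; lra.
Qed.

Lemma continuous_sum (R : realType) (T : topologicalType) (f : nat -> T -> R) m n :
  (forall k, continuous (f k)) -> continuous (fun x => \sum_(m <= k < n) f k x).
Proof.
move=> cf y; rewrite /continuous_at; elim: (index_iota m n) => [|k s IH].
  by under eq_fun do rewrite big_nil; rewrite big_nil; exact: cvg_cst.
under eq_fun do rewrite big_cons; rewrite big_cons.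
by apply: cvgD; [exact: cf|exact: IH].
Qed.

Lemma continuous_series (R : realType) (T : topologicalType)
    (f : nat -> T -> R) (M : nat -> R) C :
  (forall k, continuous (f k)) -> (forall k x, `|f k x| <= `|M k|) ->
  bsum M C -> continuous (fun x => limn (series (f^~ x))).
Proof.
move=> cf fM MC x; apply/cvgrPdist_le => /= e e0.
have [r r0 rP] := bsum_tail MC.
have /cvgrPdist_le/(_ (e / 3) ltac:(lra))[N _ /(_ N (leqnn _))] := r0.
rewrite sub0r normrN => rN.
have cS : continuous (fun x => series (f^~ x) N).
  exact: continuous_sum.
have /cvgrPdist_le/(_ (e / 3) ltac:(lra)) := cS x.
apply: filterS => y xy.
have A z : `|limn (series (f^~ z)) - series (f^~ z) N| <= e / 3.
  by apply: le_trans (rN); apply: le_trans (ler_norm _); exact: rP.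
have := A x; have := A y; move: xy.
rewrite !ler_norml; lra.
Qed.

Section integrals.
Context {R : realType}.
Notation mu := (@lebesgue_measure R).

Lemma cts_integrable (f : R -> R) a b :
  continuous f -> mu.-integrable `[a, b] (EFin \o f).
Proof.
move=> cf; apply: continuous_compact_integrable.
  exact: segment_compact.
exact: continuous_subspaceT.
Qed.

#[global] Arguments cts_integrable {f} a b _.

Lemma cts_RintegralD (f g : R -> R) a b : continuous f -> continuous g ->
  \int[mu]_(x in `[a, b]) (f x + g x) =
  \int[mu]_(x in `[a, b]) f x + \int[mu]_(x in `[a, b]) g x.
Proof. by move=> cf cg; rewrite RintegralD//; exact: cts_integrable. Qed.

Lemma cts_RintegralB (f g : R -> R) a b : continuous f -> continuous g ->
  \int[mu]_(x in `[a, b]) (f x - g x) =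
  \int[mu]_(x in `[a, b]) f x - \int[mu]_(x in `[a, b]) g x.
Proof. by move=> cf cg; rewrite RintegralB//; exact: cts_integrable. Qed.

Lemma cts_RintegralZ (c : R) (f : R -> R) a b : continuous f ->
  \int[mu]_(x in `[a, b]) (c * f x) = c * \int[mu]_(x in `[a, b]) f x.
Proof. by move=> cf; rewrite RintegralZl//; exact: cts_integrable. Qed.

Lemma cts_Rintegral_sum (f : nat -> R -> R) m n a b : (forall k, continuous (f k)) ->
  \int[mu]_(x in `[a, b]) (\sum_(m <= k < n) f k x) =
  \sum_(m <= k < n) \int[mu]_(x in `[a, b]) f k x.
Proof.
move=> cf; elim: n => [|n IH].
  under eq_Rintegral do rewrite big_geq//.
  by rewrite big_geq// Rintegral_cst// mul0r.
have [mn|nm] := leqP m n; last first.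
  under eq_Rintegral do rewrite big_geq//.
  by rewrite big_geq// Rintegral_cst// mul0r.
under eq_Rintegral do rewrite big_nat_recr//=.
rewrite cts_RintegralD//; last exact: continuous_sum.
by rewrite IH big_nat_recr.
Qed.

Lemma is_derive_continuous_at (f : R -> R) (x d : R) :
  is_derive x (1 : R) f d -> {for x, continuous f}.
Proof.
move=> df; apply: differentiable_continuous.
apply/derivable1_diffP; exact: (@ex_derive _ _ _ _ _ _ _ df).
Qed.

Lemma is_derive_continuous (f df : R -> R) :
  (forall x : R, is_derive x (1 : R) f (df x)) -> continuous f.
Proof. by move=> df' x; exact: is_derive_continuous_at (df' x). Qed.

Lemma is_derive_derivable (f : R -> R) (x d : R) :
  is_derive x (1 : R) f d -> derivable f x 1.
Proof. by move=> df; exact: (@ex_derive _ _ _ _ _ _ _ df). Qed.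

Lemma is_derive_derive1 (f : R -> R) (x d : R) :
  is_derive x (1 : R) f d -> derive1 f x = d.
Proof. by move=> df; rewrite derive1E; exact: (@derive_val _ _ _ _ _ _ _ df). Qed.

Lemma derivable_is_derive (f : R -> R) (x : R) :
  derivable f x 1 -> is_derive x (1 : R) f (derive1 f x).
Proof. by move=> df; rewrite derive1E; exact: DeriveDef. Qed.

Lemma is_derive_LR (F f : R -> R) (a b : R) : a <= b ->
  (forall x : R, a <= x <= b -> is_derive x (1 : R) F (f x)) ->
  derivable_oo_LRcontinuous F a b.
Proof.
move=> ab dF; split.
- move=> x /[!in_itv]/= /andP[ax xb].
  by apply: is_derive_derivable (dF x _); rewrite !ltW.
- by apply/cvg_at_right_filter/(is_derive_continuous_at (dF a _)); rewrite lexx.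
- by apply/cvg_at_left_filter/(is_derive_continuous_at (dF b _)); rewrite lexx andbT.
Qed.

Lemma Rintegral_FTC (F f : R -> R) (a b : R) : a <= b ->
  continuous f -> (forall x : R, a <= x <= b -> is_derive x (1 : R) F (f x)) ->
  \int[mu]_(x in `[a, b]) f x = F b - F a.
Proof.
move=> ab cf dF; have LR := is_derive_LR ab dF.
move: ab; rewrite le_eqVlt => /orP[/eqP <- |ab].
  by rewrite set_itv1 Rintegral_set1 subrr.
rewrite /Rintegral (@continuous_FTC2 _ f F)//.
- exact: continuous_subspaceT.
- move=> x /[!in_itv]/= /andP[ax xb].
  by apply: is_derive_derive1 (dF x _); rewrite !ltW.
Qed.

Lemma Rintegral_by_parts (F G f g : R -> R) (a b : R) : a <= b ->
  continuous f -> continuous g ->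
  (forall x : R, a <= x <= b -> is_derive x (1 : R) F (f x)) ->
  (forall x : R, a <= x <= b -> is_derive x (1 : R) G (g x)) ->
  \int[mu]_(x in `[a, b]) (F x * g x) =
  F b * G b - F a * G a - \int[mu]_(x in `[a, b]) (f x * G x).
Proof.
move=> ab cf cg dF dG; have LRF := is_derive_LR ab dF.
have LRG := is_derive_LR ab dG.
move: ab; rewrite le_eqVlt => /orP[/eqP <- |ab].
  by rewrite set_itv1 !Rintegral_set1 !subrr.
rewrite (@Rintegration_by_parts _ F G f g)//.
- exact: continuous_subspaceT.
- move=> x /[!in_itv]/= /andP[ax xb].
  by apply: is_derive_derive1 (dF x _); rewrite !ltW.
- exact: continuous_subspaceT.
- move=> x /[!in_itv]/= /andP[ax xb].
  by apply: is_derive_derive1 (dG x _); rewrite !ltW.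
Qed.

Lemma is_derive_Rintegral (f : R -> R) (a x : R) : continuous f -> a < x ->
  is_derive x (1 : R) (fun x => \int[mu]_(t in `[a, x]) f t) (f x).
Proof.
move=> cf ax.
have [d1 d2] := @continuous_FTC1_closed _ f a x (x + 1) ltac:(lra)
  (cts_integrable _ _ cf) ax (cf x).
by rewrite -d2; exact: derivable_is_derive.
Qed.

Lemma Rintegral_norm_le (f : R -> R) (a b M : R) : a <= b -> continuous f ->
  (forall x, a <= x <= b -> `|f x| <= M) ->
  `|\int[mu]_(x in `[a, b]) f x| <= M * (b - a).
Proof.
move=> ab cf fM.
apply: le_trans (le_normr_Rintegral _ (cts_integrable _ _ cf)) _ => //.
apply: (@le_trans _ _ (\int[mu]_(x in `[a, b]) cst M x)).
  apply: le_Rintegral => //.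
  - apply: cts_integrable => x; apply: cvg_norm; exact: cf.
  - by apply: cts_integrable; exact: cst_continuous.
rewrite Rintegral_cst//= lebesgue_measure_itv/= lte_fin; case: ltP => [_|h] /=.
  by rewrite lexx.
by rewrite mulr0 (_ : b = a) ?subrr ?mulr0//; lra.
Qed.

Lemma Rintegral_support (f : R -> R) (D : set R) (a b : R) :
  measurable D -> `[a, b]%classic `<=` D ->
  (forall x, ~~ (a <= x <= b) -> f x = 0) ->
  \int[mu]_(x in D) f x = \int[mu]_(x in `[a, b]) f x.
Proof.
move=> mD abD f0; rewrite /Rintegral; congr fine.
rewrite [RHS]integral_mkcond [LHS]integral_mkcond; apply: eq_integral => x _.
rewrite /patch; case: ifPn => [xD|xD]; case: ifPn => // xab.
- by rewrite f0//; move: xab; rewrite notin_setE/= in_itv/= => /negP.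
- by move: xab; rewrite inE => /abD /mem_set; rewrite (negbTE xD).
Qed.

(** Dominated convergence for partial sums, with a majorant that separates index and point. [h] is 1
    on the circle, for Fourier coefficients, and an integrable profile on the line, for superposed
    kernels. *)
Lemma series_Rintegral d (T : measurableType d)
    (nu : {measure set T -> \bar R}) (D : set T)
    (f : nat -> T -> R) (M : nat -> R) (h : T -> R) C : measurable D ->
  (forall k, measurable_fun D (f k)) ->
  (forall k x, D x -> `|f k x| <= `|M k| * h x) -> (forall x, D x -> 0 <= h x) ->
  bsum M C -> nu.-integrable D (EFin \o h) ->
  nu.-integrable D (EFin \o (fun x => limn (series (f^~ x)))) /\
  series (fun k => \int[nu]_(x in D) f k x) @ \oo -->
    \int[nu]_(x in D) limn (series (f^~ x)).
Proof.
move=> mD mf fM h0 MC ih.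
have bf x : D x -> bsum (f^~ x) (C * h x).
  move=> Dx n; apply: (@le_trans _ _ (\sum_(0 <= k < n) `|M k| * h x)).
    by apply: ler_sum => k _; exact: fM.
  by rewrite -mulr_suml ler_wpM2r ?h0.
have iF k : nu.-integrable D (EFin \o f k).
  apply: (@le_integrable _ _ _ nu _ mD _ (EFin \o (fun x => `|M k| * h x))).
  - exact/measurable_EFinP.
  - move=> x Dx; rewrite /= lee_fin.
    by apply: (le_trans (fM k x Dx)); rewrite ler_norm.
  - by under [_ \o _]eq_fun do rewrite /= EFinM; exact: integrableZl.
have mS n : measurable_fun D (fun x => (series (f^~ x) n)%:E).
  by apply/measurable_EFinP; rewrite /series/=; apply: measurable_sum.
have cS x : D x -> (series (f^~ x) n)%:E @[n --> \oo] -->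
    (limn (series (f^~ x)))%:E.
  by move=> Dx; apply: cvg_EFin; [exact: nearW|exact: bsum_cvgP (bf x Dx)].
have mL : measurable_fun D (fun x => (limn (series (f^~ x)))%:E).
  by apply: (emeasurable_fun_cvg _ _ mS) => x; exact: cS.
have ig : nu.-integrable D (EFin \o (fun x => C * h x)).
  by under [_ \o _]eq_fun do rewrite /= EFinM; exact: integrableZl.
have dom : {ae nu, forall x n, D x -> (`|(series (f^~ x) n)%:E| <=
    (C * h x)%:E)%E}.
  by apply/aeW => x n Dx; rewrite /= lee_fin; exact: bsum_series_le (bf x Dx).
have [iS _ cI] := dominated_convergence mD mS mL (aeW _ cS) ig dom.
split; first exact: iS.
have -> : series (fun k => \int[nu]_(x in D) f k x) =
    (fun n => fine (\int[nu]_(x in D) (series (f^~ x) n)%:E)%E).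
  apply/funext => n; rewrite /series/=.
  elim: n => [|n IH].
    rewrite big_geq//; under eq_integral do rewrite big_geq//.
    by rewrite integral0.
  rewrite big_nat_recr//= IH -[in LHS]RintegralD//.
    by congr fine; apply: eq_integral => x _; rewrite big_nat_recr.
  have -> : EFin \o (fun x => \sum_(0 <= k < n) f k x) =
    (fun x => \sum_(0 <= k < n) (EFin \o f k) x)%E.
    by apply/funext => x /=; rewrite sumEFin.
  exact: integrable_sum.
rewrite /Rintegral; apply: fine_cvg; rewrite fineK; first exact: cI.
exact: integrable_fin_num iS.
Qed.

End integrals.

(** * Fourier coefficients *)

Section trig.
Context {R : realType}.
Notation mu := (@lebesgue_measure R).

Lemma cos_sin_nat2pi (k : nat) :
  cos (k%:R * (2 * pi) : R) = 1 /\ sin (k%:R * (2 * pi) : R) = 0.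
Proof.
have e2 : 2 * pi = pi *+ 2 :> R by rewrite mulr_natl.
elim: k => [|k [IHc IHs]]; first by rewrite mul0r cos0 sin0.
by rewrite -natr1 mulrDl mul1r e2 cosD2pi sinD2pi -e2 IHc IHs.
Qed.

Lemma continuous_cosM (c : R) : continuous (fun x : R => cos (c * x)).
Proof.
by move=> x; apply: continuous_comp; [exact: mulrl_continuous|exact: continuous_cos].
Qed.

Lemma continuous_sinM (c : R) : continuous (fun x : R => sin (c * x)).
Proof.
by move=> x; apply: continuous_comp; [exact: mulrl_continuous|exact: continuous_sin].
Qed.

#[global] Arguments continuous_cosM c : clear implicits.
#[global] Arguments continuous_sinM c : clear implicits.

Lemma continuousM (f g : R -> R) :
  continuous f -> continuous g -> continuous (fun x => f x * g x).
Proof. by move=> cf cg x; apply: cvgM; [exact: cf|exact: cg]. Qed.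

Lemma continuousD (f g : R -> R) :
  continuous f -> continuous g -> continuous (fun x => f x + g x).
Proof. by move=> cf cg x; apply: cvgD; [exact: cf|exact: cg]. Qed.

Lemma continuousB (f g : R -> R) :
  continuous f -> continuous g -> continuous (fun x => f x - g x).
Proof. by move=> cf cg x; apply: cvgB; [exact: cf|exact: cg]. Qed.

Lemma continuousZ (c : R) (f : R -> R) :
  continuous f -> continuous (fun x => c * f x).
Proof. by move=> cf x; apply: cvgM; [exact: cvg_cst|exact: cf]. Qed.

Lemma is_derive_sinM (c x : R) :
  is_derive x (1 : R) (fun x => sin (c * x)) (c * cos (c * x)).
Proof.
have h : is_derive x (1 : R) (fun x : R => c * x) c.
  by apply: is_derive_eq; rewrite /GRing.scale/= mulr1.
by have := is_derive1_comp (is_derive_sin (c * x)) h; rewrite mulrC.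
Qed.

Lemma is_derive_cosM (c x : R) :
  is_derive x (1 : R) (fun x => cos (c * x)) (- (c * sin (c * x))).
Proof.
have h : is_derive x (1 : R) (fun x : R => c * x) c.
  by apply: is_derive_eq; rewrite /GRing.scale/= mulr1.
by have := is_derive1_comp (is_derive_cos (c * x)) h; rewrite mulrC mulrN.
Qed.

Lemma is_derive_expM (c x : R) :
  is_derive x (1 : R) (fun x => expR (c * x)) (c * expR (c * x)).
Proof.
have h : is_derive x (1 : R) (fun x : R => c * x) c.
  by apply: is_derive_eq; rewrite /GRing.scale/= mulr1.
by have := is_derive1_comp (is_derive_expR (c * x)) h; rewrite mulrC.
Qed.

Lemma circle_cos (c : R) : c != 0 -> sin (c * (2 * pi)) = 0 ->
  \int[mu]_(t in `[0, 2 * pi]) cos (c * t) = 0.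
Proof.
move=> c0 sc.
have dF (x : R) : 0 <= x <= 2 * pi ->
    is_derive x (1 : R) (fun t => c^-1 * sin (c * t)) (cos (c * x)).
  move=> _; have h := is_derive_sinM c x.
  by apply: is_derive_eq; rewrite /GRing.scale/= mulKf.
rewrite (Rintegral_FTC _ _ dF).
- by rewrite sc (mulr0 c) sin0 !mulr0 subrr.
- by rewrite mulr_ge0// pi_ge0.
- exact: continuous_cosM.
Qed.

Lemma circle_sin (c : R) : cos (c * (2 * pi)) = 1 ->
  \int[mu]_(t in `[0, 2 * pi]) sin (c * t) = 0.
Proof.
have [-> _|c0 sc] := eqVneq c 0.
  under eq_Rintegral do rewrite mul0r sin0.
  by rewrite Rintegral_cst// mul0r.
have dF (x : R) : 0 <= x <= 2 * pi ->
    is_derive x (1 : R) (fun t => - c^-1 * cos (c * t)) (sin (c * x)).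
  move=> _; have h := is_derive_cosM c x.
  by apply: is_derive_eq; rewrite /GRing.scale/= mulrNN mulKf.
rewrite (Rintegral_FTC _ _ dF).
- by rewrite sc mulr0 cos0 subrr.
- by rewrite mulr_ge0// pi_ge0.
- exact: continuous_sinM.
Qed.

Lemma sin_cos_subnat (k j : nat) :
  cos ((k%:R - j%:R) * (2 * pi) : R) = 1 /\ sin ((k%:R - j%:R) * (2 * pi) : R) = 0.
Proof.
have [ck sk] := cos_sin_nat2pi k; have [cj sj] := cos_sin_nat2pi j.
by rewrite mulrBl cosB sinB ck sk cj sj; split; ring.
Qed.

Lemma sin_cos_addnat (k j : nat) :
  cos ((k%:R + j%:R) * (2 * pi) : R) = 1 /\ sin ((k%:R + j%:R) * (2 * pi) : R) = 0.
Proof. by rewrite -natrD; exact: cos_sin_nat2pi. Qed.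

Lemma circle_coscos (k j : nat) :
  \int[mu]_(t in `[0, 2 * pi]) (cos (k%:R * t) * cos (j%:R * t)) =
  if k == j then (if k == 0%N then 2 * pi else pi) else 0.
Proof.
have e t : cos (k%:R * t) * cos (j%:R * t) =
    2^-1 * (cos ((k%:R + j%:R) * t) + cos ((k%:R - j%:R) * t)) :> R.
  by rewrite mulrDl mulrBl cosD cosB; lra.
under eq_Rintegral do rewrite e.
rewrite cts_RintegralZ; last by apply: continuousD; exact: continuous_cosM.
rewrite cts_RintegralD; [|exact: continuous_cosM..].
have [<-|kj] := eqVneq k j.
  rewrite subrr; under [X in _ + X]eq_Rintegral do rewrite mul0r cos0.
  rewrite Rintegral_cst//= lebesgue_measure_itv/= lte_fin mulr_gt0 ?pi_gt0//=.
  have [->|k0] := eqVneq k 0%N.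
    rewrite addr0; under [X in X + _]eq_Rintegral do rewrite mul0r cos0.
    rewrite Rintegral_cst//= lebesgue_measure_itv/= lte_fin mulr_gt0 ?pi_gt0//=.
    by rewrite oppr0; lra.
  rewrite circle_cos ?(sin_cos_addnat k k).2 ?oppr0//; first by lra.
  by rewrite -natrD pnatr_eq0; move: k0; case: (k).
rewrite !circle_cos ?(sin_cos_addnat k j).2 ?(sin_cos_subnat k j).2//; first by lra.
- by rewrite subr_eq0 eqr_nat.
- by rewrite -natrD pnatr_eq0 addn_eq0; apply: contraNN kj => /andP[/eqP-> /eqP->].
Qed.

Lemma circle_sincos (k j : nat) :
  \int[mu]_(t in `[0, 2 * pi]) (sin (k%:R * t) * cos (j%:R * t)) = 0.
Proof.
have e t : sin (k%:R * t) * cos (j%:R * t) =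
    2^-1 * (sin ((k%:R + j%:R) * t) + sin ((k%:R - j%:R) * t)) :> R.
  by rewrite mulrDl mulrBl sinD sinB; lra.
under eq_Rintegral do rewrite e.
rewrite cts_RintegralZ; last by apply: continuousD; exact: continuous_sinM.
rewrite cts_RintegralD; [|exact: continuous_sinM..].
rewrite !circle_sin ?(sin_cos_addnat k j).1 ?(sin_cos_subnat k j).1//.
by rewrite addr0 mulr0.
Qed.

Lemma circle_sinsin (k j : nat) :
  \int[mu]_(t in `[0, 2 * pi]) (sin (k%:R * t) * sin (j%:R * t)) =
  if (k == j) && (k != 0%N) then pi else 0.
Proof.
have e t : sin (k%:R * t) * sin (j%:R * t) =
    cos ((k%:R - j%:R) * t) - cos (k%:R * t) * cos (j%:R * t) :> R.
  by rewrite mulrBl cosB; lra.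
under eq_Rintegral do rewrite e.
rewrite cts_RintegralB; [|exact: continuous_cosM|apply: continuousM; exact: continuous_cosM].
rewrite circle_coscos.
have [<-|kj] := eqVneq k j => /=.
  under [X in X - _]eq_Rintegral do rewrite subrr mul0r cos0.
  rewrite Rintegral_cst//= lebesgue_measure_itv/= lte_fin mulr_gt0 ?pi_gt0//=.
  by rewrite oppr0 addr0; case: eqVneq => _ /=; lra.
rewrite circle_cos ?(sin_cos_subnat k j).2 ?subrr//.
by rewrite subr_eq0 eqr_nat.
Qed.

Lemma series_single (j : nat) (c : R) :
  series (fun k => if k == j then c else 0) @ \oo --> c.
Proof.
apply: cvg_near_cst; exists j.+1 => // n /= jn.
rewrite /series/= big_mkord (bigD1 (Ordinal jn))//= eqxx big1 ?addr0// => i ij.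
by rewrite ifF//; apply/negbTE; apply: contraNN ij => /eqP ij; exact/eqP/val_inj.
Qed.

Section coefs.
Variables (al be : nat -> R) (Ma : R) (Mb : R) (w : R -> R).
Hypothesis (bal : bsum al Ma) (bbe : bsum be Mb).
Hypothesis wE : forall t,
  w t = limn (series (fun k => al k * cos (k%:R * t) + be k * sin (k%:R * t))).

Let M (k : nat) : R := `|al k| + `|be k|.
Let bM : bsum M (Ma + Mb).
Proof.
by apply: bsumD => n; under eq_bigr do rewrite normr_id.
Qed.

Let termle k t : `|al k * cos (k%:R * t) + be k * sin (k%:R * t)| <= M k.
Proof.
apply: (le_trans (ler_normD _ _)); rewrite !normrM; apply: lerD.
  by rewrite ler_piMr// cos_max.
by rewrite ler_piMr// sin_max.
Qed.

Let term_cts k : continuous (fun t : R => al k * cos (k%:R * t) + be k * sin (k%:R * t)).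
Proof.
apply: continuousD; apply: continuousZ; [exact: continuous_cosM|exact: continuous_sinM].
Qed.

Lemma fourier_integral (h : R -> R) (hc : continuous h) (h1 : forall t, `|h t| <= 1) :
  series (fun k => \int[mu]_(t in `[0, 2 * pi])
    ((al k * cos (k%:R * t) + be k * sin (k%:R * t)) * h t)) @ \oo -->
  \int[mu]_(t in `[0, 2 * pi]) (w t * h t).
Proof.
have := @series_Rintegral R _ _ mu `[0, 2 * pi]%classic
  (fun k t => (al k * cos (k%:R * t) + be k * sin (k%:R * t)) * h t) M (cst 1)
  _ _ _ _ _ bM _.
move=> []//.
- move=> k; apply: measurable_funTS; apply: continuous_measurable_fun.
  exact: continuousM.
- move=> k t _; rewrite mulr1 normrM -[leRHS]mulr1.
  apply: ler_pM => //; apply: le_trans (termle k t) (ler_norm _).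
- by apply: cts_integrable; exact: cst_continuous.
move=> _; congr (_ --> _); apply: eq_Rintegral => t _.
pose u := fun k : nat => al k * cos (k%:R * t) + be k * sin (k%:R * t).
have cu : cvgn (series u).
  apply: (@bsum_cvg _ _ (Ma + Mb)); apply: bsum_le bM => k.
  exact: le_trans (termle k t) (ler_norm _).
rewrite wE -/u mulrC; apply: etrans (lim_seriesZ (h t) cu); congr (limn (series _)).
by apply/funext => k /=; rewrite /GRing.scale/= mulrC.
Qed.

Lemma cos_coef_fourier j : cos_coef w j = al j.
Proof.
have := fourier_integral (continuous_cosM j%:R) (fun t => cos_max _).
set u := (fun k : nat => _).
have -> : u = (fun k => if k == j then al j * (if j == 0%N then 2 * pi else pi) else 0).
  apply/funext => k; rewrite /u.
  under eq_Rintegral do rewrite mulrDl -!mulrA.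
  have cc : continuous (fun t : R => cos (k%:R * t) * cos (j%:R * t)).
    by apply: continuousM; exact: continuous_cosM.
  have sc : continuous (fun t : R => sin (k%:R * t) * cos (j%:R * t)).
    by apply: continuousM; [exact: continuous_sinM|exact: continuous_cosM].
  rewrite cts_RintegralD; [|exact: continuousZ..].
  rewrite !cts_RintegralZ//.
  rewrite circle_coscos circle_sincos mulr0 addr0.
  by case: eqVneq => [->//|]; rewrite mulr0.
move=> h; rewrite /cos_coef -(cvg_unique _ (@series_single j _) h)//.
have := @pi_gt0 R; case: (j == 0%N) => p0; field; lra.
Qed.

Lemma sin_coef_fourier j : sin_coef w j = if j == 0%N then 0 else be j.
Proof.
have := fourier_integral (continuous_sinM j%:R) (fun t => sin_max _).
set u := (fun k : nat => _).
have -> : u = (fun k => if k == j then be j * (if j == 0%N then 0 else pi) else 0).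
  apply/funext => k; rewrite /u.
  under eq_Rintegral do rewrite mulrDl -!mulrA.
  have ss : continuous (fun t : R => sin (k%:R * t) * sin (j%:R * t)).
    by apply: continuousM; exact: continuous_sinM.
  have cs : continuous (fun t : R => cos (k%:R * t) * sin (j%:R * t)).
    by apply: continuousM; [exact: continuous_cosM|exact: continuous_sinM].
  rewrite cts_RintegralD; [|exact: continuousZ..].
  rewrite !cts_RintegralZ//.
  under [X in _ * X + _]eq_Rintegral do rewrite mulrC.
  rewrite circle_sinsin circle_sincos mulr0 add0r.
  by case: eqVneq => [->|] /=; rewrite ?mulr0//; case: eqVneq.
move=> h; rewrite /sin_coef -(cvg_unique _ (@series_single j _) h)//.
have := @pi_gt0 R; case: (j == 0%N) => p0; first by rewrite !mulr0.
field; lra.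
Qed.

End coefs.

(** Expanding the integral of [(w - S) ^+ 2], with [S] the partial sum without constant term, bounds
    pi times the sum of squares by the integral of [w ^+ 2]. Index 0 is left out because its
    coefficient is normalised differently; the factor 2 is 2 pi / pi. *)
Lemma bessel (w : R -> R) (M : R) (J : nat) : continuous w ->
  (forall t, 0 <= t <= 2 * pi -> `|w t| <= M) ->
  \sum_(1 <= j < J) (cos_coef w j) ^+ 2 <= 2 * M ^+ 2.
Proof.
move=> cw wM.
have p0 := @pi_gt0 R.
pose v := cos_coef w.
pose S t : R := \sum_(1 <= j < J) v j * cos (j%:R * t).
have cS : continuous S.
  apply: continuous_sum => j; apply: continuousZ; exact: continuous_cosM.
pose I (f : R -> R) := \int[mu]_(t in `[0, 2 * pi]) f t.
have IS (f : R -> R) : continuous f ->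
    I (fun t => f t * S t) = \sum_(1 <= j < J) v j * I (fun t => f t * cos (j%:R * t)).
  move=> cf; rewrite /I.
  have cfc j : continuous (fun t : R => f t * cos (j%:R * t)).
    by apply: continuousM => //; exact: continuous_cosM.
  have e t : f t * S t = \sum_(1 <= j < J) (v j * (f t * cos (j%:R * t))).
    by rewrite /S mulr_sumr; apply: eq_bigr => j _; rewrite mulrCA.
  under eq_Rintegral do rewrite e.
  rewrite cts_Rintegral_sum; last by move=> j; exact: continuousZ.
  by apply: eq_bigr => j _; rewrite cts_RintegralZ.
have Iw j : (1 <= j)%N -> I (fun t => w t * cos (j%:R * t)) = pi * v j.
  by move=> j1; rewrite /v /cos_coef -/(I _); case: j j1 => //= j _; field; lra.
have ISc j : (1 <= j < J)%N -> I (fun t => S t * cos (j%:R * t)) = pi * v j.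
  move=> /andP[j1 jJ].
  have -> : I (fun t => S t * cos (j%:R * t)) = I (fun t => cos (j%:R * t) * S t).
    by apply: eq_Rintegral => t _; rewrite mulrC.
  rewrite IS; last exact: continuous_cosM.
  rewrite (@big_cat_nat _ _ _ j)//=; last exact: ltnW.
  rewrite [X in _ + X]big_ltn//= /I !circle_coscos eqxx.
  rewrite big_nat_cond big1 ?add0r; last first.
    move=> i /andP[/andP[_ ij] _]; rewrite circle_coscos ifF ?mulr0//.
    by apply/negbTE; rewrite gtn_eqF.
  rewrite big_nat_cond big1 ?addr0; last first.
    move=> i /andP[/andP[ij _] _]; rewrite circle_coscos ifF ?mulr0//.
    by apply/negbTE; rewrite ltn_eqF.
  by rewrite (gtn_eqF j1) mulrC.
have IwS : I (fun t => w t * S t) = pi * \sum_(1 <= j < J) v j ^+ 2.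
  rewrite IS// mulr_sumr; apply: eq_big_nat => j /andP[j1 _].
  by rewrite Iw//; ring.
have ISS : I (fun t => S t * S t) = pi * \sum_(1 <= j < J) v j ^+ 2.
  rewrite IS// mulr_sumr; apply: eq_big_nat => j jJ.
  by rewrite ISc//; ring.
have c1 := continuousM cw cw.
have c2 := continuousM cw cS.
have c3 := continuousM cS cS.
have c4 := continuousB c3 c2.
have c5 := continuousB c1 c2.
have h0 : 0 <= I (fun t => (w t * w t - w t * S t) + (S t * S t - w t * S t)).
  apply: Rintegral_ge0 => t _.
  by rewrite (_ : _ + _ = (w t - S t) ^+ 2) ?sqr_ge0//; ring.
move: h0; rewrite /I cts_RintegralD// !cts_RintegralB//.
rewrite -!/(I _) IwS ISS.
have Iww : I (fun t => w t * w t) <= M ^+ 2 * (2 * pi - 0).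
  apply: le_trans (ler_norm _) _; apply: Rintegral_norm_le => //.
    by rewrite mulr_ge0// ltW.
  by move=> t /wM h; rewrite normrM -expr2 ler_sqr ?nnegrE// (le_trans _ h).
set s := \sum_(_ <= _ < _) _.
rewrite subrr addr0 subr_ge0 => h.
have {Iww}h : pi * s <= pi * (2 * M ^+ 2) by apply: (le_trans h); apply: (le_trans Iww); lra.
by rewrite -(ler_pM2l p0).
Qed.

End trig.

(** * Fourier modes of functions of class H^s *)

Section lorentz.
Context {R : realType}.
Notation mu := (@lebesgue_measure R).

Lemma sqrD_gt0 (r x : R) : 0 < r -> 0 < r ^+ 2 + x ^+ 2.
Proof. by move=> r0; rewrite ltr_wpDr ?sqr_ge0// exprn_gt0. Qed.

Lemma continuous_lorentz (r : R) : 0 < r -> continuous (fun x : R => (r ^+ 2 + x ^+ 2)^-1).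
Proof.
move=> r0 x; apply: cvgV; first by rewrite gt_eqF// sqrD_gt0.
apply: cvgD; first exact: cvg_cst.
exact: (@exprn_continuous R 2 x).
Qed.

Lemma integral_lorentz (r : R) : 0 < r ->
  (\int[mu]_x ((r ^+ 2 + x ^+ 2)^-1)%:E = (pi / r)%:E)%E.
Proof.
move=> r0.
have lor0 x : 0 <= (r ^+ 2 + x ^+ 2)^-1 by rewrite invr_ge0 ltW// sqrD_gt0.
have dF (x : R) : is_derive x (1 : R) (fun x => r^-1 * atan (r^-1 * x)) ((r ^+ 2 + x ^+ 2)^-1).
  have h : is_derive x (1 : R) (fun x : R => r^-1 * x) r^-1.
    by apply: is_derive_eq; rewrite /GRing.scale/= mulr1.
  have h2 := is_derive1_comp (is_derive1_atan (r^-1 * x)) h.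
  apply: is_derive_eq; rewrite /GRing.scale/=.
  by field; rewrite !gt_eqF// ?sqrD_gt0//.
have cF := is_derive_continuous dF.
have fy : r^-1 * atan (r^-1 * x) @[x --> +oo%R] --> r^-1 * (pi / 2).
  apply: cvgM; first exact: cvg_cst.
  apply: (@cvg_comp _ _ _ (fun x => r^-1 * x) _ _ (+oo)%R); last exact: cvgy_atan.
  apply/cvgryPge => B; exists (B * r); split; first exact: num_real.
  by move=> x /ltW h; rewrite mulrC ler_pdivlMr.
rewrite ge0_symfun_integralT//.
- rewrite -set_itvcy (@ge0_continuous_FTC2y _ _ (fun x => r^-1 * atan (r^-1 * x)) 0 (r^-1 * (pi / 2)))//.
  + by rewrite mulr0 atan0 mulr0 sube0 -EFinM; congr EFin; lra.
  + exact/continuous_subspaceT/continuous_lorentz.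
  + exact/cvg_at_right_filter/cF.
  + by move=> x _; exact: is_derive_derive1 (dF x).
- exact: continuous_lorentz.
- by move=> x /=; rewrite sqrrN.
Qed.

Lemma integrable_lorentz (r : R) : 0 < r ->
  mu.-integrable setT (EFin \o (fun x : R => (r ^+ 2 + x ^+ 2)^-1)).
Proof.
move=> r0; apply/integrableP; split.
  by apply/measurable_EFinP; apply: continuous_measurable_fun; exact: continuous_lorentz.
under eq_integral => x _ do rewrite /= ger0_norm ?invr_ge0 ?(ltW (sqrD_gt0 x r0))//.
by rewrite integral_lorentz// ltry.
Qed.

Lemma Rintegral_lorentz (r : R) : 0 < r ->
  \int[mu]_x (r ^+ 2 + x ^+ 2)^-1 = pi / r.
Proof. by move=> r0; rewrite /Rintegral integral_lorentz. Qed.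

Lemma sum_inv_sqr (n : nat) : \sum_(0 <= k < n) (1 + k%:R ^+ 2)^-1 <= 3 :> R.
Proof.
case: n => [|n]; first by rewrite big_geq//.
(* The subtracted term strengthens the claim so that it passes through the induction. *)
suff : \sum_(0 <= k < n.+1) (1 + k%:R ^+ 2)^-1 <= 3 - 2 / n.+1%:R :> R.
  move=> h; apply: (le_trans h); rewrite gerBl//.
elim: n => [|n IH]; first by rewrite big_nat1 expr0n addr0 invr1; lra.
rewrite big_nat_recr//=; apply: le_trans (lerD IH (lexx _)) _.
have n0 : 0 < n.+1%:R :> R by rewrite ltr0n.
rewrite -[n.+2%:R]natr1; move: n.+1%:R n0 => m m0.
rewrite -subr_ge0.
rewrite (_ : _ - _ = (m ^+ 2 - m + 2) / (m * (m + 1) * (1 + m ^+ 2))); last first.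
  by field; rewrite !gt_eqF//; nra.
rewrite divr_ge0//; first by nra.
by rewrite !mulr_ge0//; nra.
Qed.

End lorentz.

(** * Summable majorants for the modes of an H^s function *)

Section Hs.
Context {R : realType}.
Notation mu := (@lebesgue_measure R).
Variables (s T : R) (s_gt : 3 / 2 < s) (T_gt0 : 0 < T).

Let om : R := 2 * pi / T.
Let om_gt0 : 0 < om.
Proof. by rewrite /om divr_gt0// mulr_gt0// pi_gt0. Qed.

(** The power 3 / 2 is split as 1 / 2 + 1: a factor [r], which depends on the time frequency alone,
    and a factor whose inverse is integrable in [x]. The inverse of the product integrates to pi / r
    ^ 2, which is summable over the modes. *)
Lemma sobolev_weight_ge (r x : R) : 1 <= r ->
  r * (r ^+ 2 + x ^+ 2) <= (r ^+ 2 + x ^+ 2) `^ s.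
Proof.
move=> r1; set w := r ^+ 2 + x ^+ 2.
have rw : r ^+ 2 <= w by rewrite lerDl sqr_ge0.
have w1 : 1 <= w by apply: le_trans rw; rewrite expr_ge1//; lra.
have w0 : 0 <= w by lra.
apply: (@le_trans _ _ (w `^ (2^-1 + 1))).
  rewrite powRD; last by apply/implyP => _; rewrite gt_eqF//; lra.
  rewrite powRr1// powR12_sqrt// ler_wpM2r//.
  by rewrite -[leLHS]ger0_norm -?sqrtr_sqr ?ler_wsqrtr//; lra.
apply: ler_powR => //; apply: le_trans (ltW s_gt).
by rewrite (_ : 2^-1 + 1 = 3 / 2) //; field.
Qed.

(** Young's inequality, used pointwise in place of the Cauchy-Schwarz inequality: integrability of
    [A] follows from that of [w^-1] and of the Sobolev density. *)
Lemma norm_le_weight (A w W : R) : 0 < w -> w <= W -> `|A| <= (w^-1 + W * A ^+ 2) / 2.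
Proof.
move=> w0 wW.
have h : w * A ^+ 2 <= W * A ^+ 2 by rewrite ler_wpM2r ?sqr_ge0.
have : 0 <= w^-1 * (1 - w * `|A|) ^+ 2 by rewrite mulr_ge0 ?sqr_ge0// invr_ge0 ltW.
have -> : w^-1 * (1 - w * `|A|) ^+ 2 = w^-1 - 2 * `|A| + w * A ^+ 2.
  by rewrite -(real_normK (num_real A)); field; rewrite gt_eqF.
lra.
Qed.

Variables (A B : nat -> R -> R).
Hypothesis (mA : forall k, measurable_fun setT (A k)).
Hypothesis (mB : forall k, measurable_fun setT (B k)).
Let wt (k : nat) (eta : R) : R := (1 + eta ^+ 2 + (2 * pi * k%:R / T) ^+ 2) `^ s.
Let g (k : nat) (eta : R) : R := wt k eta * ((A k eta) ^+ 2 + (B k eta) ^+ 2).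
Hypothesis gfin : (\sum_(0 <= k <oo) \int[mu]_eta (g k eta)%:E < +oo)%E.

Let r (k : nat) : R := Num.sqrt (1 + (om * k%:R) ^+ 2).
Let r2 k : r k ^+ 2 = 1 + (om * k%:R) ^+ 2.
Proof. by rewrite sqr_sqrtr// addr_ge0// sqr_ge0. Qed.
Let r1 k : 1 <= r k.
Proof. by rewrite -[leLHS]sqrtr1 ler_wsqrtr// lerDl sqr_ge0. Qed.
Let r0 k : 0 < r k.
Proof. exact: lt_le_trans (r1 k). Qed.

Let wtE k eta : wt k eta = (r k ^+ 2 + eta ^+ 2) `^ s.
Proof.
rewrite /wt r2 /om; congr (_ `^ _).
by rewrite (_ : 2 * pi * k%:R / T = 2 * pi / T * k%:R); [ring|rewrite mulrAC].
Qed.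

Let g_ge0 k eta : 0 <= g k eta.
Proof. by rewrite mulr_ge0// ?powR_ge0// addr_ge0// sqr_ge0. Qed.

Let mg k : measurable_fun setT (g k).
Proof.
apply: measurable_funM.
  apply: (measurableT_comp (measurable_powR s)).
  apply: continuous_measurable_fun => x; apply: cvgD; last exact: cvg_cst.
  apply: cvgD; first exact: cvg_cst.
  exact: (@exprn_continuous R 2 x).
by apply: measurable_funD; apply: measurable_funX.
Qed.

Let intg_ge0 k : (0 <= \int[mu]_eta (g k eta)%:E)%E.
Proof. by apply: integral_ge0 => x _; rewrite lee_fin. Qed.

Let intg_part n : (\sum_(0 <= k < n) \int[mu]_eta (g k eta)%:E <=
  \sum_(0 <= k <oo) \int[mu]_eta (g k eta)%:E)%E.
Proof. by apply: nneseries_lim_ge => k _ _; exact: intg_ge0. Qed.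

Let intg_lty k : (\int[mu]_eta (g k eta)%:E < +oo)%E.
Proof.
apply: le_lt_trans gfin; apply: le_trans (intg_part k.+1).
by rewrite big_nat_recr//= leeDr// sume_ge0.
Qed.

Let ig k : mu.-integrable setT (EFin \o g k).
Proof.
apply/integrableP; split; first by apply/measurable_EFinP; exact: mg.
by under eq_integral => x _ do rewrite /= ger0_norm//.
Qed.

(** Majorant of [|A k| + |B k|]: the first term integrates to pi / r_k ^ 2, the second is the
    Sobolev energy of mode k, and both are summable in k. *)
Let G k eta : R := (r k)^-1 * (r k ^+ 2 + eta ^+ 2)^-1 + g k eta.

Let iG k : mu.-integrable setT (EFin \o G k).
Proof.
have -> : EFin \o G k = (fun x => ((r k)^-1)%:E * ((r k ^+ 2 + x ^+ 2)^-1)%:E + (g k x)%:E)%E.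
  by apply/funext => x; rewrite /= EFinD EFinM.
apply: integrableD => //; last exact: ig.
by apply: integrableZl => //; exact: integrable_lorentz.
Qed.

Let ABG k eta : `|A k eta| + `|B k eta| <= G k eta.
Proof.
have h := @sobolev_weight_ge (r k) eta (r1 k).
have w0 : 0 < r k * (r k ^+ 2 + eta ^+ 2) by rewrite mulr_gt0// sqrD_gt0.
have hA := norm_le_weight (A k eta) w0 h.
have hB := norm_le_weight (B k eta) w0 h.
apply: (le_trans (lerD hA hB)); rewrite /G /g wtE invfM mulrDr.
set p := (r k)^-1 / _; set q := _ * A k eta ^+ 2; set q' := _ * B k eta ^+ 2.
have q0 : 0 <= q by rewrite mulr_ge0 ?powR_ge0 ?sqr_ge0.
have q0' : 0 <= q' by rewrite mulr_ge0 ?powR_ge0 ?sqr_ge0.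
by move: p q q' q0 q0' => p q q' q0 q0'; lra.
Qed.

Let M k : R := \int[mu]_eta G k eta.
Let N k : R := fine (\int[mu]_eta (g k eta)%:E)%E.

Let ME k : M k = pi / r k ^+ 2 + N k.
Proof.
rewrite /M RintegralD//.
  rewrite RintegralZl//; last exact: integrable_lorentz.
  by rewrite Rintegral_lorentz//; congr (_ + _); field; rewrite gt_eqF.
have -> : EFin \o (fun x => (r k)^-1 * (r k ^+ 2 + x ^+ 2)^-1) =
    (fun x => ((r k)^-1)%:E * ((r k ^+ 2 + x ^+ 2)^-1)%:E)%E.
  by apply/funext => x; rewrite /= EFinM.
by apply: integrableZl => //; exact: integrable_lorentz.
Qed.

Let M_ge0 k : 0 <= M k.
Proof.
by apply: Rintegral_ge0 => x _; apply: le_trans (ABG k x); rewrite addr_ge0.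
Qed.

Let bM : exists C, bsum M C.
Proof.
exists (pi * ((1 + om ^- 2) * 3) + fine (\sum_(0 <= k <oo) \int[mu]_eta (g k eta)%:E)%E).
move=> n; under eq_bigr do rewrite ger0_norm// ME.
rewrite big_split/=; apply: lerD.
  rewrite -mulr_sumr ler_wpM2l ?pi_ge0//.
  apply: (@le_trans _ _ (\sum_(0 <= k < n) (1 + om ^- 2) * (1 + k%:R ^+ 2)^-1)).
    apply: ler_sum => k _; rewrite r2 exprMn.
    have k0 : 0 <= k%:R ^+ 2 :> R by rewrite sqr_ge0.
    have o2 : 0 < om ^+ 2 by rewrite exprn_gt0.
    move: (k%:R ^+ 2) (om ^+ 2) k0 o2 => q o q0 o0.
    have oq : 0 <= o * q by rewrite mulr_ge0// ltW.
    rewrite -[leLHS]mul1r ler_pdivrMr; last by lra.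
    rewrite mulrAC ler_pdivlMr; last by lra.
    rewrite mul1r mulrDl mul1r mulrDr mulr1 mulKf ?gt_eqF//.
    have : 0 <= o^-1 by rewrite invr_ge0 ltW.
    lra.
  rewrite -mulr_sumr ler_wpM2l ?sum_inv_sqr// addr_ge0// invr_ge0.
  by rewrite exprn_ge0// ltW.
have fin : (\sum_(0 <= k <oo) \int[mu]_eta (g k eta)%:E)%E \is a fin_num.
  by rewrite ge0_fin_numE//; apply: nneseries_ge0 => k _ _; exact: intg_ge0.
rewrite -lee_fin fineK// -sumEFin; apply: le_trans (intg_part n).
apply: lee_sum => k _; rewrite /N fineK// ge0_fin_numE; [exact: intg_lty|exact: intg_ge0].
Qed.

Let mAc (c : R) k (x : R) : measurable_fun setT (fun eta => A k eta * cos (eta * x + c) + B k eta * sin (eta * x + c)).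
Proof.
have cx : continuous (fun eta : R => eta * x + c).
  by move=> e; apply: cvgD; [exact: mulrr_continuous|exact: cvg_cst].
apply: measurable_funD; apply: measurable_funM => //; apply: continuous_measurable_fun => e.
  by apply: continuous_comp; [exact: cx|exact: continuous_cos].
by apply: continuous_comp; [exact: cx|exact: continuous_sin].
Qed.

Let ABle (c : R) k (x eta : R) :
  `|A k eta * cos (eta * x + c) + B k eta * sin (eta * x + c)| <= G k eta.
Proof.
apply: le_trans (ABG k eta); apply: le_trans (ler_normD _ _) _.
by rewrite !normrM lerD// ler_piMr// ?cos_max ?sin_max.
Qed.

Let iAB (c : R) k (x : R) : mu.-integrable setT
  (EFin \o (fun eta => A k eta * cos (eta * x + c) + B k eta * sin (eta * x + c))).
Proof.
apply: (le_integrable _ _ _ (iG k)) => //.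
  by apply/measurable_EFinP; exact: mAc.
move=> eta _; rewrite /= lee_fin; apply: le_trans (ler_norm _); exact: ABle.
Qed.

Let osc k c x : R := \int[mu]_eta (A k eta * cos (eta * x + c) + B k eta * sin (eta * x + c)).

Let osc_cts k c : continuous (osc k c).
Proof.
move=> x.
have := @continuity_under_integral R _ _ mu
  (fun x eta => A k eta * cos (eta * x + c) + B k eta * sin (eta * x + c)) setT
  measurableT (x - 1) (x + 1) (fun y _ => iAB c k y) _ (G k) (iG k) _ x.
apply.
- apply: aeW => eta _ y _.
  have cx : continuous (fun y : R => eta * y + c).
    by move=> e; apply: cvgD; [exact: mulrl_continuous|exact: cvg_cst].
  apply: cvgD; apply: cvgM; (try exact: cvg_cst).
    by apply: continuous_comp; [exact: cx|exact: continuous_cos].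
  by apply: continuous_comp; [exact: cx|exact: continuous_sin].
- by move=> y _; apply: aeW => eta _; exact: ABle.
- by rewrite inE/= in_itv/=; apply/andP; split; lra.
Qed.

Let osc_le k c x : `|osc k c x| <= M k.
Proof.
apply: le_trans (le_normr_Rintegral _ (iAB c k x)) _ => //.
apply: le_Rintegral => //.
rewrite (_ : EFin \o _ = (fun y => `|(A k y * cos (y * x + c) + B k y * sin (y * x + c))%R%:E|)%E)//.
by apply: integrable_abse; exact: iAB.
Qed.

Lemma Hs_modes : exists (a b : nat -> R -> R) (M : nat -> R) (C : R),
  [/\ bsum M C, (forall k, continuous (a k)) /\ (forall k, continuous (b k)),
    (forall k x, `|a k x| <= M k /\ `|b k x| <= M k) &
    forall k x t, \int[mu]_eta (A k eta * cos (eta * x + 2 * pi * k%:R / T * t)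
      + B k eta * sin (eta * x + 2 * pi * k%:R / T * t)) =
      a k x * cos (2 * pi * k%:R / T * t) + b k x * sin (2 * pi * k%:R / T * t)].
Proof.
have [C MC] := bM.
(* A phase shift by pi / 2 turns cos into - sin and sin into cos, so both families are values of the
   same oscillatory integral [osc]. *)
exists (fun k => osc k 0), (fun k => osc k (pi / 2)), M, C; split => //.
move=> k x t; set th := 2 * pi * k%:R / T * t.
rewrite /osc -!RintegralZr//; [|exact: iAB..].
rewrite -RintegralD//; first last.
- rewrite (_ : EFin \o _ = (fun y => (A k y * cos (y * x + pi / 2) + B k y * sin (y * x + pi / 2))%R%:E * (sin th)%:E)%E)//.
  by apply: integrableZr => //; exact: iAB.
- rewrite (_ : EFin \o _ = (fun y => (A k y * cos (y * x + 0) + B k y * sin (y * x + 0))%R%:E * (cos th)%:E)%E)//.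
  by apply: integrableZr => //; exact: iAB.
apply: eq_Rintegral => eta _; rewrite cosDpihalf sinDpihalf addr0 cosD sinD; ring.
Qed.

End Hs.

Lemma Hs_cylinder_modes (R : realType) (s T : R) (U : R -> R -> R) :
  3 / 2 < s -> 0 < T -> Hs_cylinder s T U ->
  exists (a b : nat -> R -> R) (M : nat -> R) (C : R),
  [/\ bsum M C, (forall k, continuous (a k)) /\ (forall k, continuous (b k)),
    (forall k x, `|a k x| <= M k /\ `|b k x| <= M k) &
    forall x t, U x t = limn (series (fun k => a k x * cos (2 * pi * k%:R / T * t)
      + b k x * sin (2 * pi * k%:R / T * t)))].
Proof.
move=> s_gt T0 [A [B [mA mB fin UE]]].
have [a [b [M [C [MC cab abM abE]]]]] := Hs_modes s_gt T0 mA mB fin.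
exists a, b, M, C; split => // x t.
rewrite -(cvg_lim _ (UE x t))//; congr (limn (series _)).
by apply/funext => k; exact: abE.
Qed.

(** * Exponential estimates for linear second-order equations *)

Section decay.
Context {R : realType}.
Implicit Types (f df : R -> R) (X A B a b c : R).

Lemma derive_ge0_le f df X : (forall x : R, X < x -> is_derive x (1 : R) f (df x)) ->
  (forall x, X < x -> 0 <= df x) -> forall x y, X < x -> x <= y -> f x <= f y.
Proof.
move=> dF df0 x y Xx; rewrite le_eqVlt => /orP[/eqP->//|xy].
have dF' z : z \in `]x, y[ -> is_derive z (1 : R) f (df z).
  by rewrite in_itv/= => /andP[xz _]; apply: dF; apply: lt_trans xz.
have cf : {within `[x, y], continuous f}.
  apply: derivable_within_continuous => z; rewrite in_itv/= => /andP[xz _].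
  by apply: is_derive_derivable (dF z _); apply: lt_le_trans xz.
have [z zxy e] := MVT xy dF' cf.
rewrite -subr_ge0 e mulr_ge0 ?subr_ge0 ?(ltW xy)// df0//.
by move: zxy; rewrite in_itv/= => /andP[xz _]; apply: lt_trans xz.
Qed.

Lemma exp_small (B c e : R) : 0 < c -> 0 < e -> exists Y : R, forall y, Y <= y -> B * expR (- (c * y)) <= e.
Proof.
move=> c0 e0; have [B0|B0] := leP B 0.
  exists 0 => y _; apply: le_trans (ltW e0).
  by rewrite mulr_le0_ge0// expR_ge0.
exists (c^-1 * (B / e)) => y Yy.
rewrite expRN ler_pdivrMr ?expR_gt0// -ler_pdivrMl// mulrC.
apply: le_trans (ltW _ : _ <= 1 + c * y) (expR_ge1Dx _).
by move: Yy; rewrite ler_pdivrMl// => h; lra.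
Qed.

Lemma le0_exp (X z B c : R) : 0 < c -> (forall y, X < y -> z <= B * expR (- (c * y))) -> z <= 0.
Proof.
move=> c0 h; rewrite leNgt; apply/negP => z0.
have z2 : 0 < z / 2 by lra.
have [Y hY] := exp_small B c0 z2.
have := hY (Num.max Y (X + 1)) ltac:(by rewrite le_max lexx).
have := h (Num.max Y (X + 1)) ltac:(by rewrite lt_max ltrDl ltr01 orbT); lra.
Qed.

Lemma is_derive_exp (A a x : R) : is_derive x (1 : R) (fun x => A * expR (a * x)) (A * (a * expR (a * x))).
Proof.
have h := is_derive_expM a x.
by apply: is_derive_eq; rewrite /GRing.scale/=.
Qed.

(** [f - A / a * exp (- a x)] is nondecreasing and bounded above by a vanishing exponential, hence
    nonpositive; likewise for [- f]. The a priori rate [c] and constant [B] serve only at infinity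
    and disappear from the result. *)
Lemma decay1 f df X A B a c : 0 < a -> 0 < c ->
  (forall x : R, X < x -> is_derive x (1 : R) f (df x)) ->
  (forall x, X < x -> `|df x| <= A * expR (- (a * x))) ->
  (forall x, X < x -> `|f x| <= B * expR (- (c * x))) ->
  forall x, X < x -> `|f x| <= A / a * expR (- (a * x)).
Proof.
move=> a0 c0 dF dA fB.
have key g dg : (forall x : R, X < x -> is_derive x (1 : R) g (dg x)) ->
  (forall x, X < x -> - (A * expR (- (a * x))) <= dg x) ->
  (forall x, X < x -> g x <= B * expR (- (c * x))) ->
  0 <= A ->
  forall x, X < x -> g x <= A / a * expR (- (a * x)).
  move=> dG dgA gB A0 x Xx; rewrite -subr_le0.
  apply: (@le0_exp x _ B c c0) => y xy.
  have Xy := lt_trans Xx xy.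
  apply: (@le_trans _ _ (g y - A / a * expR (- (a * y)))); last first.
    rewrite lerBlDr ler_wpDr ?gB// mulr_ge0 ?expR_ge0// divr_ge0// ltW//.
  have dh z : X < z -> is_derive z (1 : R) (fun z => g z - A / a * expR (- a * z)) (dg z + A * expR (- a * z)).
    move=> Xz; have h1 := dG z Xz; have h2 := is_derive_exp (A / a) (- a) z.
    by apply: is_derive_eq; field; rewrite gt_eqF.
  have := derive_ge0_le dh _ Xx (ltW xy); rewrite !mulNr; apply.
  by move=> z Xz; have := dgA z Xz; rewrite mulNr; lra.
move=> x Xx.
have A0 : 0 <= A.
  have := le_trans (normr_ge0 _) (dA x Xx).
  by rewrite pmulr_lge0// expR_gt0.
rewrite ler_norml; apply/andP; split; last first.
  apply: (key f df) => // z Xz.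
    by have := dA z Xz; rewrite ler_norml => /andP[].
  by have := fB z Xz; rewrite ler_norml => /andP[].
rewrite lerNl; apply: (key (fun x => - f x) (fun x => - df x)) => // z Xz.
- have h := dF z Xz; exact: is_deriveN.
- by rewrite lerN2; have := dA z Xz; rewrite ler_norml => /andP[].
- by rewrite lerNl; have := fB z Xz; rewrite ler_norml => /andP[].
Qed.

(** [f - E] is nondecreasing, [f + E] nonincreasing, and the first stays below the second; [k] is
    the supremum of the first. *)
Lemma decay_lim f df X A a : 0 < a ->
  (forall x : R, X < x -> is_derive x (1 : R) f (df x)) ->
  (forall x, X < x -> `|df x| <= A * expR (- (a * x))) ->
  exists k, forall x, X < x -> `|f x - k| <= A / a * expR (- (a * x)).
Proof.
move=> a0 dF dA.
have A0 : 0 <= A.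
  have := le_trans (normr_ge0 _) (dA (X + 1) ltac:(lra)).
  by rewrite pmulr_lge0// expR_gt0.
pose E x : R := A / a * expR (- a * x).
have E0 x : 0 <= E x by rewrite mulr_ge0 ?expR_ge0// divr_ge0// ltW.
have dE (x : R) : is_derive x (1 : R) E (- (A * expR (- a * x))).
  have h2 := is_derive_exp (A / a) (- a) x.
  by apply: is_derive_eq; field; rewrite gt_eqF.
have up x y : X < x -> x <= y -> f x - E x <= f y - E y.
  move=> Xx xy; apply: (@derive_ge0_le (fun z => f z - E z) (fun z => df z + A * expR (- a * z)) X _ _ x y Xx xy) => z Xz.
    have h1 := dF z Xz; have h2 := dE z.
    by apply: is_derive_eq; rewrite opprK.
  by have := dA z Xz; rewrite ler_norml => /andP[+ _]; rewrite mulNr; lra.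
have dn x y : X < x -> x <= y -> - f x - E x <= - f y - E y.
  move=> Xx xy; apply: (@derive_ge0_le (fun z => - f z - E z) (fun z => - df z + A * expR (- a * z)) X _ _ x y Xx xy) => z Xz.
    have h1 := dF z Xz; have h2 := dE z.
    by apply: is_derive_eq; rewrite opprK.
  by have := dA z Xz; rewrite ler_norml => /andP[_ +]; rewrite mulNr; lra.
have cross x y : X < x -> X < y -> f x - E x <= f y + E y.
  move=> Xx Xy; have [xy|/ltW yx] := leP x y.
    by have := up x y Xx xy; have := E0 y; lra.
  by have := dn y x Xy yx; have := E0 x; lra.
pose S := [set f x - E x | x in [set x | X < x]].
have S0 : S !=set0 by exists (f (X + 1) - E (X + 1)), (X + 1) => //=; lra.
exists (sup S) => x Xx.
have h1 : f x - E x <= sup S.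
  apply: ub_le_sup; last by exists x.
  by exists (f x + E x) => _ [y Xy <-]; exact: cross.
have h2 : sup S <= f x + E x by apply: ge_sup => // _ [y Xy <-]; exact: cross.
by rewrite /E mulNr in h1 h2; rewrite ler_norml; lra.
Qed.

(** * The hyperbolic mode: c'' = e^2 c + n *)

Section hyperbolic.
Variables (e X N B b g : R) (c dc n : R -> R).
Hypotheses (e0 : 0 < e) (b0 : 0 < b) (g0 : 0 < g).
Hypothesis dC : forall x : R, X < x -> is_derive x (1 : R) c (dc x).
Hypothesis ddC : forall x : R, X < x -> is_derive x (1 : R) dc (e ^+ 2 * c x + n x).
Hypothesis nN : forall x, X < x -> `|n x| <= N * expR (- (g * x)).
Hypothesis cB : forall x, X < x -> `|c x| <= B * expR (- (b * x)).
Hypothesis dcB : forall x, X < x -> `|dc x| <= B * expR (- (b * x)).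

(** The operator d^2 - e^2 factors as (d - e)(d + e). Multiplying by [expR (e * x)] turns the second
    factor into a derivative: [dq] is q', and the leading coefficient [k] will be the limit of
    [q]. *)
Let q x : R := c x * expR (e * x).
Let dq x : R := (dc x + e * c x) * expR (e * x).

Let dQ (x : R) : X < x -> is_derive x (1 : R) q (dq x).
Proof.
move=> Xx; have h1 := dC Xx; have h2 := is_derive_expM e x.
by apply: is_derive_eq; rewrite /GRing.scale/= /dq; ring.
Qed.

(** The first factor: [(dc + e c) exp (- e x)] has derivative [n exp (- e x)]. The a priori bounds
    exclude the growing solution exp (e x), so this quantity is integrated from infinity. *)
Let dq_le x : X < x -> `|dq x| <= N / (g + e) * expR (- ((g - e) * x)).
Proof.
move: (e0) (b0) (g0) => e0' b0' g0' Xx.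
have h := @decay1 (fun x => (dc x + e * c x) * expR (- e * x))
  (fun x => n x * expR (- e * x)) X N ((1 + e) * B) (g + e) (b + e) _ _ _ _ _ x Xx.
have {h} : `|(dc x + e * c x) * expR (- e * x)| <= N / (g + e) * expR (- ((g + e) * x)).
  apply: h; [lra|lra|move=> {}x {}Xx..].
  - have h1 := dC Xx; have h2 := ddC Xx; have h3 := is_derive_expM (- e) x.
    by apply: is_derive_eq; rewrite /GRing.scale/=; ring.
  - rewrite normrM [`|expR _|]ger0_norm ?expR_ge0//.
    rewrite (_ : - ((g + e) * x) = - (g * x) + - e * x); last by ring.
    by rewrite expRD mulrA ler_wpM2r ?expR_ge0// nN.
  - rewrite normrM [`|expR _|]ger0_norm ?expR_ge0//.
    rewrite (_ : - ((b + e) * x) = - (b * x) + - e * x); last by ring.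
    rewrite expRD mulrA ler_wpM2r ?expR_ge0//; apply: le_trans (ler_normD _ _) _.
    rewrite normrM (ger0_norm (ltW e0)).
    have h1 : e * `|c x| <= e * (B * expR (- (b * x))) by rewrite ler_pM2l// cB.
    by have h2 := dcB Xx; lra.
move=> h; rewrite /dq.
rewrite (_ : expR (e * x) = expR (- e * x) * expR (2 * e * x)); last first.
  by rewrite -expRD; congr expR; ring.
rewrite mulrA normrM [`|expR (2 * e * x)|]ger0_norm ?expR_ge0//.
rewrite (_ : - ((g - e) * x) = - ((g + e) * x) + 2 * e * x); last by ring.
by rewrite expRD mulrA ler_wpM2r ?expR_ge0.
Qed.

Let c_q x : c x = q x * expR (- (e * x)).
Proof. by rewrite /q -mulrA -expRD subrr expR0 mulr1. Qed.

Lemma hyperbolic_lim : e < g -> exists k, forall x, X < x ->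
  `|c x - k * expR (- (e * x))| <= N / (g + e) / (g - e) * expR (- (g * x)).
Proof.
move=> eg; have ge0 : 0 < g - e by lra.
have [k kP] := decay_lim ge0 dQ dq_le.
exists k => x Xx; have := kP x Xx.
rewrite -(ler_pM2r (expR_gt0 (- (e * x)))) => h.
rewrite c_q -mulrBl normrM [`|expR _|]ger0_norm ?expR_ge0//.
apply: (le_trans h); rewrite -!mulrA -expRD.
by rewrite (_ : - ((g - e) * x) + - (e * x) = - (g * x))//; ring.
Qed.

(** The extra decay forces the limit of [q] to be 0. The resulting constant does not involve [B'],
    which is what permits iteration. *)
Lemma hyperbolic_unique (B' : R) : e < g ->
  (forall x, X < x -> `|c x| <= B' * expR (- (g * x))) ->
  forall x, X < x -> `|c x| <= N / (g + e) / (g - e) * expR (- (g * x)).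
Proof.
move=> eg cB' x Xx.
have h := @decay1 q dq X _ B' (g - e) (g - e) _ _ dQ dq_le _ x Xx.
have {h} : `|q x| <= N / (g + e) / (g - e) * expR (- ((g - e) * x)).
  apply: h; [lra|lra|move=> z Xz].
  rewrite /q normrM [`|expR _|]ger0_norm ?expR_ge0//.
  rewrite (_ : - ((g - e) * z) = - (g * z) + e * z); last by ring.
  by rewrite expRD mulrA ler_wpM2r ?expR_ge0// cB'.
move=> h; rewrite c_q normrM [`|expR _|]ger0_norm ?expR_ge0//.
rewrite (_ : - (g * x) = - ((g - e) * x) + - (e * x)); last by ring.
by rewrite expRD mulrA ler_wpM2r ?expR_ge0.
Qed.

(** For [g < e] the bound on q' grows, so [q] is integrated forward, against the growing primitive
    [E]. The constant depends on the value at the starting point [X + 1], which must lie inside the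
    half-line; hence the shift. *)
Lemma hyperbolic_boot : g < e -> exists C, forall x, X + 1 <= x ->
  `|c x| <= C * expR (- (g * x)).
Proof.
move: (e0) (b0) (g0) => e0' b0' g0' ge.
have N0 : 0 <= N.
  have := le_trans (normr_ge0 _) (nN (x := X + 1) ltac:(lra)).
  by rewrite pmulr_lge0// expR_gt0.
pose K := N / (g + e) / (e - g).
have K0 : 0 <= K by rewrite !divr_ge0//; lra.
pose E x : R := K * expR ((e - g) * x).
have dE (x : R) : is_derive x (1 : R) E (N / (g + e) * expR ((e - g) * x)).
  have h2 := is_derive_exp K (e - g) x.
  by apply: is_derive_eq; rewrite /K; field; lra.
have up x y : X < x -> x <= y -> q x + E x <= q y + E y.
  move=> Xx xy; apply: (@derive_ge0_le (fun z => q z + E z) (fun z => dq z + N / (g + e) * expR ((e - g) * z)) X _ _ x y Xx xy) => z Xz.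
    by have h1 := dQ Xz; have h2 := dE z; apply: is_derive_eq.
  have := dq_le Xz; rewrite ler_norml => /andP[+ _].
  by rewrite (_ : - ((g - e) * z) = (e - g) * z); [lra|ring].
have dn x y : X < x -> x <= y -> - q x + E x <= - q y + E y.
  move=> Xx xy; apply: (@derive_ge0_le (fun z => - q z + E z) (fun z => - dq z + N / (g + e) * expR ((e - g) * z)) X _ _ x y Xx xy) => z Xz.
    by have h1 := dQ Xz; have h2 := dE z; apply: is_derive_eq.
  have := dq_le Xz; rewrite ler_norml => /andP[_ +].
  by rewrite (_ : - ((g - e) * z) = (e - g) * z); [lra|ring].
have X1 : X < X + 1 by lra.
have E0 x : 0 <= E x by rewrite mulr_ge0 ?expR_ge0.
exists (`|q (X + 1)| * expR (- ((e - g) * (X + 1))) + K) => x Xx.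
have h1 := up _ _ X1 Xx; have h2 := dn _ _ X1 Xx.
have h : `|q x| <= `|q (X + 1)| + E x.
  rewrite ler_norml; have := ler_norm (q (X + 1)); have := ler_norm (- q (X + 1)).
  by rewrite normrN; have := E0 (X + 1); lra.
have {}h : `|q x| <= (`|q (X + 1)| * expR (- ((e - g) * (X + 1))) + K) * expR ((e - g) * x).
  apply: (le_trans h); rewrite mulrDl lerD2r -mulrA -expRD.
  rewrite ler_peMr// -[leLHS]expR0 ler_expR.
  have : 0 <= (e - g) * (x - (X + 1)) by rewrite mulr_ge0//; lra.
  lra.
rewrite c_q normrM [`|expR _|]ger0_norm ?expR_ge0//.
rewrite (_ : - (g * x) = (e - g) * x + - (e * x)); last by ring.
by rewrite expRD mulrA ler_wpM2r ?expR_ge0.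
Qed.

End hyperbolic.

(** * The elliptic modes: an energy estimate over all frequencies *)

Section elliptic.
Variables (X S b g : R) (om : nat -> R) (d dd n : nat -> R -> R) (B : nat -> R).
Hypotheses (b0 : 0 < b) (bg : b <= g) (S0 : 0 < S).
Hypothesis om_gt0 : forall j, (1 < j)%N -> 0 < om j.
Hypothesis om_sum : forall J, \sum_(2 <= j < J) (om j)^-1 <= 18.
Hypothesis dD : forall j (x : R), X < x -> is_derive x (1 : R) (d j) (dd j x).
Hypothesis ddD : forall j (x : R), (1 < j)%N -> X < x ->
  is_derive x (1 : R) (dd j) (- om j * d j x + n j x).
Hypothesis nS : forall J x, X < x -> \sum_(2 <= j < J) (n j x) ^+ 2 <= S ^+ 2 * expR (- (2 * g * x)).
Hypothesis dB : forall j x, X < x -> `|d j x| <= B j * expR (- (b * x)).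
Hypothesis ddB : forall j x, X < x -> `|dd j x| <= B j * expR (- (b * x)).

(** [om j] stands here for the positive stiffness of mode j, which is w ^ 2 j ^ 2 - 1 in the
    application. This energy is conserved by the free oscillators, so only the source changes it. *)
Let E J x : R := \sum_(2 <= j < J) ((dd j x) ^+ 2 + om j * (d j x) ^+ 2).

Let dE J (x : R) : X < x ->
  is_derive x (1 : R) (E J) (\sum_(2 <= j < J) 2 * (dd j x * n j x)).
Proof.
move=> Xx; elim: J => [|J IH].
  rewrite big_geq// (_ : E 0%N = cst 0); first exact: is_derive_cst.
  by apply/funext => y; rewrite /E big_geq.
have [J2|J2] := ltnP J 2.
  rewrite big_geq// (_ : E J.+1 = cst 0); first exact: is_derive_cst.
  by apply/funext => y; rewrite /E big_geq.
rewrite big_nat_recr//= (_ : E J.+1 = (fun y => E J y + ((dd J y) ^+ 2 + om J * (d J y) ^+ 2))); last first.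
  by apply/funext => y; rewrite /E big_nat_recr.
have h1 := dD J Xx; have h2 := @ddD J x J2 Xx.
by apply: is_derive_eq; rewrite /GRing.scale/=; ring.
Qed.

Let K : R := S ^+ 2 / (b * g).
Let K0 : 0 < K.
Proof. by rewrite divr_gt0// ?exprn_gt0// mulr_gt0// (lt_le_trans b0). Qed.

(** The factor [expR (b * x)] produces a term b E that absorbs the loss in
    [2 dd n >= - b dd ^ 2 - n ^ 2 / b]; the remaining source is paid for by the second term of [h],
    so [h] is nondecreasing. By the a priori rate it lies below a vanishing exponential, hence it is
    nonpositive. *)
Lemma elliptic_energy J x : X < x -> E J x <= K * expR (- (2 * g * x)).
Proof.
move: (b0) (bg) => b0' bg' Xx; have g0 : 0 < g by lra.
pose h x : R := E J x * expR (b * x) - K * expR ((b - 2 * g) * x).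
pose dh x : R := (\sum_(2 <= j < J) 2 * (dd j x * n j x) + b * E J x) * expR (b * x)
  + K * (2 * g - b) * expR ((b - 2 * g) * x).
have dH (y : R) : X < y -> is_derive y (1 : R) h (dh y).
  move=> Xy; have h1 := dE J Xy; have h2 := is_derive_expM b y.
  have h3 := is_derive_exp K (b - 2 * g) y.
  by apply: is_derive_eq; rewrite /GRing.scale/= /dh; ring.
have dh0 y : X < y -> 0 <= dh y.
  move=> Xy; rewrite /dh.
  rewrite (_ : (b - 2 * g) * y = - (2 * g * y) + b * y); last by ring.
  rewrite expRD mulrA -mulrDl mulr_ge0 ?expR_ge0//.
  have s1 : - (b * E J y) - b^-1 * \sum_(2 <= j < J) (n j y) ^+ 2 <=
      \sum_(2 <= j < J) 2 * (dd j y * n j y).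
    rewrite /E !mulr_sumr -!sumrN -big_split/= big_nat_cond [leRHS]big_nat_cond.
    apply: ler_sum => j /andP[/andP[j2 _] _].
    have o0 := om_gt0 j2.
    have hsq : 0 <= b^-1 * (b * dd j y + n j y) ^+ 2.
      by rewrite mulr_ge0 ?sqr_ge0// invr_ge0 ltW.
    have e : b^-1 * (b * dd j y + n j y) ^+ 2 =
      b * dd j y ^+ 2 + 2 * (dd j y * n j y) + b^-1 * n j y ^+ 2.
      by field; rewrite gt_eqF.
    have : 0 <= b * (om j * d j y ^+ 2) by apply: mulr_ge0; [exact: ltW|apply: mulr_ge0; [exact: ltW|exact: sqr_ge0]].
    move: hsq; rewrite e; lra.
  have s2 : b^-1 * \sum_(2 <= j < J) (n j y) ^+ 2 <= b^-1 * (S ^+ 2 * expR (- (2 * g * y))).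
    by rewrite ler_pM2l ?invr_gt0// nS.
  have s3 : b^-1 * (S ^+ 2 * expR (- (2 * g * y))) <= K * (2 * g - b) * expR (- (2 * g * y)).
    rewrite mulrA ler_wpM2r ?expR_ge0// /K -subr_ge0.
    rewrite (_ : _ - _ = S ^+ 2 / (b * g) * (g - b)); last by field; rewrite !gt_eqF.
    by rewrite mulr_ge0 ?subr_ge0// divr_ge0 ?sqr_ge0// mulr_ge0// ltW.
  lra.
have hx : h x <= 0.
  (* [C] depends on the truncation [J], which is harmless: it only multiplies an exponential that
     vanishes at infinity. *)
  pose C : R := \sum_(2 <= j < J) (B j ^+ 2 + om j * B j ^+ 2).
  apply: (@le0_exp x _ C b b0) => y xy.
  have Xy := lt_trans Xx xy.
  apply: le_trans (derive_ge0_le dH dh0 Xx (ltW xy)) _.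
  apply: (@le_trans _ _ (E J y * expR (b * y))).
    by rewrite /h gerBl mulr_ge0 ?expR_ge0// ltW.
  rewrite (_ : - (b * y) = - (b * y) + - (b * y) + b * y); last by ring.
  rewrite expRD mulrA ler_wpM2r ?expR_ge0// expRD -expr2 mulr_suml.
  rewrite /E big_nat_cond [leRHS]big_nat_cond.
  apply: ler_sum => j /andP[/andP[j2 _] _]; rewrite mulrDl -mulrA -!exprMn.
  have sq z : `|z| <= B j * expR (- (b * y)) -> z ^+ 2 <= (B j * expR (- (b * y))) ^+ 2.
    by move=> zB; rewrite -real_normK ?num_real// ler_sqr ?nnegrE// (le_trans _ zB).
  by rewrite lerD ?sq ?ddB// ler_pM2l ?om_gt0// sq// dB.
move: hx; rewrite /h (_ : (b - 2 * g) * x = - (2 * g * x) + b * x); last by ring.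
by rewrite expRD mulrA -mulrBl pmulr_lle0 ?expR_gt0// subr_le0.
Qed.

(** Cauchy-Schwarz through Young's inequality with parameter [l], the square root of the energy
    bound: 18 / 2 + 1 / 2 is at most 10. The factor 1 / sqrt g is what makes large weights
    contracting. *)
Lemma elliptic_sum J x : X < x ->
  \sum_(2 <= j < J) `|d j x| <= 10 * S / Num.sqrt (b * g) * expR (- (g * x)).
Proof.
move: (b0) (bg) => b0' bg' Xx; have g0 : 0 < g by lra.
have bg0 : 0 < b * g by rewrite mulr_gt0.
pose l : R := S / Num.sqrt (b * g) * expR (- (g * x)).
have l0 : 0 < l by rewrite mulr_gt0 ?expR_gt0// divr_gt0// sqrtr_gt0.
have l2 : K * expR (- (2 * g * x)) = l ^+ 2.
  rewrite /l /K exprMn expr_div_n sqr_sqrtr ?(ltW bg0)// [expR _ ^+ 2]expr2 -expRD.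
  by congr (_ * expR _); ring.
have hE := @elliptic_energy J x Xx; rewrite l2 in hE.
apply: (@le_trans _ _ (\sum_(2 <= j < J) (2^-1 * l * (om j)^-1 + (2 * l)^-1 * (om j * d j x ^+ 2)))).
  rewrite big_nat_cond [leRHS]big_nat_cond.
  apply: ler_sum => j /andP[/andP[j2 _] _]; have o0 := om_gt0 j2.
  rewrite -subr_ge0 -(real_normK (num_real (d j x))).
  rewrite (_ : _ - _ = (l - om j * `|d j x|) ^+ 2 / (2 * l * om j)); last first.
    by field; rewrite !gt_eqF.
  by rewrite divr_ge0 ?sqr_ge0// !mulr_ge0// ltW.
rewrite big_split/= -!mulr_sumr.
have h1 : 2^-1 * l * \sum_(2 <= j < J) (om j)^-1 <= 2^-1 * l * 18.
  by rewrite ler_pM2l ?om_sum// mulr_gt0.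
have h2 : (2 * l)^-1 * \sum_(2 <= j < J) om j * d j x ^+ 2 <= (2 * l)^-1 * l ^+ 2.
  rewrite ler_pM2l; last by rewrite invr_gt0 mulr_gt0.
  apply: le_trans hE; rewrite /E.
  by apply: ler_sum => j _; rewrite lerDr sqr_ge0.
apply: (le_trans (lerD h1 h2)).
rewrite (_ : 10 * S / Num.sqrt (b * g) * expR (- (g * x)) = 10 * l); last by rewrite /l; ring.
rewrite (_ : (2 * l)^-1 * l ^+ 2 = l / 2); last by field; rewrite gt_eqF.
lra.
Qed.

End elliptic.
End decay.

(** * Real power series of entire functions *)

Section power_series.
Context {R : realType}.
Implicit Types (a c : nat -> R).

Lemma bounded_terms (u : nat -> R) (l : R) : series u @ \oo --> l ->
  exists B, forall n, `|u n| <= B.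
Proof.
move=> ul; have cu : cvgn (series u) by apply/cvg_ex; exists l.
have [M [_ hM]] := cvg_series_bounded cu.
by exists (M + 1) => n; apply: (hM (M + 1) _ n) => //; rewrite ltrDl.
Qed.

Lemma bsum_power a (r : R) : 0 < r -> (forall y : R, exists l : R, series (fun n => a n * y ^+ n) @ \oo --> l) ->
  exists C, bsum (fun n => a n * r ^+ n) C.
Proof.
move=> r0 ca; have [l hl] := ca (2 * r).
have [B hB] := bounded_terms hl.
exists (B / (1 - 2^-1)); apply: bsum_geometric; first by lra.
move=> k; have := hB k; rewrite exprMn mulrCA normrM.
rewrite [`|2 ^+ k|]ger0_norm ?exprn_ge0// => h.
by rewrite exprVn ler_pdivlMr ?exprn_gt0// mulrC.
Qed.

Lemma power_series_remainder c (M y : R) m : bsum c M -> `|y| <= 1 ->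
  (forall k, (k < m)%N -> c k = 0) ->
  `|limn (series (fun k => c k * y ^+ k)) - c m * y ^+ m| <= M * `|y| ^+ m.+1.
Proof.
move=> cM y1 c0.
pose v k := if (k <= m)%N then 0 else c k * y ^+ k.
have vM : bsum v (`|y| ^+ m.+1 * M).
  have := bsumZ (`|y| ^+ m.+1) cM; rewrite [X in bsum _ (X * _)]ger0_norm ?exprn_ge0//; apply: bsum_le => k.
  rewrite /v; case: leqP => km; first by rewrite normr0.
  rewrite !normrM mulrC ler_wpM2r// normrX [leRHS]ger0_norm ?exprn_ge0//.
  by rewrite -(subnKC km) exprD ler_piMr ?exprn_ge0// exprn_ile1.
have h1 := bsum_cvgP vM.
have h2 := @series_single R m (c m * y ^+ m).
have -> : limn (series (fun k => c k * y ^+ k)) = limn (series v) + c m * y ^+ m.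
  apply: cvg_lim => //.
  have -> : (fun k => c k * y ^+ k) = v + (fun k => if k == m then c m * y ^+ m else 0).
    apply/funext => k; rewrite /v !fctE; case: ltngtP => km.
    - by rewrite c0// mul0r addr0.
    - by rewrite addr0.
    - by rewrite km add0r.
  by rewrite seriesD; apply: cvgD.
by rewrite addrK mulrC; exact: bsum_lim_le.
Qed.

(** At the first nonzero coefficient, the chosen small [y] makes the remainder at most half of the
    leading term, so the sum cannot vanish. *)
Lemma power_series_eq0 c (M : R) : bsum c M ->
  (forall y : R, 0 < y <= 1 -> limn (series (fun k => c k * y ^+ k)) = 0) -> forall m, c m = 0.
Proof.
move=> cM c0; elim/ltn_ind => m IH.
apply/eqP; rewrite -normr_le0 leNgt; apply/negP => cm0.
have M0 := bsum_ge0 cM.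
pose y : R := Num.min 1 (`|c m| / (2 * (M + 1))).
have y0 : 0 < y by rewrite lt_min ltr01 divr_gt0//; lra.
have y1 : y <= 1 by rewrite ge_min lexx.
have := @power_series_remainder c M y m cM _ IH.
rewrite c0 ?y0// sub0r normrN normrM normrX (gtr0_norm y0) exprSr mulrA [M * _]mulrC -mulrA.
rewrite [`|c m| * _]mulrC ler_pM2l ?exprn_gt0// => /(_ y1).
have : M * y <= M * (`|c m| / (2 * (M + 1))) by rewrite ler_wpM2l// ge_min lexx orbT.
have : M * (`|c m| / (2 * (M + 1))) <= `|c m| / 2.
  rewrite -subr_ge0 (_ : _ - _ = `|c m| / (2 * (M + 1))); last by field; lra.
  by rewrite divr_ge0//; lra.
lra.
Qed.

Lemma expr_lipschitz (x y r : R) m : `|x| <= r -> `|y| <= r ->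
  `|x ^+ m - y ^+ m| <= m%:R * r ^+ m.-1 * `|x - y|.
Proof.
move=> xr yr; rewrite subrXX normrM mulrC ler_wpM2r//.
apply: le_trans (ler_norm_sum _ _ _) _.
apply: (@le_trans _ _ (\sum_(i < m) r ^+ m.-1)).
  apply: ler_sum => i _; rewrite normrM !normrX.
  have r0 : 0 <= r by apply: le_trans xr.
  rewrite (_ : m.-1 = (m.-1 - i) + i)%N; last by have := ltn_ord i; lia.
  rewrite exprD; apply: ler_pM; rewrite ?exprn_ge0//.
    by rewrite (_ : (m.-1 - i + i - i = m.-1 - i)%N) ?lerXn2r ?nnegrE//; lia.
  by rewrite lerXn2r ?nnegrE.
by rewrite sumr_const card_ord mulr_natl.
Qed.

Variables (a : nat -> R).
Hypothesis a_entire : forall r : R, exists C, bsum (fun m => a m * r ^+ m) C.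
Let P (y : R) : R := limn (series (fun m => a m * y ^+ m)).

(** The absence of powers below 3 yields the factor [r ^+ 2]: smallness of the arguments becomes
    smallness of the Lipschitz constant, with one [L] for all radii up to [rho]. *)
Lemma power_series_lipschitz (rho : R) : (forall m, (m < 3)%N -> a m = 0) -> 1 <= rho ->
  exists L : R, 0 < L /\ forall r x y, r <= rho -> `|x| <= r -> `|y| <= r ->
    `|P x - P y| <= L * r ^+ 2 * `|x - y|.
Proof.
(* Summability at [2 * rho] leaves a spare factor [2 ^+ m], which absorbs the factor [m] of the mean
   value bound. *)
move=> a0 rho1; have [C hC] := a_entire (2 * rho).
have C0 := bsum_ge0 hC.
exists (C + 1); split; first by lra.
move=> r x y rrho xr yr; have r0 : 0 <= r by apply: le_trans xr.
have [Cx hx] := a_entire x; have [Cy hy] := a_entire y.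
have -> : P x - P y = limn (series (fun m => a m * (x ^+ m - y ^+ m))).
  apply/esym/cvg_lim => //.
  have -> : (fun m => a m * (x ^+ m - y ^+ m)) = (fun m => a m * x ^+ m) + - (fun m => a m * y ^+ m).
    by apply/funext => m; rewrite !fctE; ring.
  rewrite seriesD seriesN; apply: cvgB; [exact: bsum_cvgP hx|exact: bsum_cvgP hy].
apply: (@le_trans _ _ (C * (r ^+ 2 * `|x - y|))); last first.
  by rewrite -mulrA ler_wpM2r ?mulr_ge0 ?exprn_ge0//; lra.
apply: bsum_lim_le; rewrite mulrC.
have := bsumZ (r ^+ 2 * `|x - y|) hC; rewrite [X in bsum _ (X * _)]ger0_norm ?mulr_ge0 ?exprn_ge0//.
apply: bsum_le => m.
have [m3|m3] := ltnP m 3; first by rewrite a0// !mul0r mulr0.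
rewrite !normrM [leRHS]mulrCA ler_wpM2l//.
apply: (le_trans (expr_lipschitz m xr yr)).
rewrite normr_id -(normrM r r) (ger0_norm (mulr_ge0 r0 r0)) -expr2 [leRHS]mulrAC ler_wpM2r//.
rewrite [`|_ ^+ m|]ger0_norm; last by rewrite exprn_ge0// mulr_ge0//; lra.
rewrite exprMn.
have e : r ^+ m.-1 <= r ^+ 2 * rho ^+ m.
  rewrite (_ : m.-1 = 2 + (m - 3))%N; last by lia.
  rewrite exprD ler_wpM2l ?exprn_ge0//.
  apply: (@le_trans _ _ (rho ^+ (m - 3))); first by rewrite lerXn2r ?nnegrE//; lra.
  by apply: ler_weXn2l => //; lia.
have m2 : m%:R <= 2 ^+ m :> R by rewrite -natrX ler_nat ltnW// ltn_expl.
rewrite mulrCA; apply: ler_pM => //; exact: exprn_ge0.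
Qed.

Lemma power_series_continuous : (forall m, (m < 3)%N -> a m = 0) -> continuous P.
Proof.
move=> a0 x; have x1 : 1 <= `|x| + 1 by rewrite lerDr.
have [L [L0 hL]] := power_series_lipschitz a0 x1.
pose K := L * (`|x| + 1) ^+ 2.
have K0 : 0 < K by rewrite mulr_gt0// exprn_gt0//; lra.
apply/cvgrPdist_le => e e0; near=> y.
have xy1 : `|x - y| <= 1 by near: y; apply: cvgr_dist_le.
have xyK : `|x - y| <= e / K.
  by near: y; apply: cvgr_dist_le => //; rewrite divr_gt0.
apply: le_trans (hL (`|x| + 1) x y (lexx _) _ _) _.
- by rewrite lerDl.
- rewrite -[y](subrK x) addrC; apply: le_trans (ler_normD _ _) _.
  by rewrite lerD2l distrC.
- by rewrite -/K mulrC -ler_pdivlMr.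
Unshelve. all: end_near. Qed.

End power_series.

(** * From the entire function to the cubic nonlinearity on the real line *)

Section entire.
Context {R : realType}.
Variable g : R[i]^o -> R[i]^o.
Local Open Scope complex_scope.

Lemma cvg_Re (T : Type) (F : set_system T) {FF : Filter F} (h : T -> R[i]^o) (l : R[i]^o) :
  h @ F --> l -> (fun t => complex.Re (h t)) @ F --> complex.Re l.
Proof.
move=> /cvgrPdist_lt hl; apply/cvgrPdist_lt => e e0.
have e0' : 0 < e%:C by rewrite ltcR.
apply: filterS (hl _ e0') => t ht.
rewrite -ltcR; apply: le_lt_trans ht.
by apply: le_trans (normc_ge_Re _); rewrite raddfB.
Qed.

(** Splits off the linear part. What remains starts at order 3, because oddness removes the even
    coefficients and the derivative at 0 fixes the first one. *)
Lemma entire_nonlinearity :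
  entire_real_coef g -> (forall z : R[i]^o, g (- z) = - g z) ->
  is_derive (0 : R[i]^o) (1 : R[i]^o) g (1 : R[i]^o) ->
  exists a : nat -> R,
  [/\ forall m, (m < 3)%N || ~~ odd m -> a m = 0,
      forall r : R, exists C, bsum (fun m => a m * r ^+ m) C &
      forall y : R, on_reals g y = y + limn (series (fun m => a m * y ^+ m))].
Proof.
move=> [a ga] g_odd g'0.
pose f := on_reals g.
have fa y : series (fun n => a n * y ^+ n) @ \oo --> f y.
  have h := cvg_Re (ga y%:C).
  suff -> : series (fun n => a n * y ^+ n) = (fun t => complex.Re
    (series (fun n => ((a n)%:C * y%:C ^+ n : R[i]^o)) t)) by exact: h.
  apply/funext => n; rewrite /series/= raddf_sum; apply: eq_bigr => k _.
  by rewrite -rmorphXn -rmorphM.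
have aE r : exists C, bsum (fun m => a m * r ^+ m) C.
  have r1 : 0 < `|r| + 1 by apply: ltr_wpDl.
  have fa' y : exists l : R, series (fun n => a n * y ^+ n) @ \oo --> l by exists (f y).
  have [C hC] := bsum_power r1 fa'.
  exists C; apply: bsum_le hC => k; rewrite !normrM !normrX ler_wpM2l//.
  by rewrite lerXn2r ?nnegrE// [leRHS]ger0_norm ?lerDl// addr_ge0.
have [M hM] := aE 1.
have {}hM : bsum a M by move: hM; apply: bsum_le => k; rewrite expr1n mulr1.
have f_odd y : f (- y) = - f y.
  by rewrite /f /on_reals (_ : (- y)%:C = - y%:C) ?g_odd ?raddfN//; rewrite rmorphN.
(* The power series of f(y) + f(- y) vanishes identically, and its coefficient of even index [m] is
   twice [a m]. *)
have aev m : ~~ odd m -> a m = 0.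
  move=> om.
  have hc : bsum (fun k => a k + (-1) ^+ k * a k) (M + M).
    apply: bsumD => //; apply: bsum_le hM => k.
    by rewrite normrM normrX normrN1 expr1n mul1r.
  have := power_series_eq0 hc _ m; rewrite -signr_odd (negbTE om) expr0 mul1r => h.
  suff : a m + a m = 0 by lra.
  apply: h => y _; apply: cvg_lim => //.
  have -> : (fun k => (a k + (-1) ^+ k * a k) * y ^+ k) =
     (fun k => a k * y ^+ k) + (fun k => a k * (- y) ^+ k).
    by apply/funext => k; rewrite !fctE (exprNn y); ring.
  rewrite seriesD -(subrr (f y)) -f_odd; apply: cvgD; exact: fa.
have f0 : f 0 = 0 by have := f_odd 0; rewrite oppr0; lra.
(* The derivative is complex; only real increments are used. If [a 1] differed from 1 by d > 0, some
   small real y would have f(y) / y within d / 4 of both numbers. *)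
have a1 : a 1%N = 1.
  apply/eqP; rewrite -subr_eq0 -normr_le0 leNgt; apply/negP => d0.
  have M0 := bsum_ge0 hM.
  have /cvg_ex [/= l gl] := @ex_derive _ _ _ _ _ _ _ g'0.
  have l1 : l = 1.
    by rewrite -(@derive_val _ _ _ _ _ _ _ g'0); apply/esym/cvg_lim.
  rewrite l1 in gl.
  pose d : R := `|a 1%N - 1|.
  have {}d0 : 0 < d by exact: d0.
  have d4 : 0 < (d / 4)%:C by rewrite ltcR divr_gt0.
  move/cvgrPdist_lt : gl => /(_ _ d4) [e /= e0 he].
  (* The radius is an element of [R[i]]; being positive, it is real. *)
  have e0' : 0 < complex.Re e by move: e0; rewrite ltcE => /andP[_].
  pose y := Num.min 1 (Num.min (complex.Re e / 2) (d / (4 * (M + 1)))).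
  have y0 : 0 < y by rewrite !lt_min ltr01 !divr_gt0//; lra.
  have y1 : y <= 1 by rewrite ge_min lexx.
  have ye : y < complex.Re e.
    apply: (@le_lt_trans _ _ (complex.Re e / 2)); last by lra.
    by rewrite !ge_min lexx !orbT.
  have yd : M * y <= d / 4.
    apply: (@le_trans _ _ (M * (d / (4 * (M + 1))))).
      by rewrite ler_wpM2l// !ge_min lexx !orbT.
    rewrite -subr_ge0 (_ : _ - _ = d / (4 * (M + 1))); last by field; lra.
    by apply: divr_ge0; [exact: ltW|lra].
  have h1 : `|f y / y - 1| < d / 4.
    have := he y%:C; rewrite /ball_/= sub0r normrN.
    have -> : `|y%:C| = y%:C :> R[i] by rewrite normc_def/= expr0n addr0 sqrtr_sqr gtr0_norm.
    have -> : y%:C < e :> R[i].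
      by move: e0; rewrite !ltcE/= => /andP[/eqP-> _]; rewrite eqxx.
    move=> /(_ isT); rewrite eq_complex/= negb_and gt_eqF//= => /(_ isT).
    move=> h; rewrite -ltcR; apply: le_lt_trans h.
    apply: le_trans (normc_ge_Re _).
    rewrite raddfB/= distrC lecR (_ : complex.Re _ = f y / y)//.
    rewrite addr0 (_ : y%:C *: (1 : R[i]^o) = y%:C); last by rewrite /GRing.scale/= mulr1.
    rewrite (_ : g 0 = 0); last first.
      by have := g_odd 0; rewrite oppr0 => /eqP; rewrite -addr_eq0 -mulr2n mulrn_eq0/= => /eqP.
    rewrite subr0 /GRing.scale/= -fmorphV /f /on_reals; case: (g y%:C) => p q /=.
    by rewrite mul0r subr0 mulrC.
  have h2 : `|f y - a 1%N * y| <= M * y ^+ 2.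
    have := @power_series_remainder _ a M y 1 hM.
    rewrite (cvg_lim _ (fa y))// expr1 gtr0_norm//; apply => // k.
    by rewrite ltnS leqn0 => /eqP->; exact: aev.
  have h3 : `|f y / y - a 1%N| <= d / 4.
    rewrite (_ : f y / y - a 1%N = (f y - a 1%N * y) / y); last by field; rewrite gt_eqF.
    rewrite normrM normfV (gtr0_norm y0) ler_pdivrMr//; apply: (le_trans h2).
    by rewrite expr2 mulrA ler_pM2r.
  have : d <= `|f y / y - 1| + `|f y / y - a 1%N|.
    by rewrite /d distrC (distrC (f y / y) 1); exact: ler_distD.
  lra.
pose a' m := if m == 1%N then 0 else a m.
exists a'; split.
- move=> [|[|[|m]]]//= h; rewrite /a'/=; (try exact: aev).
- move=> r; have [C hC] := aE r; exists C; apply: bsum_le hC => k; rewrite /a'.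
  by case: eqP => //; rewrite mul0r normr0.
- move=> y; rewrite -/f; apply/eqP; rewrite addrC -subr_eq; apply/eqP/esym/cvg_lim => //.
  have -> : (fun m => a' m * y ^+ m) = (fun m => a m * y ^+ m) + - (fun m => if m == 1%N then y else 0).
    apply/funext => m; rewrite !fctE /a'; case: eqP => [->|]; last by rewrite subr0.
    by rewrite a1 expr1; ring.
  rewrite seriesD seriesN; apply: cvgB; [exact: fa|exact: series_single].
Qed.

End entire.

(** * Distributional second derivatives on a half-line *)

Section smooth.
Context {R : realType}.
Notation mu := (@lebesgue_measure R).

(** The derivative is an existential witness rather than [derive1 f], so that closure under sums,
    products and affine substitutions is a plain induction. *)
Fixpoint Ck (n : nat) (f : R -> R) : Prop :=
  if n is m.+1 then exists2 df : R -> R, forall x : R, is_derive x (1 : R) f (df x) & Ck m df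
  else continuous f.

Definition smooth (f : R -> R) := forall n, Ck n f.

Lemma Ck_continuous n f : Ck n f -> continuous f.
Proof. by case: n => //= n [df h _]; exact: is_derive_continuous h. Qed.

Lemma CkS n f : Ck n.+1 f -> Ck n f.
Proof.
elim: n f => [|n IH] f; first by move=> /Ck_continuous.
by move=> [df h1 h2]; exists df => //; exact: IH.
Qed.

Lemma CkD n f g : Ck n f -> Ck n g -> Ck n (fun x => f x + g x).
Proof.
elim: n f g => [|n IH] f g /=; first exact: continuousD.
move=> [df f1 f2] [dg g1 g2]; exists (fun x => df x + dg x); last exact: IH.
by move=> x; have := f1 x; have := g1 x => ? ?; exact: is_deriveD.
Qed.

Lemma CkM n f g : Ck n f -> Ck n g -> Ck n (fun x => f x * g x).
Proof.
elim: n f g => [|n IH] f g; first exact: continuousM.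
move=> hf hg; have f0 := CkS hf; have g0 := CkS hg.
move: hf hg => [df f1 f2] [dg g1 g2]; exists (fun x => f x * dg x + g x * df x).
  by move=> x; have := f1 x; have := g1 x => ? ?; exact: is_deriveM.
by apply: CkD; exact: IH.
Qed.

Lemma Ck_cst n (c : R) : Ck n (fun=> c).
Proof.
elim: n c => [|n IH] c /=; first exact: cst_continuous.
by exists (fun=> 0) => // x; exact: is_derive_cst.
Qed.

Lemma Ck_affine n (f : R -> R) (a c : R) : Ck n f -> Ck n (fun x => f (a * x + c)).
Proof.
elim: n f => [|n IH] f /=.
  move=> cf x; apply: continuous_comp; last exact: cf.
  by apply: cvgD; [exact: mulrl_continuous|exact: cvg_cst].
move=> [df f1 f2]; exists (fun x => a * df (a * x + c)).
  move=> x.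
  have h : is_derive x (1 : R) (fun x : R => a * x + c) a.
    by apply: is_derive_eq; rewrite /GRing.scale/= mulr1 addr0.
  by have := @is_derive1_comp R f (fun x => a * x + c) x _ _ (f1 (a * x + c)) h; rewrite mulrC.
by apply: CkM; [exact: Ck_cst|exact: IH].
Qed.

Lemma smooth_derive1 f : smooth f -> smooth (derive1 f).
Proof.
move=> sf n; have [df f1 f2] := sf n.+1.
rewrite (_ : derive1 f = df)//; apply/funext => x.
exact: is_derive_derive1 (f1 x).
Qed.

Lemma smooth_is_derive f (x : R) : smooth f -> is_derive x (1 : R) f (derive1 f x).
Proof.
move=> sf; have [df f1 _] := sf 1%N.
by apply: derivable_is_derive; exact: is_derive_derivable (f1 x).
Qed.

Lemma smooth_continuous f : smooth f -> continuous f.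
Proof. by move=> /(_ 0%N). Qed.

Lemma smooth_of_derive f df : (forall x : R, is_derive x (1 : R) f (df x)) -> smooth df -> smooth f.
Proof.
move=> h sdf [|n]; first exact: is_derive_continuous h.
by exists df.
Qed.

Lemma is_derive0_quadratic (f : R -> R) (C : R) :
  (forall y, `|y| <= 1 -> `|f y| <= C * y ^+ 2) -> is_derive (0 : R) (1 : R) f 0.
Proof.
move=> fC; have f0 : f 0 = 0.
  by apply/eqP; rewrite -normr_le0; have := fC 0; rewrite normr0 expr0n mulr0 ler01; exact.
have h : h^-1 *: (f (h *: (1 : R) + 0) - f 0) @[h --> 0^'] --> (0 : R).
  apply/cvgrPdist_le => e e0; rewrite f0.
  have C0 : 0 <= C by have := fC 1; rewrite normr1 lexx expr1n mulr1 => /(_ isT); apply: le_trans.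
  near=> y; rewrite sub0r normrN addr0 subr0 /GRing.scale/= mulr1 normrM normfV.
  have y0 : y != 0 by near: y; exact: nbhs_dnbhs_neq.
  have y1 : `|y| <= 1 by near: y; apply: dnbhs0_le.
  have ye : `|y| <= e / (C + 1) by near: y; apply: dnbhs0_le; rewrite divr_gt0//; lra.
  rewrite mulrC ler_pdivrMr ?normr_gt0//; apply: (le_trans (fC _ y1)).
  rewrite -real_normK ?num_real// expr2 mulrA ler_wpM2r//.
  apply: (@le_trans _ _ ((C + 1) * `|y|)); first by rewrite ler_wpM2r//; lra.
  by rewrite mulrC -ler_pdivlMr//; lra.
have dv : derivable f 0 1 by apply/cvg_ex; exists 0.
by apply: DeriveDef => //; apply/cvg_lim.
Unshelve. all: end_near. Qed.

(* The functions P(1/x) exp (- 1/x), P a polynomial, are closed under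
   differentiation; this makes the bump functions smooth. *)
Definition flat (P : {poly R}) (x : R) : R := if 0 < x then P.[x^-1] * expR (- x^-1) else 0.

Lemma horner_norm_le (P : {poly R}) : exists2 C : R, 0 <= C & forall s, 1 <= s -> `|P.[s]| <= C * s ^+ size P.
Proof.
exists (\sum_(i < size P) `|P`_i|); first exact: sumr_ge0.
move=> s s1; rewrite horner_coef; apply: le_trans (ler_norm_sum _ _ _) _.
rewrite mulr_suml; apply: ler_sum => i _; rewrite normrM ler_wpM2l//.
rewrite normrX ger0_norm; last by lra.
by apply: ler_weXn2l => //; exact/ltnW/ltn_ord.
Qed.

(** With s = 1 / y and n = [size P], exp s exceeds s ^ (n + 2) / (n + 2)!, which beats the growth of
    P and leaves y ^ 2. This gives derivative 0 at the gluing point for every P, hence at every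
    order of differentiation. *)
Lemma flat_quadratic P : exists C, forall y, `|y| <= 1 -> `|flat P y| <= C * y ^+ 2.
Proof.
have [C C0 hC] := horner_norm_le P.
exists (C * ((size P).+2)`!%:R) => y y1; rewrite /flat; case: ifPn => y0; last first.
  by rewrite normr0 mulr_ge0 ?sqr_ge0 ?mulr_ge0.
have s1 : 1 <= y^-1 by rewrite -invr1 lef_pV2 ?posrE//; rewrite gtr0_norm in y1.
rewrite normrM [`|expR _|]ger0_norm ?expR_ge0//.
apply: (@le_trans _ _ (C * y^-1 ^+ size P * expR (- y^-1))).
  by rewrite ler_wpM2r ?expR_ge0// hC.
rewrite -!mulrA ler_wpM2l// expRN ler_pdivrMr ?expR_gt0//.
have s0 : 0 < y^-1 by rewrite invr_gt0.
have := @expR_ge1Dxn R y^-1 (size P).+1 (ltW s0).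
set E := expR _ => h.
have {}h : y^-1 ^+ (size P).+2 / ((size P).+2)`!%:R <= E by lra.
have F0 : 0 < ((size P).+2)`!%:R :> R by rewrite ltr0n fact_gt0.
rewrite ler_pdivrMr// in h.
rewrite (_ : y^-1 ^+ size P = y ^+ 2 * y^-1 ^+ (size P).+2); last first.
  by rewrite !exprSr !mulrA; field; rewrite gt_eqF.
by rewrite [X in _ <= X * E]mulrC -[leRHS]mulrA ler_wpM2l ?sqr_ge0// mulrC.
Qed.

Lemma is_derive_flat P (x : R) :
  is_derive x (1 : R) (flat P) (flat ('X^2 * (P - P^`())) x).
Proof.
have [x0|x0|->] := ltgtP x 0.
- rewrite /flat ltNge (ltW x0)/=.
  apply: (@near_eq_is_derive _ _ _ (cst 0 : R -> R)).
  near=> y; rewrite ifF//; apply/negbTE; rewrite -leNgt ltW//.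
  by near: y; exact: lt_nbhsl.
- rewrite {2}/flat x0.
  apply: (@near_eq_is_derive _ _ _ (fun y : R => P.[y^-1] * expR (- y^-1))).
    by near=> y; rewrite /flat ifT//; near: y; exact: lt_nbhsr.
  have xn0 : x != 0 by rewrite gt_eqF.
  have hv : is_derive x (1 : R) (fun y : R => y^-1) (- x ^- 2).
    by have := @is_deriveV R id x 1 1 xn0 (is_derive_id _ _); rewrite /GRing.scale/= mulr1.
  have h1 := is_derive1_comp (is_derive_poly P x^-1) hv.
  have hn : is_derive x (1 : R) (fun y : R => - y^-1) (x ^- 2).
    by have := is_deriveN hv; rewrite opprK.
  have h2 := @is_derive1_comp R expR (fun y => - y^-1) x _ _ (is_derive_expR (- x^-1)) hn.
  apply: is_derive_eq; rewrite /GRing.scale/= !hornerE/= -exprVn; ring.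
- rewrite {2}/flat ltxx; have [C hC] := flat_quadratic P.
  exact: is_derive0_quadratic hC.
Unshelve. all: end_near. Qed.

Lemma smooth_flat P : smooth (flat P).
Proof.
move=> n; elim: n P => [|n IH] P; first exact: is_derive_continuous (is_derive_flat P).
by exists (flat ('X^2 * (P - P^`()))) => //; exact: is_derive_flat.
Qed.

Definition bump (d x : R) : R := flat 1 (d + x) * flat 1 (d - x).

Lemma smooth_bump d : smooth (bump d).
Proof.
move=> n; apply: CkM.
  have := Ck_affine 1 d (smooth_flat 1 n).
  by under eq_fun do rewrite mul1r addrC.
have := Ck_affine (-1) d (smooth_flat 1 n).
by under eq_fun do rewrite mulN1r addrC.
Qed.

Lemma bump_ge0 d x : 0 <= bump d x.
Proof.
by apply: mulr_ge0; rewrite /flat; case: ifP => // _; rewrite hornerC mul1r expR_ge0.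
Qed.

Lemma bump_gt0 d x : `|x| < d -> 0 < bump d x.
Proof.
rewrite ltr_norml => /andP[x1 x2]; apply: mulr_gt0; rewrite /flat ifT.
- by rewrite hornerC mul1r expR_gt0.
- lra.
- by rewrite hornerC mul1r expR_gt0.
- lra.
Qed.

Lemma bump0 d x : d <= `|x| -> bump d x = 0.
Proof.
move=> h; rewrite /bump /flat; case: ifPn => x1; last by rewrite mul0r.
case: ifPn => x2; last by rewrite mulr0.
have : `|x| < d by rewrite ltr_norml; apply/andP; split; lra.
by rewrite ltNge h.
Qed.

(** The integral over [[a, x]] is a primitive only to the right of [a], so the base point [A x]
    moves with x. Differences of values do not depend on it, and near a given point it can be
    frozen. *)
Lemma antiderivative (f : R -> R) : continuous f ->
  exists F : R -> R, forall x : R, is_derive x (1 : R) F (f x).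
Proof.
move=> cf.
pose G a x : R := \int[mu]_(t in `[a, x]) f t.
have dG a (x : R) : a < x -> is_derive x (1 : R) (G a) (f x).
  by move=> ax; exact: is_derive_Rintegral.
have Gaa (a a' x : R) : a < a' -> a' <= x -> G a' x = G a x - G a a'.
  move=> aa' a'x.
  have dG' (y : R) : a' <= y <= x -> is_derive y (1 : R) (G a) (f y).
    by move=> /andP[a'y _]; apply: dG; apply: lt_le_trans a'y.
  by rewrite {1}/G (Rintegral_FTC a'x cf dG').
pose A (x : R) : R := - (`|x| + 1).
exists (fun x => G (A x) x - G (A x) 0) => x.
pose a := A (`|x| + 1).
have n1 : `| `|x| + 1 | = `|x| + 1 by rewrite ger0_norm// addr_ge0.
apply: (@near_eq_is_derive _ _ _ (fun y => G a y - G a 0)).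
  near=> y.
  have xy : `|x - y| < 1 by near: y; apply: cvgr_dist_lt.
  have yx : `|y| < `|x| + 1.
    by rewrite -[y](subrK x); have := ler_normD (y - x) x; rewrite distrC; lra.
  have aA : a < A y by rewrite /a /A ltrN2 n1; lra.
  have Ay : A y <= y by rewrite /A; have := ler_norm (- y); rewrite normrN; lra.
  have A0 : A y <= 0 by rewrite /A oppr_le0 addr_ge0.
  by rewrite (Gaa a (A y) y)// (Gaa a (A y) 0)//; ring.
have ax : a < x.
  rewrite /a /A n1.
  by have := ler_norm (- x); rewrite normrN; lra.
have h := dG a x ax.
by apply: is_derive_eq; rewrite subr0.
Unshelve. all: end_near. Qed.

Lemma derive_eq0_const (F : R -> R) (f : R -> R) (a b : R) : a <= b ->
  (forall x : R, is_derive x (1 : R) F (f x)) -> (forall x, a <= x <= b -> f x = 0) -> F a = F b.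
Proof.
rewrite le_eqVlt => /orP[/eqP->//|ab] dF f0.
have [z zab e] := MVT ab (fun z _ => dF z) (continuous_subspaceT (is_derive_continuous dF)).
apply/eqP; rewrite eq_sym -subr_eq0 e f0 ?mul0r//.
by move: zab; rewrite in_itv/= => /andP[/ltW-> /ltW->].
Qed.

(* X2 is affine on either side of the support of the bump, so combinations of
   its translates to three points with vanishing affine part are test functions;
   they show that a function with zero weak second derivative is affine. *)
Lemma bump_antiderivatives (d : R) : 0 < d -> exists (X1 X2 : R -> R) (m k : R),
  [/\ forall x : R, is_derive x (1 : R) X1 (bump d x),
      forall x : R, is_derive x (1 : R) X2 (X1 x),
      forall x, x <= - d -> X1 x = 0 /\ X2 x = 0,
      forall x, d <= x -> X1 x = m /\ X2 x = m * x + k & 0 < m].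
Proof.
move=> d0; have cb := smooth_continuous (smooth_bump d).
have [F dF] := antiderivative cb.
pose X1 x := F x - F (- d).
have dX1 (x : R) : is_derive x (1 : R) X1 (bump d x).
  by have h := dF x; apply: is_derive_eq; rewrite subr0.
have [H dH] := antiderivative (is_derive_continuous dX1).
pose X2 x := H x - H (- d).
have dX2 (x : R) : is_derive x (1 : R) X2 (X1 x).
  by have h := dH x; apply: is_derive_eq; rewrite subr0.
have X10 x : x <= - d -> X1 x = 0.
  move=> xd; have -> : X1 x = X1 (- d).
    apply: (derive_eq0_const xd dX1) => y /andP[_ yd].
    by apply: bump0; rewrite ler0_norm//; lra.
  by rewrite /X1 subrr.
have X1m x : d <= x -> X1 x = X1 d.
  move=> dx; apply/esym/(derive_eq0_const dx dX1) => y /andP[dy _].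
  by apply: bump0; rewrite ger0_norm//; lra.
exists X1, X2, (X1 d), (X2 d - X1 d * d); split => //.
- move=> x xd; split; first exact: X10.
  have -> : X2 x = X2 (- d).
    by apply: (derive_eq0_const xd dX2) => y /andP[_ yd]; exact: X10.
  by rewrite /X2 subrr.
- move=> x dx; split; first exact: X1m.
  have dK (y : R) : is_derive y (1 : R) (fun y => X2 y - X1 d * y) (X1 y - X1 d).
    have h := dX2 y; apply: is_derive_eq.
    by rewrite /GRing.scale/= mulr1.
  have := derive_eq0_const dx dK; rewrite /= => e.
  have {}e : X2 d - X1 d * d = X2 x - X1 d * x.
    by apply: e => y /andP[dy _]; rewrite X1m// subrr.
  by lra.
- have dd : - d < d by lra.
  have [z zab e] := MVT dd (fun z _ => dX1 z) (continuous_subspaceT (is_derive_continuous dX1)).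
  rewrite (_ : X1 d = X1 d - X1 (- d)); last by rewrite [X1 (- d)]X10// subr0.
  rewrite e mulr_gt0//; last by lra.
  apply: bump_gt0; move: zab; rewrite in_itv/= => /andP[z1 z2].
  by rewrite ltr_norml z1 z2.
Qed.

(** Passes from averages to values: [ip], [ix], [iq] are integrals of w against bumps of mass [m] at
    the three points, related exactly by [hI], and the absolute weights of the relation add up to 2
    (q - p). *)
Lemma three_point_estimate (p x q m e ip ix iq wp wx wq : R) : p < x -> x < q -> 0 < m ->
  (q - x) * ip - (q - p) * ix + (x - p) * iq = 0 ->
  `|ip - wp * m| <= e * m -> `|ix - wx * m| <= e * m -> `|iq - wq * m| <= e * m ->
  `|(q - x) * wp - (q - p) * wx + (x - p) * wq| <= 2 * (q - p) * e.
Proof.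
move=> px xq m0 hI h1 h2 h3; rewrite -(ler_pM2r m0) -{1}(gtr0_norm m0) -normrM.
rewrite (_ : (_ + _) * m = (q - p) * (ix - wx * m) - (q - x) * (ip - wp * m)
   - (x - p) * (iq - wq * m)); last first.
  rewrite -[LHS]subr0 -hI; ring.
have a1 : 0 < q - x by lra.
have a2 : 0 < q - p by lra.
have a3 : 0 < x - p by lra.
apply: le_trans (ler_normB _ _) _; apply: le_trans (lerD (ler_normB _ _) (lexx _)) _.
rewrite !normrM (gtr0_norm a1) (gtr0_norm a2) (gtr0_norm a3).
have k1 : (q - x) * `|ip - wp * m| <= (q - x) * (e * m) by rewrite ler_pM2l.
have k2 : (q - p) * `|ix - wx * m| <= (q - p) * (e * m) by rewrite ler_pM2l.
have k3 : (x - p) * `|iq - wq * m| <= (x - p) * (e * m) by rewrite ler_pM2l.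
apply: le_trans (lerD (lerD k2 k1) k3) _.
by rewrite le_eqVlt; apply/orP; left; apply/eqP; ring.
Qed.

Lemma half_lt_contra (D p x q : R) : 0 < D -> p < x -> x < q -> D <= 2 * (q - p) * (D / (4 * (q - p))) -> False.
Proof.
move=> D0 px xq; rewrite (_ : 2 * (q - p) * (D / (4 * (q - p))) = D / 2); last by field; lra.
lra.
Qed.

(** * A continuous weak solution of c'' = r is a classical one *)

Section weak.
Variables (c r : R -> R) (x0 : R).
Hypotheses (cc : continuous c) (cr : continuous r).
Hypothesis weak : forall (psi : R -> R) (a b : R), smooth psi -> x0 < a -> a <= b ->
  (forall x, ~~ (a <= x <= b) -> psi x = 0) ->
  \int[mu]_(x in `[a, b]) (c x * derive1 (derive1 psi) x) =
  \int[mu]_(x in `[a, b]) (r x * psi x).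

Let V1 : R -> R := sval (cid (antiderivative cr)).
Let dV1 (x : R) : is_derive x (1 : R) V1 (r x).
Proof. exact: (svalP (cid (antiderivative cr))). Qed.
Let V : R -> R := sval (cid (antiderivative (is_derive_continuous dV1))).
Let dV (x : R) : is_derive x (1 : R) V (V1 x).
Proof. exact: (svalP (cid (antiderivative (is_derive_continuous dV1)))). Qed.
(** Subtracting a second primitive of [r] leaves a continuous function with zero weak second
    derivative beyond [x0]; it has to be shown affine there. *)
Let w x : R := c x - V x.
Let cw : continuous w.
Proof. by apply: continuousB => //; exact: is_derive_continuous dV. Qed.

Let weak_w (psi : R -> R) (a b : R) : smooth psi -> x0 < a -> a < b ->
  (forall x, x <= a \/ b <= x -> psi x = 0 /\ derive1 psi x = 0) ->
  \int[mu]_(x in `[a, b]) (w x * derive1 (derive1 psi) x) = 0.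
Proof.
move=> sp xa ab p0.
have sp1 := smooth_derive1 sp; have sp2 := smooth_derive1 sp1.
have cp := smooth_continuous sp; have cp1 := smooth_continuous sp1.
have cp2 := smooth_continuous sp2.
have cV := is_derive_continuous dV; have cV1 := is_derive_continuous dV1.
under eq_Rintegral do rewrite mulrBl.
rewrite cts_RintegralB; [|exact: continuousM..].
rewrite weak//; first last.
- move=> x /negP h; apply: (p0 x _).1; have [|ax] := leP x a; first by left.
  by right; rewrite leNgt; apply/negP => bx; apply: h; rewrite !ltW.
- exact: ltW.
have [pa p1a] := p0 a (or_introl (lexx _)).
have [pb p1b] := p0 b (or_intror (lexx _)).
rewrite (Rintegral_by_parts (ltW ab) cV1 cp2 (fun x _ => dV x) (fun x _ => smooth_is_derive x sp1)).
rewrite (Rintegral_by_parts (ltW ab) cr cp1 (fun x _ => dV1 x) (fun x _ => smooth_is_derive x sp)).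
by rewrite pa pb p1a p1b; ring.
Qed.

Let three_points_sorted (p x q : R) : x0 < p -> p < x -> x < q ->
  (q - x) * w p - (q - p) * w x + (x - p) * w q = 0.
Proof.
move=> xp px xq; apply/eqP; rewrite -normr_le0 leNgt; apply/negP.
set D := `|_| => D0.
(* With this tolerance the three-point estimate gives D <= D / 2, a contradiction. *)
pose e : R := D / (4 * (q - p)).
have e0 : 0 < e by rewrite divr_gt0// mulr_gt0//; lra.
have cont y : \forall d \near (0 : R)^'+, forall z, `|z - y| <= d -> `|w z - w y| <= e.
  have /cvgrPdist_le/(_ _ e0)/nbhs_ballP[d /= d0 hd] := @cw y.
  near=> d' => z zy; rewrite distrC; apply: hd => /=; rewrite /ball/=.
  rewrite distrC; apply: le_lt_trans zy _; near: d'; exact: nbhs_right_lt.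
near (0 : R)^'+ => d.
have d0 : 0 < d by [].
have pd : x0 < p - d.
  by rewrite ltrBrDr -ltrBrDl; near: d; apply: nbhs_right_lt; lra.
have wp : forall z, `|z - p| <= d -> `|w z - w p| <= e by near: d; exact: cont.
have wx : forall z, `|z - x| <= d -> `|w z - w x| <= e by near: d; exact: cont.
have wq : forall z, `|z - q| <= d -> `|w z - w q| <= e by near: d; exact: cont.
have [X1 [X2 [m [k [dX1 dX2 X0 Xm m0]]]]] := bump_antiderivatives d0.
pose sh (f : R -> R) y z := f (z - y).
have dsh f df y (z : R) : (forall u : R, is_derive u (1 : R) f (df u)) ->
    is_derive z (1 : R) (sh f y) (sh df y z).
  move=> dF; have h : is_derive z (1 : R) (fun z : R => z - y) 1.
    by apply: is_derive_eq; rewrite subr0.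
  by have := @is_derive1_comp R f (fun z => z - y) z _ _ (dF (z - y)) h; rewrite mulr1.
(* The three weights annihilate affine functions, so [comb X2] vanishes to the right of the bumps as
   well as to the left. It is therefore an admissible test function, and its second derivative is a
   combination of bumps. *)
pose comb (f : R -> R) z := (q - x) * sh f p z - (q - p) * sh f x z + (x - p) * sh f q z.
have dcomb f df (z : R) : (forall u : R, is_derive u (1 : R) f (df u)) ->
    is_derive z (1 : R) (comb f) (comb df z).
  move=> dF; have h1 := dsh f df p z dF; have h2 := dsh f df x z dF.
  by have h3 := dsh f df q z dF; exact: is_derive_eq.
have e1 : derive1 (comb X2) = comb X1.
  by apply/funext => z; exact: is_derive_derive1 (dcomb _ _ z dX2).
have e2 : derive1 (comb X1) = comb (bump d).
  by apply/funext => z; exact: is_derive_derive1 (dcomb _ _ z dX1).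
have ssh y : smooth (sh (bump d) y).
  move=> n; have := Ck_affine 1 (- y) (smooth_bump d n).
  by rewrite /sh; under eq_fun do rewrite mul1r.
have sb : smooth (comb (bump d)).
  move=> n; apply: CkD; last by apply: CkM; [exact: Ck_cst|exact: ssh].
  rewrite (_ : (fun z => _ - _) = (fun z => (q - x) * sh (bump d) p z + (- (q - p)) * sh (bump d) x z)).
    by apply: CkD; apply: CkM; (try exact: Ck_cst); exact: ssh.
  by apply/funext => z; rewrite mulNr.
have s2 : smooth (comb X2).
  apply: (@smooth_of_derive (comb X2) (comb X1) (fun z => dcomb _ _ z dX2)).
  exact: (@smooth_of_derive (comb X1) (comb (bump d)) (fun z => dcomb _ _ z dX1)).
have pq : p - d < q + d by lra.
have := weak_w s2 pd pq _; rewrite e1 e2 => h.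
have {}h : \int[mu]_(z in `[p - d, q + d]) (w z * comb (bump d) z) = 0.
  apply: h => z [zp|zq]; rewrite /comb /sh.
    have [-> ->] := X0 (z - p) ltac:(lra); have [-> ->] := X0 (z - x) ltac:(lra).
    by have [-> ->] := X0 (z - q) ltac:(lra); split; ring.
  have [-> ->] := Xm (z - p) ltac:(lra); have [-> ->] := Xm (z - x) ltac:(lra).
  by have [-> ->] := Xm (z - q) ltac:(lra); split; ring.
have csh y : continuous (sh (bump d) y) by exact: smooth_continuous.
pose I y : R := \int[mu]_(z in `[p - d, q + d]) (w z * sh (bump d) y z).
have cI y : continuous (fun z => w z * sh (bump d) y z) by exact: continuousM.
have hI : (q - x) * I p - (q - p) * I x + (x - p) * I q = 0.
  rewrite -h /I -!cts_RintegralZ// -cts_RintegralB; [|exact: continuousZ..].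
  rewrite -cts_RintegralD; [|by apply: continuousB; exact: continuousZ|exact: continuousZ].
  by apply: eq_Rintegral => z _; rewrite /comb; ring.
have Ibump y : p <= y -> y <= q -> \int[mu]_(z in `[p - d, q + d]) sh (bump d) y z = m.
  move=> py yq; have dy (z : R) := dsh _ _ y z dX1.
  rewrite (Rintegral_FTC (ltW pq) (csh y) (fun z _ => dy z)) /sh.
  have dq : d <= q + d - y by rewrite lerBrDr addrC lerD2r.
  have pd' : p - d - y <= - d by rewrite lerBlDr [leLHS]addrC lerD2l.
  by rewrite (Xm _ dq).1 (X0 _ pd').1 subr0.
have Iy y : p <= y -> y <= q -> (forall z, `|z - y| <= d -> `|w z - w y| <= e) ->
    `|I y - w y * m| <= e * m.
  move=> py yq wy; rewrite -(Ibump y py yq) -!cts_RintegralZ// -cts_RintegralB//; last exact: continuousZ.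
  apply: le_trans (le_normr_Rintegral _ _) _ => //.
    by apply: cts_integrable; apply: continuousB => //; exact: continuousZ.
  apply: le_Rintegral => //.
  - apply: cts_integrable => z; apply: cvg_norm.
    exact: (continuousB (cI y) (continuousZ (csh y))).
  - by apply: cts_integrable; exact: continuousZ.
  - move=> z _; rewrite -mulrBl normrM [`|sh _ _ _|]ger0_norm ?bump_ge0//.
    have [zy|zy] := leP `|z - y| d; first by rewrite ler_wpM2r ?bump_ge0// wy.
    by rewrite /sh bump0 ?mulr0// ltW.
have h1 := Iy p (lexx p) (ltW (lt_trans px xq)) wp.
have h2 := Iy x (ltW px) (ltW xq) wx.
have h3 := Iy q (ltW (lt_trans px xq)) (lexx q) wq.
have := three_point_estimate px xq m0 hI h1 h2 h3; rewrite -/D /e.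
exact: half_lt_contra D0 px xq.
Unshelve. all: end_near. Qed.

Let three_points (p x q : R) : x0 < p -> x0 < x -> x0 < q ->
  (q - x) * w p - (q - p) * w x + (x - p) * w q = 0.
Proof.
move=> hp hx hq.
case: (ltgtP p x) => [px|xp|<-]; last by ring.
- case: (ltgtP x q) => [xq|qx|<-]; last by ring.
  + exact: three_points_sorted.
  + case: (ltgtP p q) => [pq|qp|<-]; last by ring.
    * have := three_points_sorted hp pq qx; lra.
    * have := three_points_sorted hq qp px; lra.
- case: (ltgtP p q) => [pq|qp|<-]; last by ring.
  + have := three_points_sorted hx xp pq; lra.
  + case: (ltgtP x q) => [xq|qx|<-]; last by ring.
    * have := three_points_sorted hx xq qp; lra.
    * have := three_points_sorted hq qx xp; lra.
Qed.

(** The three-point relation with two fixed points makes [w] affine on the half-line, so [c] is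
    there a second primitive of [r] up to an affine function. *)
Lemma weak_second_derivative : exists c' : R -> R, forall x : R, x0 < x ->
  is_derive x (1 : R) c (c' x) /\ is_derive x (1 : R) c' (r x).
Proof.
pose p := x0 + 1; pose q := x0 + 2.
pose s : R := w q - w p.
have wE x : x0 < x -> c x = V x + (w p - s * p) + s * x.
  move=> xx; have := @three_points p x q; rewrite /p /q => /(_ ltac:(lra) xx ltac:(lra)) h.
  have : w x = c x - V x by [].
  rewrite /s /p /q; nra.
exists (fun x => V1 x + s) => x xx; split.
  apply: (@near_eq_is_derive _ _ _ (fun x => V x + (w p - s * p) + s * x)).
    by near=> y; apply/esym/wE; near: y; exact: lt_nbhsr.
  by have h := dV x; apply: is_derive_eq; rewrite /GRing.scale/= mulr1 addr0.
by have h := dV1 x; apply: is_derive_eq; rewrite addr0.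
Unshelve. all: end_near. Qed.

End weak.
End smooth.

(** * The ordinary differential equations of the modes *)

Section separable.
Context {R : realType}.
Notation mu := (@lebesgue_measure R).

Lemma is_derive_trig (A B c t : R) :
  is_derive t (1 : R) (fun t => A * cos (c * t) + B * sin (c * t))
    (B * c * cos (c * t) + - (A * c) * sin (c * t)).
Proof.
have h1 := is_derive_cosM c t; have h2 := is_derive_sinM c t.
by apply: is_derive_eq; rewrite /GRing.scale/=; ring.
Qed.

Definition separable (c : R) (psi : R -> R) (A B : R) : R -> R -> R :=
  fun x t => psi x * (A * cos (c * t) + B * sin (c * t)).

Lemma dx_separable c psi A B : smooth psi ->
  dx (separable c psi A B) = separable c (derive1 psi) A B.
Proof.
move=> sp; apply/funext => x; apply/funext => t; rewrite /dx /separable.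
apply: is_derive_derive1; have h := smooth_is_derive x sp.
by apply: is_derive_eq; rewrite /GRing.scale/= mulr0 add0r mulrC.
Qed.

Lemma dt_separable c psi A B :
  dt (separable c psi A B) = separable c psi (B * c) (- (A * c)).
Proof.
apply/funext => x; apply/funext => t; rewrite /dt /separable.
apply: is_derive_derive1; have h := is_derive_trig A B c t.
by apply: is_derive_eq.
Qed.

Lemma partial_separable c psi A B w : smooth psi ->
  exists psi' A' B', smooth psi' /\ partial w (separable c psi A B) = separable c psi' A' B'.
Proof.
move=> sp; elim: w => [|b w [psi' [A' [B' [sp' e]]]]]; first by exists psi, A, B.
case: b; rewrite /partial/= -/(partial w _) e.
  by exists (derive1 psi'), A', B'; split; [exact: smooth_derive1|exact: dx_separable].
by exists psi', (B' * c), (- (A' * c)); split => //; exact: dt_separable.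
Qed.

Lemma smooth2_separable c psi A B : smooth psi -> smooth2 (separable c psi A B).
Proof.
move=> sp w; have [psi' [A' [B' [sp' ->]]]] := partial_separable c A B w sp.
split.
- move=> [x t]; apply: cvgM.
    apply: continuous_comp; [exact: cvg_fst|exact: smooth_continuous sp' x].
  apply: (@continuous_comp _ _ _ snd (fun t => A' * cos (c * t) + B' * sin (c * t))).
    exact: cvg_snd.
  exact: is_derive_continuous_at (is_derive_trig A' B' c t).
- move=> x t; have h := smooth_is_derive x sp'.
  by apply: derivableM; [exact: is_derive_derivable h|exact: derivable_cst].
- move=> x t; have h := is_derive_trig A' B' c t.
  by apply: derivableM; [exact: derivable_cst|exact: is_derive_derivable h].
Qed.

Lemma Rintegral_rescale (h : R -> R) (T : R) : 0 < T -> continuous h ->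
  \int[mu]_(t in `[0, T]) h t = T / (2 * pi) * \int[mu]_(t in `[0, 2 * pi]) h (T * t / (2 * pi)).
Proof.
move=> T0 ch; have [H dH] := antiderivative ch.
have p0 : 0 < 2 * pi :> R by rewrite mulr_gt0// pi_gt0.
rewrite (Rintegral_FTC (ltW T0) ch (fun x _ => dH x)).
have d1 (x : R) : is_derive x (1 : R) (fun x : R => T * x / (2 * pi)) (T / (2 * pi)).
  by apply: is_derive_eq; rewrite /GRing.scale/=; ring.
have dK (x : R) : 0 <= x <= 2 * pi ->
    is_derive x (1 : R) (fun x => 2 * pi / T * H (T * x / (2 * pi))) (h (T * x / (2 * pi))).
  move=> _; have h2 := @is_derive1_comp R H (fun x => T * x / (2 * pi)) x _ _ (dH _) (d1 x).
  apply: is_derive_eq; rewrite /GRing.scale/=; move: (h _).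
  by move: (@pi R) (pi_gt0 R) => q q0 z; field; rewrite ?(gt_eqF T0) ?(gt_eqF q0).
rewrite (Rintegral_FTC (ltW p0) _ dK); last first.
  move=> x; apply: (@continuous_comp _ _ _ (fun x => T * x / (2 * pi)) h); last exact: ch.
  exact: is_derive_continuous_at (d1 x).
rewrite mulr0 mul0r mulfK ?gt_eqF// -mulrBr mulrA (_ : T / (2 * pi) * (2 * pi / T) = 1) ?mul1r//.
move: (@pi R) (pi_gt0 R) => q q0; by field; rewrite ?(gt_eqF T0) ?(gt_eqF q0).
Qed.

End separable.

(** * The wave equation tested against separated functions *)

Section modes.
Context {R : realType}.
Notation mu := (@lebesgue_measure R).
Variables (T x0 C : R) (u : R -> R -> R) (a b : nat -> R -> R) (M : nat -> R) (P : R -> R).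
Hypotheses (T0 : 0 < T) (MC : bsum M C).
Hypotheses (ca : forall k, continuous (a k)) (cb : forall k, continuous (b k)).
Hypothesis abM : forall k x, `|a k x| <= M k /\ `|b k x| <= M k.
Let om (k : nat) : R := 2 * pi * k%:R / T.
Let U x t : R := limn (series (fun k => a k x * cos (om k * t) + b k x * sin (om k * t))).
Hypothesis cP : continuous P.

Let M_ge0 k : 0 <= M k.
Proof. by apply: le_trans (normr_ge0 (a k 0)) _; have [] := abM k 0. Qed.

Let p0 : 0 < pi :> R := pi_gt0 R.

Lemma modes_term_le k x t : `|a k x * cos (om k * t) + b k x * sin (om k * t)| <= `|2 * M k|.
Proof.
have [h1 h2] := abM k x; rewrite [leRHS]ger0_norm ?mulr_ge0//.
apply: le_trans (ler_normD _ _) _; rewrite !normrM.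
have : `|a k x| * `|cos (om k * t)| <= M k * 1 by rewrite ler_pM// cos_max.
have : `|b k x| * `|sin (om k * t)| <= M k * 1 by rewrite ler_pM// sin_max.
lra.
Qed.

Let M2 : bsum (fun k => 2 * M k) (`|2| * C) := bsumZ 2 MC.

Lemma modes_bound x t : `|U x t| <= `|2| * C.
Proof.
apply: bsum_lim_le; apply: bsum_le M2 => k; exact: modes_term_le.
Qed.

Lemma modes_continuous_t x : continuous (U x).
Proof.
apply: (continuous_series _ _ M2); last by move=> k t; exact: modes_term_le.
move=> k; exact: is_derive_continuous (is_derive_trig (a k x) (b k x) (om k)).
Qed.

Lemma modes_continuous_x t : continuous (U^~ t).
Proof.
apply: (continuous_series (f := fun k x => a k x * cos (om k * t) + b k x * sin (om k * t)) _ _ M2).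
  move=> k; apply: continuousD => x; apply: cvgM; (try exact: cvg_cst).
    exact: ca.
  exact: cb.
by move=> k x; exact: modes_term_le.
Qed.

Let Urescale x tau : U x (T * tau / (2 * pi)) =
  limn (series (fun k => a k x * cos (k%:R * tau) + b k x * sin (k%:R * tau))).
Proof.
rewrite /U; congr (limn (series _)); apply/funext => k.
rewrite (_ : om k * (T * tau / (2 * pi)) = k%:R * tau)// /om; move: (@pi R) (pi_gt0 R) => q q0; by field; rewrite ?(gt_eqF T0) ?(gt_eqF q0).
Qed.

Let bsum_a x : bsum (a^~ x) C.
Proof.
by apply: bsum_le MC => k; rewrite [leRHS]ger0_norm//; have [] := abM k x.
Qed.
Let bsum_b x : bsum (b^~ x) C.
Proof.
by apply: bsum_le MC => k; rewrite [leRHS]ger0_norm//; have [] := abM k x.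
Qed.

Lemma cos_coef_modes x j : cos_coef (fun tau => U x (T * tau / (2 * pi))) j = a j x.
Proof. exact: (cos_coef_fourier (bsum_a x) (bsum_b x) (Urescale x)). Qed.

Lemma sin_coef_modes x j : sin_coef (fun tau => U x (T * tau / (2 * pi))) j =
  if j == 0%N then 0 else b j x.
Proof. exact: (sin_coef_fourier (bsum_a x) (bsum_b x) (Urescale x)). Qed.

Definition nl_coef (j : nat) (x : R) : R := cos_coef (fun tau => P (U x (T * tau / (2 * pi)))) j.

Let ctau : continuous (fun tau : R => T * tau / (2 * pi)).
Proof.
move=> x; apply: cvgM; last exact: cvg_cst.
exact: mulrl_continuous.
Qed.

Let PU_cts x : continuous (fun tau => P (U x (T * tau / (2 * pi)))).
Proof.
move=> tau; apply: (@continuous_comp _ _ _ (fun tau => U x (T * tau / (2 * pi))) P); last exact: cP.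
by apply: (@continuous_comp _ _ _ (fun tau : R => T * tau / (2 * pi)) (U x)); [exact: ctau|exact: modes_continuous_t].
Qed.

Lemma continuous_bounded (f : R -> R) (B : R) : continuous f ->
  exists K, forall y, `|y| <= B -> `|f y| <= K.
Proof.
move=> cf; have [B0|B0] := ltP B 0.
  by exists 0 => y yB; have := le_lt_trans yB B0; rewrite ltNge normr_ge0.
have cn : {within `[- B, B], continuous (fun x => `|f x|)}.
  by apply: continuous_subspaceT => x; apply: cvg_norm; exact: cf.
have BB : - B <= B by lra.
have [c _ hc] := EVT_max BB cn.
by exists `|f c| => y yB; apply: hc; rewrite in_itv/= -ler_norml.
Qed.

(** Continuity in x of the source term is what turns the weak equation of a mode into a classical
    one. *)
Lemma nl_coef_continuous j : continuous (nl_coef j).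
Proof.
move=> x; rewrite /nl_coef /cos_coef.
apply: cvgM; first exact: cvg_cst.
have [K hK] := continuous_bounded (`|2| * C) cP.
have K0 : 0 <= K by apply: le_trans (hK _ (modes_bound 0 0)).
have cc y : continuous (fun tau => P (U y (T * tau / (2 * pi))) * cos (j%:R * tau)).
  by apply: continuousM; [exact: PU_cts|exact: continuous_cosM].
have := @continuity_under_integral R _ _ mu
  (fun x tau => P (U x (T * tau / (2 * pi))) * cos (j%:R * tau)) `[0, 2 * pi]%classic
  (measurable_itv _) (x - 1) (x + 1) (fun y _ => cts_integrable _ _ (cc y)) _ (cst K)
  _ _ x.
apply.
- apply: aeW => tau _ y _; apply: cvgM; last exact: cvg_cst.
  apply: (@continuous_comp _ _ _ (fun x => U x (T * tau / (2 * pi))) P); last exact: cP.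
  exact: modes_continuous_x.
- by apply: cts_integrable; exact: cst_continuous.
- move=> y _; apply: aeW => tau _; rewrite normrM -[leRHS]mulr1.
  by apply: ler_pM; rewrite ?cos_max// hK// modes_bound.
- by rewrite inE/= in_itv/=; apply/andP; split; lra.
Qed.

(** Products [psi x * cos (om j * t)] are admissible test functions; integrating in t first leaves
    the weak form of an ordinary equation for mode j. Its coefficients are continuous on the whole
    line because [v] extends to the cylinder as [U]. *)
Lemma modes_ode (v : R -> R -> R) (f : R -> R) j :
  (forall y, f y = y + P y) -> (forall x t, x0 <= x -> v x t = U x t) ->
  wave_equation f T x0 v ->
  exists a' : R -> R, forall x : R, x0 < x -> is_derive x (1 : R) (a j) (a' x) /\
    is_derive x (1 : R) a' ((1 - om j ^+ 2) * a j x + nl_coef j x).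
Proof.
move=> fE vU weq.
have cr : continuous (fun x => (1 - om j ^+ 2) * a j x + nl_coef j x).
  by apply: continuousD; [exact: continuousZ|exact: nl_coef_continuous].
apply: (weak_second_derivative (@ca j) cr) => psi l r sp xl lr psi0.
have sp1 := smooth_derive1 sp; have sp2 := smooth_derive1 sp1.
have cp := smooth_continuous sp; have cp2 := smooth_continuous sp2.
pose phi := separable (om j) psi 1 0.
have tphi : test_function T x0 phi.
  split; first exact: smooth2_separable.
  - move=> x t; rewrite /phi /separable !mul0r !mul1r !addr0; congr (_ * _).
    rewrite (_ : om j * (t + T) = om j * t + j%:R * (2 * pi)); last first.
      rewrite /om; move: (@pi R) (pi_gt0 R) => q q0; by field; rewrite ?(gt_eqF T0) ?(gt_eqF q0).
    by rewrite cosD (cos_sin_nat2pi j).1 (cos_sin_nat2pi j).2 mulr1 mulr0 subr0.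
  - by exists l, r; split => // x t xlr; rewrite /phi /separable psi0// mul0r.
have psi2_0 x : ~~ (l <= x <= r) -> derive1 (derive1 psi) x = 0.
  move=> xlr.
  have off : \forall y \near x, ~~ (l <= y <= r).
    move: xlr; rewrite negb_and -!ltNge => /orP[xl'|rx']; near=> y; rewrite negb_and -!ltNge.
      by apply/orP; left; near: y; exact: lt_nbhsl.
    by apply/orP; right; near: y; exact: lt_nbhsr.
  have off1 : \forall y \near x, derive1 psi y = 0.
    apply: filterS (nbhs_interior off) => y hy.
    apply: is_derive_derive1; apply: (@near_eq_is_derive _ _ _ (cst 0 : R -> R)).
    by apply: filterS hy => z /psi0->.
  apply: is_derive_derive1; apply: (@near_eq_is_derive _ _ _ (cst 0 : R -> R)).
  by apply: filterS off1 => z ->.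
have := weq phi tphi.
(* The integral of the squared cosine over one period, which undoes the normalisation of
   [cos_coef]. *)
pose K : R := if j == 0%N then T else T / 2.
have K0 : K != 0 by rewrite /K; case: (j == 0%N); rewrite gt_eqF ?divr_gt0.
pose I (h : R -> R) : R := \int[mu]_(t in `[0, T]) (h t * cos (om j * t)).
have IK (h : R -> R) : continuous h ->
   I h = K * cos_coef (fun tau => h (T * tau / (2 * pi))) j.
  move=> ch; rewrite /I Rintegral_rescale//; last first.
    by apply: continuousM => //; exact: continuous_cosM.
  rewrite /cos_coef mulrA.
  rewrite (_ : K * ((if j == 0%N then 1 else 2) / (2 * pi)) = T / (2 * pi)); last first.
    rewrite /K; move: (@pi R) (pi_gt0 R) => q q0.
    by case: (j == 0%N); field; rewrite (gt_eqF q0).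
  congr (_ * _); apply: eq_Rintegral => t _; congr (_ * cos _).
  rewrite /om; move: (@pi R) (pi_gt0 R) => q q0; by field; rewrite ?(gt_eqF T0) ?(gt_eqF q0).
have cU x := @modes_continuous_t x.
have cPU x : continuous (fun t => P (U x t)).
  by move=> t; apply: (@continuous_comp _ _ _ (U x) P); [exact: cU|exact: cP].
have inner x : x0 < x ->
  \int[mu]_(t in `[0, T]) (v x t * (dt (dt phi) x t - dx (dx phi) x t) + f (v x t) * phi x t) =
  K * (psi x * ((1 - om j ^+ 2) * a j x + nl_coef j x) - a j x * derive1 (derive1 psi) x).
  move=> x0x.
  rewrite /phi !dt_separable !dx_separable//.
  rewrite (_ : (fun t => _) = (fun t => (psi x * (1 - om j ^+ 2) - derive1 (derive1 psi) x) * (U x t * cos (om j * t))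
    + psi x * (P (U x t) * cos (om j * t)))); last first.
    by apply/funext => t; rewrite vU ?(ltW x0x)// fE /separable; ring.
  have c1 : continuous (fun t => U x t * cos (om j * t)).
    by apply: continuousM => //; exact: continuous_cosM.
  have c2 : continuous (fun t => P (U x t) * cos (om j * t)).
    by apply: continuousM => //; exact: continuous_cosM.
  rewrite cts_RintegralD; [|exact: continuousZ..].
  rewrite !cts_RintegralZ// -/(I (U x)) -/(I (fun t => P (U x t))).
  by rewrite !IK// cos_coef_modes -/(nl_coef j x); ring.
rewrite [X in X = 0 -> _](_ : _ = \int[mu]_(x in `]x0, +oo[)
  (K * (psi x * ((1 - om j ^+ 2) * a j x + nl_coef j x) - a j x * derive1 (derive1 psi) x))); last first.
  by apply: eq_Rintegral => x; rewrite inE/= in_itv/= andbT; exact: inner.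
rewrite (@Rintegral_support _ _ _ l r)//; first last.
- by move=> x h; rewrite psi0// psi2_0// mul0r mulr0 subrr mulr0.
- by move=> x /=; rewrite !in_itv/= andbT => /andP[lx _]; exact: lt_le_trans lx.
have k1 : continuous (fun x => psi x * ((1 - om j ^+ 2) * a j x + nl_coef j x)) by exact: continuousM.
have k2 : continuous (fun x => a j x * derive1 (derive1 psi) x) by exact: continuousM.
rewrite cts_RintegralZ; last exact: continuousB.
rewrite cts_RintegralB// => /eqP; rewrite mulf_eq0 (negbTE K0)/= subr_eq0 => /eqP <-.
by apply: eq_Rintegral => x _; rewrite mulrC.
Unshelve. all: end_near. Qed.

End modes.

(** * Decay and uniqueness for the modal system *)

(** The weight adds up what each part needs: [g - e >= 8 l] and [g + e >= 1] bring the hyperbolic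
    contribution below 1 / 4, and [e g >= (80 l) ^ 2] does so for the elliptic one. *)
Lemma contraction_factor (R : realType) (e l : R) : 0 < e -> 0 < l ->
  (2 / (e + 1 + 8 * l + (80 * l) ^+ 2 / e + e) / (e + 1 + 8 * l + (80 * l) ^+ 2 / e - e)
   + 20 / Num.sqrt (e * (e + 1 + 8 * l + (80 * l) ^+ 2 / e))) * l <= 2^-1.
Proof.
move=> e0 l0; set g := e + 1 + 8 * l + (80 * l) ^+ 2 / e.
have q0 : 0 <= (80 * l) ^+ 2 / e by rewrite divr_ge0 ?sqr_ge0// ltW.
have hg : e + 1 + 8 * l <= g by rewrite /g lerDl.
have ge : 8 * l <= g - e by lra.
have ge1 : 1 <= g + e by lra.
have h1 : 2 / (g + e) / (g - e) * l <= 4^-1.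
  rewrite (_ : _ * l = 2 * l / ((g + e) * (g - e))); last by field; lra.
  rewrite ler_pdivrMr; last by rewrite mulr_gt0; lra.
  have : g - e <= (g + e) * (g - e) by rewrite ler_peMl//; lra.
  lra.
have h2 : 20 / Num.sqrt (e * g) * l <= 4^-1.
  have eg0 : 0 < Num.sqrt (e * g) by rewrite sqrtr_gt0 mulr_gt0//; lra.
  rewrite mulrAC ler_pdivrMr//.
  have : 80 * l <= Num.sqrt (e * g).
    have l80 : 0 <= 80 * l by lra.
    rewrite -(ger0_norm l80) -sqrtr_sqr ler_wsqrtr// -ler_pdivrMl// mulrC.
    by rewrite /g; lra.
  lra.
rewrite mulrDl; lra.
Qed.

Section modal.
Context {R : realType}.
Variables (T : R) (P : R -> R).
Hypotheses (T0 : 0 < T) (cP : continuous P).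
Let om (k : nat) : R := 2 * pi * k%:R / T.
Variable e : R.
Hypotheses (e0 : 0 < e) (e2 : e ^+ 2 = 1 - om 1 ^+ 2).
Hypothesis om_gt1 : forall j, (1 < j)%N -> 0 < om j ^+ 2 - 1.
Hypothesis om_sum : forall J, \sum_(2 <= j < J) (om j ^+ 2 - 1)^-1 <= 18.

(** What uniqueness needs of a solution, freed from Sobolev spaces and distributions. The notion is
    stable under restriction, translation and change of sign, and the zero function satisfies it. *)
Record modal (x0 : R) (w : R -> R -> R) (a a' n : nat -> R -> R) : Prop := Modal {
  modal_cts : forall x, x0 < x -> continuous (w x);
  modal_bsum : forall x, x0 < x -> exists C, bsum (a^~ x) C;
  modal_sum : forall x t, x0 < x -> w x t = limn (series (fun k => a k x * cos (om k * t)));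
  modal_a0 : forall x, x0 < x -> a 0%N x = 0;
  modal_d1 : forall j (x : R), x0 < x -> is_derive x (1 : R) (a j) (a' j x);
  modal_d2 : forall j (x : R), x0 < x ->
    is_derive x (1 : R) (a' j) ((1 - om j ^+ 2) * a j x + n j x);
  modal_nl : forall j x, x0 < x -> n j x = cos_coef (fun tau => P (w x (T * tau / (2 * pi)))) j
}.

Lemma cos_coefB (f g : R -> R) j : continuous f -> continuous g ->
  cos_coef (fun t => f t - g t) j = cos_coef f j - cos_coef g j.
Proof.
move=> cf cg; rewrite /cos_coef -mulrBr; congr (_ * _).
have c1 (h : R -> R) : continuous h -> continuous (fun t : R => h t * cos (j%:R * t)).
  by move=> ch; apply: continuousM => //; exact: continuous_cosM.
rewrite -cts_RintegralB; [|exact: c1..].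
by apply: eq_Rintegral => t _; rewrite mulrBl.
Qed.

Lemma cos_series_le (a : nat -> R) (C D t : R) : bsum a C -> a 0%N = 0 ->
  (forall J, \sum_(1 <= k < J) `|a k| <= D) ->
  `|limn (series (fun k => a k * cos (om k * t)))| <= D.
Proof.
move=> aC a0 aD; apply: bsum_lim_le => n.
apply: (@le_trans _ _ (\sum_(0 <= k < n) `|a k|)).
  by apply: ler_sum => k _; rewrite normrM ler_piMr// cos_max.
case: n => [|n]; first by rewrite big_geq//; have := aD 0%N; rewrite big_geq.
by rewrite big_ltn// a0 normr0 add0r.
Qed.

Let crescale (w : R -> R) : continuous w -> continuous (fun tau : R => P (w (T * tau / (2 * pi)))).
Proof.
move=> cw tau; apply: (@continuous_comp _ _ _ (fun tau : R => w (T * tau / (2 * pi))) P); last exact: cP.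
apply: (@continuous_comp _ _ _ (fun tau : R => T * tau / (2 * pi)) w); last exact: cw.
by apply: cvgM; [exact: mulrl_continuous|exact: cvg_cst].
Qed.

(** * The difference of two modal solutions *)

Section diff.
Variables (x0 X : R) (w1 w2 : R -> R -> R) (a1 a1' n1 a2 a2' n2 : nat -> R -> R).
Hypotheses (m1 : modal x0 w1 a1 a1' n1) (m2 : modal x0 w2 a2 a2' n2) (xX : x0 <= X).
Variables (b g S : R).
Hypotheses (b0 : 0 < b) (bg : b <= g) (S0 : 0 < S).
Hypothesis apriori : forall j, exists B, forall x, X < x ->
  `|a1 j x - a2 j x| <= B * expR (- (b * x)) /\ `|a1' j x - a2' j x| <= B * expR (- (b * x)).
Hypothesis PS : forall x t, X < x -> `|P (w1 x t) - P (w2 x t)| <= S * expR (- (g * x)).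

Let d j x : R := a1 j x - a2 j x.
Let d' j x : R := a1' j x - a2' j x.
Let n j x : R := n1 j x - n2 j x.

Let dD j (x : R) : X < x -> is_derive x (1 : R) (d j) (d' j x).
Proof.
move=> Xx; have h1 := modal_d1 m1 j (le_lt_trans xX Xx).
by have h2 := modal_d1 m2 j (le_lt_trans xX Xx); apply: is_derive_eq.
Qed.

Let ddD j (x : R) : X < x -> is_derive x (1 : R) (d' j) ((1 - om j ^+ 2) * d j x + n j x).
Proof.
move=> Xx; have h1 := modal_d2 m1 j (le_lt_trans xX Xx).
have h2 := modal_d2 m2 j (le_lt_trans xX Xx); apply: is_derive_eq.
by rewrite /d /n; ring.
Qed.

(** Bessel's inequality gives 2 S ^ 2; this is rounded up to the square of 2 S, the form in which
    the elliptic estimate takes its source. *)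
Lemma modal_bessel J x : X < x ->
  \sum_(1 <= j < J) (n j x) ^+ 2 <= (2 * S) ^+ 2 * expR (- (2 * g * x)).
Proof.
move=> Xx; have x0x := le_lt_trans xX Xx.
have c1 := crescale (modal_cts m1 x0x); have c2 := crescale (modal_cts m2 x0x).
have := bessel J (continuousB c1 c2) (fun t _ => PS (T * t / (2 * pi)) Xx).
under eq_bigr do rewrite cos_coefB// -(modal_nl m1)// -(modal_nl m2)//.
move=> h; apply: (le_trans h).
rewrite exprMn expr2 [expR _ ^+ 2]expr2 -expRD -expr2.
rewrite (_ : - (g * x) + - (g * x) = - (2 * g * x)); last by ring.
rewrite mulrA ler_wpM2r ?expR_ge0//; have := sqr_ge0 S; rewrite exprMn; lra.
Qed.

Lemma modal_n1 x : X < x -> `|n 1%N x| <= 2 * S * expR (- (g * x)).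
Proof.
move=> Xx; have := modal_bessel 2 Xx; rewrite big_nat1 => h.
have r0 : 0 <= 2 * S * expR (- (g * x)) by rewrite !mulr_ge0 ?expR_ge0// ltW.
rewrite -(ler_sqr (_ : _ \is Num.nneg)) ?nnegrE// real_normK ?num_real//.
apply: (le_trans h); rewrite [in leRHS]exprMn [expR _ ^+ 2]expr2 -expRD.
by rewrite (_ : - (g * x) + - (g * x) = - (2 * g * x))//; ring.
Qed.

Lemma modal_tail J x : X < x ->
  \sum_(2 <= j < J) `|d j x| <= 20 * S / Num.sqrt (b * g) * expR (- (g * x)).
Proof.
move=> Xx; rewrite (_ : 20 * S = 10 * (2 * S)); last by ring.
have /choice[B hB] := apriori.
apply: (@elliptic_sum _ X (2 * S) b g (fun j => om j ^+ 2 - 1) d d' n B) => //.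
- by rewrite mulr_gt0.
- by move=> j z j1 Xz; have := ddD j Xz; rewrite opprB.
- move=> K z Xz; apply: le_trans (modal_bessel K Xz).
  have [K2|K2] := ltnP 1 K; first by rewrite [leRHS]big_ltn// lerDr sqr_ge0.
  by rewrite [leLHS]big_geq ?(leqW K2)// sumr_ge0// => j _; rewrite sqr_ge0.
- by move=> j z Xz; have [] := hB j z Xz.
- by move=> j z Xz; have [] := hB j z Xz.
Qed.

Let mode1 (x : R) : X < x -> is_derive x (1 : R) (d' 1%N) (e ^+ 2 * d 1%N x + n 1%N x).
Proof. by rewrite e2; exact: ddD. Qed.

Lemma modal_sup (D : R) x t : X < x -> `|d 1%N x| <= D ->
  `|w1 x t - w2 x t| <= D + 20 * S / Num.sqrt (b * g) * expR (- (g * x)).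
Proof.
move=> Xx dD1; have x0x := le_lt_trans xX Xx.
rewrite (modal_sum m1)// (modal_sum m2)//.
have [C1 h1] := modal_bsum m1 x0x; have [C2 h2] := modal_bsum m2 x0x.
have cb (a : nat -> R) C : bsum a C -> bsum (fun k => a k * cos (om k * t)) C.
  by apply: bsum_le => k; rewrite normrM ler_piMr// cos_max.
have h3 := bsumZ (-1) h2; have h4 := bsumD h1 h3.
rewrite (_ : _ - _ = limn (series (fun k => d k x * cos (om k * t)))); last first.
  apply/esym/cvg_lim => //.
  rewrite (_ : (fun k => _) = (fun k => a1 k x * cos (om k * t)) + - (fun k => a2 k x * cos (om k * t))).
    rewrite seriesD seriesN; apply: cvgB; [exact: bsum_cvgP (cb _ _ h1)|exact: bsum_cvgP (cb _ _ h2)].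
  by apply/funext => k; rewrite !fctE /d mulrBl.
apply: (@cos_series_le _ (C1 + `|-1| * C2)).
- by move=> k; have := h4 k; under eq_bigr do rewrite mulN1r.
- by rewrite /d (modal_a0 m1)// (modal_a0 m2)// subrr.
- move=> J; have [J2|J2] := ltnP 1 J.
    by rewrite big_ltn// lerD// modal_tail.
  rewrite big_geq// addr_ge0 ?(le_trans _ dD1)// mulr_ge0 ?expR_ge0// divr_ge0 ?sqrtr_ge0//.
  by rewrite mulr_ge0// ltW.
Qed.

(** [S] measures the difference of the nonlinear terms. The factor in front of it is independent of
    the a priori constants, so the estimate can be iterated. It contracts in two ways: through a
    large [g], or because [S] is a small multiple of the difference itself. *)
Lemma modal_contract (B' : R) : e < g ->
  (forall x, X < x -> `|d 1%N x| <= B' * expR (- (g * x))) ->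
  forall x t, X < x -> `|w1 x t - w2 x t| <=
    (2 / (g + e) / (g - e) + 20 / Num.sqrt (b * g)) * S * expR (- (g * x)).
Proof.
move=> eg hB' x t Xx.
have [B hB] := apriori 1%N.
have g0 : 0 < g by apply: lt_le_trans bg.
have h := @hyperbolic_unique _ e X (2 * S) B b g (d 1%N) (d' 1%N) (n 1%N) e0 b0 g0
  (dD 1%N) mode1 modal_n1 (fun z Xz => (hB z Xz).1) (fun z Xz => (hB z Xz).2) B' eg hB' x Xx.
apply: le_trans (modal_sup t Xx h) _.
by rewrite -mulrDl; apply: ler_wpM2r; rewrite ?expR_ge0// le_eqVlt; apply/orP; left; apply/eqP; ring.
Qed.

Lemma modal_boot : g < e -> exists C, forall x t, X + 1 <= x ->
  `|w1 x t - w2 x t| <= C * expR (- (g * x)).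
Proof.
move=> ge; have [B hB] := apriori 1%N.
have g0 : 0 < g by apply: lt_le_trans bg.
have [C hC] := @hyperbolic_boot _ e X (2 * S) B b g (d 1%N) (d' 1%N) (n 1%N) e0 b0 g0
  (dD 1%N) mode1 modal_n1 (fun z Xz => (hB z Xz).1) (fun z Xz => (hB z Xz).2) ge.
exists (C + 20 * S / Num.sqrt (b * g)) => x t Xx.
rewrite mulrDl; apply: modal_sup; last exact: hC.
by apply: lt_le_trans Xx; rewrite ltrDl.
Qed.

Lemma modal_lim : e < g -> exists k, forall x, X < x ->
  `|d 1%N x - k * expR (- (e * x))| <= 2 * S / (g + e) / (g - e) * expR (- (g * x)).
Proof.
move=> eg; have [B hB] := apriori 1%N.
have g0 : 0 < g by apply: lt_le_trans bg.
exact: (@hyperbolic_lim _ e X (2 * S) B b g (d 1%N) (d' 1%N) (n 1%N) e0 b0 g0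
  (dD 1%N) mode1 modal_n1 (fun z Xz => (hB z Xz).1) (fun z Xz => (hB z Xz).2) eg).
Qed.

End diff.

Variable x0 : R.

Lemma modal_coef w a a' n j x : modal x0 w a a' n -> x0 < x ->
  a j x = cos_coef (fun tau => w x (T * tau / (2 * pi))) j.
Proof.
move=> m x0x; have [C hC] := modal_bsum m x0x.
have b0 : bsum (fun=> 0 : R) 0 by move=> k; rewrite big1// => i _; rewrite normr0.
apply/esym/(cos_coef_fourier hC b0) => t.
rewrite (modal_sum m)//; congr (limn (series _)); apply/funext => k.
rewrite mul0r addr0 (_ : om k * (T * t / (2 * pi)) = k%:R * t)// /om.
by move: (@pi R) (pi_gt0 R) => q q0; field; rewrite (gt_eqF T0) (gt_eqF q0).
Qed.

Hypothesis P_lip : forall rho : R, 1 <= rho -> exists L : R, 0 < L /\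
  forall r x y, r <= rho -> `|x| <= r -> `|y| <= r -> `|P x - P y| <= L * r ^+ 2 * `|x - y|.
Hypothesis P_odd : forall y, P (- y) = - P y.

Let P0 : P 0 = 0.
Proof. by have := P_odd 0; rewrite oppr0; lra. Qed.

(** Comparison with zero turns each estimate on differences into an estimate on a single
    solution. *)
Lemma modal_zero : modal x0 (fun _ _ => 0) (fun _ _ => 0) (fun _ _ => 0) (fun _ _ => 0).
Proof.
split.
- by move=> x _; exact: cst_continuous.
- by move=> x _; exists 0 => k; rewrite big1// => i _; rewrite normr0.
- move=> x t _; apply/esym/cvg_lim => //.
  rewrite (_ : series _ = cst 0); first exact: cvg_cst.
  by apply/funext => k; rewrite /series/= big1// => i _; rewrite mul0r.
- by [].
- by move=> j x _; exact: is_derive_cst.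
- by move=> j x _; rewrite mulr0 addr0; exact: is_derive_cst.
- move=> j x _; rewrite /cos_coef P0; under eq_Rintegral do rewrite mul0r.
  by rewrite Rintegral_cst// mul0r mulr0.
Qed.

Lemma is_derive_translate (f df : R -> R) (h x : R) :
  is_derive (x + h) (1 : R) f (df (x + h)) -> is_derive x (1 : R) (fun x => f (x + h)) (df (x + h)).
Proof.
move=> dF; have h1 : is_derive x (1 : R) (fun x : R => x + h) 1.
  by apply: is_derive_eq; rewrite addr0.
by have := @is_derive1_comp R f (fun x => x + h) x _ _ dF h1; rewrite mulr1.
Qed.

Lemma modal_translate w a a' n (h : R) (neg : bool) : modal x0 w a a' n ->
  modal (x0 - h) (fun x t => (-1) ^+ neg * w (x + h) t) (fun j x => (-1) ^+ neg * a j (x + h))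
    (fun j x => (-1) ^+ neg * a' j (x + h)) (fun j x => (-1) ^+ neg * n j (x + h)).
Proof.
move=> m; have xh x : x0 - h < x -> x0 < x + h by rewrite ltrBlDr.
split.
- by move=> x /xh hx; apply: continuousZ; exact: modal_cts m _ hx.
- move=> x /xh hx; have [C hC] := modal_bsum m hx; exists C; apply: bsum_le hC => k.
  by rewrite normrM normr_sign mul1r.
- move=> x t /xh hx; rewrite (modal_sum m)//.
  have [C hC] := modal_bsum m hx.
  have cc : cvgn (series (fun k => a k (x + h) * cos (om k * t))).
    apply: (@bsum_cvg _ _ C); apply: bsum_le hC => k.
    by rewrite normrM ler_piMr// cos_max.
  apply: etrans (esym (lim_seriesZ ((-1) ^+ neg) cc)) _; congr (limn (series _)).
  by apply/funext => k; rewrite -mulrA.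
- by move=> x /xh hx; rewrite (modal_a0 m)// mulr0.
- move=> j x /xh hx; have h1 := is_derive_translate (modal_d1 m j hx).
  by apply: is_derive_eq.
- move=> j x /xh hx; have h1 := is_derive_translate (df := fun x => (1 - om j ^+ 2) * a j x + n j x) (modal_d2 m j hx).
  by apply: is_derive_eq; rewrite /GRing.scale/=; ring.
- move=> j x /xh hx; rewrite (modal_nl m)//; case: neg => /=; rewrite ?expr0 ?expr1; last first.
    by rewrite mul1r; congr (cos_coef _ j); apply/funext => t; rewrite mul1r.
  rewrite mulN1r -sub0r -[X in X - _](_ : cos_coef (fun=> 0 : R) j = 0); last first.
    by rewrite /cos_coef; under eq_Rintegral do rewrite mul0r; rewrite Rintegral_cst// mul0r mulr0.
  rewrite -cos_coefB; [|exact: cst_continuous|exact: crescale (modal_cts m hx)].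
  by congr (cos_coef _ j); apply/funext => t; rewrite sub0r mulN1r P_odd.
Qed.

Definition decays (w : R -> R -> R) (a a' : nat -> R -> R) (X b : R) : Prop :=
  [/\ x0 <= X, 0 < b, exists B, forall x t, X < x -> `|w x t| <= B * expR (- (b * x)) &
    forall j, exists B, forall x, X < x ->
      `|a j x| <= B * expR (- (b * x)) /\ `|a' j x| <= B * expR (- (b * x))].

Lemma exp_weaken (B b b' X : R) : b' <= b ->
  exists2 B', 0 < B' & forall x, X < x -> B * expR (- (b * x)) <= B' * expR (- (b' * x)).
Proof.
move=> bb'; exists (`|B| * expR (- ((b - b') * X)) + 1).
  by rewrite ltr_wpDl ?mulr_ge0 ?expR_ge0.
move=> x Xx; apply: (@le_trans _ _ (`|B| * expR (- ((b - b') * X)) * expR (- (b' * x)))).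
  rewrite -mulrA -expRD; apply: (@le_trans _ _ (`|B| * expR (- (b * x)))).
    by rewrite ler_wpM2r ?expR_ge0// ler_norm.
  rewrite ler_wpM2l// ler_expR.
  have : 0 <= (b - b') * (x - X) by rewrite mulr_ge0//; lra.
  lra.
by rewrite ler_wpM2r ?expR_ge0//; lra.
Qed.

(** Stands in for a fixed-point argument: no function space is set up, and a bound that can be
    halved again and again forces vanishing. It is applied with pairs (x, t) as indices. *)
Lemma halving (I : Type) (A : I -> Prop) (F E : I -> R) (D : R) : 0 < D ->
  (forall D, 0 < D -> (forall i, A i -> F i <= D * E i) -> forall i, A i -> F i <= D / 2 * E i) ->
  (forall i, A i -> F i <= D * E i) -> forall i, A i -> F i <= 0.
Proof.
move=> D0 step h0 i Ai.
have hn n : forall i, A i -> F i <= D / 2 ^+ n * E i.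
  elim: n => [|n IH]; first by rewrite expr0 divr1.
  by move=> j Aj; rewrite exprSr invfM mulrA; apply: step => //; rewrite divr_gt0// exprn_gt0.
have hl : (fun n => D / 2 ^+ n * E i) @ \oo --> (0 : R).
  rewrite -(mul0r (E i)); apply: cvgM; last exact: cvg_cst.
  have := @cvg_geometric R D 2^-1; rewrite ger0_norm// => /(_ ltac:(lra)).
  by apply: cvg_trans; apply: near_eq_cvg; near=> n; rewrite /geometric/= exprVn.
rewrite leNgt; apply/negP => F0.
move/cvgrPdist_lt : hl => /(_ _ F0) [N _ /(_ N (leqnn _))] /=.
rewrite sub0r normrN => h; have := hn N i Ai; have := ler_norm (D / 2 ^+ N * E i); lra.
Unshelve. all: end_near. Qed.

(** * Decay rate, asymptotics and unique continuation of one solution *)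

Section solution.
Variables (w : R -> R -> R) (a a' n : nat -> R -> R) (Cb : R).
Hypotheses (m : modal x0 w a a' n) (wC : forall x t, x0 < x -> `|w x t| <= Cb).

Let rho : R := Num.max 1 Cb.
Let rho1 : 1 <= rho. Proof. by rewrite le_max lexx. Qed.
Let L : R := sval (cid (P_lip rho1)).
Let L0 : 0 < L. Proof. exact: (svalP (cid (P_lip rho1))).1. Qed.

Lemma modal_cubic x t : x0 < x -> `|P (w x t) - P 0| <= L * `|w x t| ^+ 3.
Proof.
move=> xx; have h := (svalP (cid (P_lip rho1))).2 `|w x t| (w x t) 0.
apply: le_trans (h _ (lexx _) _) _.
- by apply: le_trans (wC t xx) _; rewrite le_max lexx orbT.
- by rewrite normr0.
- by rewrite subr0 -mulrA -exprSr.
Qed.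

Lemma modal_cubic_exp (X r g : R) : x0 <= X -> g <= 3 * r ->
  (exists B, forall x t, X < x -> `|w x t| <= B * expR (- (r * x))) ->
  exists2 S, 0 < S & forall x t, X < x -> `|P (w x t) - P 0| <= S * expR (- (g * x)).
Proof.
move=> xX gr [B hB]; have [S S0 hS] := exp_weaken (L * B ^+ 3) X gr.
exists S => // x t Xx; apply: le_trans (hS x Xx).
apply: le_trans (modal_cubic t (le_lt_trans xX Xx)) _.
rewrite -mulrA ler_wpM2l ?(ltW L0)//.
rewrite (_ : - (3 * r * x) = - (r * x) *+ 3); last by ring.
rewrite -mulr_natl expRM_natl -exprMn lerXn2r ?nnegrE ?hB//.
exact: le_trans (normr_ge0 _) (hB x t Xx).
Qed.

Lemma modal_rate (X b : R) : decays w a a' X b -> b <= e / 2 ->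
  forall k, exists Y, X <= Y /\ exists B, forall x t, Y < x ->
    `|w x t| <= B * expR (- (Num.min (2 ^+ k * b) (e / 2) * x)).
Proof.
move=> [xX b0 hw ha] be; elim=> [|k [Y [XY hB]]].
  by exists X; split=> //; rewrite expr0 mul1r min_l.
set r := Num.min (2 ^+ k * b) (e / 2) in hB *; set r' := Num.min _ _.
have rr' : r' <= 3 * r.
  rewrite /r /r' exprS -mulrA; have : 0 < 2 ^+ k * b by rewrite mulr_gt0// exprn_gt0.
  by move: (2 ^+ k * b) => z z0; rewrite !minEle; do 2 case: ifP => ?; move: e0; lra.
have br' : b <= r'.
  by rewrite le_min be andbT ler_peMl ?(ltW b0)// exprn_ege1// ler1n.
have r'e : r' < e by rewrite gt_min; apply/orP; right; move: e0; lra.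
have xY := le_trans xX XY.
have [S S0 hS] := modal_cubic_exp xY rr' hB.
have ap : forall j, exists B, forall x, Y < x ->
  `|a j x - 0| <= B * expR (- (b * x)) /\ `|a' j x - 0| <= B * expR (- (b * x)).
  move=> j; have [B' hB'] := ha j; exists B' => x Yx; rewrite !subr0; apply: hB'.
  exact: le_lt_trans Yx.
have [C hC] := @modal_boot x0 Y w (fun _ _ => 0) a a' n _ _ _ m modal_zero xY b r' S b0 br' S0 ap hS r'e.
exists (Y + 1); split; first by rewrite (le_trans XY)// lerDl.
by exists C => x t Yx; have := hC x t (ltW Yx); rewrite subr0.
Qed.

Lemma modal_asymptotics (X b : R) : decays w a a' X b -> b <= e / 2 ->
  exists k Y, X <= Y /\ exists2 C, 0 < C & forall x, Y < x ->
    (forall t, `|w x t| <= C * expR (- (e / 2 * x))) /\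
    `|a 1%N x - k * expR (- (e * x))| <= C * expR (- (3 / 2 * e * x)).
Proof.
move=> D be; have [xX b0 hw ha] := D.
have [k hk] : exists k, e / 2 <= 2 ^+ k * b.
  exists (Num.truncn (e / 2 / b)).+1; rewrite -ler_pdivrMr//.
  apply: le_trans (ltW (truncnS_gt _)) _.
  by rewrite -natrX ler_nat ltnW// ltn_expl.
have [Y [XY hB]] := modal_rate D be k.
rewrite min_r// in hB.
have xY := le_trans xX XY.
have g3 : 3 / 2 * e <= 3 * (e / 2) by lra.
have [S S0 hS] := modal_cubic_exp xY g3 hB.
have ap : forall j, exists B, forall x, Y < x ->
  `|a j x - 0| <= B * expR (- (b * x)) /\ `|a' j x - 0| <= B * expR (- (b * x)).
  move=> j; have [B' hB'] := ha j; exists B' => x Yx; rewrite !subr0; apply: hB'.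
  exact: le_lt_trans Yx.
have bg : b <= 3 / 2 * e by move: e0 be; lra.
have eg : e < 3 / 2 * e by move: e0; lra.
have [c hc] := @modal_lim x0 Y w (fun _ _ => 0) a a' n _ _ _ m modal_zero xY b _ S b0 bg S0 ap hS eg.
have [B {}hB] := hB.
set Q := 2 * S / _ / _ in hc.
exists c, Y; split => //; exists (`|B| + `|Q| + 1).
  by rewrite ltr_wpDl// addr_ge0.
move=> x Yx; split=> [t|].
  apply: le_trans (hB x t Yx) _; rewrite ler_wpM2r ?expR_ge0//.
  by have := ler_norm B; have := normr_ge0 Q; lra.
have := hc x Yx; rewrite subr0 => h; apply: (le_trans h).
rewrite ler_wpM2r ?expR_ge0//.
by have := ler_norm Q; have := normr_ge0 B; lra.
Qed.

(** Unique continuation towards [x0]. The solution is only bounded here, so its Lipschitz constant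
    [Lam] has to be beaten by a large weight [g]. Vanishing beyond [X] provides exponential a priori
    bounds of any rate. *)
Lemma modal_vanish (X : R) : x0 <= X -> (forall x t, X < x -> w x t = 0) ->
  forall x t, x0 < x -> w x t = 0.
Proof.
move=> xX wX x t x0x.
(* Stepping inside the open half-line gives a compact interval [[x1, Z]], on which the modes and
   their derivatives are bounded. *)
pose x1 := (x0 + x) / 2.
have x01 : x0 < x1 by rewrite /x1; lra.
have x1x : x1 < x by rewrite /x1; lra.
pose Lam : R := L * rho ^+ 2.
have rho0 : 0 < rho by apply: lt_le_trans rho1.
have Lam0 : 0 < Lam by rewrite mulr_gt0// exprn_gt0.
pose g : R := e + 1 + 8 * Lam + (80 * Lam) ^+ 2 / e.
have q0 : 0 <= (80 * Lam) ^+ 2 / e by rewrite divr_ge0 ?sqr_ge0// ltW.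
have eg : e < g by rewrite /g; lra.
have g0 : 0 < g by move: (e0); lra.
have kap := contraction_factor e0 Lam0; rewrite -/g in kap.
have aX j y : X < y -> a j y = 0.
  move=> Xy; rewrite (modal_coef j m (le_lt_trans xX Xy)) /cos_coef.
  under eq_Rintegral do rewrite wX// mul0r.
  by rewrite Rintegral_cst// mul0r mulr0.
have a'X j y : X < y -> a' j y = 0.
  move=> Xy; rewrite -(is_derive_derive1 (modal_d1 m j (le_lt_trans xX Xy))).
  apply: is_derive_derive1; apply: (@near_eq_is_derive _ _ _ (cst 0 : R -> R)).
  by near=> z; rewrite aX//; near: z; exact: lt_nbhsr.
pose Z := Num.max X x1 + 1.
have x1Z : x1 <= Z by rewrite /Z ler_wpDr// le_max lexx orbT.
have XZ : X <= Z by rewrite /Z ler_wpDr// le_max lexx.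
have tail_bound (h : R -> R) (g' : R) : (forall y, x0 < y -> {for y, continuous h}) ->
    0 <= g' -> (forall y, X < y -> h y = 0) ->
    exists B, forall y, x1 < y -> `|h y| <= B * expR (- (g' * y)).
  move=> ch g'0 hX.
  have cn : {within `[x1, Z], continuous (fun y => `|h y|)}.
    apply: continuous_in_subspaceT => y; rewrite inE/= in_itv/= => /andP[x1y _].
    by apply: cvg_norm; apply: ch; apply: lt_le_trans x1y.
  have [c _ hc] := EVT_max x1Z cn.
  exists (`|h c| * expR (g' * Z)) => y x1y; have [yZ|Zy] := leP y Z; last first.
    by rewrite hX ?normr0 ?mulr_ge0 ?expR_ge0//; apply: le_lt_trans Zy.
  apply: le_trans (hc y _) _; first by rewrite in_itv/= (ltW x1y).
  rewrite -mulrA -expRD ler_peMr// -[leLHS]expR0 ler_expR -mulrBr.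
  by rewrite mulr_ge0// subr_ge0.
have xx1 := ltW x01.
have ap : forall j, exists B, forall y, x1 < y ->
  `|a j y - 0| <= B * expR (- (e * y)) /\ `|a' j y - 0| <= B * expR (- (e * y)).
  move=> j.
  have [B1 h1] := @tail_bound (a j) e (fun y xy => is_derive_continuous_at (modal_d1 m j xy)) (ltW e0) (aX j).
  have [B2 h2] := @tail_bound (a' j) e (fun y xy => is_derive_continuous_at (modal_d2 m j xy)) (ltW e0) (a'X j).
  exists (Num.max B1 B2) => y x1y; rewrite !subr0; split.
    by apply: le_trans (h1 y x1y) _; rewrite ler_wpM2r ?expR_ge0// le_max lexx.
  by apply: le_trans (h2 y x1y) _; rewrite ler_wpM2r ?expR_ge0// le_max lexx orbT.
have [B' hB'] := @tail_bound (a 1%N) g (fun y xy => is_derive_continuous_at (modal_d1 m 1%N xy)) (ltW g0) (aX 1%N).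
have Pw y s : x1 < y -> `|P (w y s) - P 0| <= Lam * `|w y s|.
  move=> x1y; have xy := lt_trans x01 x1y.
  have h := (svalP (cid (P_lip rho1))).2 rho (w y s) 0 (lexx _) _ _.
  apply: le_trans (h _ _) _.
  - by apply: le_trans (wC s xy) _; rewrite le_max lexx orbT.
  - by rewrite normr0 ltW.
  - by rewrite subr0.
pose D0 := (`|Cb| + 1) * expR (g * Z).
have D00 : 0 < D0 by rewrite mulr_gt0 ?expR_gt0// ltr_wpDl.
have init (i : R * R) : x1 < i.1 -> `|w i.1 i.2| <= D0 * expR (- (g * i.1)).
  move=> x1i; have [iZ|Zi] := leP i.1 Z; last first.
    by rewrite wX ?normr0 ?mulr_ge0 ?expR_ge0 ?(ltW D00)//; apply: le_lt_trans Zi.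
  apply: le_trans (wC _ (lt_trans x01 x1i)) _.
  apply: (@le_trans _ _ (`|Cb| + 1)); first by have := ler_norm Cb; lra.
  rewrite -mulrA -expRD ler_peMr ?addr_ge0// -[leLHS]expR0 ler_expR -mulrBr.
  by rewrite mulr_ge0 ?(ltW g0)// subr_ge0.
have := @halving (R * R)%type (fun i => x1 < i.1) (fun i => `|w i.1 i.2|) (fun i => expR (- (g * i.1)))
  D0 D00 _ init (x, t) x1x.
rewrite /= normr_le0 => h; apply/eqP/h => {h} D DD hD i x1i.
have SD : 0 < Lam * D by rewrite mulr_gt0.
have PS y s : x1 < y -> `|P (w y s) - P 0| <= Lam * D * expR (- (g * y)).
  move=> x1y; apply: le_trans (Pw y s x1y) _; rewrite -mulrA ler_wpM2l ?(ltW Lam0)//.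
  exact: (hD (y, s)).
have hB'' y : x1 < y -> `|a 1%N y - 0| <= B' * expR (- (g * y)) by rewrite subr0; exact: hB'.
have := @modal_contract x0 x1 w (fun _ _ => 0) a a' n _ _ _ m modal_zero xx1 e g (Lam * D)
  e0 (ltW eg) SD ap PS B' eg hB'' i.1 i.2 x1i.
rewrite subr0 => h; apply: (le_trans h); rewrite ler_wpM2r ?expR_ge0// mulrA.
by rewrite mulrC ler_pM2l.
Unshelve. all: end_near. Qed.

End solution.

(** Equal leading coefficients make the first modes differ at rate [g = 3 / 2 * e], beyond e. The
    weight stays fixed; the contraction comes from going far out, where both solutions are small and
    the cubic Lipschitz constant brings the factor down to 1 / 2. *)
Lemma modal_unique w1 w2 a1 a1' n1 a2 a2' n2 (C b1 b2 X k : R) :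
  modal x0 w1 a1 a1' n1 -> modal x0 w2 a2 a2' n2 ->
  (forall x t, x0 < x -> `|w1 x t| <= C) -> (forall x t, x0 < x -> `|w2 x t| <= C) ->
  decays w1 a1 a1' X b1 -> decays w2 a2 a2' X b2 -> b1 <= e / 2 -> b2 <= e / 2 -> 0 < C ->
  (forall x, X < x -> (forall t, `|w1 x t| <= C * expR (- (e / 2 * x))) /\
    `|a1 1%N x - k * expR (- (e * x))| <= C * expR (- (3 / 2 * e * x))) ->
  (forall x, X < x -> (forall t, `|w2 x t| <= C * expR (- (e / 2 * x))) /\
    `|a2 1%N x - k * expR (- (e * x))| <= C * expR (- (3 / 2 * e * x))) ->
  exists2 Y, X <= Y & forall x t, Y < x -> w1 x t = w2 x t.
Proof.
move=> m1 m2 wC1 wC2 D1 D2 b1e b2e C0 A1 A2.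
have [xX b10 _ ha1] := D1; have [_ b20 _ ha2] := D2.
pose b := Num.min b1 b2; have b0 : 0 < b by rewrite lt_min b10.
pose g := 3 / 2 * e.
have eg : e < g by rewrite /g; move: e0; lra.
have bg : b <= g.
  by rewrite (le_trans _ (ltW eg))// (le_trans _ (_ : e / 2 <= e))//; [rewrite ge_min b1e|move: e0; lra].
pose rho := Num.max 1 C.
have rho1 : 1 <= rho by rewrite le_max lexx.
have [L [L0 hL]] := P_lip rho1.
pose kap := 2 / (g + e) / (g - e) + 20 / Num.sqrt (b * g).
(* The square of the bound C exp (- e Y / 2) enters the Lipschitz constant, whence the rate [e] in
   this smallness condition. *)
have [Y0 hY0] := @exp_small R (kap * L * C ^+ 2) e 2^-1 e0 ltac:(lra).
pose Y := Num.max X Y0.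
have XY : X <= Y by rewrite le_max lexx.
have YY0 : Y0 <= Y by rewrite le_max lexx orbT.
have xY := le_trans xX XY.
exists Y => // x t Yx.
have ap : forall j, exists B, forall x, Y < x ->
  `|a1 j x - a2 j x| <= B * expR (- (b * x)) /\ `|a1' j x - a2' j x| <= B * expR (- (b * x)).
  move=> j; have [B1 h1] := ha1 j; have [B2 h2] := ha2 j.
  have b1b : b <= b1 by rewrite ge_min lexx.
  have b2b : b <= b2 by rewrite ge_min lexx orbT.
  have [B1' B10 h1'] := exp_weaken B1 X b1b; have [B2' B20 h2'] := exp_weaken B2 X b2b.
  exists (B1' + B2') => y Yy; have Xy := le_lt_trans XY Yy.
  have [p1 q1] := h1 y Xy; have [p2 q2] := h2 y Xy.
  have r1 := h1' y Xy; have r2 := h2' y Xy; rewrite mulrDl.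
  split; apply: le_trans (ler_normB _ _) _; apply: lerD.
  - exact: le_trans p1 r1.
  - exact: le_trans p2 r2.
  - exact: le_trans q1 r1.
  - exact: le_trans q2 r2.
have hB' y : Y < y -> `|a1 1%N y - a2 1%N y| <= (C + C) * expR (- (g * y)).
  move=> Yy; have Xy := le_lt_trans XY Yy.
  have [_ p1] := A1 y Xy; have [_ p2] := A2 y Xy.
  rewrite (_ : a1 1%N y - a2 1%N y = (a1 1%N y - k * expR (- (e * y))) - (a2 1%N y - k * expR (- (e * y)))); last by ring.
  by rewrite mulrDl; apply: le_trans (ler_normB _ _) _; apply: lerD.
have g3 : g <= 3 * (e / 2) by rewrite /g; lra.
have [S1 S10 hS1] := modal_cubic_exp wC1 xX g3 (ex_intro _ C (fun x t Xx => (A1 x Xx).1 t)).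
have [S2 S20 hS2] := modal_cubic_exp wC2 xX g3 (ex_intro _ C (fun x t Xx => (A2 x Xx).1 t)).
have contr S : 0 < S -> (forall y s, Y < y -> `|P (w1 y s) - P (w2 y s)| <= S * expR (- (g * y))) ->
    forall y s, Y < y -> `|w1 y s - w2 y s| <= kap * S * expR (- (g * y)).
  move=> S0 PS; exact: (@modal_contract x0 Y w1 w2 a1 a1' n1 a2 a2' n2 m1 m2 xY b g S b0 bg S0 ap PS _ eg hB').
have init := contr (S1 + S2) (addr_gt0 S10 S20).
have {}init : forall y s, Y < y -> `|w1 y s - w2 y s| <= kap * (S1 + S2) * expR (- (g * y)).
  apply: init => y s Yy; have Xy := le_lt_trans XY Yy.
  rewrite (_ : P (w1 y s) - P (w2 y s) = (P (w1 y s) - P 0) - (P (w2 y s) - P 0)); last by ring.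
  rewrite mulrDl; apply: le_trans (ler_normB _ _) _; apply: lerD; [exact: hS1|exact: hS2].
have kap0 : 0 < kap.
  rewrite /kap ltr_pwDl ?divr_ge0 ?sqrtr_ge0// !divr_gt0//; move: (e0) eg; lra.
have D00 : 0 < kap * (S1 + S2) by rewrite mulr_gt0// addr_gt0.
have := @halving (R * R)%type (fun i => Y < i.1) (fun i => `|w1 i.1 i.2 - w2 i.1 i.2|) (fun i => expR (- (g * i.1)))
  _ D00 _ (fun i => init i.1 i.2) (x, t) Yx.
rewrite /= normr_le0 subr_eq0 => h; apply/eqP/h => {h} D DD hD i Yi.
pose r := C * expR (- (e / 2 * Y)).
have r0 : 0 < r by rewrite mulr_gt0 ?expR_gt0.
have r2 : kap * L * r ^+ 2 <= 2^-1.
  rewrite /r exprMn [expR _ ^+ 2]expr2 -expRD (_ : - (e / 2 * Y) + - (e / 2 * Y) = - (e * Y)); last by field.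
  by rewrite mulrA; exact: hY0.
have SD : 0 < L * r ^+ 2 * D by apply: mulr_gt0 => //; apply: mulr_gt0 => //; exact: exprn_gt0.
have PS y s : Y < y -> `|P (w1 y s) - P (w2 y s)| <= L * r ^+ 2 * D * expR (- (g * y)).
  move=> Yy; have Xy := le_lt_trans XY Yy; have x0y := le_lt_trans xX Xy.
  have small (v : R -> R -> R) : `|v y s| <= C -> `|v y s| <= C * expR (- (e / 2 * y)) -> `|v y s| <= Num.min rho r.
    move=> v1 v2; rewrite le_min; apply/andP; split; first by rewrite (le_trans v1)// le_max lexx orbT.
    apply: (le_trans v2); rewrite ler_wpM2l ?(ltW C0)// ler_expR lerN2 ler_wpM2l ?(ltW Yy)//.
    by move: e0; lra.
  have s1 := small w1 (wC1 y s x0y) ((A1 y Xy).1 s).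
  have s2 := small w2 (wC2 y s x0y) ((A2 y Xy).1 s).
  have mr : Num.min rho r <= rho by rewrite ge_min lexx.
  apply: le_trans (hL _ _ _ mr s1 s2) _.
  rewrite -[leRHS]mulrA; apply: ler_pM => //.
  - by rewrite mulr_ge0 ?(ltW L0)// sqr_ge0.
  - rewrite ler_wpM2l ?(ltW L0)// lerXn2r ?nnegrE ?(ltW r0)//.
      by rewrite le_min (ltW r0) andbT; lra.
    by rewrite ge_min lexx orbT.
  - exact: (hD (y, s)).
apply: le_trans (contr _ SD PS i.1 i.2 Yi) _; rewrite ler_wpM2r ?expR_ge0//.
rewrite (_ : kap * (L * r ^+ 2 * D) = kap * L * r ^+ 2 * D); last by ring.
by rewrite [leRHS]mulrC; apply: ler_wpM2r => //; exact: ltW.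
Qed.

End modal.

(** * Numerical bounds on the frequencies for 2 pi < T < 5/2 pi *)

Section frequency.
Context {R : realType}.
Variable T : R.
Hypotheses (T1 : 2 * pi < T) (T2 : T < 5 / 2 * pi).
Let om (k : nat) : R := 2 * pi * k%:R / T.

Lemma period_gt0 : 0 < T.
Proof. by apply: lt_trans T1; rewrite mulr_gt0// pi_gt0. Qed.

Lemma freq_bounds : 4 / 5 < om 1 < 1.
Proof.
rewrite /om mulr1; have t0 := period_gt0; rewrite ltr_pdivlMr// ltr_pdivrMr// mul1r T1 andbT.
move: T2; lra.
Qed.

Lemma freqE k : om k = k%:R * om 1.
Proof. by rewrite /om mulr1; ring. Qed.

Lemma freq_sqr_ge k : k%:R ^+ 2 * (16 / 25) <= om k ^+ 2.
Proof.
rewrite freqE exprMn ler_wpM2l ?sqr_ge0//.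
have /andP[h _] := freq_bounds.
rewrite (_ : 16 / 25 = (4 / 5) ^+ 2); last by field.
by rewrite lerXn2r ?nnegrE ?(ltW h)//; lra.
Qed.

Lemma freq_gt1 j : (1 < j)%N -> 0 < om j ^+ 2 - 1.
Proof.
move=> j1; have := freq_sqr_ge j.
have : 2 ^+ 2 <= j%:R ^+ 2 :> R by rewrite -!natrX ler_nat leq_sqr.
rewrite (_ : 2 ^+ 2 = 4 :> R); [lra|ring].
Qed.

(** For j >= 2 the stiffness is at least (1 + j ^ 2) / 6, by the lower bound 4 / 5 on the
    fundamental frequency; the sum of 1 / (1 + j ^ 2) being at most 3, this gives 18. *)
Lemma freq_sum J : \sum_(2 <= j < J) (om j ^+ 2 - 1)^-1 <= 18.
Proof.
apply: (@le_trans _ _ (6 * \sum_(0 <= j < J) (1 + j%:R ^+ 2)^-1)); last by have := @sum_inv_sqr R J; lra.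
have p0 j : 0 < 1 + j%:R ^+ 2 :> R by rewrite ltr_pwDl ?sqr_ge0.
have [J2|J2] := leqP J 2.
  by rewrite big_geq// mulr_ge0// sumr_ge0// => j _; rewrite invr_ge0 ltW.
rewrite [in leRHS](big_cat_nat (leq0n 2) (ltnW J2))/= mulrDr.
have q0 : 0 <= 6 * \sum_(0 <= i < 2) (1 + i%:R ^+ 2)^-1 :> R.
  by rewrite mulr_ge0// sumr_ge0// => j _; rewrite invr_ge0 ltW.
rewrite (ler_wpDl q0)//.
rewrite mulr_sumr !big_nat; apply: ler_sum => j /andP[j2 _].
rewrite -lef_pV2 ?posrE ?mulr_gt0 ?invr_gt0 ?freq_gt1// invrK invfM invrK.
have := freq_sqr_ge j.
have : 2 ^+ 2 <= j%:R ^+ 2 :> R by rewrite -!natrX ler_nat leq_sqr.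
rewrite (_ : 2 ^+ 2 = 4 :> R); [lra|ring].
Qed.

Lemma eps_gt0 : 0 < eps T.
Proof.
have /andP[h1 h2] := freq_bounds; rewrite /om mulr1 in h1 h2.
by rewrite sqrtr_gt0 subr_gt0 expr_lt1//; lra.
Qed.

Lemma eps_sqr : eps T ^+ 2 = 1 - om 1 ^+ 2.
Proof.
have := eps_gt0; rewrite sqrtr_gt0 => /ltW h.
by rewrite sqr_sqrtr// /om mulr1.
Qed.

Lemma eps_bounds : eps T < 3 / 5.
Proof.
have e0 := eps_gt0; have h35 : 0 <= 3 / 5 :> R by lra.
rewrite -ltr_sqr ?nnegrE ?(ltW e0)//.
have /andP[h1 h2] := freq_bounds; rewrite eps_sqr.
have : (4 / 5) ^+ 2 < om 1 ^+ 2 by rewrite ltr_sqr ?nnegrE//; lra.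
rewrite !expr2; lra.
Qed.

End frequency.

Lemma sobolev_sqnorm_ge0 (R : realType) (s : R) c : (0 <= sobolev_sqnorm s c)%E.
Proof. by apply: nneseries_ge0 => j _ _; rewrite lee_fin mulr_ge0 ?powR_ge0// sqr_ge0. Qed.

Lemma sobolev_sqnorm_sum (R : realType) (s : R) (c : nat -> R) D J :
  (sobolev_sqnorm s c <= D%:E)%E -> \sum_(0 <= j < J) (c j ^+ 2 * (1 + j%:R ^+ 2) `^ s) <= D.
Proof.
move=> h; rewrite -lee_fin; apply: le_trans h; rewrite -sumEFin.
by apply: nneseries_lim_ge => j _ _; rewrite lee_fin mulr_ge0 ?powR_ge0// sqr_ge0.
Qed.

(** Young's inequality against the summable 1 / (1 + j ^ 2). Scaling it by [E] yields a bound linear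
    in [E] from a hypothesis that is quadratic. *)
Lemma sobolev_sum_le (R : realType) (s : R) (c : nat -> R) (C E : R) J : 1 <= s -> 0 < E ->
  (sobolev_sqnorm s c <= (C * E ^+ 2)%:E)%E -> \sum_(0 <= j < J) `|c j| <= (3 + C) / 2 * E.
Proof.
move=> s1 E0 h; have := sobolev_sqnorm_sum J h => {}h.
have w1 j : 1 <= 1 + j%:R ^+ 2 :> R by rewrite lerDl sqr_ge0.
apply: (@le_trans _ _ (\sum_(0 <= j < J) ((E / 2) * (1 + j%:R ^+ 2)^-1 + (2 * E)^-1 * (c j ^+ 2 * (1 + j%:R ^+ 2) `^ s)))).
  apply: ler_sum => j _.
  have wj : (1 + j%:R ^+ 2) / E <= (1 + j%:R ^+ 2) `^ s / E.
    by rewrite ler_pM2r ?invr_gt0// -[leLHS]powRr1 ?ler_powR//; have := w1 j; lra.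
  have wp : 0 < (1 + j%:R ^+ 2) / E by rewrite divr_gt0//; have := w1 j; lra.
  apply: le_trans (norm_le_weight (c j) wp wj) _.
  rewrite le_eqVlt; apply/orP; left; apply/eqP.
  rewrite invfM invrK; move: (w1 j); set w := 1 + _ => {}w1.
  by field; rewrite !gt_eqF//; lra.
rewrite big_split/= -!mulr_sumr.
have := @sum_inv_sqr R J => h3.
have e1 : E / 2 * (\sum_(0 <= k < J) (1 + k%:R ^+ 2)^-1) <= E / 2 * 3 by rewrite ler_wpM2l// divr_ge0// ltW.
have e2 : (2 * E)^-1 * (\sum_(0 <= j < J) c j ^+ 2 * (1 + j%:R ^+ 2) `^ s) <= (2 * E)^-1 * (C * E ^+ 2).
  by rewrite ler_wpM2l// invr_ge0 mulr_ge0// ltW.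
apply: (le_trans (lerD e1 e2)); rewrite le_eqVlt; apply/orP; left; apply/eqP.
by field; rewrite gt_eqF.
Qed.

Lemma sobolev_coef_le (R : realType) (s : R) (c : nat -> R) (D : R) j : 0 <= s ->
  (sobolev_sqnorm s c <= D%:E)%E -> c j ^+ 2 <= D.
Proof.
move=> s0 h; apply: le_trans (sobolev_sqnorm_sum j.+1 h).
rewrite big_nat_recr//= ler_wpDl ?sumr_ge0// => [k _|].
  by rewrite mulr_ge0 ?powR_ge0// sqr_ge0.
rewrite ler_peMr ?sqr_ge0// -[leLHS](powRr0 (1 + j%:R ^+ 2)) ler_powR// lerDl sqr_ge0//.
Qed.

(** * From decaying solutions to modal ones, and uniqueness *)

Section solution.
Context {R : realType}.
Variables (T s : R) (P f : R -> R).
Hypotheses (T1 : 2 * pi < T) (T2 : T < 5 / 2 * pi) (s_gt : 3 / 2 < s) (cP : continuous P).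
Hypothesis fE : forall y, f y = y + P y.
Let om (k : nat) : R := 2 * pi * k%:R / T.
Let e := eps T.
Let T0 := period_gt0 T1.
Let e0 : 0 < e := eps_gt0 T1 T2.

(** [U], continuous in x on the whole line, is returned as well because [modal] speaks of x > x0
    only, whereas a solution might be nonzero just at [x0]. *)
Lemma solution_modal (x0 : R) u : decaying_solution f s T x0 u ->
  exists (a a' n : nat -> R -> R) (C b X : R) (U : R -> R -> R),
  [/\ modal T P x0 u a a' n /\ (forall x t, x0 < x -> `|u x t| <= C),
      decays x0 u a a' X b, b <= e / 2, forall t, continuous (U^~ t) &
      forall x t, x0 <= x -> u x t = U x t].
Proof.
move=> [_ uodd [U UHs uU] uw [Cd [be [/andP[be0 be1] [N0 [_ Nd]]]]]].
have [a [b [M [C [MC [ca cb] abM UE]]]]] := Hs_cylinder_modes s_gt T0 UHs.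
have UE' x : U x = (fun t => limn (series (fun k => a k x * cos (om k * t) + b k x * sin (om k * t)))).
  by apply/funext => t; exact: UE.
have uE x t : x0 <= x -> u x t = limn (series (fun k => a k x * cos (om k * t) + b k x * sin (om k * t))).
  by move=> h; rewrite uU// UE'.
have cU x : continuous (U x) by rewrite UE'; exact: (@modes_continuous_t _ T C a b M MC abM x).
have cUx t : continuous (U^~ t).
  rewrite (_ : U^~ t = (fun x => limn (series (fun k => a k x * cos (om k * t) + b k x * sin (om k * t))))).
    exact: (@modes_continuous_x _ T C a b M MC ca cb abM t).
  by apply/funext => x; exact: UE.
have uUx x : x0 <= x -> u x = U x by move=> h; apply/funext => t; exact: uU.
have cos_u x j : x0 <= x -> cos_coef (fun tau => u x (T * tau / (2 * pi))) j = a j x.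
  move=> h; rewrite uUx// UE'; exact: (@cos_coef_modes _ T C a b M T0 MC abM x j).
have sin_u x j : x0 <= x -> sin_coef (fun tau => u x (T * tau / (2 * pi))) j = if j == 0%N then 0 else b j x.
  move=> h; rewrite uUx// UE'; exact: (@sin_coef_modes _ T C a b M T0 MC abM x j).
have bz x j : x0 <= x -> (0 < j)%N -> b j x = 0.
  by move=> h j0; have := (uodd x h).1 j; rewrite sin_u// eqn0Ngt j0.
have a0 x : x0 <= x -> a 0%N x = 0.
  by move=> h; have := (uodd x h).2 0%N isT; rewrite cos_u.
have wsum x t : x0 <= x -> u x t = limn (series (fun k => a k x * cos (om k * t))).
  move=> h; rewrite uE//; congr (limn (series _)); apply/funext => k.
  case: k => [|k]; last by rewrite bz// mul0r addr0.
  by rewrite /om mulr0 !mul0r sin0 mulr0 addr0.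
pose n := @nl_coef _ T a b P.
have /choice[a' ha'] j : exists a'j : R -> R, forall x : R, x0 < x -> is_derive x (1 : R) (a j) (a'j x) /\
    is_derive x (1 : R) a'j ((1 - om j ^+ 2) * a j x + n j x).
  by apply: (@modes_ode _ T x0 C a b M P T0 MC ca cb abM cP u f j fE) => // x t h; rewrite uU// UE.
have bsum_a x : bsum (a^~ x) C.
  by apply: bsum_le MC => k; apply: le_trans (abM k x).1 (ler_norm _).
have m : modal T P x0 u a a' n.
  split.
  - by move=> x /ltW h; rewrite uUx.
  - by move=> x _; exists C.
  - by move=> x t /ltW h; exact: wsum.
  - by move=> x /ltW h; exact: a0.
  - by move=> j x h; exact: (ha' j x h).1.
  - by move=> j x h; exact: (ha' j x h).2.
  - by move=> j x /ltW h; rewrite uUx// UE'.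
have uC x t : x0 < x -> `|u x t| <= `|2| * C.
  by move=> /ltW h; rewrite uE//; exact: (@modes_bound _ T C a b M MC abM x t).
pose r := Num.min (be * e) (e / 2).
pose X := Num.max x0 (Num.max 0 (N0 / e)).
have x0X : x0 <= X by rewrite le_max lexx.
have r0 : 0 < r by rewrite lt_min mulr_gt0//= divr_gt0.
have re : r <= be * e by rewrite ge_min lexx.
have key x : X < x -> (forall J, \sum_(0 <= j < J) `|a j x| <= (3 + Cd) / 2 * expR (- (r * x))) /\
    forall j, `|a' j x| <= (1 + Cd) * expR (- (r * x)).
  rewrite !gt_max => /and3P[x0x xp]; rewrite ltr_pdivrMr// => Nx.
  pose E := expR (- (be * (x * e))).
  have EE : Cd * E ^+ 2 = Cd * expR (- (2 * be * (x * e))).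
    by rewrite /E [expR _ ^+ 2]expr2 -expRD; congr (_ * expR _); ring.
  have Er : E <= expR (- (r * x)).
    rewrite ler_expR lerN2 [x * e]mulrC mulrA; apply: ler_wpM2r => //; exact: ltW.
  have := Nd _ Nx; rewrite -EE.
  have ec j y : x0 <= y -> cos_coef (rescale T u (y * e)) j = a j y.
    move=> h; rewrite -(cos_u y j h); congr cos_coef; apply/funext => t.
    by rewrite /rescale mulfK// gt_eqF.
  have ec' j : derive1 (fun y => cos_coef (rescale T u y) j) (x * e) = a' j x / e.
    apply: is_derive_derive1.
    apply: (@near_eq_is_derive _ _ _ (fun y => a j (e^-1 * y))).
      near=> y; rewrite mulrC -ec ?divfK ?gt_eqF//.
      rewrite ler_pdivlMr//; apply: ltW; near: y; apply: lt_nbhsr; rewrite ltr_pM2r//.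
    have h1 : is_derive (x * e) (1 : R) (fun y : R => e^-1 * y) e^-1.
      by apply: is_derive_eq; rewrite /GRing.scale/= mulr1.
    have xe : e^-1 * (x * e) = x by rewrite mulrC mulfK// gt_eqF.
    have h2 : is_derive (e^-1 * (x * e)) (1 : R) (a j) (a' j x) by rewrite xe; exact: (ha' j x x0x).1.
    exact: (@is_derive1_comp R (a j) (fun y => e^-1 * y) (x * e) _ _ h2 h1).
  rewrite (_ : cos_coef (rescale T u (x * e)) = a^~ x); last by apply/funext => j; rewrite ec// ltW.
  rewrite (_ : (fun j => derive1 _ _) = (fun j => a' j x / e)); last by apply/funext => j; exact: ec'.
  move=> h.
  have n1 := sobolev_sqnorm_ge0 s (a^~ x); have n2 := sobolev_sqnorm_ge0 (s - 1) (fun j => a' j x / e).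
  have e20 : (0 <= (eps T ^+ 2)%:E)%E by rewrite lee_fin sqr_ge0.
  have h1 : (sobolev_sqnorm s (a^~ x) <= (Cd * E ^+ 2)%:E)%E.
    by apply: le_trans h; rewrite leeDl// mule_ge0.
  have E0 : 0 < E := expR_gt0 _.
  have s1 : 1 <= s by move: s_gt; lra.
  have Cd0 : 0 <= Cd.
    have := le_trans n1 h1; rewrite lee_fin pmulr_lge0// exprn_gt0//.
  split=> [J|j].
    apply: le_trans (sobolev_sum_le J s1 E0 h1) _.
    by rewrite ler_wpM2l// divr_ge0// addr_ge0.
  (* The factor eps ^ 2 in the decay condition compensates the 1 / e that the change of variable
     puts on the derivative, so that [a'] decays like [a]. *)
  have h2 : (sobolev_sqnorm (s - 1) (fun j => (a' j x / e)%R) <= (e ^- 2 * (Cd * E ^+ 2))%:E)%E.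
    have : ((eps T ^+ 2)%:E * sobolev_sqnorm (s - 1) (fun j => (a' j x / e)%R) <= (Cd * E ^+ 2)%:E)%E.
      by apply: le_trans h; rewrite leeDr.
    by move=> h'; rewrite [X in (_ <= X)%E]EFinM lee_pdivlMl ?exprn_gt0.
  have s1' : 0 <= s - 1 by lra.
  have := sobolev_coef_le j s1' h2.
  rewrite exprMn mulrC exprVn ler_pM2l ?invr_gt0 ?exprn_gt0// => h3.
  apply: (@le_trans _ _ ((1 + Cd) * E)); last by rewrite ler_wpM2l// addr_ge0.
  rewrite -ler_sqr ?nnegrE ?mulr_ge0 ?addr_ge0 ?(ltW E0)// real_normK ?num_real//.
  apply: (le_trans h3); rewrite exprMn ler_wpM2r ?sqr_ge0//.
  have := sqr_ge0 Cd; rewrite sqrrD expr1n mul1r => ?; lra.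
exists a, a', n, (`|2| * C), r, X, U; split => //; last by rewrite ge_min lexx orbT.
split => //.
  exists ((3 + Cd) / 2) => x t Xx; have [h _] := key x Xx; have x0x := le_lt_trans x0X Xx.
  rewrite wsum ?(ltW x0x)//; apply: (@bsum_lim_le _ _ ((3 + Cd) / 2 * expR (- (r * x)))) => J.
  by apply: le_trans (h J); apply: ler_sum => k _; rewrite normrM ler_piMr// cos_max.
move=> j; exists (Num.max ((3 + Cd) / 2) (1 + Cd)) => x Xx; have [h1 h2] := key x Xx; split.
  apply: (@le_trans _ _ ((3 + Cd) / 2 * expR (- (r * x)))); last by rewrite ler_wpM2r ?expR_ge0// le_max lexx.
  by apply: le_trans (h1 j.+1); rewrite big_nat_recr//= lerDr sumr_ge0.
apply: le_trans (h2 j) _; by rewrite ler_wpM2r ?expR_ge0// le_max lexx orbT.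
Unshelve. all: end_near. Qed.

Hypothesis P_lip : forall rho : R, 1 <= rho -> exists L : R, 0 < L /\
  forall r x y, r <= rho -> `|x| <= r -> `|y| <= r -> `|P x - P y| <= L * r ^+ 2 * `|x - y|.
Hypothesis P_odd : forall y, P (- y) = - P y.

Let oe := eps_sqr T1 T2.
Let og := freq_gt1 T1 T2.
Let os := freq_sum T1 T2.

Lemma decays_weaken x0 (u : R -> R -> R) a a' X Y b : decays x0 u a a' X b -> X <= Y -> decays x0 u a a' Y b.
Proof.
move=> [xX b0 [B hB] ha] XY; split => //; first exact: le_trans XY.
  by exists B => x t Yx; apply: hB; exact: le_lt_trans Yx.
by move=> j; have [B' h] := ha j; exists B' => x Yx; apply: h; exact: le_lt_trans Yx.
Qed.

(** If [k] were 0, the solution would share its leading coefficient with the zero solution; it would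
    vanish for large x, then on the open half-line by unique continuation, and at [x0] by
    continuity. *)
Lemma asymptotics_neq0 x0 u a a' n (C b X k Y Ca : R) (U : R -> R -> R) :
  modal T P x0 u a a' n -> (forall x t, x0 < x -> `|u x t| <= C) ->
  decays x0 u a a' X b -> b <= e / 2 -> (forall t, continuous (U^~ t)) ->
  (forall x t, x0 <= x -> u x t = U x t) -> nonzero_on x0 u -> X <= Y -> 0 < Ca ->
  (forall x, Y < x -> (forall t, `|u x t| <= Ca * expR (- (e / 2 * x))) /\
    `|a 1%N x - k * expR (- (e * x))| <= Ca * expR (- (3 / 2 * e * x))) -> k != 0.
Proof.
move=> m uC D be cU uU [x1 [t1 [x01 /eqP unz]]] XY Ca0 A; apply/eqP => k0; apply: unz.
have D' := decays_weaken D XY; have [xY _ _ _] := D'.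
pose Cm := Num.max 1 (Num.max C Ca).
have Cm1 : 0 < Cm by rewrite lt_max ltr01.
have Cm2 : C <= Cm by rewrite !le_max lexx orbT.
have Cm3 : Ca <= Cm by rewrite !le_max lexx !orbT.
have zD : decays x0 (fun _ _ => 0) (fun _ _ => 0) (fun _ _ => 0) Y b.
  split => //; first by case: D.
    by exists 0 => x t _; rewrite normr0 mul0r.
  by move=> j; exists 0 => x _; rewrite normr0 mul0r.
have uCm x t : x0 < x -> `|u x t| <= Cm by move=> h; exact: le_trans (uC x t h) Cm2.
have zCm (x t : R) : x0 < x -> `|0 : R| <= Cm by rewrite normr0 ltW.
have A' x : Y < x -> (forall t, `|u x t| <= Cm * expR (- (e / 2 * x))) /\
    `|a 1%N x - 0 * expR (- (e * x))| <= Cm * expR (- (3 / 2 * e * x)).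
  move=> Yx; split=> [t|].
    by apply: le_trans ((A x Yx).1 t) _; rewrite ler_wpM2r ?expR_ge0.
  by rewrite -k0; apply: le_trans ((A x Yx).2) _; rewrite ler_wpM2r ?expR_ge0.
have zA x : Y < x -> (forall t : R, `|0 : R| <= Cm * expR (- (e / 2 * x))) /\
    `|0 - 0 * expR (- (e * x))| <= Cm * expR (- (3 / 2 * e * x)).
  by move=> Yx; split=> [t|]; rewrite ?mul0r ?subr0 normr0 mulr_ge0 ?expR_ge0// ltW.
have [Z YZ hZ] := @modal_unique _ T P cP e e0 oe og os x0 P_lip u (fun _ _ => 0) a a' n (fun _ _ => 0) (fun _ _ => 0) (fun _ _ => 0) Cm b b Y 0 m
  (modal_zero T x0 P_odd) uCm zCm D' zD be be Cm1 A' zA.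
have u0 := @modal_vanish _ T P T0 cP e e0 oe og os x0 P_lip P_odd u a a' n C m uC Z (le_trans xY YZ) hZ.
have [x01'|] := ltP x0 x1; first exact: u0.
move=> x10; have {x01 x10} -> : x1 = x0 by apply/eqP; rewrite eq_le x10.
rewrite uU//; apply/eqP; rewrite -normr_le0; apply/ler_addgt0Pl => d d0; rewrite addr0.
have /cvgrPdist_le/(_ d d0) := cU t1 x0.
case=> h /= h0 hh; have := hh (x0 + h / 2); rewrite /ball/= opprD addNKr normrN ger0_norm; last by rewrite divr_ge0// ltW.
rewrite -(uU (x0 + h / 2)); last by rewrite lerDl divr_ge0// ltW.
rewrite u0; last by rewrite ltrDl divr_gt0.
by rewrite subr0; apply; lra.
Qed.

Lemma solution_unique (x0 x1 : R) u v :
  decaying_solution f s T x0 u -> nonzero_on x0 u ->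
  decaying_solution f s T x1 v -> nonzero_on x1 v ->
  same_up_to_translation_sign u v.
Proof.
move=> su nu sv nv.
have [a [a' [n [C [b [X [U [[m uC] D be cU uU]]]]]]]] := solution_modal su.
have [a2 [a2' [n2 [C2 [b2 [X2 [V [[m2 vC] D2 be2 cV vV]]]]]]]] := solution_modal sv.
have [k [Y [XY [Ca Ca0 A]]]] := @modal_asymptotics _ T P cP e e0 oe og os x0 P_lip P_odd u a a' n C m uC X b D be.
have [k2 [Y2 [XY2 [Ca2 Ca20 A2]]]] := @modal_asymptotics _ T P cP e e0 oe og os x1 P_lip P_odd v a2 a2' n2 C2 m2 vC X2 b2 D2 be2.
have k0 := asymptotics_neq0 m uC D be cU uU nu XY Ca0 A.
have k20 := asymptotics_neq0 m2 vC D2 be2 cV vV nv XY2 Ca20 A2.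
(* Translation by [h] multiplies the leading coefficient by exp (- e h). Together with the sign
   [neg], this choice turns [k2] into [k]. *)
pose h : R := ln (`|k2| / `|k|) / e.
pose neg := k * k2 < 0.
have eh : (-1) ^+ neg * (k2 * expR (- (e * h))) = k.
  have -> : e * h = ln (`|k2| / `|k|) by rewrite /h mulrCA divff ?mulr1// gt_eqF.
  rewrite expRN lnK ?posrE ?divr_gt0 ?normr_gt0// invf_div.
  rewrite -[RHS](mulr_sg_norm k) -{1}(mulr_sg_norm k2).
  have -> : Num.sg k2 * `|k2| * (`|k| / `|k2|) = Num.sg k2 * `|k|.
    by field; rewrite normr_eq0.
  rewrite mulrA; congr (_ * _); rewrite /neg.
  have [kp|kn|/eqP] := ltgtP k 0; last by rewrite (negbTE k0).
    rewrite nmulr_rlt0// (ltr0_sg kp).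
    have [kp2|kn2|/eqP] := ltgtP k2 0; last by rewrite (negbTE k20).
      by rewrite (ltr0_sg kp2) mul1r.
    by rewrite (gtr0_sg kn2) mulr1.
  rewrite pmulr_rlt0// (gtr0_sg kn).
  have [kp2|kn2|/eqP] := ltgtP k2 0; last by rewrite (negbTE k20).
    by rewrite (ltr0_sg kp2) mulrNN mulr1.
  by rewrite (gtr0_sg kn2) mul1r.
exists h, neg.
have m2' := modal_translate cP P_odd h neg m2.
pose z0 := Num.max x0 (x1 - h).
pose Z := Num.max (Num.max Y (Y2 - h)) z0.
have restrict (y : R) w c c' p : y <= z0 -> modal T P y w c c' p -> modal T P z0 w c c' p.
  move=> yz [q1 q2 q3 q4 q5 q6 q7].
  by split; [move=> x zx; apply: q1|move=> x zx; apply: q2|move=> x t zx; apply: q3|move=> x zx; apply: q4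
    |move=> j x zx; apply: q5|move=> j x zx; apply: q6|move=> j x zx; apply: q7]; exact: le_lt_trans zx.
have x0z : x0 <= z0 by rewrite le_max lexx.
have x1z : x1 - h <= z0 by rewrite le_max lexx orbT.
have YZ : Y <= Z by rewrite !le_max lexx.
have YZ2 x : Z < x -> Y2 < x + h.
  move=> Zx; rewrite -ltrBlDr; apply: le_lt_trans Zx; by rewrite !le_max lexx orbT.
have zZ : z0 <= Z by rewrite le_max lexx orbT.
(* Bounds the factors exp (- c h) introduced by the translation, for every rate c between 0 and 3 /
   2 e. *)
pose H : R := expR (`|e * h|) + expR (`|3 / 2 * e * h|).
have H1 (c : R) : 0 <= c <= 3 / 2 * e -> expR (- (c * h)) <= H.
  move=> /andP[c0 ce]; apply: (@le_trans _ _ (expR (`|3 / 2 * e * h|))); last by rewrite lerDr expR_ge0.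
  rewrite ler_expR; apply: le_trans (ler_norm _) _; rewrite normrN [leLHS]normrM [leRHS]normrM ler_wpM2r//.
  by rewrite !ger0_norm//; apply: le_trans ce.
have H0 : 0 < H by rewrite addr_gt0 ?expR_gt0.
have H1b : 0 <= b2 <= 3 / 2 * e by move: (e0) be2; case: D2 => _ /ltW-> _ _; move=> *; lra.
pose Cm := Num.max 1 (Num.max (Num.max C C2) (Num.max Ca (Ca2 * H))).
have Cm1 : 0 < Cm by rewrite lt_max ltr01.
have CmC : C <= Cm by rewrite !le_max lexx !orbT.
have CmC2 : C2 <= Cm by rewrite !le_max lexx !orbT.
have CmCa : Ca <= Cm by rewrite !le_max lexx !orbT.
have CmCa2 : Ca2 * H <= Cm by rewrite !le_max lexx !orbT.
pose v' x t := (-1) ^+ neg * v (x + h) t.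
have exph (c x : R) : expR (- (c * (x + h))) = expR (- (c * h)) * expR (- (c * x)).
  by rewrite -expRD; congr expR; ring.
have DZ : decays z0 u a a' Z b.
  have [_ bb hB ha] := decays_weaken D (le_trans XY YZ).
  by split.
have DZ2 : decays z0 v' (fun j x => (-1) ^+ neg * a2 j (x + h)) (fun j x => (-1) ^+ neg * a2' j (x + h)) Z b2.
  have [_ bb [B hB] ha] := decays_weaken D2 XY2; split => //.
    exists (B * expR (- (b2 * h))) => x t Zx; rewrite normrM normr_sign mul1r -mulrA -exph.
    by apply: hB; exact: YZ2.
  move=> j; have [B' hB'] := ha j; exists (B' * expR (- (b2 * h))) => x Zx.
  rewrite !normrM !normr_sign !mul1r -mulrA -exph.
  by apply: hB'; exact: YZ2.
have e1 : 0 <= e / 2 <= 3 / 2 * e by move: (e0) => ?; apply/andP; split; lra.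
have e2 : 0 <= 3 / 2 * e <= 3 / 2 * e by rewrite lexx andbT mulr_ge0// ltW.
have A' x : Z < x -> (forall t, `|v' x t| <= Cm * expR (- (e / 2 * x))) /\
    `|(-1) ^+ neg * a2 1%N (x + h) - k * expR (- (e * x))| <= Cm * expR (- (3 / 2 * e * x)).
  move=> Zx; have [B1 B2] := A2 _ (YZ2 x Zx); split.
    move=> t; rewrite normrM normr_sign mul1r; apply: le_trans (B1 t) _.
    rewrite exph mulrA ler_wpM2r ?expR_ge0//; apply: le_trans CmCa2.
    by rewrite ler_wpM2l ?H1// ltW.
  rewrite -eh (_ : (-1) ^+ neg * (k2 * _) * _ = (-1) ^+ neg * (k2 * expR (- (e * (x + h))))); last first.
    by rewrite exph !mulrA.
  rewrite -mulrBr normrM normr_sign mul1r; apply: le_trans B2 _.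
  rewrite exph mulrA ler_wpM2r ?expR_ge0//; apply: le_trans CmCa2.
  by rewrite ler_wpM2l ?H1// ltW.
have uCm x t : z0 < x -> `|u x t| <= Cm.
  by move=> q; exact: le_trans (uC x t (le_lt_trans x0z q)) CmC.
have vCm x t : z0 < x -> `|v' x t| <= Cm.
  move=> q; rewrite normrM normr_sign mul1r; apply: le_trans (vC _ t _) CmC2.
  by rewrite -ltrBlDr; exact: le_lt_trans q.
have A1 x : Z < x -> (forall t, `|u x t| <= Cm * expR (- (e / 2 * x))) /\
    `|a 1%N x - k * expR (- (e * x))| <= Cm * expR (- (3 / 2 * e * x)).
  move=> Zx; have [p1 p2] := A x (le_lt_trans YZ Zx); split=> [t|].
    by apply: le_trans (p1 t) _; rewrite ler_wpM2r ?expR_ge0.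
  by apply: le_trans p2 _; rewrite ler_wpM2r ?expR_ge0.
have [Q ZQ hQ] := @modal_unique _ T P cP e e0 oe og os z0 P_lip u v' a a' n _ _ _ Cm b b2 Z k
  (restrict _ _ _ _ _ x0z m) (restrict _ _ _ _ _ x1z m2') uCm vCm DZ DZ2 be be2 Cm1 A1 A'.
by exists Q; split; [exact: num_real|move=> x Qx t; exact: hQ].
Qed.

End solution.

(** * Formal solution *)

Section poly_norm.
Context {R : realType} {A : comNzRingType}.
Variables (N : A -> R) (rho : R).

(** A weighted l^1 norm, submultiplicative when [N] is. It is nested, with weight 1 in the inner
    variable and [rho] in the outer one, so that it controls values at 0 <= z <= rho uniformly in
    t. *)
Definition poly_norm (p : {poly A}) : R := \sum_(0 <= i < size p) N p`_i * rho ^+ i.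

Hypotheses (N_ge0 : forall a, 0 <= N a) (N0 : N 0 = 0).
Hypothesis ND : forall a b, N (a + b) <= N a + N b.
Hypothesis NM : forall a b, N (a * b) <= N a * N b.
Hypothesis rho_ge0 : 0 <= rho.

Lemma poly_norm_widen (p : {poly A}) n : (size p <= n)%N -> poly_norm p = \sum_(0 <= i < n) N p`_i * rho ^+ i.
Proof.
move=> pn; rewrite (big_cat_nat (leq0n _) pn)/= [X in _ + X]big_nat [X in _ + X]big1 ?addr0// => i /andP[pi _].
by rewrite nth_default// N0 mul0r.
Qed.

Lemma poly_norm_ge0 p : 0 <= poly_norm p.
Proof. by apply: sumr_ge0 => i _; rewrite mulr_ge0// exprn_ge0. Qed.

Lemma poly_norm0 : poly_norm 0 = 0.
Proof. by rewrite /poly_norm size_poly0 big_geq. Qed.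

Lemma poly_normD p q : poly_norm (p + q) <= poly_norm p + poly_norm q.
Proof.
pose n := maxn (size p) (size q).
rewrite (@poly_norm_widen p n) ?leq_maxl// (@poly_norm_widen q n) ?leq_maxr//.
rewrite (@poly_norm_widen (p + q) n) ?size_polyD// -big_split; apply: ler_sum => i _ /=.
by rewrite coefD -mulrDl ler_wpM2r ?exprn_ge0.
Qed.

Lemma poly_norm_cons p c : poly_norm (p * 'X + c%:P) = rho * poly_norm p + N c.
Proof.
rewrite (@poly_norm_widen _ (size p).+1); last by rewrite size_MXaddC; case: ifP.
rewrite big_nat_recl// coefD coefMX coefC eqxx add0r expr0 mulr1 addrC; congr (_ + _).
rewrite mulr_sumr; apply: eq_bigr => i _.
by rewrite coefD coefMX coefC/= addr0 exprS; ring.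
Qed.

Lemma poly_normC c p : poly_norm (c%:P * p) <= N c * poly_norm p.
Proof.
rewrite (@poly_norm_widen _ (size p)); last by rewrite mul_polyC size_scale_leq.
rewrite mulr_sumr; apply: ler_sum => i _; rewrite coefCM mulrA.
by rewrite ler_wpM2r ?exprn_ge0.
Qed.

Lemma poly_normM p q : poly_norm (p * q) <= poly_norm p * poly_norm q.
Proof.
elim/poly_ind: p => [|p c IH]; first by rewrite mul0r poly_norm0 mul0r.
rewrite poly_norm_cons mulrDl mulrDl; apply: le_trans (poly_normD _ _) _.
apply: lerD; last exact: poly_normC.
rewrite (_ : p * 'X * q = p * q * 'X + 0%:P); last by rewrite polyC0 addr0; ring.
by rewrite poly_norm_cons N0 addr0 -mulrA ler_wpM2l.
Qed.

Lemma poly_norm_coef (p : {poly A}) i : N p`_i * rho ^+ i <= poly_norm p.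
Proof.
rewrite (@poly_norm_widen p (maxn i.+1 (size p))) ?leq_maxr//.
rewrite big_mkord (bigD1 (Ordinal (leq_maxl i.+1 (size p))))//= lerDl.
by apply: sumr_ge0 => j _; rewrite mulr_ge0// exprn_ge0.
Qed.

Lemma poly_norm_sum (I : Type) (r : seq I) (F : I -> {poly A}) :
  poly_norm (\sum_(i <- r) F i) <= \sum_(i <- r) poly_norm (F i).
Proof.
elim: r => [|i r IH]; first by rewrite !big_nil poly_norm0.
by rewrite !big_cons; apply: le_trans (poly_normD _ _) _; rewrite lerD2l.
Qed.

Hypothesis N1 : N 1 <= 1.

Lemma poly_norm1 : poly_norm 1 <= 1.
Proof. by rewrite /poly_norm size_poly1 big_nat1 coefC eqxx expr0 mulr1. Qed.

Lemma poly_normX p m : poly_norm (p ^+ m) <= poly_norm p ^+ m.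
Proof.
elim: m => [|m IH]; first by rewrite !expr0 poly_norm1.
rewrite !exprS; apply: le_trans (poly_normM _ _) _.
by rewrite ler_wpM2l ?poly_norm_ge0.
Qed.

End poly_norm.

(** * Valuation and parity with respect to z *)

Section order.
Context {A : comNzRingType}.
Implicit Types p q : {poly A}.

Definition order_ge (n : nat) (p : {poly A}) : Prop := forall i, (i < n)%N -> p`_i = 0.

Lemma order_geM n m p q : order_ge n p -> order_ge m q -> order_ge (n + m) (p * q).
Proof.
move=> pn qm i inm; rewrite coefM big1// => j _.
have [jn|nj] := ltnP j n; first by rewrite pn// mul0r.
by rewrite qm ?mulr0//; have := ltn_ord j; lia.
Qed.

Lemma order_geW n m p : (n <= m)%N -> order_ge m p -> order_ge n p.
Proof. by move=> nm h i im; apply: h; apply: leq_trans im nm. Qed.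

Lemma order_geD n p q : order_ge n p -> order_ge n q -> order_ge n (p + q).
Proof. by move=> pn qn i h; rewrite coefD pn// qn// addr0. Qed.

Lemma order_ge_sum n (I : Type) (r : seq I) (F : I -> {poly A}) :
  (forall i, order_ge n (F i)) -> order_ge n (\sum_(i <- r) F i).
Proof.
move=> h; elim: r => [|i r IH]; first by rewrite big_nil => i _; rewrite coef0.
by rewrite big_cons; exact: order_geD.
Qed.

Lemma order_geX p m : order_ge 1 p -> order_ge m (p ^+ m).
Proof.
move=> h; elim: m => [|m IH]; first by [].
by rewrite exprS -add1n; exact: order_geM.
Qed.

(** p ^ m - q ^ m is the product of p - q and a factor of order at least m - 1 >= 1. Hence the next
    coefficient of the nonlinearity depends only on coefficients already known, and the recursion
    makes sense. *)
Lemma order_ge_subX p q n m : (1 < m)%N -> order_ge 1 p -> order_ge 1 q ->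
  order_ge n (p - q) -> order_ge n.+1 (p ^+ m - q ^+ m).
Proof.
move=> m1 p1 q1 pq; rewrite subrXX -addn1; apply: order_geM => //.
apply: order_ge_sum => i; have im := ltn_ord i.
apply: (@order_geW _ ((m.-1 - i) + i)); first by lia.
by rewrite -subn1 subnAC subn1 addnC addnC; apply: order_geM; rewrite ?subnS; exact: order_geX.
Qed.

Definition parity (b : bool) (p : {poly A}) : Prop := forall i, odd i != b -> p`_i = 0.

Lemma parityM b c p q : parity b p -> parity c q -> parity (b (+) c) (p * q).
Proof.
move=> pb qc i; rewrite coefM => ibc; rewrite big1// => j _.
have [jb|jb] := eqVneq (odd j) b; last by rewrite pb// mul0r.
rewrite qc ?mulr0//; rewrite oddB ?jb; last by rewrite -ltnS.
 apply: contra ibc => /eqP <-.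
by rewrite addbCA addbb addbF.
Qed.

Lemma parityX p m : parity true p -> parity (odd m) (p ^+ m).
Proof.
move=> h; elim: m => [|m IH]; first by rewrite expr0 => i; rewrite coef1; case: i.
by rewrite exprS oddS -addTb; exact: parityM.
Qed.

Lemma parityD b p q : parity b p -> parity b q -> parity b (p + q).
Proof. by move=> pb qb i ib; rewrite coefD pb// qb// addr0. Qed.

End order.

Section homogeneous.
Context {A : comNzRingType}.
Implicit Types p q : {poly {poly A}}.

(* In {poly {poly R}} the outer variable is z = exp (- e x), and the coefficient of
   index k inside that of z^n stands for cos ((2 k - n) w t). *)
Definition homog (p : {poly {poly A}}) : Prop := forall n, (size (p`_n)%R <= n.+1)%N.

Lemma homogM p q : homog p -> homog q -> homog (p * q).
Proof.
move=> hp hq n; rewrite coefM; apply: (leq_trans (size_sum _ _ _)).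
apply/bigmax_leqP => i _; apply: (leq_trans (size_polyMleq _ _)).
have := hp i; have := hq (n - i)%N; have := ltn_ord i; lia.
Qed.

Lemma homogD p q : homog p -> homog q -> homog (p + q).
Proof.
move=> hp hq n; rewrite coefD; apply: (leq_trans (size_polyD _ _)).
by rewrite geq_max hp hq.
Qed.

Lemma homogX p m : homog p -> homog (p ^+ m).
Proof.
move=> hp; elim: m => [|m IH]; last by rewrite exprS; exact: homogM.
by move=> n; rewrite expr0 coef1; case: n => [|n]; rewrite ?size_poly1 ?size_poly0.
Qed.

Lemma homogC c p : homog p -> homog (c%:P%:P * p).
Proof.
by move=> hp n; rewrite coefCM mul_polyC; apply: leq_trans (size_scale_leq _ _) (hp n).
Qed.

End homogeneous.

(** * Recursive construction of the series and its convergence *)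

Section formal_solution.
Context {R : realType}.
Variables (a : nat -> R) (e w : R).
Hypotheses (a3 : forall m, (m < 3)%N || ~~ odd m -> a m = 0).
Hypotheses (e0 : 0 < e) (ew : e ^+ 2 + w ^+ 2 = 1).

(* Minus the symbol of [d_tt - d_xx + 1] on
   [exp (- n e x) cos ((2 k - n) w t)]. *)
Definition formal_symbol (n k : nat) : R := e ^+ 2 * n%:R ^+ 2 + w ^+ 2 * ((2 * k)%:R - n%:R) ^+ 2 - 1.

(** Here n >= 3 and 2 k - n is odd, so its square is at least 1, and 9 e ^ 2 + w ^ 2 - 1 = 8 e ^
    2. *)
Lemma symbol_ge n k : odd n -> (1 < n)%N -> 8 * e ^+ 2 <= formal_symbol n k.
Proof.
move=> on n1; have n3 : (3 <= n)%N by case: n on n1 => [|[|[|]]].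
have h1 : 9 <= n%:R ^+ 2 :> R by rewrite -natrX ler_nat (_ : 9 = 3 ^ 2)%N// leq_sqr.
have h2 : 1 <= ((2 * k)%:R - n%:R) ^+ 2 :> R.
  have [nk|kn] := leqP n (2 * k).
    rewrite -natrB// -natrX ler1n expn_gt0 subn_gt0 ltn_neqAle nk andbT orbF.
    by apply/eqP => E; move: on; rewrite E oddM.
  by rewrite -sqrrN opprB -natrB ?(ltnW kn)// -natrX ler1n expn_gt0 subn_gt0 kn.
have q1 : e ^+ 2 * 9 <= e ^+ 2 * n%:R ^+ 2 by rewrite ler_wpM2l ?sqr_ge0.
have q2 : w ^+ 2 * 1 <= w ^+ 2 * ((2 * k)%:R - n%:R) ^+ 2 by rewrite ler_wpM2l ?sqr_ge0.
rewrite /formal_symbol; move: (ew); lra.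
Qed.

Lemma symbol_sym n k : (k <= n)%N -> formal_symbol n (n - k) = formal_symbol n k.
Proof.
move=> kn; rewrite /formal_symbol; congr (_ + _ * _ - _).
by rewrite natrM natrB// natrM; ring.
Qed.

Local Notation N1 := (poly_norm (fun x : R => `|x|) 1).
Local Notation N2 := (poly_norm N1).

(** Averaging with the index n - k leaves the represented cosine sum unchanged, cos being even, and
    makes the coefficients symmetric, as reality of the evaluation requires. *)
Definition sym_div (n : nat) (Q : {poly R}) : {poly R} :=
  \poly_(k < n.+1) ((Q`_k + Q`_(n - k)) / 2 / formal_symbol n k).

Definition nonlin (M : nat) (V : {poly {poly R}}) : {poly {poly R}} :=
  \sum_(0 <= m < M) (a m)%:P%:P * V ^+ m.

(** [formal N] settles the coefficients up to z ^ (N + 1), starting from the encoding of 2 z cos (w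
    t). Cutting the nonlinearity after the power N' + 2 loses nothing in the coefficient used,
    because an m-th power has order at least m. *)
Fixpoint formal (N : nat) : {poly {poly R}} :=
  if N is N'.+1 then
    formal N' + (sym_div N'.+2 (nonlin N'.+3 (formal N'))`_N'.+2)%:P * 'X^(N'.+2)
  else ('X + 1%:P)%:P * 'X.

Lemma formalS N : formal N.+1 =
  formal N + (sym_div N.+2 (nonlin N.+3 (formal N))`_N.+2)%:P * 'X^(N.+2).
Proof. by []. Qed.

Lemma formal0 : formal 0 = ('X + 1%:P)%:P * 'X.
Proof. by []. Qed.

Arguments formal : simpl never.

Lemma formal_order N : order_ge 1 (formal N).
Proof.
elim: N => [|N IH]; first by case=> // _; rewrite formal0 coefCM coefX mulr0.
rewrite formalS; apply: order_geD => //.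
by case=> // _; rewrite coefCM coefXn mulr0.
Qed.

Lemma formal_coef_gt N n : (N.+1 < n)%N -> (formal N)`_n = 0.
Proof.
elim: N n => [|N IH] n h.
  by rewrite formal0 coefCM coefX; case: n h => [|[|]]// n _; rewrite mulr0.
rewrite formalS coefD IH; last exact: ltnW.
by rewrite coefCM coefXn gtn_eqF// mulr0 addr0.
Qed.

Lemma formal_coef_stable N n : (n <= N.+1)%N -> (formal N.+1)`_n = (formal N)`_n.
Proof.
by move=> h; rewrite formalS coefD coefCM coefXn ltn_eqF// mulr0 addr0.
Qed.

Lemma nonlin_coef M M' V n : order_ge 1 V -> (n < M)%N -> (n < M')%N ->
  (nonlin M V)`_n = (nonlin M' V)`_n.
Proof.
suff wl M1 M2 : (M1 <= M2)%N -> order_ge 1 V -> (n < M1)%N ->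
    (nonlin M2 V)`_n = (nonlin M1 V)`_n.
  move=> V1 nM nM'; have [h|/ltnW h] := leqP M M'; last exact: wl.
  by apply/esym/wl.
move=> h V1 nM; rewrite /nonlin (big_cat_nat (leq0n _) h)/= coefD [X in _ + X](_ : _ = 0) ?addr0//.
rewrite big_nat coef_sum big1// => m /andP[Mm _].
by rewrite coefCM (order_geX V1) ?mulr0//; lia.
Qed.

Lemma nonlin_stable N M n : (n <= N.+2)%N ->
  (nonlin M (formal N.+1))`_n = (nonlin M (formal N))`_n.
Proof.
move=> h; apply/eqP; rewrite -subr_eq0 -coefB /nonlin -sumrB.
apply/eqP; rewrite coef_sum big1// => m _; rewrite -mulrBr coefCM.
have [m1|m1] := ltnP 1 m; last first.
  by rewrite a3 ?mul0r// (leq_ltn_trans m1).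
rewrite (@order_ge_subX _ _ _ N.+2 m m1 (formal_order _) (formal_order _)) ?mulr0//.
move=> i iN; rewrite coefB formal_coef_stable ?subrr//.
Qed.

Lemma formal_coef N n M : (1 < n <= N.+1)%N -> (n < M)%N ->
  (formal N)`_n = sym_div n (nonlin M (formal N))`_n.
Proof.
move=> + nM; elim: N => [|N IH] /andP[n1 nN]; first by move: nN; rewrite leqNgt n1.
have [nN'|Nn] := leqP n N.+1.
  by rewrite formal_coef_stable// nonlin_stable ?(leqW nN')// IH// n1.
have {nN n1} E : n = N.+2 by apply/eqP; rewrite eqn_leq nN.
rewrite formalS coefD formal_coef_gt ?add0r; last by rewrite E.
rewrite coefCM coefXn E eqxx mulr1; congr (sym_div _ _).
rewrite -formalS nonlin_stable//; apply: nonlin_coef; [exact: formal_order|by []|by rewrite -E].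
Qed.

Lemma nonlin_parity M V : parity true V -> parity true (nonlin M V).
Proof.
move=> pV; rewrite /nonlin; elim: M => [|M IH]; first by rewrite big_geq// => i _; rewrite coef0.
rewrite big_nat_recr//=; apply: parityD => // i io; rewrite coefCM.
have [om|om] := boolP (odd M); last by rewrite a3 ?mul0r// om orbT.
by have := @parityX _ _ M pV; rewrite om => ->//; rewrite mulr0.
Qed.

Lemma sym_div0 n : sym_div n 0 = 0.
Proof. by apply/polyP => k; rewrite coef_poly !coef0 addr0 !mul0r if_same. Qed.

Lemma formal_parity N : parity true (formal N).
Proof.
elim: N => [|N IH].
  by move=> i io; rewrite formal0 coefCM coefX; case: i io => [|[|i]]//= _; rewrite mulr0.
rewrite formalS; apply: parityD => // i io.
rewrite coefCM coefXn; have [iN|_] := eqVneq; last by rewrite mulr0.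
by rewrite -iN nonlin_parity// ?sym_div0 ?mul0r.
Qed.

Lemma formal_homog N : homog (formal N).
Proof.
elim: N => [|N IH].
  move=> i; rewrite formal0 coefCM coefX; case: i => [|[|i]]; rewrite ?mulr0 ?mulr1 ?size_poly0//.
  by rewrite size_XaddC.
rewrite formalS; apply: homogD => // i.
rewrite coefCM coefXn; have [->|_] := eqVneq; last by rewrite mulr0 size_poly0.
by rewrite mulr1 size_poly.
Qed.

Lemma nonlin_homog M N : homog (nonlin M (formal N)).
Proof.
rewrite /nonlin; elim: M => [|M IH]; first by rewrite big_geq// => i; rewrite coef0 size_poly0.
by rewrite big_nat_recr//=; apply: homogD => //; apply: homogC; apply: homogX; exact: formal_homog.
Qed.

Lemma formal_sym N n k : (k <= n)%N -> (formal N)`_n`_(n - k) = (formal N)`_n`_k.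
Proof.
move=> kn; elim: N => [|N IH].
  rewrite formal0 coefCM coefX; case: n kn => [|[|n]] kn; rewrite ?mulr0 ?coef0// mulr1.
  by rewrite !coefD !coefX !coefC; case: k kn => [|[|]]//= _; rewrite ?addr0 ?add0r.
rewrite formalS !coefD IH coefCM coefXn; have [E|_] := eqVneq; last by rewrite mulr0 !coef0.
rewrite -E mulr1 !coef_poly !ltnS leq_subr kn subKn// symbol_sym//.
by congr (_ + _ / _ / _); rewrite addrC.
Qed.

Let absr_ge0 (x : R) : 0 <= `|x| := normr_ge0 x.
Let absr0 : `|0 : R| = 0 := normr0 R.
Let absrM (x y : R) : `|x * y| <= `|x| * `|y|. Proof. by rewrite normrM. Qed.
Let N1_ge0 p : 0 <= N1 p.
Proof. exact: poly_norm_ge0. Qed.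
Let N1_0 : N1 0 = 0.
Proof. exact: poly_norm0. Qed.
Let N1_D p q : N1 (p + q) <= N1 p + N1 q.
Proof. by apply: poly_normD => //; exact: ler_normD. Qed.
Let N1_M p q : N1 (p * q) <= N1 p * N1 q.
Proof. by apply: poly_normM => //; exact: ler_normD. Qed.
Let N1_1 : N1 1 <= 1.
Proof. by apply: poly_norm1; rewrite normr1. Qed.

Lemma sym_div_norm n (Q : {poly R}) : (size Q <= n.+1)%N -> (forall k, 8 * e ^+ 2 <= formal_symbol n k) ->
  N1 (sym_div n Q) <= (8 * e ^+ 2)^-1 * N1 Q.
Proof.
move=> sQ sy; have E0 : 0 < 8 * e ^+ 2 by rewrite mulr_gt0// exprn_gt0.
rewrite (@poly_norm_widen _ _ _ _ absr0 _ n.+1) ?size_poly// (@poly_norm_widen _ _ _ _ absr0 Q n.+1)//.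
under eq_bigr do rewrite expr1n mulr1.
under [X in _ <= _ * X]eq_bigr do rewrite expr1n mulr1.
apply: (@le_trans _ _ (\sum_(0 <= k < n.+1) (8 * e ^+ 2)^-1 * ((`|Q`_k| + `|Q`_(n - k)|) / 2))).
  rewrite !big_nat; apply: ler_sum => k /andP[_ kn]; rewrite coef_poly kn.
  have sp : 0 < formal_symbol n k by apply: lt_le_trans (sy k).
  rewrite normrM mulrC ger0_norm ?invr_ge0 ?(ltW sp)//; apply: ler_pM => //.
  - by rewrite invr_ge0 ltW.
  - by rewrite lef_pV2.
  - by rewrite normrM [X in _ * X]ger0_norm// ler_wpM2r// ler_normD.
rewrite -mulr_sumr ler_wpM2l ?invr_ge0 ?(ltW E0)// -mulr_suml big_split/=.
rewrite [X in _ + X](_ : _ = \sum_(0 <= k < n.+1) `|Q`_k|); first by lra.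
by rewrite big_nat_rev/=; apply: eq_big_nat => k /andP[_ kn]; rewrite add0n subSS subKn.
Qed.

Hypothesis a_entire : forall r : R, exists C, bsum (fun m => a m * r ^+ m) C.

Lemma nonlin_norm (M : nat) V (rho C r : R) : 0 < rho -> 0 < r <= 1 -> bsum a C ->
  N2 rho V <= r -> N2 rho (nonlin M V) <= C * r ^+ 3.
Proof.
move=> r0 /andP[rp r1] aC VR.
apply: (@le_trans _ _ (\sum_(0 <= m < M) `|a m| * r ^+ 3)); last first.
  by rewrite -mulr_suml ler_wpM2r// exprn_ge0// ltW.
apply: le_trans (poly_norm_sum N1_0 N1_D (ltW r0) _ _) _.
apply: ler_sum => m _.
have [m3|m3] := ltnP m 3.
  have -> : a m = 0 by rewrite a3 ?m3.
  by rewrite !rmorph0 mul0r poly_norm0 normr0 mul0r.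
apply: le_trans (poly_normC N1_0 N1_M (ltW r0) _ _) _.
have -> : N1 (a m)%:P = `|a m|.
  rewrite (@poly_norm_widen _ _ _ _ absr0 _ 1) ?size_polyC_leq1// big_nat1.
  by rewrite coefC eqxx expr0 mulr1.
rewrite ler_wpM2l//; apply: le_trans (poly_normX N1_ge0 N1_0 N1_D N1_M (ltW r0) N1_1 _ _) _.
apply: (@le_trans _ _ (r ^+ m)).
  by rewrite lerXn2r ?nnegrE ?(ltW rp)//; apply: poly_norm_ge0 => //; exact: ltW.
by rewrite -(subnK m3) exprD ler_piMl ?exprn_ge0 ?(ltW rp)// exprn_ile1// ltW.
Qed.

(** The ball of radius 4 rho is stable under the recursion: the first term has norm 2 rho, and
    division by at least 8 e ^ 2 turns the cubic bound into [K (4 rho) ^ 3]. A bound uniform in [N]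
    is a bound on the whole series. *)
Lemma formal_norm_bound : exists rho C : R, [/\ 0 < rho, 0 < C,
  forall N, N2 rho (formal N) <= C & forall N M, N2 rho (nonlin M (formal N)) <= C].
Proof.
have [C] := a_entire 1; under [fun m => _]funext do rewrite expr1n mulr1; move=> aC.
have C0 := bsum_ge0 aC.
have E0 : 0 < 8 * e ^+ 2 by rewrite mulr_gt0// exprn_gt0.
pose K := (8 * e ^+ 2)^-1 * C.
have K0 : 0 <= K by rewrite mulr_ge0// invr_ge0 ltW.
(* Makes K (4 rho) ^ 3 = 32 K rho * 2 rho ^ 2 at most 2 rho, and 4 rho at most 1. *)
pose rho : R := (32 * (K + 1))^-1.
have rho0 : 0 < rho by rewrite invr_gt0 mulr_gt0// ltr_wpDl.
have rK : 32 * rho * (K + 1) = 1 by rewrite /rho; field; lra.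
have rho_small : 4 * rho <= 1.
  have : 0 <= rho * K by rewrite mulr_ge0// ltW.
  move: rK; lra.
have r4 : 0 < 4 * rho <= 1 by rewrite rho_small mulr_gt0.
have step : K * (4 * rho) ^+ 3 <= 2 * rho.
  have h1 : K * (32 * rho) <= 1 by move: rK rho0; lra.
  rewrite (_ : K * (4 * rho) ^+ 3 = K * (32 * rho) * (2 * rho ^+ 2)); last by ring.
  apply: (@le_trans _ _ (1 * (2 * rho ^+ 2))); first by rewrite ler_wpM2r// mulr_ge0// sqr_ge0.
  rewrite mul1r ler_wpM2l// expr2 ler_piMl ?(ltW rho0)//; lra.
have base : N2 rho (formal 0) = 2 * rho.
  rewrite formal0 (_ : _ * 'X = ('X + 1%:P)%:P * 'X + 0%:P); last by rewrite addr0.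
  rewrite poly_norm_cons// N1_0 addr0 (_ : N2 rho _ = N1 ('X + 1%:P)).
    rewrite (_ : 'X = 1%:P * 'X); last by rewrite mul1r.
    rewrite poly_norm_cons// mul1r (_ : N1 1%:P = 1); first by rewrite normr1 mulrC; congr (_ * _).
    by rewrite /poly_norm size_poly1 big_nat1 coefC eqxx normr1 expr0 mulr1.
  rewrite (@poly_norm_widen _ _ _ _ N1_0 _ 1) ?size_polyC_leq1// big_nat1.
  by rewrite coefC eqxx expr0 mulr1.
have bd N : N2 rho (formal N) <= 4 * rho.
  elim: N => [|N IH]; first by rewrite base; lra.
  have hQ := @nonlin_norm N.+3 (formal N) rho C (4 * rho) rho0 r4 aC IH.
  (* Only these coefficients come from the division; those of the nonlinearity outside this range
     are dropped, their norms being nonnegative. *)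
  have h2 : \sum_(2 <= n < N.+3) N1 (formal N.+1)`_n * rho ^+ n <=
     (8 * e ^+ 2)^-1 * N2 rho (nonlin N.+3 (formal N)).
    rewrite (@poly_norm_widen _ _ _ _ N1_0 (nonlin N.+3 (formal N)) (maxn N.+3 (size (nonlin N.+3 (formal N))))) ?leq_maxr//.
    rewrite [in leRHS](big_cat_nat (leq0n N.+3) (leq_maxl _ _))/=.
    rewrite [in leRHS](big_cat_nat (leq0n 2))//= mulrDr ler_wpDr//.
      rewrite mulr_ge0 ?invr_ge0 ?(ltW E0)// sumr_ge0// => i _.
      by rewrite mulr_ge0// exprn_ge0// ltW.
    rewrite mulrDr ler_wpDl//.
      rewrite mulr_ge0 ?invr_ge0 ?(ltW E0)// sumr_ge0// => i _.
      by rewrite mulr_ge0// exprn_ge0// ltW.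
    rewrite mulr_sumr !big_nat; apply: ler_sum => n /andP[n2 nN].
    rewrite mulrA ler_wpM2r ?exprn_ge0 ?(ltW rho0)//.
    have [on|en] := boolP (odd n); last first.
      rewrite formal_parity ?N1_0 ?mulr_ge0 ?invr_ge0 ?(ltW E0)//.
      by move: en; case: (odd n).
    rewrite (@formal_coef N.+1 n N.+3)//; last by rewrite n2.
    rewrite nonlin_stable//.
    apply: sym_div_norm; first exact: nonlin_homog.
    by move=> k; exact: symbol_ge.
  have -> : N2 rho (formal N.+1) = N1 (formal N.+1)`_1 * rho + \sum_(2 <= n < N.+3) N1 (formal N.+1)`_n * rho ^+ n.
    rewrite (@poly_norm_widen _ _ _ _ N1_0 _ N.+3); last first.
      by apply/leq_sizeP => n h; exact: formal_coef_gt.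
    rewrite big_ltn// big_ltn// formal_order// N1_0 mul0r add0r expr1//.
  have -> : (formal N.+1)`_1 = (formal 0)`_1.
    by elim: N.+1 => // k IHk; rewrite formal_coef_stable.
  have b1 : N1 (formal 0)`_1 * rho ^+ 1 <= 2 * rho.
    by rewrite -base; apply: poly_norm_coef => //; exact: ltW.
  rewrite expr1 in b1.
  have : (8 * e ^+ 2)^-1 * N2 rho (nonlin N.+3 (formal N)) <= K * (4 * rho) ^+ 3.
    by rewrite /K -mulrA ler_wpM2l ?invr_ge0 ?(ltW E0).
  move: h2 b1 step; lra.
exists rho, (4 * rho + C * (4 * rho) ^+ 3); split => //.
- by rewrite ltr_wpDr ?mulr_ge0 ?exprn_ge0//; move: rho0; lra.
- by move=> N; apply: le_trans (bd N) _; rewrite lerDl mulr_ge0 ?exprn_ge0//; move: rho0; lra.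
- move=> N M; apply: le_trans (nonlin_norm M rho0 r4 aC (bd N)) _.
  by rewrite lerDr; move: rho0; lra.
Qed.

End formal_solution.

(** * Evaluation of formal sums at complex exponentials *)

Section evaluation.
Context {R : realType}.
Local Open Scope complex_scope.

Definition unit_complex (t : R) : R[i] := cos t +i* sin t.

Lemma unit_complexM (s t : R) : unit_complex s * unit_complex t = unit_complex (s + t).
Proof. by rewrite /unit_complex cosD sinD; apply/eqP; rewrite eq_complex/= eqxx addrC mulrC [cos s * _]mulrC eqxx. Qed.

Lemma unit_complexX (t : R) k : unit_complex t ^+ k = unit_complex (k%:R * t).
Proof.
elim: k => [|k IH].
  by rewrite expr0 mul0r /unit_complex cos0 sin0.
by rewrite exprS IH unit_complexM; congr unit_complex; rewrite mulrSr mulrDl mul1r addrC.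
Qed.

(* A symmetric homogeneous coefficient \sum_k c_k cos ((2 k - n) t) is read off as
   the evaluation at (exp (2 i t), z exp (- i t)), which is multiplicative. *)
Definition eval_inner (t : R) : {rmorphism {poly R} -> R[i]} :=
  horner_eval (unit_complex (2 * t)) \o map_poly (real_complex R).

Definition eval_outer (t z : R) : {rmorphism {poly {poly R}} -> R[i]} :=
  horner_eval (z%:C * unit_complex (- t)) \o map_poly (eval_inner t).

Lemma real_complexM (x : R) (c : R[i]) : x%:C * c = (x * complex.Re c) +i* (x * complex.Im c).
Proof. by case: c => u v; apply/eqP; rewrite eq_complex/= !mul0r subr0 addr0 !eqxx. Qed.

Lemma eval_outerE t z V M : homog V -> (size V <= M)%N ->
  eval_outer t z V = \sum_(0 <= n < M) \sum_(0 <= k < n.+1)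
    (V`_n`_k * z ^+ n)%:C * unit_complex (((2 * k)%:R - n%:R) * t).
Proof.
move=> hV VM.
rewrite -[LHS]/((map_poly (eval_inner t) V).[z%:C * unit_complex (- t)]).
rewrite (@horner_coef_wide _ M); last first.
  by apply: leq_trans VM; rewrite map_polyE; apply: leq_trans (size_Poly _) _; rewrite size_map.
rewrite [RHS]big_mkord; apply: eq_bigr => n _; rewrite coef_map.
apply: (@etrans _ _ ((map_poly (real_complex R) V`_n).[unit_complex (2 * t)] * (z%:C * unit_complex (- t)) ^+ n)); first by [].
rewrite (@horner_coef_wide _ n.+1); last by rewrite size_map_poly.
rewrite mulr_suml [RHS]big_mkord; apply: eq_bigr => k _; rewrite coef_map/=.
rewrite exprMn !unit_complexX rmorphM rmorphXn -!mulrA; congr (_ * _).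
rewrite mulrCA; congr (_ * _); rewrite unit_complexM; congr unit_complex.
by rewrite natrM; ring.
Qed.

Lemma Re_sum (I : Type) (r : seq I) (F : I -> R[i]) :
  complex.Re (\sum_(i <- r) F i) = \sum_(i <- r) complex.Re (F i).
Proof. by elim: r => [|i r IH]; rewrite ?big_nil// !big_cons -IH; case: (F i) (bigop.body _ _ _) => a b [c d]. Qed.

Lemma Im_sum (I : Type) (r : seq I) (F : I -> R[i]) :
  complex.Im (\sum_(i <- r) F i) = \sum_(i <- r) complex.Im (F i).
Proof. by elim: r => [|i r IH]; rewrite ?big_nil// !big_cons -IH; case: (F i) (bigop.body _ _ _) => a b [c d]. Qed.

Lemma eval_Re t z V M : homog V -> (size V <= M)%N ->
  complex.Re (eval_outer t z V) = \sum_(0 <= n < M) z ^+ n * \sum_(0 <= k < n.+1)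
    V`_n`_k * cos (((2 * k)%:R - n%:R) * t).
Proof.
move=> hV VM; rewrite (eval_outerE _ _ hV VM) Re_sum; apply: eq_bigr => n _.
rewrite Re_sum mulr_sumr; apply: eq_bigr => k _.
by rewrite real_complexM/=; ring.
Qed.

(** Symmetric coefficients cancel in pairs. Reality is what lets the real part commute with powers,
    hence with the nonlinearity. *)
Lemma eval_Im t z V : homog V -> (forall n k, (k <= n)%N -> V`_n`_(n - k) = V`_n`_k) ->
  complex.Im (eval_outer t z V) = 0.
Proof.
move=> hV sV; rewrite (eval_outerE _ _ hV (leqnn _)) Im_sum big1// => n _.
rewrite Im_sum; under eq_bigr do rewrite real_complexM/=.
set S := (X in X = 0); suff : S = - S by lra.
rewrite {1}/S big_nat_rev/= -sumrN; apply: eq_big_nat => k /andP[_ kn].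
rewrite add0n subSS sV// -mulrN -sinN; congr (_ * sin _).
by rewrite natrM natrB// natrM; ring.
Qed.

End evaluation.

(** Regroups a sum by frequency: with truncated subtraction, [(2 * k - n) + (n - 2 * k)] is the
    absolute value of 2 k - n. *)
Lemma sum_by_dist (R : realType) (n : nat) (f : nat -> R) (h : nat -> R) :
  \sum_(0 <= k < n.+1) f k * h ((2 * k - n) + (n - 2 * k))%N =
  \sum_(0 <= j < n.+1) (\sum_(0 <= k < n.+1) f k * ((2 * k - n) + (n - 2 * k) == j)%N%:R) * h j.
Proof.
under [RHS]eq_bigr do rewrite mulr_suml.
rewrite exchange_big_nat/=; apply: eq_big_nat => k /andP[_ kn].
have dn : ((2 * k - n) + (n - 2 * k) < n.+1)%N by lia.
rewrite big_mkord (bigD1 (Ordinal dn))//= eqxx mulr1 big1 ?addr0// => j jd.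
rewrite (_ : (_ == _) = false) ?mulr0 ?mul0r//.
by apply/negbTE; apply: contraNneq jd => E; apply/eqP/val_inj.
Qed.

Lemma dist_cos (R : realType) (n k : nat) (t : R) :
  cos (((2 * k)%:R - n%:R) * t) = cos (((2 * k - n) + (n - 2 * k))%N%:R * t).
Proof.
have [nk|kn] := leqP n (2 * k).
  by rewrite (eqP (_ : n - 2 * k == 0)%N) ?subn_eq0// addn0 natrB.
rewrite (eqP (_ : 2 * k - n == 0)%N) ?subn_eq0 ?(ltnW kn)// add0n natrB ?(ltnW kn)//.
by rewrite -opprB mulNr cosN.
Qed.

Lemma dist_sqr (R : realType) (n k : nat) :
  ((2 * k)%:R - n%:R) ^+ 2 = ((2 * k - n) + (n - 2 * k))%N%:R ^+ 2 :> R.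
Proof.
have [nk|kn] := leqP n (2 * k).
  by rewrite (eqP (_ : n - 2 * k == 0)%N) ?subn_eq0// addn0 natrB.
rewrite (eqP (_ : 2 * k - n == 0)%N) ?subn_eq0 ?(ltnW kn)// add0n natrB ?(ltnW kn)//.
by rewrite -opprB sqrrN.
Qed.

(** * The equation satisfied by the truncated sums *)

Section modal_series.
Context {R : realType}.
Variables (a : nat -> R) (e w : R).
Hypotheses (a3 : forall m, (m < 3)%N || ~~ odd m -> a m = 0).
Hypotheses (e0 : 0 < e) (ew : e ^+ 2 + w ^+ 2 = 1).
Hypothesis a_entire : forall r : R, exists C, bsum (fun m => a m * r ^+ m) C.
Let P (y : R) : R := limn (series (fun m => a m * y ^+ m)).
Local Notation N1 := (poly_norm (fun x : R => `|x|) 1).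
Local Notation N2 := (poly_norm N1).
Local Notation formal := (formal a e w).
Local Notation nonlin := (nonlin a).
Local Notation symbol := (formal_symbol e w).

Lemma formal_coef_diag N n : (n <= N.+1)%N -> (formal N)`_n = (formal n)`_n.
Proof.
move=> nN; have [{nN}|Nn] := leqP n N; last first.
  have -> : n = N.+1 by apply/eqP; rewrite eqn_leq nN.
  by rewrite formal_coef_stable.
elim: N => [|N IH] nN; first by move: nN; rewrite leqn0 => /eqP->.
move: nN; rewrite leq_eqVlt => /orP[/eqP->//|nN].
by rewrite formal_coef_stable ?IH// ltnW.
Qed.

(** Stated for cosine sums, which do not see the symmetrisation in the recursion. At n = 1 the
    symbol vanishes and the nonlinearity, of order 3, has no term; for even n both sides are zero by
    parity. *)
Lemma formal_eqn N n M t : (n <= N.+1)%N -> (n < M)%N ->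
  \sum_(0 <= k < n.+1) (nonlin M (formal N))`_n`_k * cos (((2 * k)%:R - n%:R) * t) =
  \sum_(0 <= k < n.+1) (symbol n k * (formal N)`_n`_k) * cos (((2 * k)%:R - n%:R) * t).
Proof.
move=> nN nM.
have [n1|n1] := ltnP 1 n; last first.
  have z0 : (nonlin M (formal N))`_n = 0.
    rewrite /nonlin coef_sum big1// => m _; rewrite coefCM.
    have [m3|m3] := ltnP m 3; first by rewrite a3 ?m3// mul0r.
    by rewrite (order_geX (formal_order a e w N)) ?mulr0//; lia.
  rewrite z0; under eq_bigr do rewrite coef0 mul0r.
  rewrite sumr_const_nat mul0rn; apply/esym.
  case: n n1 nN nM z0 => [|[|n]]// _ _ _ _.
    by rewrite big1// => k _; rewrite formal_order// coef0 mulr0 mul0r.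
  have s0 k : (k < 2)%N -> symbol 1 k = 0.
    move=> k2; suff -> : symbol 1 k = e ^+ 2 + w ^+ 2 - 1 by rewrite ew subrr.
    by rewrite /formal_symbol; case: k k2 => [|[|]]// _; rewrite ?muln0 ?muln1; ring.
  by rewrite big_nat big1// => k /andP[_ k2]; rewrite s0// !mul0r.
have [on|en] := boolP (odd n); last first.
  rewrite nonlin_parity//; last by move: en; case: (odd n).
    by rewrite (@formal_parity _ a e w a3 N) ?coef0; [|by move: en; case: (odd n)];
      rewrite !big1// => k _; rewrite coef0 ?mulr0 mul0r.
  exact: formal_parity.
have sp k : 0 < symbol n k.
  by apply: lt_le_trans (symbol_ge ew k on n1); rewrite mulr_gt0// exprn_gt0.
rewrite (@formal_coef _ a e w a3 e0 N n M)// ?n1//.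
set Q := (nonlin M (formal N))`_n.
apply: (@etrans _ _ (\sum_(0 <= k < n.+1) ((Q`_k + Q`_(n - k)) / 2) * cos (((2 * k)%:R - n%:R) * t))); last first.
  apply: eq_big_nat => k /andP[_ kn]; rewrite coef_poly kn; congr (_ * _).
  by rewrite [RHS]mulrC divfK// gt_eqF.
have rv : \sum_(0 <= k < n.+1) Q`_(n - k) * cos (((2 * k)%:R - n%:R) * t) =
    \sum_(0 <= k < n.+1) Q`_k * cos (((2 * k)%:R - n%:R) * t).
  rewrite big_nat_rev/=; apply: eq_big_nat => k /andP[_ kn].
  rewrite add0n subSS subKn//; congr (_ * _); rewrite -[RHS]cosN; congr cos.
  by rewrite natrM natrB// natrM; ring.
apply: (@etrans _ _ (2^-1 * (\sum_(0 <= k < n.+1) Q`_k * cos (((2 * k)%:R - n%:R) * t)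
   + \sum_(0 <= k < n.+1) Q`_(n - k) * cos (((2 * k)%:R - n%:R) * t)))); first by rewrite rv; lra.
rewrite -big_split/= mulr_sumr; apply: eq_bigr => k _; ring.
Qed.

Lemma nonlin_sum N M : nonlin M (formal N) = \sum_(0 <= m < M) (a m)%:P%:P * formal N ^+ m.
Proof. by []. Qed.

Lemma eval_formal N t z : complex.Re (eval_outer t z (formal N)) =
  \sum_(0 <= n < N.+2) z ^+ n * \sum_(0 <= k < n.+1) (formal n)`_n`_k * cos (((2 * k)%:R - n%:R) * t).
Proof.
rewrite (@eval_Re _ t z _ N.+2); [|exact: formal_homog|]; last first.
  by apply/leq_sizeP => n h; exact: formal_coef_gt.
by apply: eq_big_nat => n /andP[_ nN]; rewrite formal_coef_diag.
Qed.

Lemma eval_nonlin N M t z : complex.Re (eval_outer t z (nonlin M (formal N))) =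
  \sum_(0 <= m < M) a m * (complex.Re (eval_outer t z (formal N))) ^+ m.
Proof.
have Im0 := @eval_Im _ t z (formal N) (formal_homog a e w N) (@formal_sym _ a e w N).
set u := complex.Re (eval_outer t z (formal N)).
have E : eval_outer t z (formal N) = real_complex R u.
  by rewrite /u; case: (eval_outer _ _ _) Im0 => x y /= ->.
rewrite nonlin_sum rmorph_sum Re_sum; apply: eq_bigr => m _.
rewrite rmorphM rmorphXn E (_ : eval_outer t z (a m)%:P%:P = real_complex R (a m)).
  by rewrite -rmorphXn -rmorphM.
have -> : eval_outer t z (a m)%:P%:P = (map_poly (eval_inner t) (a m)%:P%:P).[z%:C%C * unit_complex (- t)] by [].
rewrite map_polyC hornerC.
apply: (@etrans _ _ (map_poly (real_complex R) (a m)%:P).[unit_complex (2 * t)]); first by [].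
by rewrite map_polyC hornerC.
Qed.

Lemma P_series y : series (fun m => a m * y ^+ m) @ \oo --> P y.
Proof. by have [C hC] := a_entire y; exact: bsum_cvgP hC. Qed.

(** Up to z ^ (N + 1) the truncated sum solves the equation exactly. The higher coefficients of the
    nonlinearity are bounded in the norm of weight [rho], so for z <= rho / 2 they add up to a
    geometric remainder. *)
Lemma eval_remainder : exists rho C : R, [/\ 0 < rho, 0 < C,
  forall n, N1 (formal n)`_n * rho ^+ n <= C &
  forall N t z, 0 <= z <= rho / 2 ->
   `|P (\sum_(0 <= n < N.+2) z ^+ n * \sum_(0 <= k < n.+1) (formal n)`_n`_k * cos (((2 * k)%:R - n%:R) * t))
    - \sum_(0 <= n < N.+2) z ^+ n * \sum_(0 <= k < n.+1) (symbol n k * (formal n)`_n`_k) * cos (((2 * k)%:R - n%:R) * t)|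
   <= C * 2^-1 ^+ N.+2].
Proof.
have [rho [C [rho0 C0 hF hN]]] := formal_norm_bound a3 e0 ew a_entire.
have N1_0 : N1 0 = 0 by exact: poly_norm0.
have N1_ge0 p : 0 <= N1 p by exact: poly_norm_ge0.
exists rho, C; split => //.
  move=> n; apply: le_trans (hF n); apply: (@poly_norm_coef R {poly R} N1 rho) => //.
  exact: ltW.
move=> N t z /andP[z0 zr].
rewrite -eval_formal; set u := complex.Re _; set main := (X in _ - X).
have key M : (N.+2 < M)%N -> `|series (fun m => a m * u ^+ m) M - main| <= C * 2^-1 ^+ N.+2.
  move=> NM; rewrite /series/= -eval_nonlin.
  set V := nonlin M (formal N).
  have hV : homog V := nonlin_homog a e w M N.
  pose K := maxn N.+2 (size V).
  have NK : (N.+2 <= K)%N by exact: leq_maxl.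
  rewrite (@eval_Re _ t z V K)// ?leq_maxr// (big_cat_nat (leq0n _) NK)/=.
  rewrite (_ : \sum_(0 <= i < N.+2) _ = main); last first.
    apply: eq_big_nat => n /andP[_ nN]; rewrite formal_eqn//; last exact: ltn_trans NM.
    by rewrite formal_coef_diag.
  rewrite addrAC subrr add0r; apply: le_trans (ler_norm_sum _ _ _) _.
  apply: (@le_trans _ _ (\sum_(N.+2 <= n < K) 2^-1 ^+ N.+2 * (N1 V`_n * rho ^+ n))); last first.
    rewrite -mulr_sumr mulrC ler_wpM2r ?exprn_ge0//.
    apply: le_trans (hN N M); rewrite (@poly_norm_widen _ _ N1 rho N1_0 V K) ?leq_maxr//.
    rewrite [leRHS](big_cat_nat (leq0n _) NK)/= lerDr sumr_ge0// => i _.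
    by rewrite mulr_ge0// exprn_ge0// ltW.
  rewrite !big_nat; apply: ler_sum => n /andP[Nn _].
  rewrite normrM ger0_norm ?exprn_ge0//.
  have h1 : `|\sum_(0 <= k < n.+1) V`_n`_k * cos (((2 * k)%:R - n%:R) * t)| <= N1 V`_n.
    rewrite (@poly_norm_widen _ _ (fun x : R => `|x|) 1 (normr0 R) V`_n n.+1); last exact: hV.
    apply: le_trans (ler_norm_sum _ _ _) _; apply: ler_sum => k _.
    by rewrite expr1n mulr1 normrM ler_piMr// cos_max.
  have h2 : z ^+ n <= 2^-1 ^+ N.+2 * rho ^+ n.
    apply: (@le_trans _ _ ((rho / 2) ^+ n)).
      by rewrite lerXn2r ?nnegrE// divr_ge0// ltW.
    rewrite exprMn mulrC ler_wpM2r ?exprn_ge0 ?(ltW rho0)//.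
    by rewrite -(subnK Nn) exprD ler_piMl ?exprn_ge0// exprn_ile1//; lra.
  rewrite mulrC [leRHS]mulrCA; apply: ler_pM => //.
  exact: exprn_ge0.
apply: (@cvgn_norm_ler _ (fun M => series (fun m => a m * u ^+ m) (M + N.+3) - main)).
  by apply: cvgB; [rewrite (cvg_shiftn N.+3); exact: P_series|exact: cvg_cst].
by move=> M; apply: (key (M + N.+3)%N); lia.
Qed.

Definition mode_symbol (n j : nat) : R := e ^+ 2 * n%:R ^+ 2 + w ^+ 2 * j%:R ^+ 2 - 1.

Lemma modal_coefficients : exists (G : nat -> nat -> R) (C : R),
  [/\ 0 < C, forall n j, `|G n j| <= C * 4^-1 ^+ n * 2^-1 ^+ j,
      forall n j, ~~ odd n || ~~ odd j || (n < j)%N -> G n j = 0,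
      G 1%N 1%N != 0 &
      forall N x t, 0 <= x ->
       `|P (\sum_(0 <= n < N.+2) \sum_(0 <= j < N.+2) G n j * expR (- (n%:R * e * x)) * cos (j%:R * t))
         - \sum_(0 <= n < N.+2) \sum_(0 <= j < N.+2)
             mode_symbol n j * G n j * expR (- (n%:R * e * x)) * cos (j%:R * t)|
       <= C * 2^-1 ^+ N.+2].
Proof.
have [rho [C [rho0 C0 hF hR]]] := eval_remainder.
pose d n k := ((2 * k - n) + (n - 2 * k))%N.
(* The amplitude of the solution. As 8 = 4 * 2 and the frequencies satisfy j <= n, it provides the
   decay [4^-1 ^+ n] and, separately, [2^-1 ^+ j]. *)
pose r := rho / 8.
have r0 : 0 < r by rewrite divr_gt0.
pose D n j := \sum_(0 <= k < n.+1) (formal n)`_n`_k * (d n k == j)%:R.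
pose G n j := D n j * r ^+ n.
have Dle n j : `|D n j| <= N1 (formal n)`_n.
  rewrite (@poly_norm_widen _ _ (fun x : R => `|x|) 1 (normr0 R) (formal n)`_n n.+1); last exact: formal_homog.
  apply: le_trans (ler_norm_sum _ _ _) _; apply: ler_sum => k _.
  by rewrite expr1n mulr1 normrM ler_piMr// normr_nat; case: (_ == _).
have G0 n j : ~~ odd n || ~~ odd j || (n < j)%N -> G n j = 0.
  move=> h; rewrite /G /D big_nat big1 ?mul0r// => k /andP[_ kn].
  have [on|en] := boolP (odd n); last first.
    by rewrite (@formal_parity _ a e w a3 n) ?coef0 ?mul0r//; move: en; case: (odd n).
  rewrite (_ : (_ == _) = false) ?mulr0//; apply/negbTE/eqP => E; move: h.
  rewrite on -E /d orFb; have -> : odd (2 * k - n + (n - 2 * k)).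
    have [nk|nk] := leqP n (2 * k).
      by rewrite (eqP (_ : n - 2 * k == 0)%N) ?subn_eq0// addn0 oddB// oddM on.
    by rewrite (eqP (_ : 2 * k - n == 0)%N) ?subn_eq0 ?(ltnW nk)// add0n oddB ?(ltnW nk)// oddM on.
  by rewrite orFb => h; lia.
have conv N x t (c : nat -> nat -> R) : (forall n k, (k <= n)%N -> symbol n k = mode_symbol n (d n k)) ->
    0 <= x -> (c = (fun _ _ => 1) \/ c = mode_symbol) ->
    \sum_(0 <= n < N.+2) (r * expR (- (e * x))) ^+ n * \sum_(0 <= k < n.+1) (c n (d n k) * (formal n)`_n`_k) * cos (((2 * k)%:R - n%:R) * t) =
    \sum_(0 <= n < N.+2) \sum_(0 <= j < N.+2) c n j * G n j * expR (- (n%:R * e * x)) * cos (j%:R * t).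
  move=> _ x0 _; apply: eq_big_nat => n /andP[_ nN].
  rewrite [RHS](big_cat_nat (leq0n n.+1) nN)/= [X in _ = _ + X]big_nat [X in _ = _ + X]big1 ?addr0; last first.
    by move=> j /andP[nj _]; rewrite G0 ?nj ?orbT// mulr0 !mul0r.
  under eq_bigr do rewrite dist_cos -mulrA mulrCA.
  have := sum_by_dist n (fun k => (formal n)`_n`_k) (fun j => c n j * cos (j%:R * t)).
  rewrite -/(d n) => ->; rewrite mulr_sumr; apply: eq_bigr => j _.
  rewrite /G -/(D n j) exprMn (_ : expR (- (e * x)) ^+ n = expR (- (n%:R * e * x))); first by ring.
  by rewrite -expRM_natl; congr expR; ring.
have sE n k : (k <= n)%N -> symbol n k = mode_symbol n (d n k).
  by move=> _; rewrite /formal_symbol /mode_symbol dist_sqr.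
exists G, C; split => //.
- move=> n j; have [nj|jn] := ltnP n j.
    by rewrite G0 ?nj ?orbT// normr0 !mulr_ge0 ?exprn_ge0// ltW.
  apply: (@le_trans _ _ (C * 8^-1 ^+ n)).
    rewrite /G normrM (ger0_norm (exprn_ge0 _ (ltW r0))) /r exprMn mulrA ler_wpM2r ?exprn_ge0//.
    apply: le_trans (hF n); rewrite ler_wpM2r ?exprn_ge0 ?(ltW rho0)//.
  rewrite -mulrA ler_wpM2l ?(ltW C0)//.
  rewrite (_ : 8^-1 = 4^-1 * 2^-1); last by field.
  rewrite exprMn ler_wpM2l ?exprn_ge0//.
  by rewrite -(subnK jn) exprD ler_piMl ?exprn_ge0// exprn_ile1//; lra.
- rewrite /G /D mulf_neq0 ?expf_neq0 ?gt_eqF//.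
  rewrite formal_coef_stable// formal0 coefCM coefX eqxx mulr1.
  rewrite big_nat_recr//= big_nat1 /d/= !coefD !coefX !coefC/= !mulr1 addr0 add0r.
  by rewrite (_ : 1 + 1 = 2)// pnatr_eq0.
- move=> N x t x0; pose z := r * expR (- (e * x)).
  have zr : 0 <= z <= rho / 2.
    apply/andP; split; first by rewrite mulr_ge0 ?expR_ge0 ?(ltW r0).
    apply: (@le_trans _ _ (r * 1)); last by rewrite mulr1 /r; move: rho0; lra.
    by rewrite ler_wpM2l ?(ltW r0)// -expR0 ler_expR oppr_le0 mulr_ge0// ltW.
  have := hR N t z zr.
  have E1 : \sum_(0 <= n < N.+2) z ^+ n * \sum_(0 <= k < n.+1) (formal n)`_n`_k * cos (((2 * k)%:R - n%:R) * t) =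
     \sum_(0 <= n < N.+2) \sum_(0 <= j < N.+2) G n j * expR (- (n%:R * e * x)) * cos (j%:R * t).
    have := conv N x t (fun _ _ => 1) sE x0 (or_introl erefl).
    under eq_bigr do under eq_bigr do rewrite mul1r.
    by under [X in _ = X]eq_bigr do under eq_bigr do rewrite mul1r.
  have E2 : \sum_(0 <= n < N.+2) z ^+ n * \sum_(0 <= k < n.+1) symbol n k * (formal n)`_n`_k * cos (((2 * k)%:R - n%:R) * t) =
     \sum_(0 <= n < N.+2) \sum_(0 <= j < N.+2) mode_symbol n j * G n j * expR (- (n%:R * e * x)) * cos (j%:R * t).
    rewrite -(conv N x t mode_symbol sE x0 (or_intror erefl)).
    apply: eq_bigr => n _; congr (_ * _); apply: eq_big_nat => k /andP[_ kn].
    by rewrite sE.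
  by rewrite E1 E2.
Qed.

End modal_series.

(** * Exponentials as cosine transforms *)

Lemma dominated_Rintegral (R : realType) d (T : measurableType d) (nu : {measure set T -> \bar R})
    (D : set T) (g : nat -> T -> R) (f h : T -> R) : measurable D ->
  (forall n, measurable_fun D (g n)) ->
  (forall x, D x -> (g n x) @[n --> \oo] --> f x) -> (forall n x, D x -> `|g n x| <= h x) ->
  nu.-integrable D (EFin \o h) ->
  (fun n => \int[nu]_(x in D) g n x) @ \oo --> \int[nu]_(x in D) f x.
Proof.
move=> mD mg gf gh ih.
have mg' n : measurable_fun D (fun x => (g n x)%:E) by exact/measurable_EFinP.
have cg x : D x -> (g n x)%:E @[n --> \oo] --> (f x)%:E.
  by move=> Dx; apply: cvg_EFin; [exact: nearW|exact: gf].
have mf' : measurable_fun D (fun x => (f x)%:E) by apply: (emeasurable_fun_cvg _ _ mg') => x; exact: cg.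
have dom : {ae nu, forall x n, D x -> (`|(g n x)%:E| <= (h x)%:E)%E}.
  by apply/aeW => x n Dx; rewrite /= lee_fin; exact: gh.
have [fi _ cI] := dominated_convergence mD mg' mf' (aeW _ cg) ih dom.
have ffin : (\int[nu]_(x in D) (f x)%:E)%E \is a fin_num by exact: integrable_fin_num.
by move: cI; rewrite -(fineK ffin) => /fine_cvgP[_ cI].
Qed.

Section line_integrals.
Context {R : realType}.
Let mu := @lebesgue_measure R.

Lemma dominated_integrable_line (f h : R -> R) : measurable_fun setT f ->
  (forall x, `|f x| <= h x) -> mu.-integrable setT (EFin \o h) -> mu.-integrable setT (EFin \o f).
Proof.
move=> mf fh ih; apply: (le_integrable measurableT _ _ ih); first exact/measurable_EFinP.
by move=> x _; rewrite /= lee_fin; apply: le_trans (fh x) (ler_norm _).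
Qed.

Lemma integrable_scale (c : R) (f : R -> R) : mu.-integrable setT (EFin \o f) ->
  mu.-integrable setT (EFin \o (fun x => c * f x)).
Proof.
move=> i; rewrite (_ : EFin \o _ = (fun x => c%:E * (EFin \o f) x)%E); first exact: integrableZl.
by apply/funext => y; rewrite /= EFinM.
Qed.

Lemma integrable_sub (f g : R -> R) : mu.-integrable setT (EFin \o f) ->
  mu.-integrable setT (EFin \o g) -> mu.-integrable setT (EFin \o (fun x => f x - g x)).
Proof.
move=> i j; rewrite (_ : EFin \o _ = ((EFin \o f) \- (EFin \o g))%E); first exact: integrableB.
by apply/funext => y; rewrite /= EFinB.
Qed.

Lemma is_derive_under_integral (f f' : R -> R -> R) (G : R -> R) (x : R) :
  (forall x, mu.-integrable setT (EFin \o f x)) ->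
  (forall x y : R, is_derive x (1 : R) (f^~ y) (f' x y)) ->
  (forall x y, `|f' x y| <= G y) -> mu.-integrable setT (EFin \o G) ->
  is_derive x (1 : R) (fun x => \int[mu]_y f x y) (\int[mu]_y f' x y).
Proof.
move=> fi df fG iG.
have p1 y z : partial1of2 f y z = f' y z by exact: is_derive_derive1.
have xI : `]x - 1, x + 1[%classic x by rewrite /= in_itv/=; apply/andP; split; lra.
have G0 y : 0 <= G y by apply: le_trans (fG 0 y).
have h1 : forall y z, `]x - 1, x + 1[%classic y -> setT z -> derivable (f^~ z) y 1.
  by move=> y z _ _; exact: is_derive_derivable (df y z).
have h2 : forall y z, `]x - 1, x + 1[%classic y -> setT z -> `|partial1of2 f y z| <= G z.
  by move=> y z _ _; rewrite p1.
have := @derivable_under_integral R _ _ mu f setT measurableT x (x - 1) (x + 1) xI (fun y _ => fi y) h1 G G0 iG h2.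
move=> /derivable_is_derive; rewrite (@differentiation_under_integral R _ _ mu f setT measurableT x (x - 1) (x + 1) xI (fun y _ => fi y) h1 G G0 iG h2).
by congr (is_derive _ _ _ _); apply: eq_Rintegral => y _; rewrite p1.
Qed.

Lemma Rintegral_dominated_le (f h : R -> R) : measurable_fun setT f ->
  (forall x, `|f x| <= h x) -> mu.-integrable setT (EFin \o h) ->
  `|\int[mu]_x f x| <= \int[mu]_x h x.
Proof.
move=> mf fh ih; have fi := dominated_integrable_line mf fh ih.
apply: le_trans (le_normr_Rintegral measurableT fi) _; apply: le_Rintegral => //.
apply: dominated_integrable_line ih => [|x]; last by rewrite normr_id.
exact: measurableT_comp.
Qed.

Lemma integral_of_derive (F f : R -> R) (l : R) : continuous f ->
  (forall x : R, is_derive x (1 : R) F (f x)) -> mu.-integrable setT (EFin \o f) ->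
  (fun n : nat => F n%:R - F (- n%:R)) @ \oo --> l -> \int[mu]_x f x = l.
Proof.
move=> cf dF iF Fl.
pose g (n : nat) : R -> R := f \_ `[- n%:R, n%:R].
have nn n : - n%:R <= n%:R :> R by rewrite (@le_trans _ _ 0)// oppr_le0.
have gI n : \int[mu]_x g n x = F n%:R - F (- n%:R).
  by rewrite -Rintegral_mkcond (Rintegral_FTC (nn n) cf)// => x _; exact: dF.
have mf : measurable_fun setT f by exact: continuous_measurable_fun.
have mg n : measurable_fun setT (g n).
  by rewrite /g; apply/(measurable_restrict _ _ _) => //; exact: measurable_funTS.
have cg x : setT x -> g n x @[n --> \oo] --> f x.
  move=> _; apply: cvg_near_cst.
  exists (Num.truncn `|x|).+1 => // n /= xn; rewrite /g patchE mem_set//=.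
  rewrite in_itv/= -ler_norml; apply: le_trans (ltW (truncnS_gt _)) _.
  by rewrite ler_nat.
have ig : mu.-integrable setT (EFin \o (fun x => `|f x|)).
  apply: (le_integrable measurableT _ _ iF) => [|x _].
    by apply/measurable_EFinP; exact: measurableT_comp.
  by rewrite /= lee_fin normr_id.
have gf n x : setT x -> `|g n x| <= `|f x|.
  by rewrite /g patchE; case: ifP; rewrite ?normr0.
have cI := @dominated_Rintegral R _ _ mu setT _ _ _ measurableT mg cg gf ig.
have E : (fun n => \int[mu]_x g n x) = (fun n : nat => F n%:R - F (- n%:R)).
  by apply/funext => n; exact: gI.
rewrite E in cI; rewrite -(cvg_lim (@Rhausdorff R) cI).
exact: (cvg_lim (@Rhausdorff R) Fl).
Qed.

End line_integrals.

(** * Cosine transform of the Lorentz function *)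

Section lorentz_transform.
Context {R : realType}.
Variable a : R.
Hypothesis a0 : 0 < a.
Let mu := @lebesgue_measure R.
Let h (y : R) : R := (a ^+ 2 + y ^+ 2)^-1.

Let h_gt0 y : 0 < h y.
Proof. by rewrite invr_gt0 sqrD_gt0. Qed.
Let h_cts : continuous h.
Proof. exact: continuous_lorentz. Qed.
Let h_int : mu.-integrable setT (EFin \o h).
Proof. exact: integrable_lorentz. Qed.
Let h_le y : h y <= (a ^+ 2)^-1.
Proof. by rewrite lef_pV2 ?posrE ?sqrD_gt0 ?exprn_gt0// lerDl sqr_ge0. Qed.
Let h_eq y : y ^+ 2 * h y = 1 - a ^+ 2 * h y.
Proof. by rewrite /h; field; rewrite gt_eqF// sqrD_gt0. Qed.
Let yh_le y : `|y| * h y <= (2 * a)^-1.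
Proof.
rewrite /h ler_pdivrMr ?sqrD_gt0// mulrC ler_pdivlMr ?mulr_gt0//.
rewrite -(real_normK (num_real y)); have := sqr_ge0 (a - `|y|); rewrite sqrrB; lra.
Qed.

Let scale_int (c : R) : mu.-integrable setT (EFin \o (fun y => c * h y)).
Proof. exact: integrable_scale. Qed.

Let cy : continuous (fun y : R => y).
Proof. by move=> y; exact: cvg_id. Qed.

(** Differentiating [F] under the integral sign would bring in [y * h y], which is not absolutely
    integrable. Integration by parts in y gives x F = 2 S instead; [S] and [Q], built on the squared
    kernel, can be differentiated. *)
Let F x : R := \int[mu]_y (h y * cos (y * x)).
Let Q x : R := \int[mu]_y (h y ^+ 2 * cos (y * x)).
Let S x : R := \int[mu]_y (y * h y ^+ 2 * sin (y * x)).

Let cosr (x : R) : continuous (fun y : R => cos (y * x)).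
Proof. by under eq_fun do rewrite mulrC; exact: continuous_cosM. Qed.
Let sinr (x : R) : continuous (fun y : R => sin (y * x)).
Proof. by under eq_fun do rewrite mulrC; exact: continuous_sinM. Qed.
Let ch2 : continuous (fun y => h y ^+ 2).
Proof. by apply: continuousM. Qed.
Let cyh2 : continuous (fun y : R => y * h y ^+ 2).
Proof. by apply: continuousM. Qed.

Let int_of (f : R -> R) c : continuous f -> (forall y, `|f y| <= c * h y) ->
  mu.-integrable setT (EFin \o f).
Proof.
move=> cf fh; apply: (dominated_integrable_line _ fh (scale_int c)).
exact: continuous_measurable_fun.
Qed.

Let iF x : mu.-integrable setT (EFin \o (fun y => h y * cos (y * x))).
Proof.
apply: (@int_of _ 1); first exact: continuousM.
by move=> y; rewrite mul1r normrM ger0_norm ?(ltW (h_gt0 y))// ler_piMr ?cos_max// ltW.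
Qed.

Let h2_le y : h y ^+ 2 <= (a ^+ 2)^-1 * h y.
Proof. by rewrite expr2 ler_wpM2r// ltW. Qed.

Let iQ x : mu.-integrable setT (EFin \o (fun y => h y ^+ 2 * cos (y * x))).
Proof.
apply: (@int_of _ (a ^+ 2)^-1); first exact: continuousM.
move=> y; rewrite normrM ger0_norm ?sqr_ge0//; apply: le_trans (h2_le y).
by rewrite ler_piMr ?cos_max// sqr_ge0.
Qed.

Let yh2_le y : `|y * h y ^+ 2| <= (2 * a)^-1 * h y.
Proof. by rewrite normrM (ger0_norm (sqr_ge0 _)) expr2 mulrA ler_wpM2r// ltW. Qed.

Let iS x : mu.-integrable setT (EFin \o (fun y => y * h y ^+ 2 * sin (y * x))).
Proof.
apply: (@int_of _ (2 * a)^-1); first exact: continuousM.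
by move=> y; rewrite normrM; apply: le_trans (yh2_le y); rewrite ler_piMr ?sin_max.
Qed.

Let dcos (y x c : R) : is_derive x (1 : R) (fun x => c * cos (y * x)) (- (c * y * sin (y * x))).
Proof. by have h1 := is_derive_cosM y x; apply: is_derive_eq; rewrite /GRing.scale/=; ring. Qed.
Let dsin (y x c : R) : is_derive x (1 : R) (fun x => c * sin (y * x)) (c * y * cos (y * x)).
Proof. by have h1 := is_derive_sinM y x; apply: is_derive_eq; rewrite /GRing.scale/=; ring. Qed.

Let dQ (x : R) : is_derive x (1 : R) Q (- S x).
Proof.
have -> : - S x = \int[mu]_y (- (h y ^+ 2 * y * sin (y * x))).
  by rewrite /S -mulN1r -RintegralZl//; apply: eq_Rintegral => y _; ring.
apply: (is_derive_under_integral (f' := fun x y => - (h y ^+ 2 * y * sin (y * x))) x iQ).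
- by move=> z y; exact: dcos.
- move=> z y; rewrite normrN normrM [h y ^+ 2 * y]mulrC; apply: (@le_trans _ _ _ _ _ _ (yh2_le y)).
  by rewrite ler_piMr ?sin_max.
- exact: scale_int.
Qed.

Let yhE (y : R) : h y - a ^+ 2 * h y ^+ 2 = y * h y ^+ 2 * y.
Proof.
rewrite (_ : y * h y ^+ 2 * y = h y * (y ^+ 2 * h y)); last by ring.
by rewrite h_eq; ring.
Qed.

Let dS (x : R) : is_derive x (1 : R) S (F x - a ^+ 2 * Q x).
Proof.
have -> : F x - a ^+ 2 * Q x = \int[mu]_y (y * h y ^+ 2 * y * cos (y * x)).
  rewrite -RintegralZl// -RintegralB//; last first.
    apply: (@int_of _ 1); first by apply: continuousZ; exact: continuousM.
    move=> y; rewrite mul1r mulrA normrM [X in X * _]ger0_norm; last by apply: mulr_ge0; exact: sqr_ge0.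
    apply: (@le_trans _ _ (a ^+ 2 * h y ^+ 2)).
      by rewrite ler_piMr ?cos_max//; apply: mulr_ge0; exact: sqr_ge0.
    have := h2_le y; rewrite ler_pdivlMl ?exprn_gt0//.
  apply: eq_Rintegral => y _; rewrite mulrA -mulrBl; congr (_ * _).
  exact: yhE.
apply: (is_derive_under_integral (f' := fun x y => y * h y ^+ 2 * y * cos (y * x)) x iS _ _ h_int).
- by move=> z y; exact: dsin.
- move=> z y; rewrite (_ : y * h y ^+ 2 * y = h y * (y ^+ 2 * h y)); last by ring.
  rewrite normrM ger0_norm; last first.
    by apply: mulr_ge0; [exact: ltW|apply: mulr_ge0; [exact: sqr_ge0|exact: ltW]].
  rewrite -mulrA ler_piMr ?(ltW (h_gt0 _))// h_eq.
  have h1 : 0 <= 1 - a ^+ 2 * h y <= 1.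
    by rewrite -h_eq mulr_ge0 ?sqr_ge0 ?(ltW (h_gt0 _))//= h_eq gerBl mulr_ge0 ?sqr_ge0// ltW.
  by move: h1 => /andP[q1 q2]; rewrite (le_trans (ler_piMr q1 (cos_max _))).
Qed.

Let by_parts x : x * F x = 2 * S x.
Proof.
apply/eqP; rewrite -subr_eq0 /F /S -RintegralZl// -RintegralZl//.
have i1 : mu.-integrable setT (EFin \o (fun y => x * (h y * cos (y * x)))).
  exact: integrable_scale.
have i2 : mu.-integrable setT (EFin \o (fun y => 2 * (y * h y ^+ 2 * sin (y * x)))).
  exact: integrable_scale.
rewrite -RintegralB//; apply/eqP.
apply: (@integral_of_derive _ (fun y => h y * sin (y * x))).
- apply: continuousB; first by apply: continuousZ; exact: continuousM.
  by apply: continuousZ; exact: continuousM.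
- move=> y; have d1 : is_derive y (1 : R) (fun y => sin (y * x)) (x * cos (y * x)).
    by under eq_fun do rewrite mulrC; rewrite [y * x]mulrC; exact: is_derive_sinM.
  have d2 : is_derive y (1 : R) (fun y : R => a ^+ 2 + y ^+ 2) (2 * y).
    by apply: is_derive_eq; rewrite /GRing.scale/=; ring.
  have nz : a ^+ 2 + y ^+ 2 != 0 by rewrite gt_eqF// sqrD_gt0.
  have d3 : is_derive y (1 : R) h (- (2 * y) * h y ^+ 2).
    have := @is_deriveV R (fun y : R => a ^+ 2 + y ^+ 2) y (2 * y) 1 nz d2.
    rewrite /h => d; apply: is_derive_eq; rewrite /GRing.scale/= exprVn; ring.
  by apply: is_derive_eq; rewrite /GRing.scale/=; ring.
- exact: integrable_sub.
- apply/cvgrPdist_le => d d0; near=> n.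
  rewrite sub0r normrN mulNr sinN mulrN opprK /h sqrrN -mulr2n normrMn.
  have n0 : (0 : R) < n%:R by rewrite ltr0n; near: n; exact: nbhs_infty_gt.
  apply: (@le_trans _ _ (2 * h n%:R)).
    have hs : `|h n%:R * sin (n%:R * x)| <= h n%:R.
      by rewrite normrM ger0_norm ?ler_piMr ?sin_max//; exact: ltW.
    by rewrite mulr2n [leRHS]mulr_natl mulr2n; apply: lerD.
  rewrite /h ler_pdivrMr ?sqrD_gt0// -ler_pdivrMl//.
  apply: (@le_trans _ _ n%:R).
    by near: n; exact: nbhs_infty_ger.
  apply: (@le_trans _ _ (n%:R ^+ 2)); last by rewrite lerDr sqr_ge0.
  rewrite -natrX ler_nat expnS expn1 leq_pmulr//; near: n; exact: nbhs_infty_gt.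
Unshelve. all: end_near. Qed.

Let F_le x : `|F x| <= pi / a.
Proof.
rewrite -(@Rintegral_lorentz R a a0); apply: Rintegral_dominated_le => //.
  by apply: continuous_measurable_fun; exact: continuousM.
by move=> y; rewrite normrM ger0_norm ?(ltW (h_gt0 y))// ler_piMr ?cos_max// ltW.
Qed.

Let Q_le x : `|Q x| <= (a ^+ 2)^-1 * (pi / a).
Proof.
rewrite -(@Rintegral_lorentz R a a0) -RintegralZl//.
have b y : `|h y ^+ 2 * cos (y * x)| <= (a ^+ 2)^-1 * h y.
  rewrite normrM ger0_norm ?sqr_ge0//; apply: le_trans (h2_le y).
  by rewrite ler_piMr ?cos_max// sqr_ge0.
apply: Rintegral_dominated_le => //.
by apply: continuous_measurable_fun; exact: continuousM.
Qed.

Let F1 x : R := (F x - 2 * a ^+ 2 * Q x) / x.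

Let FE x : 0 < x -> F x = 2 * S x / x.
Proof. by move=> x0; rewrite -by_parts mulrC mulKf// gt_eqF. Qed.

Let dF (x : R) : 0 < x -> is_derive x (1 : R) F (F1 x).
Proof.
move=> x0; apply: (@near_eq_is_derive _ _ _ (fun x => 2 * S x * x^-1)).
  by near=> y; rewrite FE//; near: y; exact: lt_nbhsr.
have nz : x != 0 by rewrite gt_eqF.
have d1 := dS x; have d2 := @is_deriveV R id x 1 1 nz (is_derive_id _ _).
apply: is_derive_eq; rewrite /GRing.scale/= /F1.
have := by_parts x; move: (F x) (S x) (Q x) => f s q E.
have -> : s = x * f / 2 by rewrite E mulrC mulKf.
by field.
Unshelve. all: end_near. Qed.

Let dF1 (x : R) : 0 < x -> is_derive x (1 : R) F1 (a ^+ 2 * F x).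
Proof.
move=> x0; have nz : x != 0 by rewrite gt_eqF.
have d0 := dF x0; have d1 := dQ x; have d2 := @is_deriveV R id x 1 1 nz (is_derive_id _ _).
rewrite /F1; apply: is_derive_eq; rewrite /GRing.scale/= /F1.
have := by_parts x; move: (F x) (S x) (Q x) => f s q E.
have -> : s = x * f / 2 by rewrite E mulrC mulKf.
by field.
Qed.

(** For x > 0 one has F'' = a ^ 2 F. The combination F' + a F is a multiple of exp (a x), and it is
    bounded for x away from 0, hence zero. So F is a multiple of exp (- a x), and continuity at 0
    gives the factor pi / a. *)
Lemma lorentz_transform x : 0 <= x -> \int[mu]_y (h y * cos (y * x)) = pi / a * expR (- (a * x)).
Proof.
have dE c (y : R) : is_derive y (1 : R) (fun y => expR (c * y)) (c * expR (c * y)) := is_derive_expM c y.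
have pc y : 0 < y -> F1 y + a * F y = 0.
  move=> y0.
  have cst z : y <= z -> (F1 y + a * F y) * expR (- a * y) = (F1 z + a * F z) * expR (- a * z).
    rewrite le_eqVlt => /orP[/eqP->//|yz].
    have d (t : R) : 0 < t -> is_derive t (1 : R) (fun t => (F1 t + a * F t) * expR (- a * t)) 0.
      move=> t0; have d1 := dF1 t0; have d2 := dF t0; have d3 := dE (- a) t.
      apply: is_derive_eq; rewrite /GRing.scale/=; ring.
    have dpos t : t \in `]y, z[ -> is_derive t (1 : R) (fun t => (F1 t + a * F t) * expR (- a * t)) 0.
      by rewrite in_itv/= => /andP[yt _]; apply: d; exact: lt_trans yt.
    have cts : {within `[y, z], continuous (fun t => (F1 t + a * F t) * expR (- a * t))}.
      apply: continuous_in_subspaceT => t; rewrite inE/= in_itv/= => /andP[yt _].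
      by apply: is_derive_continuous_at (d t _); exact: lt_le_trans yt.
    have [t _] := MVT yz dpos cts; rewrite mul0r => /eqP; rewrite subr_eq0 => /eqP/esym//.
  apply/eqP; rewrite -normr_le0.
  have E0 : 0 < expR (- a * y) := expR_gt0 _.
  rewrite -(pmulr_lle0 _ E0) -[X in _ * X](ger0_norm (ltW E0)) -normrM.
  pose B := (3 * (pi / a) / y + a * (pi / a)).
  apply: (@le0_exp _ y _ B a a0) => z yz.
  rewrite (cst z (ltW yz)) normrM (ger0_norm (expR_ge0 _)) mulNr ler_wpM2r ?expR_ge0//.
  have z0 : 0 < z := lt_trans y0 yz.
  apply: le_trans (ler_normD _ _) _; apply: lerD; last first.
    by rewrite normrM (gtr0_norm a0) ler_wpM2l ?F_le// ltW.
  rewrite /F1 normrM normfV (gtr0_norm z0); apply: ler_pM => //.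
  - by rewrite invr_ge0 ltW.
  - apply: le_trans (ler_normB _ _) _.
    have := F_le z; have := Q_le z; rewrite ler_pdivlMl ?exprn_gt0//.
    rewrite [`|2 * _ * _|]normrM [`|2 * _|]ger0_norm ?mulr_ge0 ?(ltW a0)//.
    by move: (pi / a) => p; lra.
  - by rewrite lef_pV2// ltW.
have Fc y z : 0 < y -> y <= z -> F y * expR (a * y) = F z * expR (a * z).
  move=> y0; rewrite le_eqVlt => /orP[/eqP->//|yz].
  have d (t : R) : 0 < t -> is_derive t (1 : R) (fun t => F t * expR (a * t)) 0.
    move=> t0; have d2 := dF t0; have d3 := dE a t.
    apply: is_derive_eq; rewrite /GRing.scale/=.
    by rewrite (_ : F1 t = - (a * F t)); [ring|have := pc t t0; lra].
  have dpos t : t \in `]y, z[ -> is_derive t (1 : R) (fun t => F t * expR (a * t)) 0.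
    by rewrite in_itv/= => /andP[yt _]; apply: d; exact: lt_trans yt.
  have cts : {within `[y, z], continuous (fun t => F t * expR (a * t))}.
    apply: continuous_in_subspaceT => t; rewrite inE/= in_itv/= => /andP[yt _].
    by apply: is_derive_continuous_at (d t _); exact: lt_le_trans yt.
  by have [t _] := MVT yz dpos cts; rewrite mul0r => /eqP; rewrite subr_eq0 => /eqP/esym.
have F0 : F 0 = pi / a.
  by rewrite -(@Rintegral_lorentz R a a0); apply: eq_Rintegral => y _; rewrite mulr0 cos0 mulr1.
have cF : {for 0, continuous F}.
  have := @continuity_under_integral R _ _ mu (fun x y => h y * cos (y * x)) setT
    measurableT (- 1) 1 (fun y _ => iF y) _ h h_int _ 0.
  apply.
  - apply: aeW => eta _ y _; apply: cvgM; first exact: cvg_cst.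
    exact: continuous_cosM.
  - move=> y _; apply: aeW => eta _; rewrite normrM ger0_norm ?(ltW (h_gt0 _))// ler_piMr ?cos_max// ltW//.
  - by rewrite inE/= in_itv/=; apply/andP; split; lra.
rewrite le_eqVlt => /orP[/eqP<-|x0]; first by rewrite -/(F 0) F0 mulr0 oppr0 expR0 mulr1.
rewrite -/(F x).
suff : F x * expR (a * x) = pi / a by move=> <-; rewrite -mulrA -expRD subrr expR0 mulr1.
have c0 : {for 0, continuous (fun y => F y * expR (a * y))}.
  by apply: cvgM => //; exact: is_derive_continuous (dE a) 0.
apply/eqP; rewrite -subr_eq0 -normr_le0; apply/ler_addgt0Pl => d d0; rewrite addr0.
move/cvgrPdist_le : c0 => /(_ d d0); rewrite mulr0 expR0 mulr1 F0 => -[r /= r0 hr].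
pose y := Num.min x (r / 2).
have y0 : 0 < y by rewrite lt_min x0 divr_gt0.
rewrite -(Fc y x y0) ?ge_min ?lexx// distrC; apply: hr => /=.
rewrite sub0r normrN gtr0_norm//; apply: (@le_lt_trans _ _ (r / 2)); last by lra.
by rewrite ge_min lexx orbT.
Qed.

End lorentz_transform.

(** * Kernels of prescribed polynomial decay *)

Section sinc.
Context {R : realType}.
Let mu := @lebesgue_measure R.

Definition sinc (y : R) : R := if y == 0 then 1 else sin y / y.

Lemma mul_sinc y : y * sinc y = sin y.
Proof.
rewrite /sinc; case: eqVneq => [->|y0]; first by rewrite mul0r sin0.
by rewrite mulrC divfK.
Qed.

Lemma sin_norm_le (y : R) : `|sin y| <= `|y|.
Proof.
have key (z : R) : 0 <= z -> `|sin z| <= z.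
  move=> z0; have dsn (x : R) : is_derive x (1 : R) (fun x => x - sin x) (1 - cos x).
    by apply: is_derive_eq.
  have dsp (x : R) : is_derive x (1 : R) (fun x => x + sin x) (1 + cos x).
    by apply: is_derive_eq.
  have zm : -1 < 0 :> R by lra.
  have h1 := @derive_ge0_le R _ _ (-1) (fun x _ => dsn x) (fun x _ => ltac:(by rewrite subr_ge0 cos_le1)) 0 z zm z0.
  have h2 := @derive_ge0_le R _ _ (-1) (fun x _ => dsp x) (fun x _ => ltac:(by have := cos_geN1 x; lra)) 0 z zm z0.
  by move: h1 h2; rewrite sin0 ler_norml => h1 h2; apply/andP; split; lra.
have [y0|y0] := leP 0 y; first by rewrite (ger0_norm y0) key.
by rewrite -normrN -sinN -[leRHS]normrN [leRHS]ger0_norm ?key// oppr_ge0 ltW.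
Qed.

Lemma sinc_le1 y : `|sinc y| <= 1.
Proof.
rewrite /sinc; case: eqVneq => [_|y0]; first by rewrite normr1.
by rewrite normrM normfV ler_pdivrMr ?normr_gt0// mul1r sin_norm_le.
Qed.

Lemma sinc_sqr_le y : sinc y ^+ 2 <= 2 / (1 + y ^+ 2).
Proof.
have p0 : 0 < 1 + y ^+ 2 by rewrite ltr_pwDl// sqr_ge0.
rewrite ler_pdivlMr// mulrDr mulr1 -exprMn [sinc y * y]mulrC mul_sinc.
have sq (z : R) : `|z| <= 1 -> z ^+ 2 <= 1 by move=> z1; rewrite -real_normK ?num_real// expr_le1.
by have := sq _ (sinc_le1 y); have := sq _ (sin_max y); lra.
Qed.

Lemma continuous_sinc : continuous sinc.
Proof.
move=> x; have [->|x0] := eqVneq x 0.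
  apply/continuous_withinNx; rewrite {2}/sinc eqxx.
  have := is_derive_sin (0 : R); rewrite cos0 => -[d1 d2].
  have : h^-1 *: (sin (h *: 1 + 0) - sin 0) @[h --> (0 : R)^'] --> (1 : R) by rewrite -[X in _ --> X]d2.
  apply: cvg_trans; apply: near_eq_cvg; near=> h.
  have h0 : h != 0 by near: h; exact: nbhs_dnbhs_neq.
  by rewrite /sinc (negbTE h0) sin0 subr0 addr0 /GRing.scale/= mulr1 mulrC.
have xnz : \forall y \near x, y != 0.
  by apply: open_nbhs_nbhs; split; [exact: open_neq|exact: x0].
have : (fun y => sin y * y^-1) @ x --> sin x * x^-1.
  by apply: cvgM; [exact: continuous_sin|apply: inv_continuous].
rewrite /continuous_at [sinc x]/sinc (negbTE x0); apply: cvg_trans; apply: near_eq_cvg; near=> y.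
have y0 : y != 0 by near: y; exact: xnz.
by rewrite /sinc (negbTE y0).
Unshelve. all: end_near. Qed.

Lemma sincN y : sinc (- y) = sinc y.
Proof. by rewrite /sinc oppr_eq0; case: eqP => // _; rewrite sinN invrN mulrNN. Qed.

Lemma continuous_sincX n : continuous (fun y => sinc y ^+ n).
Proof.
elim: n => [|n IH]; first by under eq_fun do rewrite expr0; exact: cst_continuous.
by under eq_fun do rewrite exprS; apply: continuousM => //; exact: continuous_sinc.
Qed.

Lemma measurable_sinc : measurable_fun setT sinc.
Proof. exact: continuous_measurable_fun continuous_sinc. Qed.

Let is_derive_prim (y x : R) : is_derive x (1 : R) (fun x => x * sinc (y * x)) (cos (y * x)).
Proof.
have [->|y0] := eqVneq y 0.
  rewrite mul0r cos0 (_ : (fun x => _) = id); first exact: is_derive_id.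
  by apply/funext => z; rewrite mul0r /sinc eqxx mulr1.
rewrite (_ : (fun x => _) = (fun x => y^-1 * sin (y * x))).
  have h1 := is_derive_sinM y x; apply: is_derive_eq.
  by rewrite /GRing.scale/= mulrA mulVf// mul1r.
by apply/funext => z; rewrite -mul_sinc mulrA mulrA mulVf// mul1r.
Qed.

Let prim_diff (y x : R) : (x + 1) * sinc (y * (x + 1)) - (x - 1) * sinc (y * (x - 1)) = 2 * (sinc y * cos (y * x)).
Proof.
have [->|y0] := eqVneq y 0; first by rewrite !mul0r cos0 /sinc eqxx; lra.
apply: (mulfI y0); rewrite mulrBr !mulrA !mul_sinc.
rewrite mulrDr mulrBr mulr1 sinD sinB [y * 2]mulrC -[2 * y * _]mulrA mul_sinc; lra.
Qed.

(* Multiplying a kernel by sinc averages its cosine transform over [x - 1, x + 1],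
   which only rescales an exponential. *)
Lemma sinc_average (g : R -> R) (a c X x : R) : 0 < a ->
  mu.-integrable setT (EFin \o g) ->
  (forall x, X <= x -> \int[mu]_y (g y * cos (y * x)) = c * expR (- (a * x))) ->
  X + 1 <= x ->
  \int[mu]_y (g y * sinc y * cos (y * x)) = c * ((expR a - expR (- a)) / (2 * a)) * expR (- (a * x)).
Proof.
move=> a0 ig hF Xx.
have mg : measurable_fun setT g by have /integrableP[/measurable_EFinP] := ig.
have iag : mu.-integrable setT (EFin \o (fun y => `|g y|)).
  apply: (le_integrable measurableT _ _ ig) => [|y _].
    by apply/measurable_EFinP; exact: measurableT_comp.
  by rewrite /= lee_fin normr_id.
pose S (x y : R) := g y * (x * sinc (y * x)).
have mS x' : measurable_fun setT (S x').
  apply: measurable_funM => //; apply: measurable_funM => //.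
  apply: measurableT_comp; first exact: measurable_sinc.
  by apply: continuous_measurable_fun; exact: mulrr_continuous.
have iS x' : mu.-integrable setT (EFin \o S x').
  apply: (dominated_integrable_line (mS x') _ (integrable_scale `|x'| iag)) => y.
  by rewrite normrM normrM mulrC ler_wpM2r// ler_piMr// sinc_le1.
have dL (x' : R) : is_derive x' (1 : R) (fun x => \int[mu]_y S x y) (\int[mu]_y (g y * cos (y * x'))).
  apply: (@is_derive_under_integral _ S (fun x y => g y * cos (y * x)) (fun y => `|g y|) x' iS _ _ iag).
    by move=> z y; have h := is_derive_prim y z; apply: is_derive_eq.
  by move=> z y; rewrite normrM ler_piMr// cos_max.
pose L (x : R) := \int[mu]_y S x y.
have dH (x' : R) : is_derive x' (1 : R) (fun x => L x + c / a * expR (- a * x))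
    (\int[mu]_y (g y * cos (y * x')) - c * expR (- a * x')).
  have h1 := dL x'; have h2 := is_derive_expM (- a) x'.
  apply: is_derive_eq; rewrite /GRing.scale/=; field; rewrite gt_eqF//.
have xx : x - 1 <= x + 1 by lra.
have := derive_eq0_const xx dH; rewrite -/(L _) => h.
have {h} : L (x - 1) + c / a * expR (- a * (x - 1)) = L (x + 1) + c / a * expR (- a * (x + 1)).
  by apply: h => z /andP[z1 _]; rewrite hF ?mulNr ?subrr//; lra.
have E : L (x + 1) - L (x - 1) = 2 * \int[mu]_y (g y * sinc y * cos (y * x)).
  have m1 : measurable_fun setT (fun y : R => g y * sinc y * cos (y * x)).
    apply: measurable_funM; first by apply: measurable_funM => //; exact: measurable_sinc.
    by apply: continuous_measurable_fun; under eq_fun do rewrite mulrC; exact: continuous_cosM.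
  have i1 : mu.-integrable setT (EFin \o (fun y => g y * sinc y * cos (y * x))).
    apply: (dominated_integrable_line m1 _ iag) => y; rewrite -mulrA normrM ler_piMr//.
    by rewrite normrM mulr_ile1 ?sinc_le1 ?cos_max.
  rewrite -RintegralB// -RintegralZl//; apply: eq_Rintegral => y _.
  by rewrite /S -mulrBr prim_diff; ring.
have -> : expR (- a * (x - 1)) = expR a * expR (- (a * x)) by rewrite -expRD; congr expR; ring.
have -> : expR (- a * (x + 1)) = expR (- a) * expR (- (a * x)) by rewrite -expRD; congr expR; ring.
move: E; set I := \int[mu]_y _; move: (L _) (L _) (expR _) (expR (- a)) (expR _) => l1 l2 e1 e2 e3 h1 h2.
have -> : I = (l2 - l1) / 2 by lra.
have -> : l2 - l1 = c / a * (e3 * e1) - c / a * (e2 * e1) by lra.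
by field; rewrite gt_eqF.
Qed.

(** The Lorentz kernel itself represents exp (- a |x|), whose corner at 0 limits the decay to y ^ (-
    2). Each factor [sinc] gains a power of y and costs one unit of the half-line, so that exp (- a
    x) is reproduced for x >= K only. *)
Lemma exp_kernel (K : nat) (a : R) : 0 < a -> exists k : R -> R,
  [/\ continuous k /\ (forall y, k (- y) = k y), mu.-integrable setT (EFin \o k),
      forall y, `|k y| <= a / pi * `|sinc y| ^+ K * (a ^+ 2 + y ^+ 2)^-1 &
      forall x, K%:R <= x -> \int[mu]_y (k y * cos (y * x)) = expR (- (a * x))].
Proof.
move=> a0.
(* The factor sinh a / a by which one averaging multiplies the exponential. Being at least 1, it can
   be divided out without enlarging the kernel. *)
pose sh : R := (expR a - expR (- a)) / (2 * a).
have sh1 : 1 <= sh.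
  rewrite /sh ler_pdivlMr ?mulr_gt0// mul1r -subr_ge0.
  have d (x : R) : is_derive x (1 : R) (fun x => expR x - expR (-1 * x) - 2 * x) (expR x + expR (-1 * x) - 2).
    have h := is_derive_expM (-1) x.
    by apply: is_derive_eq; rewrite /GRing.scale/=; ring.
  have dp (x : R) : 0 <= expR x + expR (-1 * x) - 2.
    rewrite mulN1r expRN; have := expR_gt0 x; move: (expR x) => u u0.
    rewrite (_ : _ - 2 = (u - 1) ^+ 2 / u); last by field; rewrite gt_eqF.
    by rewrite divr_ge0 ?sqr_ge0// ltW.
  have zm : -1 < 0 :> R by lra.
  have := @derive_ge0_le R _ _ (-1) (fun x _ => d x) (fun x _ => dp x) 0 a zm (ltW a0).
  by rewrite !mulr0 expR0 !mulN1r; lra.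
have sh0 : 0 < sh by lra.
pose h y : R := (a ^+ 2 + y ^+ 2)^-1.
have h0 y : 0 < h y by rewrite invr_gt0 sqrD_gt0.
have mh : measurable_fun setT h by apply: continuous_measurable_fun; exact: continuous_lorentz.
have mk n : measurable_fun setT (fun y => h y * sinc y ^+ n).
  by apply: measurable_funM => //; apply: measurable_funX; exact: measurable_sinc.
have ik n : mu.-integrable setT (EFin \o (fun y => h y * sinc y ^+ n)).
  apply: (dominated_integrable_line (mk n) _ (integrable_lorentz a0)) => y.
  rewrite normrM ger0_norm ?(ltW (h0 y))// ler_piMr ?(ltW (h0 y))// normrX; apply: exprn_ile1; rewrite ?sinc_le1 ?normr_ge0//.
have key n x : n%:R <= x -> \int[mu]_y (h y * sinc y ^+ n * cos (y * x)) = pi / a * sh ^+ n * expR (- (a * x)).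
  elim: n x => [|n IH] x nx.
    rewrite expr0 mulr1 -lorentz_transform//; apply: eq_Rintegral => y _.
    by rewrite expr0 mulr1.
  have := @sinc_average (fun y => h y * sinc y ^+ n) a (pi / a * sh ^+ n) n%:R x a0 (ik n) IH.
  rewrite natr1 => /(_ nx); rewrite -/sh exprSr mulrA => <-.
  by apply: eq_Rintegral => y _; rewrite exprSr mulrA.
pose c := pi / a * sh ^+ K.
have pa0 : 0 < pi / a by rewrite divr_gt0// pi_gt0.
have c0 : 0 < c by rewrite mulr_gt0// exprn_gt0.
exists (fun y => c^-1 * (h y * sinc y ^+ K)); split.
- split=> [|y]; last by rewrite /h sqrrN sincN.
  by apply: continuousZ; apply: continuousM; [exact: continuous_lorentz|exact: continuous_sincX].
- exact: integrable_scale.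
- move=> y; rewrite !normrM normrX (ger0_norm (ltW (h0 y))) [`|c^-1|]ger0_norm ?invr_ge0 ?(ltW c0)//.
  rewrite [h y * _]mulrC mulrA ler_wpM2r ?(ltW (h0 y))// ler_wpM2r ?exprn_ge0//.
  rewrite -[a / pi]invf_div lef_pV2 ?posrE// /c ler_peMr ?(ltW pa0)// exprn_ege1//.
- move=> x Kx; transitivity (c^-1 * \int[mu]_y (h y * sinc y ^+ K * cos (y * x))).
    rewrite -RintegralZl//.
      by apply: eq_Rintegral => y _; rewrite mulrA.
    have m1 : measurable_fun setT (fun y : R => h y * sinc y ^+ K * cos (y * x)).
      apply: measurable_funM => //.
      by apply: continuous_measurable_fun; under eq_fun do rewrite mulrC; exact: continuous_cosM.
    apply: (dominated_integrable_line m1 _ (integrable_lorentz a0)) => y.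
    rewrite -mulrA normrM ger0_norm ?(ltW (h0 y))// ler_piMr ?(ltW (h0 y))//.
    by rewrite normrM; apply: mulr_ile1; rewrite ?cos_max// normrX; apply: exprn_ile1; rewrite ?sinc_le1 ?normr_ge0//.
  by rewrite key// -/c mulrA mulVf ?mul1r// gt_eqF.
Qed.

End sinc.

Lemma Rintegral_odd (R : realType) (f : R -> R) : continuous f ->
  (@lebesgue_measure R).-integrable setT (EFin \o f) -> (forall x, f (- x) = - f x) ->
  \int[@lebesgue_measure R]_x f x = 0.
Proof.
move=> cf fi fo; have [F dF] := antiderivative cf.
have FN x : F (- x) = F x.
  have dN (y : R) : is_derive y (1 : R) (fun y => F y - F (-1 * y)) (f y + f (-1 * y)).
    have h1 : is_derive y (1 : R) (fun y : R => -1 * y) (-1).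
      by apply: is_derive_eq; rewrite /GRing.scale/= mulr1.
    have h2 := @is_derive1_comp R F (fun y => -1 * y) y _ _ (dF (-1 * y)) h1.
    have h3 := dF y; apply: is_derive_eq; ring.
  have z (y : R) : f y + f (-1 * y) = 0 by rewrite mulN1r fo subrr.
  have h y : 0 <= y -> F y = F (- y).
    move=> y0; have := @derive_eq0_const R _ _ 0 y y0 dN (fun t _ => z t).
    by rewrite mulr0 subrr mulN1r => /esym/eqP; rewrite subr_eq0 => /eqP.
  have [x0|x0] := leP 0 x; first by rewrite -h.
  by have := h (- x); rewrite opprK => ->//; rewrite oppr_ge0 ltW.
apply: (integral_of_derive cf dF fi).
under eq_fun do rewrite FN subrr; exact: cvg_cst.
Qed.

(** Induction on the exponent: one sqrt q pays for one factor, by Bernoulli's inequality, and the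
    other sqrt q for the remaining factors. *)
Lemma power_le_exp (R : realType) (S : nat) (q : R) : 1 < q ->
  exists2 W, 0 < W & forall k : nat, (1 + k%:R) ^+ S <= W * q ^+ k.
Proof.
elim: S q => [|S IH] q q1; first by exists 1 => // k; rewrite expr0 mul1r exprn_ege1// ltW.
pose p := Num.sqrt q.
have p1 : 1 < p by rewrite -[X in X < _]sqrtr1 ltr_sqrt//; lra.
have pq k : p ^+ k * p ^+ k = q ^+ k by rewrite -exprMn -expr2 sqr_sqrtr//; lra.
have [W W0 hW] := IH p p1.
pose d := Num.min (p - 1) 1.
have d0 : 0 < d by rewrite lt_min subr_gt0 p1/=.
have d1 : d <= 1 by rewrite ge_min lexx orbT.
have bern k : d * (1 + k%:R) <= p ^+ k.
  elim: k => [|k IHk]; first by rewrite expr0 addr0 mulr1.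
  rewrite exprS; apply: (@le_trans _ _ (p ^+ k + d)).
    by rewrite -natr1 addrA mulrDr mulr1 lerD2r.
  have pk : 1 <= p ^+ k by rewrite exprn_ege1// ltW.
  have dp : d <= p - 1 by rewrite ge_min lexx.
  have : d <= d * p ^+ k by rewrite ler_peMr// ltW.
  have : d * p ^+ k <= (p - 1) * p ^+ k by rewrite ler_wpM2r//; lra.
  lra.
exists (d^-1 * W) => [|k]; first by rewrite mulr_gt0 ?invr_gt0.
rewrite exprS -pq (_ : _ * W * _ = (d^-1 * p ^+ k) * (W * p ^+ k)); last by ring.
apply: ler_pM => //; rewrite ?exprn_ge0 ?addr_ge0//.
by rewrite ler_pdivlMl.
Qed.

Lemma sobolev_weight_exp (R : realType) (s : R) :
  exists2 W, 0 < W & forall k : nat, (1 + k%:R ^+ 2) `^ s <= W * 2 ^+ k.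
Proof.
pose S := (Num.truncn `|s|).+1.
have [W W0 hW] := @power_le_exp R (2 * S) 2 ltac:(lra).
exists W => // k; apply: le_trans (hW k).
have w1 : 1 <= 1 + k%:R ^+ 2 :> R by rewrite lerDl sqr_ge0.
apply: (@le_trans _ _ ((1 + k%:R ^+ 2) `^ S%:R)).
  by apply: ler_powR => //; apply: le_trans (ler_norm _) (ltW (truncnS_gt _)).
rewrite powR_mulrn; last by lra.
have h : 1 + k%:R ^+ 2 <= (1 + k%:R) ^+ 2 :> R.
  by rewrite sqrrD expr1n mul1r; have : 0 <= k%:R :> R by []; lra.
by rewrite exprM; apply: lerXn2r => //; rewrite nnegrE ?sqr_ge0//; lra.
Qed.

(** A power series in z = exp (- x), whose coefficients allow radius 4. Termwise differentiation is
    applied in the disc of radius 6 / 5, which contains all values of z for x > 0. *)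
Lemma is_derive_exp_series (R : realType) (g : nat -> R) (C x : R) :
  (forall n, `|g n| <= C * 4^-1 ^+ n) -> 0 < x ->
  is_derive x (1 : R) (fun x => limn (series (fun n => g n * expR (- (n%:R * x)))))
    (- limn (series (fun n => n%:R * g n * expR (- (n%:R * x))))).
Proof.
move=> gC x0.
have C0 : 0 <= C by have := le_trans (normr_ge0 _) (gC 0%N); rewrite expr0 mulr1.
have b1 (n : nat) : n.+1%:R <= 2 * (3 / 2) ^+ n :> R.
  elim: n => [|n IH]; first by rewrite expr0; lra.
  have : 1 <= (3 / 2) ^+ n :> R by rewrite exprn_ege1//; lra.
  rewrite exprS -[n.+2%:R]natr1; lra.
have b2 (n : nat) : n.+2%:R <= 2 * (3 / 2) ^+ n :> R.
  elim: n => [|n IH]; first by rewrite expr0; lra.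
  have : 1 <= (3 / 2) ^+ n :> R by rewrite exprn_ege1//; lra.
  rewrite exprS -[n.+3%:R]natr1; lra.
(* 27 / 40 is 9 / 4 * 1 / 4 * 6 / 5, where (9 / 4) ^ n absorbs the polynomial factors of the first
   two derivatives. *)
have q1 : 0 <= (27 / 40 : R) < 1 by apply/andP; split; lra.
have conv (c : nat -> R) : (forall n, `|c n| <= 4 * C * (9 / 4 * 4^-1) ^+ n) -> cvgn (pseries c (6 / 5)).
  move=> hc; apply: (@bsum_cvg _ _ (4 * C / (1 - 27 / 40))).
  apply: (bsum_geometric q1) => n.
  rewrite normrM (ger0_norm (exprn_ge0 _ _)); last by lra.
  apply: le_trans (ler_wpM2r _ (hc n)) _; first by rewrite exprn_ge0//; lra.
  rewrite -[leLHS]mulrA -exprMn (_ : 9 / 4 * 4^-1 * (6 / 5) = 27 / 40)//; by field.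
have n94 n : (3 / 2) ^+ n <= (9 / 4) ^+ n :> R by rewrite lerXn2r ?nnegrE//; lra.
have h0 : cvgn (pseries g (6 / 5)).
  apply: conv => n; apply: le_trans (gC n) _; rewrite exprMn mulrA ler_wpM2r ?exprn_ge0//.
  rewrite [4 * C]mulrC -mulrA ler_peMr//.
  have : 1 <= (9 / 4) ^+ n :> R by rewrite exprn_ege1//; lra.
  lra.
have g1 n : `|g n.+1| <= C * 4^-1 ^+ n.
  by apply: le_trans (gC _) _; rewrite ler_wpM2l// exprS ler_piMl ?exprn_ge0//; lra.
have h1 : cvgn (pseries (pseries_diffs g) (6 / 5)).
  apply: conv => n; rewrite /pseries_diffs normrM normr_nat exprMn mulrA.
  rewrite (_ : 4 * C * _ * _ = (4 * (9 / 4) ^+ n) * (C * 4^-1 ^+ n)); last by ring.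
  apply: ler_pM => //; apply: le_trans (b1 n) _.
  by apply: ler_pM => //; rewrite ?exprn_ge0//; lra.
have h2 : cvgn (pseries (pseries_diffs (pseries_diffs g)) (6 / 5)).
  apply: conv => n; rewrite /pseries_diffs !normrM !normr_nat exprMn mulrA.
  rewrite (_ : 4 * C * _ = (4 * (9 / 4) ^+ n) * (C * 4^-1 ^+ n)); last by ring.
  apply: ler_pM => //.
    rewrite (_ : 4 * (9 / 4) ^+ n = (2 * (3 / 2) ^+ n) * (2 * (3 / 2) ^+ n)).
      by apply: ler_pM.
    by rewrite (_ : 9 / 4 = 3 / 2 * (3 / 2)) ?exprMn; [ring|field].
  by apply: le_trans (g1 _) _; rewrite ler_wpM2l// exprS ler_piMl ?exprn_ge0//; lra.
pose z (x : R) := expR (-1 * x).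
have zX n (y : R) : z y ^+ n = expR (- (n%:R * y)).
  by rewrite /z -expRM_natl; congr expR; ring.
have z1 : `|z x| < `|6 / 5|.
  rewrite (ger0_norm (expR_ge0 _)) (_ : `|6 / 5 : R| = 6 / 5); last by rewrite ger0_norm//; lra.
  apply: (@le_lt_trans _ _ 1); last by lra.
  by rewrite mulN1r -[X in _ <= X]expR0 ler_expR oppr_le0 ltW.
have d1 := pseries_snd_diffs h0 h1 h2 z1.
have d2 : is_derive x (1 : R) z (-1 * z x) := is_derive_expM (-1) x.
have := @is_derive1_comp R (fun x => limn (pseries g x)) z x _ _ d1 d2.
rewrite (_ : _ \o z = (fun x => limn (series (fun n => g n * expR (- (n%:R * x)))))); last first.
  apply/funext => y /=; rewrite /pseries/=; congr (limn (series _)); apply/funext => n.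
  by rewrite zX.
move=> d; apply: is_derive_eq d _; rewrite mulN1r mulrN; congr (- _).
have cv := is_cvg_pseries_inside h1 z1.
rewrite mulrC; apply: etrans (esym (lim_seriesZ (z x) cv)) _.
have -> : series (fun n => n%:R * g n * expR (- (n%:R * x))) =
  (fun N => if N is N'.+1 then series (fun n => z x * (pseries_diffs g n * z x ^+ n)) N' else 0).
  apply/funext => -[|N]; rewrite /series/=; first by rewrite big_geq.
  rewrite big_nat_recl// !mul0r add0r.
  by apply: eq_bigr => i _; rewrite /pseries_diffs -zX exprS; ring.
have cz : cvgn (series (z x *: [sequence pseries_diffs g i * z x ^+ i]_i)) by exact: is_cvg_seriesZ.
apply/esym/cvg_lim => //.
rewrite -cvg_shiftS/=.
exact: cz.
Qed.

(** * Extension to the cylinder *)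

Section extension.
Context {R : realType}.
Variables (T s e : R) (G : nat -> nat -> R) (C : R).
Hypotheses (T0 : 0 < T) (om1 : 2 * pi / T <= 1) (e0 : 0 < e) (e1 : e <= 1).
Hypotheses (C0 : 0 < C) (G_le : forall n j, `|G n j| <= C * 4^-1 ^+ n * 2^-1 ^+ j).
Hypothesis G_0 : forall j, G 0%N j = 0.
Let mu := @lebesgue_measure R.
Let K := (Num.truncn `|s|).+1.

Definition exp_term (n : nat) (x : R) : R := expR (- (n%:R * e * x)).
Definition exp_mode (j : nat) (x : R) : R := limn (series (fun n => G n j * exp_term n x)).

Lemma exp_term_le1 n x : 0 <= x -> exp_term n x <= 1.
Proof. by move=> x0; rewrite -[X in _ <= X]expR0 ler_expR oppr_le0 !mulr_ge0// ltW. Qed.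

Lemma mode_term_le n j x : 0 <= x -> `|G n j * exp_term n x| <= C * 2^-1 ^+ j * 4^-1 ^+ n.
Proof.
move=> x0; rewrite normrM (ger0_norm (expR_ge0 _)); apply: (@le_trans _ _ `|G n j|).
  by rewrite ler_piMr// exp_term_le1.
by rewrite mulrAC.
Qed.

Lemma quarter : 0 <= (4^-1 : R) < 1. Proof. by apply/andP; split; lra. Qed.
Lemma half : 0 <= (2^-1 : R) < 1. Proof. by apply/andP; split; lra. Qed.

Lemma mode_bsum j x : 0 <= x -> bsum (fun n => G n j * exp_term n x) (C * 2^-1 ^+ j / (1 - 4^-1)).
Proof. by move=> x0; apply: (bsum_geometric quarter) => n; exact: mode_term_le. Qed.

Lemma mode_le j x : 0 <= x -> `|exp_mode j x| <= 2 * C * 2^-1 ^+ j.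
Proof.
move=> x0; apply: le_trans (bsum_lim_le (mode_bsum j x0)) _.
rewrite ler_pdivrMr; last by lra.
by have : 0 <= C * 2^-1 ^+ j; [rewrite mulr_ge0 ?exprn_ge0// ltW|lra].
Qed.

(** Common profile of the kernels of all exponents n e: replacing n e by e only enlarges the Lorentz
    factor, and the prefactor costs at most n. *)
Let H (y : R) : R := `|sinc y| ^+ K * (e ^+ 2 + y ^+ 2)^-1.

Let lor_gt0 (y : R) : 0 < (e ^+ 2 + y ^+ 2)^-1.
Proof. by rewrite invr_gt0 sqrD_gt0. Qed.

Let H_ge0 y : 0 <= H y.
Proof. by rewrite mulr_ge0 ?exprn_ge0// ltW. Qed.

Let H_le_lor y : H y <= (e ^+ 2 + y ^+ 2)^-1.
Proof. by rewrite /H ler_piMl ?(ltW (lor_gt0 _))//; apply: exprn_ile1; rewrite ?sinc_le1. Qed.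

Let H_le y : H y <= e ^- 2.
Proof.
apply: le_trans (H_le_lor y) _.
by rewrite lef_pV2 ?posrE ?sqrD_gt0 ?exprn_gt0// lerDl sqr_ge0.
Qed.

Let cH : continuous H.
Proof.
apply: continuousM; last exact: continuous_lorentz.
by under eq_fun do rewrite -normrX; move=> y; apply: cvg_norm; exact: continuous_sincX.
Qed.

Let iH : mu.-integrable setT (EFin \o H).
Proof.
apply: (dominated_integrable_line _ _ (integrable_lorentz e0)).
  exact: continuous_measurable_fun.
by move=> y; rewrite ger0_norm.
Qed.

Let H_sqr y : H y ^+ 2 <= e ^- 2 * 2 ^+ K * ((1 + y ^+ 2) ^+ K)^-1 * (e ^+ 2 + y ^+ 2)^-1.
Proof.
rewrite /H exprMn -exprM mulnC exprM real_normK ?num_real//.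
apply: (@le_trans _ _ ((2 / (1 + y ^+ 2)) ^+ K * (e ^- 2 * (e ^+ 2 + y ^+ 2)^-1))).
  have q1 : 0 <= sinc y ^+ 2 := sqr_ge0 _.
  have q2 : 0 <= 2 / (1 + y ^+ 2) by rewrite divr_ge0// addr_ge0// sqr_ge0.
  have q3 : (sinc y ^+ 2) ^+ K <= (2 / (1 + y ^+ 2)) ^+ K.
    by apply: lerXn2r; rewrite ?nnegrE//; exact: sinc_sqr_le.
  apply: (ler_pM (exprn_ge0 _ q1) (sqr_ge0 _) q3).
  rewrite expr2 ler_wpM2r ?(ltW (lor_gt0 _))//.
  by rewrite lef_pV2 ?posrE ?sqrD_gt0 ?exprn_gt0// lerDl sqr_ge0.
rewrite exprMn exprVn le_eqVlt; apply/orP; left; apply/eqP; ring.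
Qed.

Let kernel_ex (n : nat) : exists k : R -> R,
  [/\ continuous k /\ (forall y, k (- y) = k y),
      forall y, `|k y| <= n%:R * H y &
      (0 < n)%N -> forall x, K%:R <= x -> \int[mu]_y (k y * cos (y * x)) = exp_term n x].
Proof.
case: n => [|n].
  (* Nothing has to be represented at n = 0: the corresponding coefficients vanish by [G_0]. *)
  exists (cst 0); split => //; first by split => //; exact: cst_continuous.
  by move=> y; rewrite normr0 mul0r.
have n0 : 0 < n.+1%:R :> R by rewrite ltr0n.
have ne : 0 < n.+1%:R * e by rewrite mulr_gt0.
have [k [ck _ kle kint]] := exp_kernel K ne.
exists k; split => // y.
apply: le_trans (kle y) _; rewrite /H -mulrA; apply: ler_pM => //.
- by rewrite divr_ge0 ?pi_ge0// ltW.
- by rewrite mulr_ge0 ?exprn_ge0// invr_ge0 ltW// sqrD_gt0.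
- rewrite -mulrA ler_piMr ?(ltW n0)// ler_pdivrMr ?pi_gt0// mul1r.
  by apply: (le_trans e1); apply: (@le_trans _ _ 2); [lra|exact: pi_ge2].
- rewrite ler_wpM2l ?exprn_ge0// lef_pV2 ?posrE ?sqrD_gt0//.
  rewrite lerD2r exprMn ler_peMl ?sqr_ge0// exprn_ege1// ler1n//.
Qed.

Let ka n := sval (cid (kernel_ex n)).
Let ka_cts n : continuous (ka n). Proof. by have [[]] := svalP (cid (kernel_ex n)). Qed.
Let ka_even n y : ka n (- y) = ka n y. Proof. by have [[_ h] _ _] := svalP (cid (kernel_ex n)); exact: h. Qed.
Let ka_le n y : `|ka n y| <= n%:R * H y. Proof. by have [_ h _] := svalP (cid (kernel_ex n)); exact: h. Qed.
Let ka_int n x : (0 < n)%N -> K%:R <= x -> \int[mu]_y (ka n y * cos (y * x)) = exp_term n x.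
Proof. by move=> n0; have [_ _] := svalP (cid (kernel_ex n)); exact. Qed.

Let M (k n : nat) : R := C * 2^-1 ^+ k * 2^-1 ^+ n.

Let M_ge0 k n : 0 <= M k n.
Proof. by rewrite !mulr_ge0 ?exprn_ge0// ltW. Qed.

Let bM k : bsum (M k) (2 * C * 2^-1 ^+ k).
Proof.
have -> : 2 * C * 2^-1 ^+ k = C * 2^-1 ^+ k / (1 - 2^-1).
  rewrite (_ : 1 - 2^-1 = 2^-1); last by lra.
  by rewrite invrK; ring.
by apply: (bsum_geometric half) => n; rewrite ger0_norm.
Qed.

Let term_le k n y : `|G n k * ka n y| <= `|M k n| * H y.
Proof.
rewrite (ger0_norm (M_ge0 k n)) normrM.
apply: (@le_trans _ _ ((C * 4^-1 ^+ n * 2^-1 ^+ k) * (n%:R * H y))); first exact: ler_pM.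
rewrite mulrA ler_wpM2r// /M.
rewrite (_ : C * 4^-1 ^+ n * 2^-1 ^+ k * n%:R = C * 2^-1 ^+ k * (4^-1 ^+ n * n%:R)); last by ring.
rewrite ler_wpM2l ?mulr_ge0 ?exprn_ge0 ?(ltW C0)//.
rewrite (_ : 4^-1 = 2^-1 * 2^-1 :> R) ?exprMn; last by field.
rewrite -mulrA ler_piMr ?exprn_ge0// exprVn ler_pdivrMl ?exprn_gt0// mulr1.
by rewrite -natrX ler_nat ltnW// ltn_expl.
Qed.

Definition amplitude (k : nat) (y : R) : R := limn (series (fun n => G n k * ka n y)).

Let amp_bsum k y : bsum (fun n => G n k * ka n y) (2 * C * 2^-1 ^+ k * H y).
Proof.
move=> n; apply: (@le_trans _ _ (\sum_(0 <= i < n) `|M k i| * H y)).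
  by apply: ler_sum => i _; exact: term_le.
by rewrite -mulr_suml ler_wpM2r//; exact: bM.
Qed.

Let amp_le k y : `|amplitude k y| <= 2 * C * 2^-1 ^+ k * H y.
Proof. exact: bsum_lim_le (amp_bsum k y). Qed.

Let amp_cts k : continuous (amplitude k).
Proof.
have b2 := bsumZ (e ^- 2) (@bM k).
apply: (continuous_series (M := fun n => e ^- 2 * M k n) _ _ b2).
  by move=> n; apply: continuousZ; exact: ka_cts.
move=> n y; apply: le_trans (term_le k n y) _.
have e20 : 0 <= e ^- 2 by rewrite invr_ge0 sqr_ge0.
by rewrite [leRHS]normrM (ger0_norm e20) [leLHS]mulrC ler_wpM2r.
Qed.

Let amp_even k y : amplitude k (- y) = amplitude k y.
Proof. by rewrite /amplitude; congr (limn (series _)); apply/funext => n; rewrite ka_even. Qed.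

Let amp_osc_int k (h : R -> R) : continuous h -> (forall y, `|h y| <= 1) ->
  mu.-integrable setT (EFin \o (fun y => amplitude k y * h y)).
Proof.
move=> ch h1; apply: (dominated_integrable_line _ _ (integrable_scale (2 * C * 2^-1 ^+ k) iH)).
  by apply: continuous_measurable_fun; exact: continuousM.
by move=> y; rewrite normrM; apply: le_trans (amp_le k y); rewrite ler_piMr.
Qed.

Let cosr (x : R) : continuous (fun y : R => cos (y * x)).
Proof. by under eq_fun do rewrite mulrC; exact: continuous_cosM. Qed.
Let sinr (x : R) : continuous (fun y : R => sin (y * x)).
Proof. by under eq_fun do rewrite mulrC; exact: continuous_sinM. Qed.

Let al k (x : R) : R := \int[mu]_y (amplitude k y * cos (y * x)).

Let al_mode k x : K%:R <= x -> al k x = exp_mode k x.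
Proof.
move=> Kx; rewrite /al /exp_mode.
have x0 : 0 <= x by apply: le_trans Kx.
have h1 n : measurable_fun setT (fun y => G n k * ka n y * cos (y * x)).
  by apply: continuous_measurable_fun; apply: continuousM => //; apply: continuousZ; exact: ka_cts.
have h2 n y : setT y -> `|G n k * ka n y * cos (y * x)| <= `|M k n| * H y.
  by move=> _; rewrite normrM; apply: le_trans (term_le k n y); rewrite ler_piMr// cos_max.
have [_] := @series_Rintegral R _ _ mu setT _ (M k) H _ measurableT h1 h2 (fun y _ => H_ge0 y) (@bM k) iH.
rewrite (_ : (fun n => \int[mu]_y _) = (fun n => G n k * exp_term n x)); last first.
  apply/funext => -[|n].
    under eq_Rintegral do rewrite G_0 !mul0r.
    by rewrite G_0 mul0r Rintegral_cst// mul0r.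
  rewrite -ka_int// -RintegralZl//; first by apply: eq_Rintegral => y _; rewrite mulrA.
  apply: (dominated_integrable_line _ _ (integrable_scale n.+1%:R iH)).
    by apply: continuous_measurable_fun; apply: continuousM.
  by move=> y; rewrite normrM; apply: le_trans (ka_le n.+1 y); rewrite ler_piMr// cos_max.
move=> /cvg_lim -> //; apply: eq_Rintegral => y _.
have cc := bsum_cvg (amp_bsum k y).
rewrite /amplitude mulrC; apply: etrans (esym (lim_seriesZ (cos (y * x)) cc)) _.
by congr (limn (series _)); apply/funext => n; rewrite -[LHS]/(cos (y * x) * (G n k * ka n y)) mulrC.
Qed.

Let om (k : nat) : R := 2 * pi * k%:R / T.

(** The amplitude is even, so its sine transform vanishes and the phase y x + om t separates into a
    product of functions of x and t. *)
Let mode_osc k x t : \int[mu]_y (amplitude k y * cos (y * x + om k * t) + 0 * sin (y * x + om k * t)) =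
  al k x * cos (om k * t).
Proof.
have i1 := amp_osc_int k (@cosr x) (fun y => cos_max _).
have i2 := amp_osc_int k (@sinr x) (fun y => sin_max _).
have odd0 : \int[mu]_y (amplitude k y * sin (y * x)) = 0.
  apply: Rintegral_odd => //; first by apply: continuousM.
  by move=> y; rewrite amp_even mulNr sinN mulrN.
have -> : al k x * cos (om k * t) = cos (om k * t) * al k x - sin (om k * t) * \int[mu]_y (amplitude k y * sin (y * x)).
  by rewrite odd0 mulr0 subr0 mulrC.
rewrite /al -!RintegralZl// -RintegralB//; first last.
- exact: integrable_scale.
- exact: integrable_scale.
by apply: eq_Rintegral => y _; rewrite mul0r addr0 cosD; ring.
Qed.

Let al_le k x : `|al k x| <= (2 * C * (pi / e)) * 2^-1 ^+ k.
Proof.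
rewrite (_ : _ * 2^-1 ^+ k = \int[mu]_y (2 * C * 2^-1 ^+ k * (e ^+ 2 + y ^+ 2)^-1)); last first.
  rewrite RintegralZl//; last exact: integrable_lorentz.
  by rewrite Rintegral_lorentz//; move: (pi / e) => p; ring.
apply: Rintegral_dominated_le.
- by apply: continuous_measurable_fun; apply: continuousM.
- move=> y; rewrite normrM; apply: (@le_trans _ _ `|amplitude k y|); first by rewrite ler_piMr ?cos_max.
  apply: le_trans (amp_le k y) _; rewrite ler_wpM2l ?mulr_ge0 ?exprn_ge0//; exact: ltW.
- by apply: integrable_scale; exact: integrable_lorentz.
Qed.

Let s_le_K : s <= K%:R.
Proof. by apply: le_trans (ler_norm _) (ltW (truncnS_gt _)). Qed.

(** The Sobolev weight is bounded by (1 + y ^ 2) ^ K, which the sinc factors of the squared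
    amplitude compensate, times a multiple of 2 ^ k, to be set against 4 ^ (- k) from the
    coefficients. *)
Let weight_le k (y : R) W : (forall k : nat, (1 + k%:R ^+ 2) `^ `|s| <= W * 2 ^+ k) ->
  (1 + y ^+ 2 + (om k) ^+ 2) `^ s * (amplitude k y ^+ 2 + 0 ^+ 2) <=
  (W * (2 * C) ^+ 2 * e ^- 2 * 2 ^+ K) * 2^-1 ^+ k * (e ^+ 2 + y ^+ 2)^-1.
Proof.
move=> hW; rewrite [0 ^+ 2]expr0n addr0.
have p1 (x : R) : 1 <= 1 + x ^+ 2 by rewrite lerDl sqr_ge0.
have p0 (x : R) : 0 < 1 + x ^+ 2 by rewrite ltr_pwDl ?sqr_ge0.
have omk : om k ^+ 2 <= k%:R ^+ 2.
  have ok : 0 <= om k by rewrite /om divr_ge0 ?mulr_ge0 ?pi_ge0// ltW.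
  rewrite lerXn2r ?nnegrE// /om mulrAC -[leRHS]mul1r ler_wpM2r//.
have s1 : (1 + y ^+ 2 + om k ^+ 2) `^ s <= ((1 + y ^+ 2) ^+ K) * (W * 2 ^+ k).
  apply: (@le_trans _ _ ((1 + y ^+ 2 + om k ^+ 2) `^ `|s|)).
    by apply: ler_powR (ler_norm _); have := sqr_ge0 y; have := sqr_ge0 (om k); lra.
  apply: (@le_trans _ _ (((1 + y ^+ 2) * (1 + k%:R ^+ 2)) `^ `|s|)).
    have q1 := sqr_ge0 y; have q2 := sqr_ge0 (om k).
    have q3 := mulr_ge0 (sqr_ge0 y) (sqr_ge0 (k%:R : R)).
    have q4 := mulr_ge0 (ltW (p0 y)) (ltW (p0 k%:R)).
    by apply: ge0_ler_powR; rewrite ?nnegrE//; move: omk; lra.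
  rewrite powRM ?(ltW (p0 _))//; apply: ler_pM; rewrite ?powR_ge0//.
  rewrite -[X in _ <= X]powR_mulrn ?(ltW (p0 _))//; apply: ler_powR => //.
  exact: ltW (truncnS_gt _).
have s2 : amplitude k y ^+ 2 <= (2 * C * 2^-1 ^+ k) ^+ 2 * H y ^+ 2.
  rewrite -exprMn -[leLHS](real_normK (num_real _)); apply: lerXn2r; rewrite ?nnegrE//.
  exact: le_trans (normr_ge0 _) (amp_le k y).
apply: le_trans (ler_pM (powR_ge0 _ _) (sqr_ge0 _) s1 s2) _.
have W0 : 0 <= W by have := le_trans (powR_ge0 _ _) (hW 0%N); rewrite expr0 mulr1.
apply: le_trans (ler_wpM2l _ (ler_wpM2l _ (H_sqr y))) _.
- by rewrite mulr_ge0 ?exprn_ge0 ?(ltW (p0 _))// mulr_ge0// exprn_ge0.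
- exact: sqr_ge0.
rewrite le_eqVlt; apply/orP; left; apply/eqP.
have pK : (1 + y ^+ 2) ^+ K != 0 by rewrite expf_neq0// gt_eqF.
have -> : (2 ^+ k : R) = (2^-1 ^+ k)^-1 by rewrite exprVn invrK.
have h0 : (2^-1 ^+ k : R) != 0 by rewrite expf_neq0//.
rewrite exprMn; move: pK h0; move: ((1 + y ^+ 2) ^+ K) (2^-1 ^+ k) (e ^- 2) ((e ^+ 2 + y ^+ 2)^-1) (2 ^+ K) => q1 q2 q3 q4 q5 q10 q20.
by field; rewrite ?q10 ?q20.
Qed.

Lemma cylinder_extension : exists2 U : R -> R -> R, Hs_cylinder s T U &
  forall x t, K%:R <= x -> limn (series (fun k => exp_mode k x * cos (om k * t))) = U x t.
Proof.
exists (fun x t => limn (series (fun k => al k x * cos (om k * t)))); last first.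
  by move=> x t Kx; congr (limn (series _)); apply/funext => k; rewrite al_mode.
have mw k : measurable_fun setT (fun y : R => (1 + y ^+ 2 + (om k) ^+ 2) `^ s * (amplitude k y ^+ 2 + 0 ^+ 2)).
  apply: measurable_funM; last first.
    apply: continuous_measurable_fun; apply: continuousD; last exact: cst_continuous.
    exact: (continuousM (@amp_cts k) (@amp_cts k)).
  apply: (measurableT_comp (measurable_powR s)).
  apply: continuous_measurable_fun => x; apply: cvgD; last exact: cvg_cst.
  apply: cvgD; first exact: cvg_cst.
  exact: (@exprn_continuous R 2 x).
exists amplitude, (fun _ _ => 0); split.
- by move=> k; apply: continuous_measurable_fun.
- by move=> k; exact: measurable_cst.
- have [W W0 hW] := sobolev_weight_exp `|s|.
  pose c : R := W * (2 * C) ^+ 2 * e ^- 2 * 2 ^+ K.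
  have c0 : 0 <= c.
    apply: mulr_ge0; last exact: exprn_ge0.
    apply: mulr_ge0; last by rewrite invr_ge0 sqr_ge0.
    by apply: mulr_ge0; [exact: ltW|exact: sqr_ge0].
  have Ik k : (\int[mu]_y ((1 + y ^+ 2 + (om k) ^+ 2) `^ s * (amplitude k y ^+ 2 + 0 ^+ 2))%:E <=
      (c * (pi / e) * 2^-1 ^+ k)%:E)%E.
    have -> : (c * (pi / e) * 2^-1 ^+ k)%:E = (\int[mu]_y (c * 2^-1 ^+ k * (e ^+ 2 + y ^+ 2)^-1)%:E)%E.
      under eq_integral do rewrite EFinM.
      rewrite ge0_integralZl//.
      + by rewrite integral_lorentz// -EFinM; congr EFin; move: (pi / e) => p; ring.
      + by apply/measurable_EFinP; apply: continuous_measurable_fun; exact: continuous_lorentz.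
      + by move=> y _; rewrite lee_fin ltW.
      + by rewrite lee_fin mulr_ge0// exprn_ge0.
    apply: ge0_le_integral => //.
    + by move=> y _; rewrite lee_fin mulr_ge0 ?powR_ge0// addr_ge0// sqr_ge0.
    + by apply/measurable_EFinP; exact: mw.
    + apply/measurable_EFinP; apply: continuous_measurable_fun.
      by apply: continuousZ; exact: continuous_lorentz.
    + by move=> y _; rewrite lee_fin; exact: weight_le.
  have pe : 0 <= pi / e by rewrite divr_ge0 ?pi_ge0// ltW.
  apply: (@le_lt_trans _ _ ((c * (pi / e)) / (1 - 2^-1))%:E); last exact: ltry.
  apply: lime_le.
    by apply: is_cvg_nneseries => k _ _; apply: integral_ge0 => y _; rewrite lee_fin mulr_ge0 ?powR_ge0// addr_ge0// sqr_ge0.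
  apply: nearW => n.
  apply: (@le_trans _ _ (\sum_(0 <= k < n) (c * (pi / e) * 2^-1 ^+ k)%:E)%E).
    by apply: lee_sum => k _; exact: Ik.
  rewrite sumEFin lee_fin -mulr_sumr; apply: (ler_wpM2l (mulr_ge0 c0 pe)).
  exact: (sum_geometric_le n half).
- move=> x t.
  have b : bsum (fun k => al k x * cos (om k * t)) (2 * C * (pi / e) / (1 - 2^-1)).
    apply: (bsum_geometric half) => k; rewrite normrM.
    by apply: le_trans (al_le k x); rewrite ler_piMr// cos_max.
  rewrite (_ : (fun k => \int[mu]_y _) = (fun k => al k x * cos (om k * t))).
    exact: bsum_cvgP b.
  by apply/funext => k; exact: mode_osc.
Qed.

End extension.

(** * The wave equation for the constructed series *)

Section parameter_integrals.
Context {R : realType}.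
Let mu := @lebesgue_measure R.

Definition jcont (k : R -> R -> R) : Prop := continuous (fun p : R * R => k p.1 p.2).

Lemma jcont_t k x : jcont k -> continuous (k x).
Proof.
move=> ck t; apply: (@continuous_comp _ _ _ (fun t : R => (x, t)) (fun p : R * R => k p.1 p.2)); last exact: ck.
move=> P [[A B] [/= Ax Bt] AB]; apply: filterS Bt => t' Bt'; apply: AB.
by split => //=; exact: nbhs_singleton Ax.
Qed.

Lemma jcont_x k t : jcont k -> continuous (k^~ t).
Proof.
move=> ck x; apply: (@continuous_comp _ _ _ (fun x : R => (x, t)) (fun p : R * R => k p.1 p.2)); last exact: ck.
move=> P [[A B] [/= Ax Bt] AB]; apply: filterS Ax => x' Ax'; apply: AB.
by split => //=; exact: nbhs_singleton Bt.
Qed.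

Lemma jcontM k h : jcont k -> jcont h -> jcont (fun x t => k x t * h x t).
Proof. by move=> ck ch p; apply: cvgM; [exact: ck|exact: ch]. Qed.

Lemma jcontD k h : jcont k -> jcont h -> jcont (fun x t => k x t + h x t).
Proof. by move=> ck ch p; apply: cvgD; [exact: ck|exact: ch]. Qed.

Lemma jcontB k h : jcont k -> jcont h -> jcont (fun x t => k x t - h x t).
Proof. by move=> ck ch p; apply: cvgB; [exact: ck|exact: ch]. Qed.

Lemma jcont_fst (h : R -> R) : continuous h -> jcont (fun x _ => h x).
Proof. by move=> ch p; apply: (@continuous_comp _ _ _ fst h); [exact: cvg_fst|exact: ch]. Qed.

Lemma jcont_snd (h : R -> R) : continuous h -> jcont (fun _ t => h t).
Proof. by move=> ch p; apply: (@continuous_comp _ _ _ snd h); [exact: cvg_snd|exact: ch]. Qed.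

Lemma jcont_comp (h : R -> R) k : continuous h -> jcont k -> jcont (fun x t => h (k x t)).
Proof.
by move=> ch ck p; apply: (@continuous_comp _ _ _ (fun p : R * R => k p.1 p.2) h); [exact: ck|exact: ch].
Qed.

Lemma jcont_sum (F : nat -> R -> R -> R) m n : (forall i, jcont (F i)) ->
  jcont (fun x t => \sum_(m <= i < n) F i x t).
Proof. by move=> cF; apply: (@continuous_sum R (R * R)%type (fun i p => F i p.1 p.2) m n) => i; exact: cF. Qed.

Lemma jcont_bound k (a b c d : R) : jcont k ->
  exists M, forall x t, a <= x <= b -> c <= t <= d -> `|k x t| <= M.
Proof.
move=> ck.
have cK : compact (`[a, b] `*` `[c, d])%classic.
  by apply: compact_setX; exact: segment_compact.
have := @continuous_compact _ _ (fun p : R * R => k p.1 p.2) _ (continuous_subspaceT ck) cK.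
move=> /compact_bounded[M [_ hM]]; exists (M + 1) => x t xab tcd.
by apply: (hM (M + 1)); [rewrite ltrDl|exists (x, t)].
Qed.

Variables (c d : R).
Let D : set R := `[c, d]%classic.

Let mD : measurable D. Proof. exact: measurable_itv. Qed.

Let int_cst (M : R) : mu.-integrable D (EFin \o cst M).
Proof. by apply: cts_integrable; exact: cst_continuous. Qed.

Lemma continuous_param k : jcont k -> continuous (fun x => \int[mu]_(t in D) k x t).
Proof.
move=> ck x; have [M hM] := @jcont_bound k (x - 1) (x + 1) c d ck.
have := @continuity_under_integral R _ _ mu k D mD (x - 1) (x + 1)
  (fun y _ => @cts_integrable R (k y) c d (@jcont_t k y ck)) _ (cst M) (int_cst M) _ x.
apply.
- by apply: aeW => t _ y _; exact: jcont_x.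
- move=> y; rewrite /= in_itv/= => /andP[y1 y2]; apply: aeW => t.
  rewrite /D /= in_itv/= => tcd; apply: hM => //.
  by rewrite (ltW y1) (ltW y2).
- by rewrite inE/= in_itv/=; apply/andP; split; lra.
Qed.

Lemma is_derive_param k k' (x : R) : jcont k -> jcont k' ->
  (forall x t : R, is_derive x (1 : R) (k^~ t) (k' x t)) ->
  is_derive x (1 : R) (fun x => \int[mu]_(t in D) k x t) (\int[mu]_(t in D) k' x t).
Proof.
move=> ck ck' dk; have [M hM] := @jcont_bound k' (x - 1) (x + 1) c d ck'.
have p1 y t : partial1of2 k y t = k' y t by exact: is_derive_derive1.
have xI : `]x - 1, x + 1[%classic x by rewrite /= in_itv/=; apply/andP; split; lra.
have h1 : forall y t, `]x - 1, x + 1[%classic y -> D t -> derivable (k^~ t) y 1.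
  by move=> y t _ _; exact: is_derive_derivable (dk y t).
have h2 : forall y t, `]x - 1, x + 1[%classic y -> D t -> `|partial1of2 k y t| <= `|M|.
  move=> y t; rewrite /D /= !in_itv/= => /andP[y1 y2] tcd; rewrite p1.
  by apply: le_trans (ler_norm _); apply: hM => //; rewrite (ltW y1) (ltW y2).
have M0 (t : R) : 0 <= cst `|M| t by rewrite /=.
have ik := fun y (_ : `]x - 1, x + 1[%classic y) => @cts_integrable R (k y) c d (@jcont_t k y ck).
have := @derivable_under_integral R _ _ mu k D mD x (x - 1) (x + 1) xI ik h1 (cst `|M|) M0 (int_cst _) h2.
move=> /derivable_is_derive; rewrite (@differentiation_under_integral R _ _ mu k D mD x (x - 1) (x + 1) xI ik h1 (cst `|M|) M0 (int_cst _) h2).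
by congr (is_derive _ _ _ _); apply: eq_Rintegral => t _; rewrite p1.
Qed.

End parameter_integrals.

Lemma Rintegral_linear (R : realType) (f g h : R -> R) (a b c d : R) :
  continuous f -> continuous g -> continuous h ->
  \int[@lebesgue_measure R]_(t in `[a, b]) (c * f t - c * g t + d * h t) =
  c * \int[@lebesgue_measure R]_(t in `[a, b]) f t -
  c * \int[@lebesgue_measure R]_(t in `[a, b]) g t +
  d * \int[@lebesgue_measure R]_(t in `[a, b]) h t.
Proof.
move=> cf cg ch.
rewrite cts_RintegralD; [|by apply: continuousB; exact: continuousZ|exact: continuousZ].
by rewrite cts_RintegralB; [rewrite !cts_RintegralZ|exact: continuousZ..].
Qed.

#[global] Arguments Rintegral_linear {R} [f g h] a b c d.

(** * Separated exponentials against a periodic test function *)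

Section separated_wave.
Context {R : realType}.
Let mu := @lebesgue_measure R.
Variables (T x0 om r : R) (phi : R -> R -> R).
Hypotheses (T0 : 0 < T) (omT : cos (om * T) = 1) (omT' : sin (om * T) = 0).
Hypothesis sphi : smooth2 phi.
Hypothesis per : forall x t, phi x (t + T) = phi x t.

Let ph : jcont phi. Proof. by have [] := sphi [::]. Qed.
Let phx : jcont (dx phi). Proof. by have [] := sphi [:: true]. Qed.
Let phxx : jcont (dx (dx phi)). Proof. by have [] := sphi [:: true; true]. Qed.
Let pht : jcont (dt phi). Proof. by have [] := sphi [:: false]. Qed.
Let phtt : jcont (dt (dt phi)). Proof. by have [] := sphi [:: false; false]. Qed.

Lemma smooth2_dx x t : is_derive x (1 : R) (phi^~ t) (dx phi x t).
Proof. by have [_ h _] := sphi [::]; exact: derivable_is_derive (h x t). Qed.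
Lemma smooth2_dxx x t : is_derive x (1 : R) ((dx phi)^~ t) (dx (dx phi) x t).
Proof. by have [_ h _] := sphi [:: true]; exact: derivable_is_derive (h x t). Qed.
Lemma smooth2_dt x t : is_derive t (1 : R) (phi x) (dt phi x t).
Proof. by have [_ _ h] := sphi [::]; exact: derivable_is_derive (h x t). Qed.
Lemma smooth2_dtt x t : is_derive t (1 : R) (dt phi x) (dt (dt phi) x t).
Proof. by have [_ _ h] := sphi [:: false]; exact: derivable_is_derive (h x t). Qed.

Let phi0T x : phi x T = phi x 0. Proof. by rewrite -[T]add0r per. Qed.

Let phit0T x : dt phi x T = dt phi x 0.
Proof.
have h : is_derive (0 : R) (1 : R) (fun t => phi x (t + T)) (dt phi x (0 + T)).
  apply: (is_derive_translate (f := phi x) (df := dt phi x)); exact: smooth2_dt.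
rewrite -[T in LHS]add0r -(is_derive_derive1 h) -(is_derive_derive1 (smooth2_dt x 0)).
rewrite (_ : (fun t => phi x (t + T)) = phi x)//; apply/funext => t; exact: per.
Qed.

Let cc := continuous_cosM om.
Let cs := continuous_sinM om.

Lemma time_by_parts x : \int[mu]_(t in `[0, T]) (cos (om * t) * dt (dt phi) x t) =
  - om ^+ 2 * \int[mu]_(t in `[0, T]) (cos (om * t) * phi x t).
Proof.
have T00 := ltW T0.
have cd : continuous (fun t : R => - (om * sin (om * t))).
  by move=> t; apply: cvgN; exact: (@continuousZ R om _ cs t).
rewrite (Rintegral_by_parts T00 cd (@jcont_t R _ x phtt) (fun t _ => is_derive_cosM om t) (fun t _ => smooth2_dtt x t)).
rewrite omT mulr0 cos0 !mul1r phit0T subrr sub0r.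
have -> : \int[mu]_(t in `[0, T]) (- (om * sin (om * t)) * dt phi x t) =
    (- om) * \int[mu]_(t in `[0, T]) (sin (om * t) * dt phi x t).
  rewrite -cts_RintegralZ; last by apply: continuousM => //; exact: jcont_t.
  by apply: eq_Rintegral => t _; ring.
have cd' : continuous (fun t : R => om * cos (om * t)) by exact: (@continuousZ R om _ cc).
rewrite (Rintegral_by_parts T00 cd' (@jcont_t R _ x pht) (fun t _ => is_derive_sinM om t) (fun t _ => smooth2_dt x t)).
rewrite omT' mulr0 sin0 !mul0r subrr sub0r.
have -> : \int[mu]_(t in `[0, T]) (om * cos (om * t) * phi x t) =
    om * \int[mu]_(t in `[0, T]) (cos (om * t) * phi x t).
  rewrite -cts_RintegralZ; last by apply: continuousM => //; exact: jcont_t.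
  by apply: eq_Rintegral => t _; ring.
ring.
Qed.

Let Phi (x : R) : R := \int[mu]_(t in `[0, T]) (cos (om * t) * phi x t).
Let Phi1 (x : R) : R := \int[mu]_(t in `[0, T]) (cos (om * t) * dx phi x t).
Let Phi2 (x : R) : R := \int[mu]_(t in `[0, T]) (cos (om * t) * dx (dx phi) x t).

Let jc k : jcont k -> jcont (fun x t => cos (om * t) * k x t).
Proof. by move=> ck; apply: jcontM => //; exact: jcont_snd. Qed.

Let dPhi (x : R) : is_derive x (1 : R) Phi (Phi1 x).
Proof.
apply: (@is_derive_param R 0 T (fun x t => cos (om * t) * phi x t) (fun x t => cos (om * t) * dx phi x t) x); [exact: jc..|].
by move=> y t; have h := smooth2_dx y t; apply: is_derive_eq.
Qed.

Let dPhi1 (x : R) : is_derive x (1 : R) Phi1 (Phi2 x).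
Proof.
apply: (@is_derive_param R 0 T (fun x t => cos (om * t) * dx phi x t) (fun x t => cos (om * t) * dx (dx phi) x t) x); [exact: jc..|].
by move=> y t; have h := smooth2_dxx y t; apply: is_derive_eq.
Qed.

Variables (a b l q : R).
Hypotheses (la : l < a) (bq : b < q) (lq : l <= q).
Hypothesis supp : forall x t, ~~ (a <= x <= b) -> phi x t = 0.

Let outside x : x = l \/ x = q -> \forall y \near x, ~~ (a <= y <= b).
Proof.
case=> ->; near=> y; rewrite negb_and -!ltNge.
  by apply/orP; left; near: y; exact: lt_nbhsl.
by apply/orP; right; near: y; exact: lt_nbhsr.
Unshelve. all: end_near. Qed.

Let Phi_end x : x = l \/ x = q -> Phi x = 0.
Proof.
move=> /outside/nbhs_singleton xab; rewrite /Phi; under eq_Rintegral do rewrite supp// mulr0.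
by rewrite Rintegral_cst// mul0r.
Qed.

Let Phi1_end x : x = l \/ x = q -> Phi1 x = 0.
Proof.
move=> /outside xab; rewrite /Phi1.
have z t : dx phi x t = 0.
  apply: is_derive_derive1; apply: (@near_eq_is_derive _ _ _ (cst 0 : R -> R)).
  by apply: filterS xab => y /supp->.
under eq_Rintegral do rewrite z mulr0.
by rewrite Rintegral_cst// mul0r.
Qed.

Let E (x : R) : R := expR (- r * x).
Let cE : continuous E. Proof. exact: is_derive_continuous (is_derive_expM (- r)). Qed.

Lemma space_by_parts : \int[mu]_(x in `[l, q]) (E x * Phi2 x) = r ^+ 2 * \int[mu]_(x in `[l, q]) (E x * Phi x).
Proof.
have c1 : continuous (fun x => - r * E x) by exact: continuousZ.
have cP2 : continuous Phi2 by exact: (continuous_param (jc phxx)).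
have cP1 : continuous Phi1 by exact: (continuous_param (jc phx)).
have cP : continuous Phi by exact: (continuous_param (jc ph)).
rewrite (Rintegral_by_parts lq c1 cP2 (fun x _ => is_derive_expM (- r) x) (fun x _ => dPhi1 x)).
rewrite !Phi1_end; [|by left|by right]; rewrite !mulr0 subrr sub0r.
have -> : \int[mu]_(x in `[l, q]) (- r * E x * Phi1 x) = (- r) * \int[mu]_(x in `[l, q]) (E x * Phi1 x).
  by rewrite -cts_RintegralZ; [apply: eq_Rintegral => x _; rewrite mulrA|exact: continuousM].
rewrite (Rintegral_by_parts lq c1 cP1 (fun x _ => is_derive_expM (- r) x) (fun x _ => dPhi x)).
rewrite !Phi_end; [|by left|by right]; rewrite !mulr0 subrr sub0r.
have -> : \int[mu]_(x in `[l, q]) (- r * E x * Phi x) = (- r) * \int[mu]_(x in `[l, q]) (E x * Phi x).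
  by rewrite -cts_RintegralZ; [apply: eq_Rintegral => x _; rewrite mulrA|exact: continuousM].
ring.
Qed.

(** Two integrations by parts in t, with boundary terms cancelling by periodicity, and two in x,
    with boundary terms vanishing because the support lies strictly inside [[l, q]]. For r = n e the
    factor r ^ 2 + om ^ 2 is [mode_symbol] plus 1, the 1 coming from the linear part of f. *)
Lemma separated_wave :
  \int[mu]_(x in `[l, q]) \int[mu]_(t in `[0, T])
    (E x * cos (om * t) * (dt (dt phi) x t - dx (dx phi) x t) +
     (r ^+ 2 + om ^+ 2) * (E x * cos (om * t)) * phi x t) = 0.
Proof.
have cP2 : continuous Phi2 by exact: (continuous_param (jc phxx)).
have cP : continuous Phi by exact: (continuous_param (jc ph)).
rewrite [LHS](_ : _ = \int[mu]_(x in `[l, q]) (r ^+ 2 * (E x * Phi x) - E x * Phi2 x)).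
  rewrite cts_RintegralB; [|by apply: continuousZ; exact: continuousM|exact: continuousM].
  by rewrite cts_RintegralZ ?space_by_parts ?subrr//; exact: continuousM.
suff key (x : R) : \int[mu]_(t in `[0, T])
    (E x * cos (om * t) * (dt (dt phi) x t - dx (dx phi) x t) +
     (r ^+ 2 + om ^+ 2) * (E x * cos (om * t)) * phi x t) = r ^+ 2 * (E x * Phi x) - E x * Phi2 x.
  by apply: eq_Rintegral => x _; exact: key.
have c1 : continuous (fun t => cos (om * t) * dt (dt phi) x t) by exact: jcont_t (jc phtt).
have c2 : continuous (fun t => cos (om * t) * dx (dx phi) x t) by exact: jcont_t (jc phxx).
have c3 : continuous (fun t => cos (om * t) * phi x t) by exact: jcont_t (jc ph).
transitivity (\int[mu]_(t in `[0, T]) (E x * (cos (om * t) * dt (dt phi) x t) - E x * (cos (om * t) * dx (dx phi) x t)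
   + ((r ^+ 2 + om ^+ 2) * E x) * (cos (om * t) * phi x t))).
  by apply: eq_Rintegral => t _; ring.
apply: etrans (Rintegral_linear 0 T (E x) ((r ^+ 2 + om ^+ 2) * E x) c1 c2 c3) _.
have lin (i1 i2 i3 u : R) : i1 = - om ^+ 2 * i3 ->
    u * i1 - u * i2 + (r ^+ 2 + om ^+ 2) * u * i3 = r ^+ 2 * (u * i3) - u * i2.
  by move=> ->; ring.
exact: (lin _ (Phi2 x) (Phi x) (E x) (time_by_parts x)).
Qed.

End separated_wave.

(** * Iterated integrals over a rectangle *)

Section double_integrals.
Context {R : realType}.
Let mu := @lebesgue_measure R.
Variables (c d l q : R).
Hypotheses (cd : c <= d) (lq : l <= q).
Local Notation II k := (\int[mu]_(x in `[l, q]) \int[mu]_(t in `[c, d]) k x t).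

Lemma iterated_integralD (k h : R -> R -> R) : jcont k -> jcont h ->
  II (fun x t => k x t + h x t) = II k + II h.
Proof.
move=> ck ch; rewrite -cts_RintegralD; [|exact: continuous_param..].
apply: eq_Rintegral => x _; rewrite cts_RintegralD//; exact: jcont_t.
Qed.

Lemma iterated_integralZ (a : R) (k : R -> R -> R) : jcont k ->
  II (fun x t => a * k x t) = a * II k.
Proof.
move=> ck; rewrite -cts_RintegralZ; last exact: continuous_param.
apply: eq_Rintegral => x _; rewrite cts_RintegralZ//; exact: jcont_t.
Qed.

Lemma iterated_integral_sum0 (F : nat -> R -> R -> R) n : (forall i, jcont (F i)) ->
  (forall i, II (F i) = 0) -> II (fun x t => \sum_(0 <= i < n) F i x t) = 0.
Proof.
move=> cF F0; elim: n => [|n IH].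
  under eq_Rintegral do under eq_Rintegral do rewrite big_geq//.
  under eq_Rintegral do rewrite Rintegral_cst// mul0r.
  by rewrite Rintegral_cst// mul0r.
under eq_Rintegral do under eq_Rintegral do rewrite big_nat_recr//=.
by rewrite iterated_integralD ?IH ?F0 ?addr0//; exact: jcont_sum.
Qed.

Lemma iterated_integral_le (k : R -> R -> R) (M : R) : jcont k ->
  (forall x t, l <= x <= q -> c <= t <= d -> `|k x t| <= M) ->
  `|II k| <= M * (d - c) * (q - l).
Proof.
move=> ck kM; apply: Rintegral_norm_le => //; first exact: continuous_param.
move=> x xlq; apply: Rintegral_norm_le => //; first exact: jcont_t.
by move=> t tcd; exact: kM.
Qed.

Lemma iterated_integral_cvg (F : nat -> R -> R -> R) (f : R -> R -> R) (M : R) :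
  (forall n, jcont (F n)) ->
  (forall n x t, l <= x <= q -> c <= t <= d -> `|F n x t| <= M) ->
  (forall x t, l <= x <= q -> c <= t <= d -> F n x t @[n --> \oo] --> f x t) ->
  (fun n => II (F n)) @ \oo --> II f.
Proof.
move=> cF FM Ff.
have cst_int a b (m : R) : mu.-integrable `[a, b] (EFin \o cst m).
  by apply: cts_integrable; exact: cst_continuous.
have inner x : l <= x <= q -> (\int[mu]_(t in `[c, d]) F n x t) @[n --> \oo] --> \int[mu]_(t in `[c, d]) f x t.
  move=> xlq; apply: (@dominated_Rintegral R _ _ mu `[c, d]%classic _ _ (cst M)) => //.
  - by move=> n; apply: measurable_funTS; apply: continuous_measurable_fun; exact: jcont_t.
  - by move=> t; rewrite /= in_itv/=; exact: Ff.
  - by move=> n t; rewrite /= in_itv/=; exact: FM.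
apply: (@dominated_Rintegral R _ _ mu `[l, q]%classic (fun n x => \int[mu]_(t in `[c, d]) F n x t) _ (cst (M * (d - c)))) => //.
- by move=> n; apply: measurable_funTS; apply: continuous_measurable_fun; exact: continuous_param.
- move=> n x; rewrite /= in_itv/= => xlq; apply: Rintegral_norm_le => //; first exact: jcont_t.
  by move=> t; exact: FM.
Qed.

End double_integrals.

Lemma geometric_tail (R : realType) (g : nat -> R) (B : R) N : (forall n, `|g n| <= B * 4^-1 ^+ n) ->
  `|limn (series g) - series g N| <= 2 * B * 4^-1 ^+ N.
Proof.
move=> gB; have b := bsum_geometric (@quarter R) gB.
have B0 : 0 <= B by have := le_trans (normr_ge0 _) (gB 0%N); rewrite expr0 mulr1.
apply: (@cvgn_norm_ler _ (fun n => series g (n + N)%N - series g N)).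
  by apply: cvgB; [rewrite (cvg_shiftn N); exact: bsum_cvgP b|exact: cvg_cst].
move=> n; rewrite /series/= [X in X - _](big_cat_nat (leq0n N) (leq_addl n N))/= addrAC subrr add0r.
rewrite -{1}[N]add0n big_addn addnK.
apply: le_trans (ler_norm_sum _ _ _) _.
apply: (@le_trans _ _ (\sum_(0 <= i < n) (B * 4^-1 ^+ N) * 4^-1 ^+ i)).
  by apply: ler_sum => i _; apply: le_trans (gB _) _; rewrite exprD (_ : B * (4^-1 ^+ i * 4^-1 ^+ N) = B * 4^-1 ^+ N * 4^-1 ^+ i)//; ring.
rewrite -mulr_sumr; have := sum_geometric_le n (@quarter R).
have BN : 0 <= B * 4^-1 ^+ N by rewrite mulr_ge0// exprn_ge0.
rewrite (_ : (1 - 4^-1)^-1 = 4 / 3 :> R); last by field.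
move=> h; apply: (le_trans (ler_wpM2l BN h)); lra.
Qed.

(** * Passage to the limit in the weak equation *)

Section modal_solution.
Context {R : realType}.
Variables (T : R) (P f : R -> R) (G : nat -> nat -> R) (C : R).
Hypotheses (T1 : 2 * pi < T) (T2 : T < 5 / 2 * pi) (cP : continuous P).
Hypothesis fE : forall y, f y = y + P y.
Let om (k : nat) : R := 2 * pi * k%:R / T.
Let e := eps T.
Let T0 : 0 < T := period_gt0 T1.
Let e0 : 0 < e := eps_gt0 T1 T2.
Let mu := @lebesgue_measure R.
Hypotheses (C0 : 0 < C) (G_le : forall n j, `|G n j| <= C * 4^-1 ^+ n * 2^-1 ^+ j).
Hypothesis G_rem : forall N x t, 0 <= x ->
  `|P (\sum_(0 <= n < N.+2) \sum_(0 <= j < N.+2) G n j * expR (- (n%:R * e * x)) * cos (j%:R * t))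
    - \sum_(0 <= n < N.+2) \sum_(0 <= j < N.+2)
        mode_symbol e (om 1) n j * G n j * expR (- (n%:R * e * x)) * cos (j%:R * t)|
  <= C * 2^-1 ^+ N.+2.
Local Notation E := (exp_term e).
Local Notation mode := (exp_mode e G).

Definition modal_solution (x t : R) : R := limn (series (fun k => mode k x * cos (om k * t))).
Local Notation u := modal_solution.

(** The equation is verified on these finite sums, so no derivative of the infinite double series
    has to be taken. *)
Let v (N : nat) (x t : R) : R := \sum_(0 <= n < N.+2) \sum_(0 <= j < N.+2) G n j * (E n x * cos (om j * t)).

Let rem (N : nat) (x t : R) : R := P (v N x t) -
  \sum_(0 <= n < N.+2) \sum_(0 <= j < N.+2) mode_symbol e (om 1) n j * (G n j * (E n x * cos (om j * t))).

Let cosom j t : cos (om j * t) = cos (j%:R * (om 1 * t)).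
Proof. by rewrite /om mulr1; congr cos; ring. Qed.

Let rem_le N x t : 0 <= x -> `|rem N x t| <= C * 2^-1 ^+ N.+2.
Proof.
move=> x0; have := G_rem N (om 1 * t) x0; rewrite /rem.
have -> : v N x t = \sum_(0 <= n < N.+2) \sum_(0 <= j < N.+2)
    G n j * expR (- (n%:R * e * x)) * cos (j%:R * (om 1 * t)).
  by apply: eq_bigr => n _; apply: eq_bigr => j _; rewrite cosom mulrA.
rewrite (_ : \sum_(0 <= n < N.+2) \sum_(0 <= j < N.+2) mode_symbol e (om 1) n j * (G n j * (E n x * cos (om j * t))) =
  \sum_(0 <= n < N.+2) \sum_(0 <= j < N.+2)
        mode_symbol e (om 1) n j * G n j * expR (- (n%:R * e * x)) * cos (j%:R * (om 1 * t)))//.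
by apply: eq_bigr => n _; apply: eq_bigr => j _; rewrite cosom !mulrA.
Qed.

Let v_swap N x t : v N x t = \sum_(0 <= j < N.+2) series (fun n => G n j * E n x) N.+2 * cos (om j * t).
Proof.
rewrite /v exchange_big_nat/=; apply: eq_bigr => j _; rewrite /series/= mulr_suml.
by apply: eq_bigr => n _; rewrite mulrA.
Qed.

Let c_le j x : 0 <= x -> `|mode j x| <= 2 * C * 2^-1 ^+ j.
Proof. exact: mode_le e0 C0 G_le j x. Qed.

Let t_le n j x : 0 <= x -> `|G n j * E n x| <= C * 2^-1 ^+ j * 4^-1 ^+ n.
Proof. exact: mode_term_le e0 G_le n j x. Qed.

Let sum_half (a : R) n : 0 <= a -> \sum_(0 <= j < n) a * 2^-1 ^+ j <= 2 * a.
Proof.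
move=> a0; rewrite -mulr_sumr; have := sum_geometric_le n (@half R).
rewrite (_ : (1 - 2^-1)^-1 = 2 :> R); last by field.
by move=> h; rewrite mulrC; apply: (le_trans (ler_wpM2r a0 h)).
Qed.

Let v_le N x t : 0 <= x -> `|v N x t| <= 4 * C.
Proof.
move=> x0; rewrite v_swap; apply: le_trans (ler_norm_sum _ _ _) _.
apply: (@le_trans _ _ (\sum_(0 <= j < N.+2) (2 * C) * 2^-1 ^+ j)); last first.
  by have := @sum_half (2 * C) N.+2; rewrite mulr_ge0 ?(ltW C0)// => /(_ isT); lra.
apply: ler_sum => j _; rewrite normrM.
apply: (@le_trans _ _ `|series (fun n => G n j * E n x) N.+2|); first by rewrite ler_piMr// cos_max.
apply: le_trans (bsum_series_le _ (mode_bsum e0 G_le j x0)) _.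
rewrite ler_pdivrMr; last by lra.
by have : 0 <= C * 2^-1 ^+ j; [rewrite mulr_ge0 ?exprn_ge0// ltW|lra].
Qed.

Let mode_cos_bsum x t : 0 <= x -> bsum (fun k => mode k x * cos (om k * t)) (2 * C / (1 - 2^-1)).
Proof.
move=> x0; apply: (bsum_geometric (@half R)) => k; rewrite normrM.
by apply: le_trans (c_le k x0); rewrite ler_piMr// cos_max.
Qed.

(** The tails in n that the square truncation omits, summed over the frequencies present, are at
    most 4 C 4 ^ (- N); what remains is a partial sum of the series of modes. *)
Let v_cvg x t : 0 <= x -> v N x t @[N --> \oo] --> u x t.
Proof.
move=> x0.
have h1 : series (fun k => mode k x * cos (om k * t)) (N + 2)%N @[N --> \oo] --> u x t.
  by rewrite (cvg_shiftn 2); exact: bsum_cvgP (mode_cos_bsum t x0).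
have h2 : (4 * C) * 4^-1 ^+ N @[N --> \oo] --> (0 : R).
  by apply: cvg_geometric; rewrite ger0_norm//; lra.
rewrite -[X in _ --> X]subr0.
rewrite (_ : (fun N => v N x t) = (fun N => series (fun k => mode k x * cos (om k * t)) (N + 2)%N -
   (series (fun k => mode k x * cos (om k * t)) (N + 2)%N - v N x t))); last first.
  by apply/funext => N; rewrite subKr.
apply: cvgB => //; apply/norm_cvg0P.
apply: (@squeeze_cvgr _ _ _ _ (cst 0) (fun N => (4 * C) * 4^-1 ^+ N)) => //; last exact: cvg_cst.
apply: nearW => N; rewrite normr_ge0/= addn2 v_swap /series/= -sumrB.
apply: le_trans (ler_norm_sum _ _ _) _.
apply: (@le_trans _ _ (\sum_(0 <= j < N.+2) (2 * C * 4^-1 ^+ N) * 2^-1 ^+ j)); last first.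
  by have := @sum_half (2 * C * 4^-1 ^+ N) N.+2; rewrite !mulr_ge0 ?exprn_ge0 ?(ltW C0)// => /(_ isT); lra.
apply: ler_sum => j _; rewrite -mulrBl normrM.
apply: le_trans (ler_piMr (normr_ge0 _) (cos_max _)) _.
apply: le_trans (geometric_tail N.+2 (fun n => t_le n j x0)) _.
rewrite (_ : 2 * C * 4^-1 ^+ N * 2^-1 ^+ j = 2 * (C * 2^-1 ^+ j) * 4^-1 ^+ N); last by ring.
rewrite ler_wpM2l ?mulr_ge0 ?exprn_ge0 ?(ltW C0)// (_ : 4^-1 ^+ N.+2 = 4^-1 ^+ N * 4^-1 ^+ 2 :> R); last by rewrite -exprD addn2.
by rewrite ler_piMr ?exprn_ge0// exprn_ile1//; lra.
Qed.

Let E_cts n : continuous (E n).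
Proof.
rewrite (_ : E n = (fun x => expR (- (n%:R * e) * x))).
  exact: is_derive_continuous (is_derive_expM (- (n%:R * e))).
by apply/funext => x; rewrite /exp_term mulNr.
Qed.

Let jEc n j : jcont (fun x t => E n x * cos (om j * t)).
Proof. by apply: jcontM; [exact: jcont_fst|apply: jcont_snd; exact: continuous_cosM]. Qed.

Let jZ (a : R) (k : R -> R -> R) : jcont k -> jcont (fun x t => a * k x t).
Proof. by move=> ck; apply: jcontM => //; apply: jcont_fst; exact: cst_continuous. Qed.

Let jv N : jcont (v N).
Proof. by apply: jcont_sum => n; apply: jcont_sum => j; exact: jZ. Qed.

Let jrem N : jcont (rem N).
Proof.
have j1 : jcont (fun x t => P (v N x t)) by exact: (@jcont_comp R P (v N) cP (@jv N)).
apply: (jcontB j1).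
by apply: jcont_sum => n; apply: jcont_sum => j; apply: jZ; exact: jZ.
Qed.

Section weak.
Variables (K : R) (phi : R -> R -> R).
Hypotheses (K0 : 0 <= K) (tphi : test_function T K phi).

Let sphi : smooth2 phi. Proof. by case: tphi. Qed.
Let per x t : phi x (t + T) = phi x t. Proof. by case: tphi. Qed.
Let ph : jcont phi. Proof. by have [] := sphi [::]. Qed.
Let phxx : jcont (dx (dx phi)). Proof. by have [] := sphi [:: true; true]. Qed.
Let phtt : jcont (dt (dt phi)). Proof. by have [] := sphi [:: false; false]. Qed.
Let box x t : R := dt (dt phi) x t - dx (dx phi) x t.
Let jbox : jcont box. Proof. exact: jcontB. Qed.

Let F N x t : R := v N x t * box x t + f (v N x t) * phi x t.

Let cf : continuous f.
Proof. by rewrite (_ : f = (fun y => y + P y)); [apply: continuousD => // y; exact: cvg_id|exact/funext]. Qed.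

Let jF N : jcont (F N).
Proof. by apply: jcontD; apply: jcontM => //; exact: (@jcont_comp R f (v N) cf (@jv N)). Qed.

Let split_F N x t : F N x t =
  \sum_(0 <= n < N.+2) \sum_(0 <= j < N.+2) G n j *
    (expR (- (n%:R * e) * x) * cos (om j * t) * box x t +
      ((n%:R * e) ^+ 2 + om j ^+ 2) * (expR (- (n%:R * e) * x) * cos (om j * t)) * phi x t)
  + rem N x t * phi x t.
Proof.
rewrite /F fE /rem.
set p := P _; set S := \sum_(0 <= n < N.+2) \sum_(0 <= j < N.+2) mode_symbol _ _ _ _ * _.
rewrite (_ : \sum_(0 <= n < N.+2) \sum_(0 <= j < N.+2) _ = v N x t * box x t + (v N x t + S) * phi x t); first by ring.
rewrite /v /S -big_split/= !mulr_suml -big_split/=; apply: eq_bigr => n _.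
rewrite -big_split/= !mulr_suml -big_split/=; apply: eq_bigr => j _.
rewrite /mode_symbol (_ : om j = om 1 * j%:R); last by rewrite /om mulr1; ring.
rewrite (_ : E n x = expR (- (n%:R * e) * x)); last by rewrite /exp_term mulNr.
by ring.
Qed.

(** Each separated term integrates to zero against [phi], so only the residual [rem], of order 2 ^
    (- N), contributes. The limit in N is taken by dominated convergence, the sums being bounded by
    4 C for x >= 0. *)
Lemma modal_weak : exists l q : R,
  [/\ K < l, l <= q, forall x, ~~ (l <= x <= q) -> (forall t, phi x t = 0) /\ (forall t, box x t = 0) &
   \int[mu]_(x in `[l, q]) \int[mu]_(t in `[0, T]) (u x t * box x t + f (u x t) * phi x t) = 0].
Proof.
have [_ _ [a [b [Ka supp]]]] := tphi.
(* A margin around the support, so that [phi] and its x-derivatives vanish near both ends of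
   [[l, q]]. *)
pose l := (K + a) / 2; pose q := Num.max b l + 1.
have Kl : K < l by rewrite /l; lra.
have la : l < a by rewrite /l; lra.
have bq : b < q by rewrite /q ltr_pwDr// le_max lexx.
have lq : l <= q by rewrite /q ler_wpDr// le_max lexx orbT.
exists l, q; split => //.
  move=> x xlq.
  have off : \forall y \near x, ~~ (a <= y <= b).
    move: xlq; rewrite negb_and -!ltNge => /orP[xl|qx]; near=> y; rewrite negb_and -!ltNge.
      by apply/orP; left; near: y; apply: lt_nbhsl; exact: lt_trans la.
    by apply/orP; right; near: y; apply: lt_nbhsr; exact: lt_trans qx.
  have z : forall t, phi x t = 0 by move=> t; exact: supp (nbhs_singleton off).
  split => // t; rewrite /box.
  have z1 : dt phi x = fun=> 0.
    apply/funext => t'; rewrite /dt (_ : phi x = cst 0); last exact/funext.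
    by rewrite derive1_cst.
  have z2 : dt (dt phi) x t = 0 by rewrite -[LHS]/(derive1 (dt phi x) t) z1 derive1_cst.
  have z3 : \forall y \near x, dx phi y t = 0.
    apply: filterS (nbhs_interior off) => y hy.
    apply: is_derive_derive1; apply: (@near_eq_is_derive _ _ _ (cst 0 : R -> R)).
    by apply: filterS hy => y' /supp->.
  have z4 : dx (dx phi) x t = 0.
    apply: is_derive_derive1; apply: (@near_eq_is_derive _ _ _ (cst 0 : R -> R)).
    by apply: filterS z3 => y ->.
  by rewrite z2 z4 subrr.
have x_ge0 x : l <= x <= q -> 0 <= x.
  by move=> /andP[lx _]; apply: le_trans K0 (le_trans (ltW Kl) lx).
have T00 := ltW T0.
have [Bp hBp] := @jcont_bound R phi l q 0 T ph.
have [Bb hBb] := @jcont_bound R box l q 0 T jbox.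
have [KP hKP] := @continuous_bounded R f (4 * C) cf.
have lim1 : (fun N => \int[mu]_(x in `[l, q]) \int[mu]_(t in `[0, T]) F N x t) @ \oo -->
   \int[mu]_(x in `[l, q]) \int[mu]_(t in `[0, T]) (u x t * box x t + f (u x t) * phi x t).
  refine (@iterated_integral_cvg R 0 T l q T00 F (fun x t => u x t * box x t + f (u x t) * phi x t) (4 * C * Bb + KP * Bp) (@jF) _ _).
    move=> N x t xlq tT; apply: le_trans (ler_normD _ _) _; rewrite !normrM; apply: lerD; apply: ler_pM => //.
    - exact: v_le (x_ge0 x xlq).
    - exact: hBb.
    - by apply: hKP; exact: v_le (x_ge0 x xlq).
    - exact: hBp.
  move=> x t xlq tT; have hv := @v_cvg x t (x_ge0 x xlq).
  apply: cvgD; (apply: cvgM; last exact: cvg_cst) => //.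
  by apply: (@cvg_comp _ _ _ (fun N => v N x t) f _ _ _ hv); exact: cf.
have small N : `|\int[mu]_(x in `[l, q]) \int[mu]_(t in `[0, T]) F N x t| <=
    (C * Bp * (T - 0) * (q - l)) * 2^-1 ^+ N.
  have -> : \int[mu]_(x in `[l, q]) \int[mu]_(t in `[0, T]) F N x t =
     \int[mu]_(x in `[l, q]) \int[mu]_(t in `[0, T]) (rem N x t * phi x t).
    under eq_Rintegral do under eq_Rintegral do rewrite split_F.
    have jt n j : jcont (fun x t => expR (- (n%:R * e) * x) * cos (om j * t) * box x t +
        ((n%:R * e) ^+ 2 + om j ^+ 2) * (expR (- (n%:R * e) * x) * cos (om j * t)) * phi x t).
      have j1 : jcont (fun x t => expR (- (n%:R * e) * x) * cos (om j * t)).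
        apply: jcontM; last by apply: jcont_snd; exact: continuous_cosM.
        by apply: jcont_fst; exact: is_derive_continuous (is_derive_expM (- (n%:R * e))).
      by apply: jcontD; apply: jcontM => //; exact: jZ.
    rewrite iterated_integralD//; first last.
    - exact: jcontM.
    - by apply: jcont_sum => n; apply: jcont_sum => j; exact: jZ.
    rewrite iterated_integral_sum0 ?add0r// => [n|n].
      by apply: jcont_sum => j; exact: jZ.
    apply: iterated_integral_sum0 => // [j|j]; first exact: jZ.
    rewrite iterated_integralZ//.
    have omTE : om j * T = j%:R * (2 * pi).
      by rewrite /om; move: (@pi R) => p; field; rewrite gt_eqF.
    have [c1 s1] := @cos_sin_nat2pi R j; rewrite -omTE in c1 s1.
    have mul0 (y z : R) : z = 0 -> y * z = 0 by move=> ->; rewrite mulr0.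
    apply: mul0; exact: (separated_wave (n%:R * e) T0 c1 s1 sphi per la bq lq supp).
  have jr : jcont (fun x t => rem N x t * phi x t) by apply: jcontM => //; exact: jrem.
  have rb x t : l <= x <= q -> 0 <= t <= T -> `|rem N x t * phi x t| <= C * 2^-1 ^+ N * Bp.
    move=> xlq tT; rewrite normrM; apply: ler_pM => //; last exact: hBp.
    apply: le_trans (rem_le N t (x_ge0 x xlq)) _.
    by rewrite ler_wpM2l ?(ltW C0)// (_ : 2^-1 ^+ N.+2 = 2^-1 ^+ N * 2^-1 ^+ 2 :> R); [rewrite ler_piMr ?exprn_ge0// exprn_ile1//; lra|rewrite -exprD addn2].
  have h := iterated_integral_le T00 lq jr rb.
  by rewrite (_ : _ * 2^-1 ^+ N = C * 2^-1 ^+ N * Bp * (T - 0) * (q - l))//; ring.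
have lim0 : (fun N => \int[mu]_(x in `[l, q]) \int[mu]_(t in `[0, T]) F N x t) @ \oo --> (0 : R).
  apply/norm_cvg0P; apply: (@squeeze_cvgr _ _ _ _ (cst 0) (fun N => (C * Bp * (T - 0) * (q - l)) * 2^-1 ^+ N)).
  - by apply: nearW => N; rewrite normr_ge0 small.
  - exact: cvg_cst.
  - by apply: cvg_geometric; rewrite ger0_norm//; lra.
by rewrite -(cvg_lim (@Rhausdorff R) lim1) (cvg_lim (@Rhausdorff R) lim0).
Unshelve. all: end_near. Qed.

End weak.

Lemma modal_wave_equation (K : R) : 0 <= K -> wave_equation f T K u.
Proof.
move=> K0 phi tphi; have [l [q [Kl lq supp int0]]] := modal_weak K0 tphi.
rewrite (@Rintegral_support _ _ _ l q)//.
- by move=> x /=; rewrite !in_itv/= andbT => /andP[lx _]; exact: lt_le_trans lx.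
- move=> x /supp[z1 z2]; under eq_Rintegral do rewrite z1 z2 !mulr0 addr0.
  by rewrite Rintegral_cst// mul0r.
Qed.

End modal_solution.

(** The weight grows at most like 2 ^ j while the squared coefficients decay like 4 ^ (- j), which
    leaves a geometric series of sum 2. *)
Lemma sobolev_sqnorm_geometric (R : realType) (s : R) : exists2 W : R, 0 < W &
  forall (c : nat -> R) (D : R), (forall j, `|c j| <= D * 2^-1 ^+ j) ->
    (sobolev_sqnorm s c <= (2 * W * D ^+ 2)%:E)%E.
Proof.
have [W W0 hW] := @sobolev_weight_exp R s; exists W => // c D cD.
have D0 : 0 <= D by have := le_trans (normr_ge0 _) (cD 0%N); rewrite expr0 mulr1.
rewrite /sobolev_sqnorm; apply: lime_le.
  by apply: is_cvg_nneseries => j _ _; rewrite lee_fin mulr_ge0 ?sqr_ge0 ?powR_ge0.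
apply: nearW => n; rewrite sumEFin lee_fin.
apply: (@le_trans _ _ (\sum_(0 <= j < n) (W * D ^+ 2) * 2^-1 ^+ j)).
  apply: ler_sum => j _.
  have h : c j ^+ 2 <= (D * 2^-1 ^+ j) ^+ 2.
    by rewrite -real_normK ?num_real//; apply: lerXn2r (cD j); rewrite nnegrE ?mulr_ge0 ?exprn_ge0.
  apply: (le_trans (ler_pM (sqr_ge0 _) (powR_ge0 _ _) h (hW j))).
  have -> : (2 : R) ^+ j = (2^-1 ^+ j)^-1 by rewrite exprVn invrK.
  have : (2^-1 : R) ^+ j != 0 by rewrite expf_neq0// invr_eq0 pnatr_eq0.
  move: (2^-1 ^+ j) => z z0; rewrite le_eqVlt; apply/orP; left; apply/eqP; field.
  exact: z0.
rewrite -mulr_sumr; have := sum_geometric_le n (@half R).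
rewrite (_ : (1 - 2^-1)^-1 = 2 :> R); last by field.
have WD : 0 <= W * D ^+ 2 by apply: mulr_ge0; rewrite ?(ltW W0)// sqr_ge0.
by move=> h; apply: (le_trans (ler_wpM2l WD h)); lra.
Qed.

(** * The constructed series is a nonzero decaying solution *)

Section existence.
Context {R : realType}.
Variables (T s : R) (P f : R -> R) (G : nat -> nat -> R) (C : R).
Hypotheses (T1 : 2 * pi < T) (T2 : T < 5 / 2 * pi) (cP : continuous P).
Hypothesis fE : forall y, f y = y + P y.
Let om (k : nat) : R := 2 * pi * k%:R / T.
Let e := eps T.
Let T0 : 0 < T := period_gt0 T1.
Let e0 : 0 < e := eps_gt0 T1 T2.
Hypotheses (C0 : 0 < C) (G_le : forall n j, `|G n j| <= C * 4^-1 ^+ n * 2^-1 ^+ j).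
Hypothesis G_0 : forall n j, ~~ odd n || ~~ odd j || (n < j)%N -> G n j = 0.
Hypothesis G_11 : G 1%N 1%N != 0.
Hypothesis G_rem : forall N x t, 0 <= x ->
  `|P (\sum_(0 <= n < N.+2) \sum_(0 <= j < N.+2) G n j * expR (- (n%:R * e * x)) * cos (j%:R * t))
    - \sum_(0 <= n < N.+2) \sum_(0 <= j < N.+2)
        mode_symbol e (om 1) n j * G n j * expR (- (n%:R * e * x)) * cos (j%:R * t)|
  <= C * 2^-1 ^+ N.+2.
Local Notation mode := (exp_mode e G).
Local Notation u := (modal_solution T G).
Let K : R := (Num.truncn `|s|).+1%:R.

Let K0 : 0 <= K. Proof. exact: ler0n. Qed.

Let omT k : om k * T = k%:R * (2 * pi).
Proof. by rewrite /om; move: (@pi R) => p; field; rewrite gt_eqF. Qed.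

Let period x t : u x (t + T) = u x t.
Proof.
rewrite /modal_solution; congr (limn (series _)); apply/funext => k.
have [c1 s1] := @cos_sin_nat2pi R k; rewrite -omT in c1 s1.
by rewrite mulrDr cosD c1 s1 mulr1 mulr0 subr0.
Qed.

Let coef x j : 0 <= x -> cos_coef (fun tau => u x (T * tau / (2 * pi))) j = mode j x /\
  sin_coef (fun tau => u x (T * tau / (2 * pi))) j = 0.
Proof.
move=> x0.
have b1 : bsum (mode^~ x) (2 * C / (1 - 2^-1)).
  by apply: (bsum_geometric (@half R)) => k; exact: mode_le e0 C0 G_le k x x0.
have b2 : bsum (fun _ : nat => 0 : R) 0 by move=> n; rewrite normr0 big1.
have uE tau : u x (T * tau / (2 * pi)) =
    limn (series (fun k => mode k x * cos (k%:R * tau) + 0 * sin (k%:R * tau))).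
  rewrite /modal_solution; congr (limn (series _)); apply/funext => k; rewrite mul0r addr0.
  congr (_ * cos _); rewrite /om.
  have := @pi_gt0 R; move: (@pi R) (T0) => p T00 p0; field.
  by rewrite !gt_eqF.
split; first exact: (cos_coef_fourier b1 b2 uE).
by rewrite (sin_coef_fourier b1 b2 uE); case: ifP.
Qed.

Let mode_even x j : ~~ odd j -> mode j x = 0.
Proof.
move=> ej; rewrite /mode (_ : series _ = cst 0); first by rewrite lim_cst.
by apply/funext => n; rewrite /series/= big1// => i _; rewrite G_0 ?mul0r// ej orbT.
Qed.

Let om1 : 2 * pi / T <= 1.
Proof. by have /andP[_ /ltW] := freq_bounds T1 T2; rewrite mulr1. Qed.

Let e1 : e <= 1.
Proof. by have := eps_bounds T1 T2; rewrite -/e; lra. Qed.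

Let G_00 j : G 0%N j = 0. Proof. by rewrite G_0. Qed.

(** In the variable xi = e x the exponents become integers, so the modes are power series in exp (-
    xi). *)
Let h (j : nat) (xi : R) : R := limn (series (fun n => G n j * expR (- (n%:R * xi)))).
Let h' (j : nat) (xi : R) : R := - limn (series (fun n => n%:R * G n j * expR (- (n%:R * xi)))).

Let coefE xi j : 0 <= xi -> cos_coef (rescale T u xi) j = h j xi.
Proof.
move=> xi0; have x0 : 0 <= xi / e by rewrite divr_ge0// ltW.
have [-> _] := coef j x0; rewrite /exp_mode /h; congr (limn (series _)); apply/funext => n.
rewrite /exp_term -mulrA [e * _]mulrC divfK//; exact: lt0r_neq0.
Qed.

Let coefE' xi j : 0 < xi -> derive1 (fun y => cos_coef (rescale T u y) j) xi = h' j xi.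
Proof.
move=> xi0; apply: is_derive_derive1.
apply: (@near_eq_is_derive _ _ _ (h j)).
  by near=> y; rewrite coefE//; apply: ltW; near: y; exact: lt_nbhsr.
apply: (@is_derive_exp_series R (fun n => G n j) (C * 2^-1 ^+ j) xi) => // n.
by rewrite mulrAC.
Unshelve. all: end_near. Qed.

Let exp_le n (xi : R) : 0 < xi -> (0 < n)%N -> expR (- (n%:R * xi)) <= expR (- xi).
Proof.
move=> xi0 n0; rewrite ler_expR lerN2 ler_peMl ?(ltW xi0)//.
by rewrite ler1n.
Qed.

Let h_le xi j : 0 < xi -> `|h j xi| <= (2 * C * expR (- xi)) * 2^-1 ^+ j.
Proof.
move=> xi0; have B0 : 0 <= C * expR (- xi) * 2^-1 ^+ j by rewrite !mulr_ge0 ?expR_ge0 ?exprn_ge0// ltW.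
have b : bsum (fun n => G n j * expR (- (n%:R * xi))) ((C * expR (- xi) * 2^-1 ^+ j) / (1 - 4^-1)).
  apply: (bsum_geometric (@quarter R)) => -[|n].
    by rewrite G_00 mul0r normr0 expr0 mulr1.
  rewrite normrM (ger0_norm (expR_ge0 _)).
  apply: (le_trans (ler_pM (normr_ge0 _) (expR_ge0 _) (G_le _ _) (exp_le xi0 (ltn0Sn n)))).
  rewrite le_eqVlt; apply/orP; left; apply/eqP; ring.
apply: le_trans (bsum_lim_le b) _.
rewrite ler_pdivrMr; last by lra.
lra.
Qed.

Let n_quarter n : n%:R * 4^-1 ^+ n <= 2^-1 ^+ n :> R.
Proof.
have -> : (4^-1 : R) ^+ n = 2^-1 ^+ n * 2^-1 ^+ n by rewrite -exprMn; congr (_ ^+ n); field.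
rewrite mulrA ler_piMl ?exprn_ge0// exprVn ler_pdivrMr ?exprn_gt0// mul1r -natrX ler_nat.
exact: ltnW (ltn_expl _ _).
Qed.

Let h'_le xi j : 0 < xi -> `|h' j xi| <= (2 * C * expR (- xi)) * 2^-1 ^+ j.
Proof.
move=> xi0; have B0 : 0 <= C * expR (- xi) * 2^-1 ^+ j by rewrite !mulr_ge0 ?expR_ge0 ?exprn_ge0// ltW.
have b : bsum (fun n => n%:R * G n j * expR (- (n%:R * xi))) ((C * expR (- xi) * 2^-1 ^+ j) / (1 - 2^-1)).
  apply: (bsum_geometric (@half R)) => -[|n].
    by rewrite !mul0r normr0 expr0 mulr1.
  rewrite !normrM (ger0_norm (expR_ge0 _)) ger0_norm//.
  apply: (@le_trans _ _ (n.+1%:R * (C * 4^-1 ^+ n.+1 * 2^-1 ^+ j) * expR (- xi))).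
    by apply: ler_pM; rewrite ?mulr_ge0 ?expR_ge0//; [apply: ler_wpM2l|exact: exp_le].
  rewrite (_ : _ * expR _ = C * expR (- xi) * 2^-1 ^+ j * (n.+1%:R * 4^-1 ^+ n.+1)); last by ring.
  by apply: ler_wpM2l.
rewrite /h' normrN; apply: le_trans (bsum_lim_le b) _.
rewrite ler_pdivrMr; last by lra.
lra.
Qed.

Let decay : exp_decay s T u.
Proof.
have [W W0 hW] := sobolev_sqnorm_geometric s.
have [W' W'0 hW'] := sobolev_sqnorm_geometric (s - 1).
(* The squared norms decay like exp (- 2 xi), that is at the rate 1, which the condition excludes.
   One factor exp (- xi) is dropped, leaving the rate 1 / 2. *)
exists (2 * W * (2 * C) ^+ 2 + e ^+ 2 * (2 * W' * (2 * C) ^+ 2)), (1 / 2).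
split; first by apply/andP; split; lra.
near=> xi; have xi0 : 0 < xi by near: xi; exact: nbhs_pinfty_gt.
have n1 : (sobolev_sqnorm s (cos_coef (rescale T u xi)) <= (2 * W * (2 * C * expR (- xi)) ^+ 2)%:E)%E.
  by apply: hW => j; rewrite coefE ?(ltW xi0)//; exact: h_le.
have n2 : (sobolev_sqnorm (s - 1) (fun j => derive1 (fun y => cos_coef (rescale T u y) j) xi)
    <= (2 * W' * (2 * C * expR (- xi)) ^+ 2)%:E)%E.
  by apply: hW' => j; rewrite coefE'//; exact: h'_le.
apply: le_trans (leeD n1 (lee_wpmul2l _ n2)) _; first by rewrite lee_fin sqr_ge0.
rewrite -EFinM -EFinD lee_fin.
rewrite (_ : 2 * (1 / 2) * xi = xi); last by field.
have E1 : expR (- xi) ^+ 2 <= expR (- xi).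
  rewrite expr2 ler_piMr ?expR_ge0// -[X in _ <= X]expR0 ler_expR oppr_le0; exact: ltW.
rewrite -/e [X in X <= _](_ : _ = (2 * W * (2 * C) ^+ 2 + e ^+ 2 * (2 * W' * (2 * C) ^+ 2)) * expR (- xi) ^+ 2); last by ring.
apply: ler_wpM2l => //; apply: addr_ge0.
  by apply: mulr_ge0; [rewrite mulr_ge0// ltW|exact: sqr_ge0].
by apply: mulr_ge0; [exact: sqr_ge0|apply: mulr_ge0; [rewrite mulr_ge0// ltW|exact: sqr_ge0]].
Unshelve. all: end_near. Qed.

(** The half-line starts at [K] because the extension to the cylinder reproduces the exponentials
    only from there on. *)
Lemma modal_decaying : decaying_solution f s T K u.
Proof.
split.
- by move=> x t _; exact: period.
- move=> x Kx; have x0 := le_trans K0 Kx; split => j; first by have [] := coef j x0.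
  by move=> ej; have [-> _] := coef j x0; exact: mode_even.
- have [U HU uU] := cylinder_extension s T0 om1 e0 e1 C0 G_le G_00.
  by exists U => // x t Kx; exact: uU.
- exact: modal_wave_equation T1 T2 cP fE C0 G_le G_rem K K0.
- exact: decay.
Qed.

(** With y = exp (- e x), the first mode is [G 1 1 * y] up to a multiple of y ^ 2, hence nonzero for
    large x; a solution that vanished there would have zero Fourier coefficients. *)
Lemma modal_nonzero : nonzero_on K u.
Proof.
pose M := C * 2^-1 / (1 - 4^-1).
have G1 : 0 < `|G 1%N 1%N| / 2 by rewrite divr_gt0// normr_gt0.
have [Y hY] := @exp_small R M e (`|G 1%N 1%N| / 2) e0 G1.
pose x := Num.max K Y.
have Kx : K <= x by rewrite le_max lexx.
have Yx : Y <= x by rewrite le_max lexx orbT.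
have x0 := le_trans K0 Kx.
have bM : bsum (fun n => G n 1%N) M.
  apply: (bsum_geometric (@quarter R)) => n; apply: le_trans (G_le n 1) _.
  by rewrite expr1 mulrAC.
pose y := expR (- (e * x)).
have y1 : `|y| <= 1.
  by rewrite ger0_norm ?expR_ge0// -[X in _ <= X]expR0 ler_expR oppr_le0 mulr_ge0// ltW.
have m1 : mode 1 x = limn (series (fun k => G k 1%N * y ^+ k)).
  rewrite /exp_mode; congr (limn (series _)); apply/funext => n.
  by rewrite /exp_term /y -expRM_natl mulrN mulrA.
have c0 k : (k < 1)%N -> G k 1%N = 0 by case: k.
have m0 : mode 1 x != 0.
  apply/eqP => z; have := power_series_remainder bM y1 c0.
  rewrite -m1 z sub0r normrN expr1 normrM [`|y|]ger0_norm ?expR_ge0// expr2 mulrA ler_pM2r ?expR_gt0//.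
  by have := hY x Yx; rewrite -/y; move: G1; lra.
apply: contrapT => hn; move/eqP: m0; apply.
have z t : u x t = 0.
  by apply/eqP; apply: contrapT => /negP ne; apply: hn; exists x, t.
have [<- _] := coef 1 x0; rewrite /cos_coef.
under eq_Rintegral do rewrite z mul0r.
by rewrite Rintegral_cst// mul0r mulr0.
Qed.

End existence.

(** * Existence and uniqueness *)

Local Open Scope complex_scope.

Theorem theorem5 (R : realType) (g : R[i]^o -> R[i]^o) (s : R)
  (g_entire : entire_real_coef g)
  (g_odd : forall z : R[i]^o, g (- z) = - g z)
  (g_0 : g 0 = 0)
  (g'_0 : is_derive (0 : R[i]^o) (1 : R[i]^o) g (1 : R[i]^o))
  (s_gt : 3 / 2 < s) :
  exists T0 : R, 2 * pi < T0 /\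
    forall T : R, 2 * pi < T < T0 ->
      (exists (u : R -> R -> R) (x0 : R),
          decaying_solution (on_reals g) s T x0 u /\ nonzero_on x0 u) /\
      (forall (u v : R -> R -> R) (x0 x1 : R),
          decaying_solution (on_reals g) s T x0 u -> nonzero_on x0 u ->
          decaying_solution (on_reals g) s T x1 v -> nonzero_on x1 v ->
          same_up_to_translation_sign u v).
Proof.
(* Below this period the fundamental frequency exceeds 4 / 5, so all higher ones exceed 1 with the
   margin that the summation bound uses. *)
exists (5 / 2 * pi); split; first by have := @pi_gt0 R; move: (@pi R) => p; lra.
move=> T /andP[T1 T2].
have [a [a3 a_entire fE]] := entire_nonlinearity g_entire g_odd g'_0.
pose P (y : R) : R := limn (series (fun m => a m * y ^+ m)).
have a3' m : (m < 3)%N -> a m = 0 by move=> m3; rewrite a3 ?m3.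
have cP : continuous P by exact: (@power_series_continuous R a a_entire a3').
split.
  have ew : eps T ^+ 2 + (2 * pi * 1%:R / T) ^+ 2 = 1 by rewrite (eps_sqr T1 T2) subrK.
  have [G [C [C0 G_le G_0 G_11 G_rem]]] := modal_coefficients a3 (eps_gt0 T1 T2) ew a_entire.
  exists (modal_solution T G), (Num.truncn `|s|).+1%:R; split.
    exact: (modal_decaying s T1 T2 cP fE C0 G_le G_0 G_rem).
  exact: (modal_nonzero s T1 T2 C0 G_le G_0 G_11).
move=> u v x0 x1; apply: (solution_unique T1 T2 s_gt cP fE).
- by move=> rho rho1; exact: (power_series_lipschitz a_entire a3' rho1).
- move=> y; rewrite /P; have [C b] := a_entire y.
  apply: cvg_lim => //; rewrite (_ : series _ = - series (fun m => a m * y ^+ m)); first exact: cvgN (bsum_cvgP b).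
  apply/funext => n.
  suff h : \sum_(0 <= m < n) a m * (- y) ^+ m = - \sum_(0 <= m < n) a m * y ^+ m by exact: h.
  rewrite -sumrN; apply: eq_bigr => m _.
  have [om|em] := boolP (odd m); first by rewrite [(- y) ^+ m]exprNn -signr_odd om expr1 mulN1r mulrN.
  by rewrite a3 ?em ?orbT// !mul0r oppr0.
Qed.
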